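(* Let $\Omega$, $A_\Omega$, $\Lambda_\Omega$, $\omega$, $V$, $\psi$ be as in the context, with associated $\Omega^*$, $\widehat\Lambda$, $\widehat v$, $\widehat V$, $\widetilde\psi$ and $U$. If there are $\omega_0\ge0$ and $\mu\ge0$ such that $$-\operatorname{div}(A_\Omega\nabla\psi)(y)-|\omega(y)|\,|\nabla\psi(y)|-\omega_0|\nabla\psi(y)|+V(y)\psi(y)\le\mu\psi(y)\quad\text{for all }y\in\Omega,$$ then $$\int_{\Omega^*}\left[\widehat\Lambda(x)|\nabla\widetilde\psi(x)|^2-\omega_0|\nabla\widetilde\psi(x)|\widetilde\psi(x)+\widehat V(x)\widetilde\psi(x)^2\right]e^{-U(x)}dx\le\mu\int_{\Omega^*}\widetilde\psi(x)^2e^{-U(x)}dx.$$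
   Context: Setting. $n\ge1$; $\Omega\subset\mathbb R^n$ is a bounded domain (non-empty, open, connected) of class $C^2$; $A_\Omega\in C^1(\overline\Omega,\mathcal S_n(\mathbb R))$ (real symmetric matrix field), $\Lambda_\Omega\in C^1(\overline\Omega)$, $\omega\in C(\overline\Omega)$, $V\in C(\overline\Omega)$ (real-valued), with $A_\Omega(x)\ge\Lambda_\Omega(x)\mathrm{Id}$ (as quadratic forms) and $\Lambda_\Omega(x)\ge\gamma$ for all $x\in\overline\Omega$, for some constant $\gamma>0$. $\psi\in C^1(\overline\Omega)$ is analytic and positive in $\Omega$, $\psi=0$ on $\partial\Omega$, $\nabla\psi\ne0$ everywhere on $\partial\Omega$, and $f:=-\operatorname{div}(A_\Omega\nabla\psi)$ is (in $\Omega$) a non-zero polynomial. Notation. $M=\max_{\overline\Omega}\psi$; $\Omega_a=\{x\in\Omega:\psi(x)>a\}$ for $a\in[0,M)$; $\Sigma_a=\{x\in\overline\Omega:\psi(x)=a\}$ for $a\in[0,M]$, with surface measure $d\sigma_a$. $Z$ is the (finite) set of $a\in[0,M]$ such that $\nabla\psi$ vanishes at some point of $\Sigma_a$, and $Y=[0,M]\setminus Z$. $\Omega^*=B_R$ is the open ball centered at $0$ with $|\Omega^*|=|\Omega|$, $\alpha_n$ is the volume of the unit ball, and $e_r(x)=x/|x|$. $\rho(a)\in(0,R]$ is defined by $|\Omega_a|=\alpha_n\rho(a)^n$ for $a\in[0,M)$, and $\rho(M)=0$; $\rho$ is a continuous decreasing bijection from $[0,M]$ onto $[0,R]$. $E=\{x\in\overline{\Omega^*}:|x|\in\rho(Y)\}$.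 For $r\in\rho(Y)$, $$G(r)=\frac{\int_{\Sigma_{\rho^{-1}(r)}}|\nabla\psi|^{-1}d\sigma_{\rho^{-1}(r)}}{\int_{\Sigma_{\rho^{-1}(r)}}\Lambda_\Omega^{-1}|\nabla\psi|^{-1}d\sigma_{\rho^{-1}(r)}},\qquad F(r)=\frac{1}{n\alpha_nr^{n-1}G(r)}\int_{\Omega_{\rho^{-1}(r)}}\operatorname{div}(A_\Omega\nabla\psi)(x)\,dx,$$ and $F(0)=0$ ($F$ is defined a.e. in $[0,R]$ and bounded). For $x\in\overline{\Omega^*}$, $\widetilde\psi(x)=-\int_{|x|}^RF(r)\,dr$. For $x\in E$ (with $a=\rho^{-1}(|x|)$), $\widehat\Lambda(x)=G(|x|)$, $$\widehat v(x)=\left(\frac{\int_{\Sigma_a}\omega^2\Lambda_\Omega^{-1}|\nabla\psi|^{-1}d\sigma_a}{\int_{\Sigma_a}\Lambda_\Omega^{-1}|\nabla\psi|^{-1}d\sigma_a}\right)^{1/2}e_r(x),\qquad \widehat V(x)=-\frac{\int_{\Sigma_a}V^-|\nabla\psi|^{-1}d\sigma_a}{\int_{\Sigma_a}|\nabla\psi|^{-1}d\sigma_a},$$ where $V^-=\max(0,-V)$. These are defined a.e. in $\Omega^*$ and bounded, and $|\widehat v|$, $\widehat\Lambda$ are radially symmetric. For $x\in\overline{\Omega^*}$, $U(x)=\int_0^{|x|}|\widehat v(se)|\widehat\Lambda(se)^{-1}ds$, where $e$ is any unit vector of $\mathbb R^n$. *)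

(* Defs.v *)
From HB Require Import structures.
From mathcomp Require Import all_boot all_order all_algebra.
From mathcomp Require Import all_classical all_reals all_analysis.
From mathcomp Require Import (canonicals) mpoly.

Set Implicit Arguments.
Unset Strict Implicit.
Unset Printing Implicit Defensive.

Import Order.TTheory GRing.Theory Num.Theory.
Import numFieldNormedType.Exports.

Local Open Scope classical_set_scope.
Local Open Scope ring_scope.

(* R^n is 'rV[R]_n.  The library norm `|x| on it is the sup norm, hence the
   separate Euclidean norm. *)
Section euclidean.
Context {R : realType} {n : nat}.
Implicit Types (u v : 'rV[R]_n).

Definition dot u v : R := \sum_i u 0 i * v 0 i.
Definition enorm u : R := Num.sqrt (dot u u).

End euclidean.

Section calculus.
Context {R : realType} {n : nat}.
Implicit Types (f : 'rV[R]_n -> R) (U Omega : set 'rV[R]_n).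

Definition partial (i : 'I_n) f (x : 'rV[R]_n) : R := 'D_(delta_mx 0 i) f x.
Definition grad f (x : 'rV[R]_n) : 'rV[R]_n := \row_i partial i f x.
Definition divergence (W : 'rV[R]_n -> 'rV[R]_n) (x : 'rV[R]_n) : R :=
  \sum_i partial i (fun y => W y 0 i) x.

Definition isC1 U f := forall (i : 'I_n) x, U x ->
  derivable f x (delta_mx 0 i) /\ {for x, continuous (partial i f)}.
Definition isC2 U f := isC1 U f /\ forall i, isC1 U (partial i f).

Definition isC0_closure Omega f := {within closure Omega, continuous f}.
(* f in C^1(closure Omega): f is continuous on closure Omega, and its partial
   derivatives in Omega extend continuously to closure Omega. *)
Definition isC1_closure Omega f := isC0_closure Omega f /\
  forall i : 'I_n, exists g : 'rV[R]_n -> R, isC0_closure Omega g /\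
    forall x, Omega x -> derivable f x (delta_mx 0 i) /\ partial i f x = g x.
(* The gradient on closure Omega of such a function; it is [grad f] in Omega
   and does not depend on the values of f outside Omega. *)
Definition grad_closure Omega f (x : 'rV[R]_n) : 'rV[R]_n :=
  \row_i lim (partial i f y @[y --> within Omega (nbhs x)]).

(* Locally f is the sum of an absolutely convergent power series
   sum_alpha c_alpha h^alpha; both the absolute convergence and the sum are
   expressed through the partial sums over the cubes {0, ..., N-1}^n. *)
Definition analytic_at f (x : 'rV[R]_n) :=
  exists (c : {ffun 'I_n -> nat} -> R) (r : R), 0 < r /\
  forall h : 'rV[R]_n, `|h| < r ->
    let term N (alpha : {ffun 'I_n -> 'I_N}) : R :=
      c [ffun i => alpha i : nat] * \prod_i h 0 i ^+ alpha i in
    (exists K : R, forall N, \sum_alpha `|term N alpha| <= K) /\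
    \sum_alpha term N alpha @[N --> \oo] --> f (x + h).

Definition boundary Omega := closure Omega `\` interior Omega.

Definition nonzero_polynomial_on Omega f :=
  exists2 p : mpoly.mpoly n R, p != 0 &
    forall x, Omega x -> f x = mpoly.meval (fun i => x 0 i) p.

End calculus.

Section domains.
Context {R : realType} {n : nat}.

(* Near each boundary point, Omega is the strict epigraph or the strict
   hypograph, in some coordinate direction i, of a C^2 function of the n other
   coordinates. *)
Definition C2_domain (Omega : set 'rV[R]_n.+1) :=
  [/\ Omega !=set0, open Omega, connected Omega, bounded_set Omega &
   forall x, boundary Omega x ->
     exists (i : 'I_n.+1) (s : bool) (g : 'rV[R]_n -> R) (r : R),
       [/\ 0 < r, isC2 setT g &
        forall y, ball x r y ->
          (Omega y <-> 0 < (-1) ^+ s * (y 0 i - g (col' i y)))]].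

End domains.

Definition rVborel (R : realType) (n : nat) :=
  g_sigma_algebraType (@open 'rV[R]_n).

(* n-dimensional Lebesgue measure, as the iterated product of the
   one-dimensional one: the measure of A is the integral of the measures of its
   slices along the first coordinate.  It is only meant for Borel sets. *)
Fixpoint lebesgue (R : realType) (n : nat) : set (rVborel R n) -> \bar R :=
  match n return set (rVborel R n) -> \bar R with
  | 0 => fun A => (\1_A (0 : 'rV[R]_0))%:E
  | m.+1 => fun A =>
      (\int[@lebesgue_measure R]_t
        @lebesgue R m [set y : 'rV[R]_m | A (row_mx (t%:M : 'rV[R]_1) y)])%E
  end.
Arguments lebesgue {R n} _.

(* The real value of an integral; [Rintegral] is restricted to bundled
   measures. *)
Definition Rint {R : realType} {n : nat} (mu : set (rVborel R n) -> \bar R)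
    (D : set 'rV[R]_n) (f : 'rV[R]_n -> R) : R :=
  fine (\int[mu]_(x in D) (f x)%:E)%E.

Section surface_measure.
Context {R : realType} {n : nat}.

(* the point with i-th coordinate t and other coordinates y *)
Definition insert (i : 'I_n.+1) (y : 'rV[R]_n) (t : R) : 'rV[R]_n.+1 :=
  \row_j (if unlift i j is Some k then y 0 k else t).

Definition graph (i : 'I_n.+1) (g : 'rV[R]_n -> R) (D : set 'rV[R]_n) :=
  [set insert i y (g y) | y in D].

Definition graph_area (g : 'rV[R]_n -> R) (D : set 'rV[R]_n) : \bar R :=
  (\int[lebesgue]_(y in D) (Num.sqrt (1 + enorm (grad g y) ^+ 2))%:E)%E.

(* Surface measure of a C^1 hypersurface S.  A local chart of S is a C^1 graph,
   over an open set and in a coordinate direction, that is contained in S; the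
   surface measure of a Borel subset of a chart is the integral of
   sqrt(1 + |grad g|^2) over its projection.  A Borel set B then has as measure
   the supremum of the total area of finitely many disjoint such pieces
   contained in B.  In R^1 this is the counting measure. *)
Definition chart (S : set 'rV[R]_n.+1) (i : 'I_n.+1) (O : set 'rV[R]_n)
    (g : 'rV[R]_n -> R) :=
  [/\ open O, isC1 O g & graph i g O `<=` S].

Definition surface_measure (S : set 'rV[R]_n.+1) (B : set (rVborel R n.+1)) :
    \bar R :=
  ereal_sup [set a | exists (m : nat) (i : 'I_m -> 'I_n.+1)
      (O D : 'I_m -> set 'rV[R]_n) (g : 'I_m -> 'rV[R]_n -> R),
    [/\ forall k, chart S (i k) (O k) (g k),
        forall k, measurable (D k : set (rVborel R n)) /\ D k `<=` O k,
        forall k, graph (i k) (g k) (D k) `<=` B,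
        trivIset setT (fun k => graph (i k) (g k) (D k)) &
        a = (\sum_k graph_area (g k) (D k))%E]].

End surface_measure.

Section rearrangement.
Context {R : realType} {n : nat}.
Variables (Omega : set 'rV[R]_n.+1) (A : 'rV[R]_n.+1 -> 'M[R]_n.+1).
Variables (Lambda omega V psi : 'rV[R]_n.+1 -> R).

Definition alpha : R := fine (lebesgue [set x : 'rV[R]_n.+1 | enorm x < 1]).

(* the radius of the balls with the same volume as B *)
Definition volume_radius (B : set 'rV[R]_n.+1) : R :=
  (fine (lebesgue B) / alpha) `^ (n.+1%:R)^-1.

Definition radius : R := volume_radius Omega.
Definition Omega_star : set 'rV[R]_n.+1 := [set x | enorm x < radius].

Definition psi_max : R := sup (psi @` closure Omega).
Definition superlevel (a : R) : set 'rV[R]_n.+1 :=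
  [set x | Omega x /\ a < psi x].
Definition level (a : R) : set 'rV[R]_n.+1 :=
  [set x | closure Omega x /\ psi x = a].

Definition gradpsi : 'rV[R]_n.+1 -> 'rV[R]_n.+1 := grad_closure Omega psi.

Definition critical_values : set R :=
  [set a | 0 <= a <= psi_max /\ exists2 x, level a x & gradpsi x = 0].
Definition regular_values : set R :=
  [set a | 0 <= a <= psi_max] `\` critical_values.

(* superlevel psi_max is empty, so rho psi_max = 0 *)
Definition rho (a : R) : R := volume_radius (superlevel a).
Definition rho_inv (r : R) : R :=
  xget 0 [set a | 0 <= a <= psi_max /\ rho a = r].
Definition regular_radii : set R := rho @` regular_values.
Definition E : set 'rV[R]_n.+1 :=
  [set x | enorm x <= radius /\ regular_radii (enorm x)].

(* the integral of h |grad psi|^-1 over Sigma_a, with respect to dsigma_a *)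
Definition level_integral (h : 'rV[R]_n.+1 -> R) (a : R) : R :=
  Rint (surface_measure (level a)) (level a)
    (fun y => h y * (enorm (gradpsi y))^-1).

Definition div_A_grad : 'rV[R]_n.+1 -> R :=
  divergence (fun y => (A y *m (grad psi y)^T)^T).

(* The functions below are extended by 0 outside their domain of definition
   (regular_radii or E).  In particular F 0 = 0, as psi_max is a critical
   value. *)
Definition G : R -> R := (fun r =>
  level_integral (fun=> 1) (rho_inv r) /
  level_integral (fun y => (Lambda y)^-1) (rho_inv r)) \_ regular_radii.

Definition F : R -> R := (fun r =>
  (n.+1%:R * alpha * r ^+ n * G r)^-1 *
  Rint lebesgue (superlevel (rho_inv r)) div_A_grad) \_ regular_radii.

Definition psi_tilde (x : 'rV[R]_n.+1) : R :=
  - \int[lebesgue_measure]_(r in `[enorm x, radius]) F r.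

Definition Lambda_hat : 'rV[R]_n.+1 -> R := (fun x => G (enorm x)) \_ E.

Definition v_hat : 'rV[R]_n.+1 -> 'rV[R]_n.+1 := (fun x =>
  let a := rho_inv (enorm x) in
  Num.sqrt (level_integral (fun y => omega y ^+ 2 * (Lambda y)^-1) a /
            level_integral (fun y => (Lambda y)^-1) a)
    *: ((enorm x)^-1 *: x)) \_ E.

Definition V_hat : 'rV[R]_n.+1 -> R := (fun x =>
  let a := rho_inv (enorm x) in
  - (level_integral (fun y => Num.max 0 (- V y)) a /
     level_integral (fun=> 1) a)) \_ E.

(* e stands for the unit vector of the definition of U *)
Definition U (e x : 'rV[R]_n.+1) : R :=
  \int[lebesgue_measure]_(s in `[0, enorm x])
    (enorm (v_hat (s *: e)) * (Lambda_hat (s *: e))^-1).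

End rearrangement.

(* Main.v *)
(* Let Fhat(r) = -F(r), so psi_tilde(r) = int_r^R Fhat.  On almost every level
   {psi = a}, a = rho^-1(r), the coarea formula and the divergence theorem give
   |S_r| G(r) Fhat(r) = int_{psi > a} f = int_{psi = a} A grad psi . n, and the
   Cauchy-Schwarz and isoperimetric inequalities bound this below by the
   corresponding radial quantities; in particular a <= psi_tilde(r).  Integrating
   the hypothesis over the level and writing h(r) = |S_r| G Fhat, one gets the
   differential inequality
     h' - h U' <= |S_r| (omega0 Fhat + (mu - Vhat) psi_tilde),
   and multiplying by psi_tilde e^{-U} and integrating by parts on [0, R] gives
   the weighted energy estimate.  The critical values of psi are negligible, as
   psi is analytic, and the set of critical points is negligible because f is a
   non-zero polynomial. *)
Require Import Defs.
From HB Require Import structures.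
From mathcomp Require Import all_boot all_order all_algebra.
From mathcomp Require Import all_classical all_reals all_analysis.
From mathcomp Require Import measurable_realfun.
From mathcomp Require Import (canonicals) mpoly.
From mathcomp Require Import ring lra.

Set Implicit Arguments.
Unset Strict Implicit.
Unset Printing Implicit Defensive.

Import Order.TTheory GRing.Theory Num.Theory.
Import numFieldNormedType.Exports.

Local Open Scope classical_set_scope.
Local Open Scope ring_scope.

(** * Borel sets and measurable maps of row-vector spaces *)

Section borel_rV.
Context {R : realType}.

(** The obstacle is that the levels of psi are regular hypersurfaces only for almost every value,
    while their surface measure is given as a supremum over charts. Every geometric fact is
    therefore proved integrated over an interval of levels, where it is a relation between volumes,
    and is brought back to single levels by an almost-everywhere comparison. The measure dsigma /
    |grad psi| is assembled from graphs over countably many cylinders in which one partial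
    derivative of psi has a constant sign. The divergence theorem is used only for fields phi(psi) A
    grad psi with phi zero near 0, which extend by zero to compactly supported C^1 fields. The
    isoperimetric inequality comes from Brunn-Minkowski applied to dilations of superlevel sets,
    whose excess volume is summed over the levels by Tonelli. Rearranged quantities are controlled
    only off a null set of radii; so h, psi_tilde and U are handled as primitives of bounded
    functions, and integrands are exchanged off null sets without asking for their measurability. *)

Lemma open_measurable_rV n (U : set 'rV[R]_n) :
  open U -> measurable (U : set (rVborel R n)).
Proof. exact: sub_sigma_algebra. Qed.

Lemma continuous_in_measurable_rV n (D : set 'rV[R]_n) (f : 'rV[R]_n -> R) :
  open D -> (forall x, D x -> {for x, continuous f}) ->
  measurable_fun (D : set (rVborel R n)) (f : rVborel R n -> R).
Proof.
move=> oD cf.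
apply: (measurability _ (RGenOpens.measurableE R)).
move=> _ [_ [a [b ->]] <-]; apply: open_measurable_rV.
rewrite openE => x [Dx fx]; apply: filterI; first exact: open_nbhs_nbhs.
by apply: cf => //; apply: open_nbhs_nbhs; split => //; exact: interval_open.
Qed.

Lemma continuous_measurable_rV n (f : 'rV[R]_n -> R) :
  continuous f -> measurable_fun setT (f : rVborel R n -> R).
Proof.
move=> cf; apply: continuous_in_measurable_rV; first exact: openT.
by move=> x _; exact: cf.
Qed.

Lemma coord_measurable n (i : 'I_n) :
  measurable_fun setT ((fun x => x ord0 i) : rVborel R n -> R).
Proof. by apply: continuous_measurable_rV => x; exact: coord_continuous. Qed.

Lemma coord_le_norm n (x : 'rV[R]_n) i : `|x ord0 i| <= `|x|.
Proof.
rewrite [leRHS]mx_normrE; exact: (le_bigmax _ (fun ij => `|x ij.1 ij.2|) (ord0, i)).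
Qed.

Definition box n (a b : 'rV[R]_n) : set 'rV[R]_n :=
  [set y | forall i, a ord0 i < y ord0 i < b ord0 i].

Definition cbox n (a b : 'rV[R]_n) : set 'rV[R]_n :=
  [set y | forall i, a ord0 i <= y ord0 i <= b ord0 i].

Lemma box_cbox n (a b : 'rV[R]_n) : box a b `<=` cbox a b.
Proof. by move=> y yab i; have /andP[? ?] := yab i; rewrite !ltW. Qed.

Lemma ball_rVP n (x : 'rV[R]_n) e y : 0 < e ->
  ball x e y <-> forall i, `|x ord0 i - y ord0 i| < e.
Proof.
move=> e0; split=> [[_ xy] i|xy]; first exact: xy.
by split => // i j; rewrite (ord1 i); exact: xy.
Qed.

Lemma box_open n (a b : 'rV[R]_n) : open (box a b).
Proof.
rewrite openE => x xab.
suff : nbhs x [set y : 'rV[R]_n | forall i, a ord0 i < y ord0 i < b ord0 i] by [].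
apply: (@filter_forall _ _ (fun i (y : 'rV[R]_n) => a ord0 i < y ord0 i < b ord0 i)
  (nbhs x) (nbhs_filter x)) => i; have := @coord_continuous R 1 n ord0 i x.
move=> /(_ [set t | a ord0 i < t < b ord0 i]); apply; apply: open_nbhs_nbhs.
split; last exact: xab.
rewrite (_ : mkset _ = `]a ord0 i, b ord0 i[%classic); first exact: interval_open.
by apply/seteqP; split => t /=; rewrite in_itv.
Qed.

Lemma box_measurable n (a b : 'rV[R]_n) : measurable (box a b : set (rVborel R n)).
Proof. by apply: open_measurable_rV; exact: box_open. Qed.

Lemma boxI n (a b c d : 'rV[R]_n) : box a b `&` box c d =
  box (\row_i Num.max (a ord0 i) (c ord0 i)) (\row_i Num.min (b ord0 i) (d ord0 i)).
Proof.
apply/seteqP; split=> y.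
  move=> [ab cd] i; have /andP[h1 h2] := ab i; have /andP[h3 h4] := cd i.
  by rewrite !mxE gt_max lt_min h1 h2 h3 h4.
move=> h; split=> i; move: (h i); rewrite !mxE gt_max lt_min.
  by move=> /andP[/andP[-> _] /andP[-> _]].
by move=> /andP[/andP[_ ->] /andP[_ ->]].
Qed.

(* p encodes the box with rational vertices p.1 and p.2 *)
Definition rbox n (p : 'rV[rat]_n * 'rV[rat]_n) : set 'rV[R]_n :=
  box (map_mx ratr p.1) (map_mx ratr p.2).

(** The closed box, and not only the open one, is placed inside [U]: the implicit functions and
    Taylor estimates below need their hypotheses up to the boundary of the box. *)
Lemma open_rbox n (U : set 'rV[R]_n) x : open U -> U x ->
  exists p : 'rV[rat]_n * 'rV[rat]_n, rbox p x /\
    cbox (map_mx ratr p.1) (map_mx ratr p.2) `<=` U.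
Proof.
move=> oU Ux; have /nbhs_ballP[e /= e0 eU] : nbhs x U by exact: open_nbhs_nbhs.
have /choice[f fP] : forall i : 'I_n, exists q : rat,
    ratr q \in `](x ord0 i - e), (x ord0 i)[%R.
  by move=> i; apply: rat_in_itvoo; rewrite ltrBlDr ltrDl.
have /choice[g gP] : forall i : 'I_n, exists q : rat,
    ratr q \in `](x ord0 i), (x ord0 i + e)[%R.
  by move=> i; apply: rat_in_itvoo; rewrite ltrDl.
exists (\row_i f i, \row_i g i); split=> [i|y yfg].
  rewrite /= !mxE; have := fP i; have := gP i; rewrite !in_itv/=.
  by move=> /andP[-> _] /andP[_ ->].
apply: eU; apply/ball_rVP => // i; rewrite distrC ltr_distl.
have := yfg i; rewrite !mxE => /andP[h1 h2].
have := fP i; have := gP i; rewrite !in_itv/= => /andP[_ h3] /andP[h4 _].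
by rewrite (lt_le_trans h4)//= (le_lt_trans h2).
Qed.

Lemma open_bigcup_rbox n (U : set 'rV[R]_n) : open U ->
  U = \bigcup_(p in [set p | rbox p `<=` U]) rbox p.
Proof.
move=> oU; apply/seteqP; split=> [x Ux|x [p /= pU px]]; last exact: pU.
have [p [px pU]] := open_rbox oU Ux.
by exists p => //=; apply: subset_trans pU; exact: box_cbox.
Qed.

(** An open set is a countable union of rational boxes, and the preimage of a box is a finite
    intersection of preimages under the coordinates. *)
Lemma measurable_fun_rV d (T : measurableType d) (D : set T) n
    (f : T -> rVborel R n) : measurable D ->
  (forall i, measurable_fun D (fun x => f x ord0 i)) -> measurable_fun D f.
Proof.
move=> mD mf; apply: (@measurability _ _ T (rVborel R n) D f (@open 'rV[R]_n) erefl) => _ [U oU <-].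
rewrite (open_bigcup_rbox oU) preimage_bigcup setI_bigcupr bigcup_mkcond.
apply: countable_bigcupT_measurable; first exact: countableP.
move=> p; case: ifP => // _.
rewrite (_ : _ `&` _ = D `&` \bigcap_(i in [set: 'I_n])
    (D `&` (fun x => f x ord0 i) @^-1`
      `](map_mx ratr p.1 : 'rV[R]_n) ord0 i, (map_mx ratr p.2 : 'rV[R]_n) ord0 i[)).
  apply: measurableI => //; apply: fin_bigcap_measurable => [|i _].
    exact: finite_finset.
  exact: mf.
apply/seteqP; split=> [x [Dx fx]|x [Dx fx]]; split => //.
  by move=> i _; split => //=; rewrite in_itv/=; exact: fx.
by move=> i; have [_] := fx i I; rewrite /= in_itv.
Qed.

(** Open boxes are stable under intersection and generate the Borel sets, and the cubes of half-side
    k exhaust the space with finite mass, so uniqueness on a pi-system applies. *)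
Lemma rV_measure_unique n (m1 m2 : {measure set (rVborel R n) -> \bar R}) :
  (forall a b, m1 (box a b) = m2 (box a b)) ->
  (forall a b, (m1 (box a b) < +oo)%E) ->
  forall A, measurable A -> m1 A = m2 A.
Proof.
move=> m12 m1oo A mA.
pose G : set (set (rVborel R n)) := [set B | exists a b, B = box a b].
have mG : G `<=` measurable by move=> _ [a [b ->]]; exact: box_measurable.
have GE : @measurable _ (rVborel R n) `<=` <<s G >>.
  apply: smallest_sub; first exact: smallest_sigma_algebra.
  move=> U oU; rewrite (open_bigcup_rbox oU) bigcup_mkcond.
  apply: (@countable_bigcupT_measurable _ (g_sigma_algebraType G)) => [|p].
    exact: countableP.
  by case: ifP => // _; apply: sub_sigma_algebra; do 2 eexists.
apply: (g_sigma_algebra_measure_unique G mG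
  (fun k => box (const_mx (- k%:R)) (const_mx k%:R))) => //.
- by move=> k; do 2 eexists.
- apply/seteqP; split=> // x _; have [k xk] : exists k, `|x| < k%:R.
    by exists (Num.trunc `|x|).+1; exact: truncnS_gt.
  exists k => // i; rewrite !mxE -ltr_norml (le_lt_trans _ xk)//.
  exact: coord_le_norm.
- by move=> _ _ [a [b ->]] [c [d ->]]; do 2 eexists; exact: boxI.
- by move=> _ [a [b ->]]; exact: m12.
- exact: GE.
Qed.

End borel_rV.

(** * Lebesgue measure as a sigma-finite measure; Tonelli in any coordinate; scaling *)

Section leb.
Context {R : realType}.
Implicit Types m n : nat.

Definition rVcons n (p : measurableTypeR R * rVborel R n) : rVborel R n.+1 :=
  row_mx (p.1%:M : 'rV[R]_1) (p.2 : 'rV[R]_n).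

Lemma rVcons0 n p : (@rVcons n p) ord0 ord0 = p.1.
Proof.
have := @row_mxEl R 1 1 n (p.1%:M) p.2 ord0 ord0.
by rewrite [X in _ = X]mxE /= mulr1n => <-; congr (row_mx _ _ _ _); exact: val_inj.
Qed.

Lemma rVconsS n p (i : 'I_n) : (rVcons p) ord0 (lift ord0 i) = p.2 ord0 i.
Proof.
have <- := @row_mxEr R 1 1 n (p.1%:M) p.2 ord0 i.
by congr (row_mx _ _ _ _); exact: val_inj.
Qed.

Lemma measurable_rVcons n : measurable_fun setT (@rVcons n).
Proof.
apply: measurable_fun_rV => // i; case: (unliftP ord0 i) => [j|] ->.
  under eq_fun do rewrite rVconsS.
  exact: (measurableT_comp (coord_measurable j) measurable_snd).
under eq_fun do rewrite rVcons0.
exact: measurable_fst.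
Qed.

Definition rVuncons n (x : rVborel R n.+1) : measurableTypeR R * rVborel R n :=
  (x ord0 ord0, \row_i x ord0 (lift ord0 i)).

Lemma measurable_rVuncons n : measurable_fun setT (@rVuncons n).
Proof.
apply: measurable_fun_pair; first exact: coord_measurable.
apply: measurable_fun_rV => // i; under eq_fun do rewrite mxE.
exact: coord_measurable.
Qed.

Lemma rVconsK n : cancel (@rVcons n) (@rVuncons n).
Proof.
move=> [t x]; rewrite /rVuncons rVcons0; congr (_, _).
by apply/rowP => i; rewrite mxE rVconsS.
Qed.

Section step.
Variables (n : nat) (mu : {sigma_finite_measure set (rVborel R n) -> \bar R}).

(** The recursive formula of [lebesgue] only gives a set function. Presented as the image of a
    product measure, it becomes a sigma-finite measure, as Tonelli requires. *)
Definition leb_step : set (rVborel R n.+1) -> \bar R :=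
  pushforward (@lebesgue_measure R \x mu)%E (@rVcons n).

Let leb_step0 : leb_step set0 = 0%E.
Proof. by rewrite /leb_step /pushforward preimage_set0 measure0. Qed.

Let leb_step_ge0 A : (0 <= leb_step A)%E.
Proof. exact: (measure_ge0 (@lebesgue_measure R \x mu)%E). Qed.

Let leb_step_additive : semi_sigma_additive leb_step.
Proof.
exact: (@measure_semi_sigma_additive _ _ _
 (measure_function_pushforward__canonical__measure_function_Measure
    (@lebesgue_measure R \x mu)%E (@measurable_rVcons n))).
Qed.

HB.instance Definition _ := isMeasure.Build _ _ _ leb_step
  leb_step0 leb_step_ge0 leb_step_additive.

Let leb_step_sigma_finite : sigma_finite setT leb_step.
Proof.
have /sigma_finiteP[F [TF ndF Foo]] := sigma_finiteT (@lebesgue_measure R).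
have /sigma_finiteP[G [TG ndG Goo]] := sigma_finiteT mu.
exists (fun k => @rVuncons n @^-1` (F k `*` G k)).
  rewrite -preimage_bigcup (_ : \bigcup_i _ = setT)// -subTset => -[x y] _.
  have [k _ Fk] : (\bigcup_i F i) x by rewrite -TF.
  have [l _ Gl] : (\bigcup_i G i) y by rewrite -TG.
  exists (maxn k l) => //; split.
    by move: x Fk; exact/subsetPset/ndF/leq_maxl.
  by move: y Gl; exact/subsetPset/ndG/leq_maxr.
move=> k; have [mF ?] := Foo k; have [mG ?] := Goo k; split.
  rewrite -[X in measurable X]setTI; apply: measurable_rVuncons => //.
  exact: measurableX.
rewrite /leb_step /pushforward -comp_preimage (_ : _ \o _ = id); last first.
  by apply/funext => p /=; rewrite rVconsK.
by rewrite preimage_id product_measure1E// lte_mul_pinfty// ge0_fin_numE.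
Qed.

HB.instance Definition _ := Measure_isSigmaFinite.Build _ _ _ leb_step
  leb_step_sigma_finite.

End step.

Fixpoint leb n : {sigma_finite_measure set (rVborel R n) -> \bar R} :=
  match n with
  | 0 => \d_((0 : 'rV[R]_0) : rVborel R 0)
  | m.+1 => leb_step (leb m)
  end.

Lemma lebE n (A : set (rVborel R n)) : measurable A -> lebesgue A = leb n A.
Proof.
elim: n A => [|n IH] A mA; first by [].
rewrite /= /leb_step /pushforward /product_measure1; apply: eq_integral => t _.
rewrite /= IH.
  by congr (leb n _); apply/seteqP; split=> y /=; rewrite /xsection /= ?inE.
rewrite -[X in measurable X]setTI.
exact: (measurableT_comp (@measurable_rVcons n) (pair1_measurable t)).
Qed.

Lemma leb_box n (a b : 'rV[R]_n) :
  leb n (box a b) = (\prod_(i < n) lebesgue_measure `]a ord0 i, b ord0 i[%classic)%E.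
Proof.
elim: n a b => [|n IH] a b.
  rewrite big_ord0 /= /dirac indicE mem_set//= => -[].
  by move=> [].
rewrite big_ord_recl /= /leb_step /pushforward.
rewrite (_ : _ @^-1` _ = `]a ord0 ord0, b ord0 ord0[%classic `*`
    box (\row_i a ord0 (lift ord0 i)) (\row_i b ord0 (lift ord0 i))).
  rewrite product_measure1E//; last exact: box_measurable.
  congr (_ * _)%E; rewrite IH; apply: eq_bigr => i _.
  by rewrite !mxE.
apply/seteqP; split=> -[t y] /=.
  move=> tyab; split=> [|i]; first by have := tyab ord0; rewrite rVcons0 in_itv.
  by have := tyab (lift ord0 i); rewrite rVconsS !mxE.
move=> [tab yab] i; case: (unliftP ord0 i) => [j|] ->.
  by have := yab j; rewrite rVconsS !mxE.
by rewrite rVcons0; move: tab; rewrite in_itv.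
Qed.

Lemma leb_box_lty n (a b : 'rV[R]_n) : (leb n (box a b) < +oo)%E.
Proof.
rewrite leb_box ltey_eq prode_fin_num// => i _; rewrite ge0_fin_numE//.
by rewrite lebesgue_measure_itv; case: ifP => _; rewrite ltry.
Qed.

Lemma leb_unique n (m : {measure set (rVborel R n) -> \bar R}) :
  (forall a b, m (box a b) = leb n (box a b)) ->
  forall A, measurable A -> m A = leb n A.
Proof.
move=> mleb; apply: rV_measure_unique => // a b.
by rewrite mleb leb_box_lty.
Qed.

Import HBNNSimple.

(** The integral is a supremum over simple functions below the integrand, whose level sets for
    nonzero values lie in [D]; so only the masses of measurable subsets of [D] enter. Bare set
    functions such as [lebesgue] and [surface_measure] can thus be replaced by true measures,
    whatever the function [f]. *)
Lemma eq_setfun_integral d (T : measurableType d) (m1 m2 : set T -> \bar R)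
    (D : set T) (f : T -> \bar R) :
  (forall A, measurable A -> A `<=` D -> m1 A = m2 A) ->
  (\int[m1]_(x in D) f x = \int[m2]_(x in D) f x)%E.
Proof.
move=> m12.
have key (g : T -> \bar R) (h : {nnsfun T >-> R}) :
    (forall x, ~ D x -> g x = 0%E) -> (forall x, (h x)%:E <= g x)%E ->
    sintegral m1 h = sintegral m2 h.
  move=> gD hg; rewrite /sintegral; apply: eq_fsbigr => r _.
  have [->|r0] := eqVneq r 0; first by rewrite !mul0e.
  congr (_ * _)%E; apply: m12; first exact: measurable_funPTI.
  move=> x /= hx; apply: contrapT => /gD gx; have := hg x.
  rewrite gx hx lee_fin => r_le0; move/eqP : r0; apply.
  by apply/eqP; rewrite eq_le r_le0 -hx fun_ge0.
rewrite /integral; congr (ereal_sup _ - ereal_sup _)%E;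
  apply: eq_imagel => h /= hg; apply: (key _ _ _ hg) => x Dx.
- by rewrite funepos_restrict patchE memNset.
- by rewrite funeneg_restrict patchE memNset.
Qed.

Lemma integral_lebE n (D : set (rVborel R n)) (f : rVborel R n -> \bar R) :
  (\int[lebesgue]_(x in D) f x = \int[leb n]_(x in D) f x)%E.
Proof. by apply: eq_setfun_integral => A mA _; exact: lebE. Qed.

Definition insertp n (i : 'I_n.+1) (p : measurableTypeR R * rVborel R n) :
  rVborel R n.+1 := insert i p.2 p.1.

Lemma insert_i n (i : 'I_n.+1) (y : 'rV[R]_n) t : insert i y t ord0 i = t.
Proof. by rewrite mxE unlift_none. Qed.

Lemma insert_lift n (i : 'I_n.+1) (y : 'rV[R]_n) t j :
  insert i y t ord0 (lift i j) = y ord0 j.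
Proof. by rewrite mxE liftK. Qed.

Lemma measurable_insertp n i : measurable_fun setT (@insertp n i).
Proof.
apply: measurable_fun_rV => // j; case: (unliftP i j) => [k|] ->.
  under eq_fun do rewrite insert_lift.
  exact: (measurableT_comp (coord_measurable k) measurable_snd).
under eq_fun do rewrite insert_i.
exact: measurable_fst.
Qed.

(** The recursion singles out the first coordinate. Since the volume of a box is a symmetric
    product, uniqueness on boxes lets any coordinate play that role. *)
Lemma leb_insertp n (i : 'I_n.+1) (A : set (rVborel R n.+1)) : measurable A ->
  leb n.+1 A = (lebesgue_measure \x leb n)%E (@insertp n i @^-1` A).
Proof.
move=> mA; pose m := (measure_function_pushforward__canonical__measure_function_Measure
    (@lebesgue_measure R \x leb n)%E (@measurable_insertp n i)).
apply/esym; apply: (@leb_unique n.+1 m _ _ mA) => a b.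
rewrite /m /= /pushforward.
rewrite (_ : _ @^-1` _ = `]a ord0 i, b ord0 i[%classic `*`
    box (\row_j a ord0 (lift i j)) (\row_j b ord0 (lift i j))).
  rewrite product_measure1E//; last exact: box_measurable.
  rewrite !leb_box (bigD1 i)//=; congr (_ * _)%E.
  rewrite [RHS](reindex_omap (lift i) (unlift i)) /=.
    apply: eq_big => [j|j _]; first by rewrite [_ == i]eq_sym neq_lift liftK eqxx.
    by rewrite !mxE.
  by move=> j; rewrite eq_sym => /unlift_some[k ->] ->.
apply/seteqP; split=> -[t y] /=.
  move=> tyab; split=> [|j]; first by have := tyab i; rewrite insert_i in_itv.
  by have := tyab (lift i j); rewrite insert_lift !mxE.
move=> [tab yab] j; case: (unliftP i j) => [k|] ->.
  by have := yab k; rewrite insert_lift !mxE.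
by rewrite insert_i; move: tab; rewrite in_itv.
Qed.

Lemma integral_insertp n (i : 'I_n.+1) (f : rVborel R n.+1 -> \bar R) :
  measurable_fun setT f -> (forall x, 0 <= f x)%E ->
  (\int[leb n.+1]_x f x = \int[lebesgue_measure \x leb n]_p f (@insertp n i p))%E.
Proof.
move=> mf f0.
rewrite (eq_measure_integral
  (measure_function_pushforward__canonical__measure_function_Measure
    (@lebesgue_measure R \x leb n)%E (@measurable_insertp n i))) => [|A mA _].
  by rewrite (ge0_integral_pushforward (@measurable_insertp n i)).
exact: leb_insertp.
Qed.

Lemma tonelli_insert1 n (i : 'I_n.+1) (f : rVborel R n.+1 -> \bar R) :
  measurable_fun setT f -> (forall x, 0 <= f x)%E ->
  (\int[leb n.+1]_x f x = \int[lebesgue_measure]_t \int[leb n]_y f (insert i y t))%E.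
Proof.
move=> mf f0; rewrite (integral_insertp i)// fubini_tonelli1//.
exact: (measurableT_comp mf (@measurable_insertp n i)).
Qed.

Lemma tonelli_insert2 n (i : 'I_n.+1) (f : rVborel R n.+1 -> \bar R) :
  measurable_fun setT f -> (forall x, 0 <= f x)%E ->
  (\int[leb n.+1]_x f x = \int[leb n]_y \int[lebesgue_measure]_t f (insert i y t))%E.
Proof.
move=> mf f0; rewrite (integral_insertp i)// fubini_tonelli2//.
exact: (measurableT_comp mf (@measurable_insertp n i)).
Qed.

Lemma measurable_affine n (c : R) (v : 'rV[R]_n) :
  measurable_fun setT ((fun x => c *: x + v) : rVborel R n -> rVborel R n).
Proof.
apply: measurable_fun_rV => // i; under eq_fun do rewrite !mxE.
by apply: measurable_funD => //; apply: measurable_funM => //; exact: coord_measurable.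
Qed.

Lemma lebesgue_measure_affine (c v : R) (A : set R) : 0 < c -> measurable A ->
  lebesgue_measure A = (c%:E * lebesgue_measure ((fun x => c * x + v)%R @^-1` A))%E.
Proof.
move=> c0 mA.
have mf : measurable_fun setT ((fun x => c * x + v) : measurableTypeR R -> measurableTypeR R).
  by apply: measurable_funD => //; exact: measurable_funM.
pose m := mscale (NngNum (ltW c0))
  (measure_function_pushforward__canonical__measure_function_Measure
    (@lebesgue_measure R) mf).
apply: (@lebesgue_measure_unique _ m) => // _ [[a b] _ <-].
rewrite -[RHS]/(c%:E * lebesgue_measure ((fun x => (c * x + v)%R) @^-1` `]a, b]%classic))%E.
rewrite lebesgue_measure_itv /=.
rewrite (_ : _ @^-1` _ = `]((a - v) / c), ((b - v) / c)]%classic); last first.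
  apply/seteqP; split=> x /=; rewrite !in_itv/=;
    by rewrite ltr_pdivrMr// ler_pdivlMr// ltrBlDr lerBrDr mulrC.
rewrite lebesgue_measure_itv/= !lte_fin ltr_pM2r ?invr_gt0// ltrD2r.
case: ifP => ab; last by rewrite mule0.
by rewrite -EFinM; congr EFin; field; rewrite gt_eqF.
Qed.

(** Uniqueness on boxes reduces this to the scaling of intervals, with one factor [c] for each
    coordinate. *)
Lemma leb_affine n (c : R) (v : 'rV[R]_n) (A : set (rVborel R n)) :
  0 < c -> measurable A ->
  leb n A = ((c ^+ n)%:E * leb n ((fun x => c *: x + v)%R @^-1` A))%E.
Proof.
move=> c0 mA.
pose m := mscale (NngNum (ltW (exprn_gt0 n c0)))
  (measure_function_pushforward__canonical__measure_function_Measure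
    (leb n) (@measurable_affine n c v)).
apply/esym; apply: (@leb_unique n m _ _ mA) => a b.
rewrite -[LHS]/((c ^+ n)%:E * leb n ((fun x => (c *: x + v)%R) @^-1` box a b))%E.
rewrite (_ : _ @^-1` _ = box (c^-1 *: (a - v)) (c^-1 *: (b - v))); last first.
  apply/seteqP; split=> x /= xab i; have := xab i; rewrite !mxE;
    by rewrite ![c^-1 * _]mulrC ltr_pdivrMr// ltr_pdivlMr// ltrBlDr ltrBrDr mulrC.
rewrite !leb_box (_ : c ^+ n = \prod_(i < n) c); last first.
  by rewrite prodr_const card_ord.
rewrite -prodEFin -big_split /=; apply: eq_bigr => i _.
rewrite [RHS](@lebesgue_measure_affine c (v ord0 i) _ c0)//; congr (_ * _)%E.
congr lebesgue_measure; apply/seteqP; split=> x /=; rewrite !in_itv/= !mxE;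
  by rewrite ![c^-1 * _]mulrC ltr_pdivrMr// ltr_pdivlMr// ltrBlDr ltrBrDr mulrC.
Qed.

End leb.

(** * Calculus from continuous partial derivatives: mean value, chain rule, continuity *)

Section calculus.
Context {R : realType}.
Implicit Types n : nat.

Lemma is_derive_line n (f : 'rV[R]_n -> R) (x v : 'rV[R]_n) (t : R) :
  derivable f (t *: v + x) v ->
  is_derive t 1 (fun h : R => f (h *: v + x)) ('D_v f (t *: v + x)).
Proof.
move=> df; have e : (fun h : R => h^-1 *: (((fun h => f (h *: v + x)) \o shift t) (h *: 1) - f (t *: v + x))) =
    (fun h => h^-1 *: ((f \o shift (t *: v + x)) (h *: v) - f (t *: v + x))).
  apply/funext => h /=; congr (_ *: (f _ - _)).
  by rewrite [h *: 1]mulr1 scalerDl addrA.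
by split; rewrite /derivable /derive e.
Qed.

Lemma mvt_from0 (g dg : R -> R) (c : R) :
  (forall s, Num.min 0 c <= s <= Num.max 0 c -> is_derive s 1 g (dg s)) ->
  exists2 s, Num.min 0 c <= s <= Num.max 0 c & g c - g 0 = dg s * c.
Proof.
move=> gd.
have cont a b : (forall s, s \in `[a, b] -> Num.min 0 c <= s <= Num.max 0 c) ->
    {within `[a, b], continuous g}.
  move=> ab; apply: derivable_within_continuous => s /ab /gd ds.
  exact: ex_derive.
have [c0|c0] := leP 0 c; rewrite ?(min_l c0) ?(max_r c0) ?(min_r (ltW c0)) ?(max_l (ltW c0)) in gd cont *.
  have [s||s] := @MVT_segment R g dg 0 c c0.
  - by rewrite in_itv/= => /andP[s0 sc]; apply: gd; rewrite !ltW.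
  - by apply: cont => z; rewrite in_itv.
  - by rewrite in_itv/= subr0 => sc e; exists s.
have [s||s] := @MVT_segment R g dg c 0 (ltW c0).
- by rewrite in_itv/= => /andP[s0 sc]; apply: gd; rewrite !ltW.
- by apply: cont => z; rewrite in_itv.
- rewrite in_itv/= sub0r => sc e; exists s => //.
  by rewrite -opprB e mulrN opprK.
Qed.

(** The coordinate box with opposite corners x and y. For the sup norm its points are no farther
    from x than y is, so it stays inside every ball around x that contains y. *)
Definition hull n (x y : 'rV[R]_n) : set 'rV[R]_n :=
  [set z | forall i, Num.min (x ord0 i) (y ord0 i) <= z ord0 i
                  <= Num.max (x ord0 i) (y ord0 i)].

Lemma le_rV_norm n (u v : 'rV[R]_n) :
  (forall i, `|u ord0 i| <= `|v ord0 i|) -> `|u| <= `|v|.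
Proof.
move=> uv; rewrite [leLHS]mx_normrE; apply/bigmax_leP; split => //= -[i j] _ /=.
by rewrite (ord1 i) (le_trans (uv j))// coord_le_norm.
Qed.

Lemma hull_dist n (x y z : 'rV[R]_n) : hull x y z -> `|z - x| <= `|y - x|.
Proof.
move=> h; apply: le_rV_norm => i; rewrite !mxE; have := h i.
have [xy|xy] := leP (x ord0 i) (y ord0 i).
  by move=> /andP[xz zy]; rewrite !ger0_norm ?subr_ge0// lerD2r.
by move=> /andP[xz zy]; rewrite !ler0_norm ?subr_le0 ?(ltW xy)// lerN2 lerD2r.
Qed.

Lemma hull_cbox n (a b x y : 'rV[R]_n) : cbox a b x -> cbox a b y ->
  hull x y `<=` cbox a b.
Proof.
move=> xab yab z h i; have := h i; have := xab i; have := yab i.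
move=> /andP[? ?] /andP[? ?] /andP[zl zr]; apply/andP; split.
  by apply: le_trans zl; rewrite le_min; apply/andP.
by apply: (le_trans zr); rewrite ge_max; apply/andP.
Qed.

(** The increment telescopes along a path that changes one coordinate at a time, and the
    one-variable mean value theorem applies on each edge. With continuous partial derivatives this
    stands in for total differentiability. *)
Lemma mvt_rV n (f : 'rV[R]_n -> R) (x y : 'rV[R]_n) :
  (forall z, hull x y z -> forall i : 'I_n, derivable f z (delta_mx 0 i)) ->
  exists xi : 'I_n -> 'rV[R]_n, (forall k, hull x y (xi k)) /\
    f y - f x = \sum_k partial k f (xi k) * (y ord0 k - x ord0 k).
Proof.
move=> df.
(* [z k] takes its first k coordinates from y and the others from x, so consecutive points differ in
   one coordinate. *)
pose z (k : nat) : 'rV[R]_n := \row_i if (i < k)%N then y ord0 i else x ord0 i.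
have hmin (a b : R) : Num.min a b <= a <= Num.max a b.
  by rewrite ge_min le_max lexx.
have hmax (a b : R) : Num.min a b <= b <= Num.max a b.
  by rewrite ge_min le_max lexx !orbT.
have key (k : 'I_n) : exists2 xi, hull x y xi &
    f (z k.+1) - f (z k) = partial k f xi * (y ord0 k - x ord0 k).
  pose e : 'rV[R]_n := delta_mx 0 k.
  have zS : z k.+1 = (y ord0 k - x ord0 k) *: e + z k.
    apply/rowP => i; rewrite !mxE /= ltnS leq_eqVlt.
    have [->|ik] := eqVneq i k; first by rewrite eqxx ltnn /= mulr1 subrK.
    by rewrite -val_eqE /= in ik; rewrite (negbTE ik) mulr0 add0r.
  have hz s : Num.min 0 (y ord0 k - x ord0 k) <= s <= Num.max 0 (y ord0 k - x ord0 k) ->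
      hull x y (s *: e + z k).
    move=> sb i; rewrite !mxE /=.
    have [->|ik] := eqVneq i k; last first.
      by rewrite mulr0 add0r; case: ifP.
    rewrite ltnn mulr1; move: sb.
    have [xy|xy] := leP (x ord0 k) (y ord0 k).
      by rewrite !(min_l, max_r) ?subr_ge0// => /andP[? ?]; apply/andP; split; lra.
    rewrite !(min_r, max_l) ?subr_le0 ?(ltW xy)// => /andP[? ?].
    by apply/andP; split; lra.
  have [s sb es] := @mvt_from0 (fun s => f (s *: e + z k)) _ _
    (fun s sb => is_derive_line (df _ (hz s sb) k)).
  exists (s *: e + z k); first exact: hz.
  by rewrite zS -es scale0r add0r.
have /choice[xi hxi] : forall k : 'I_n, exists xi, hull x y xi /\
    f (z k.+1) - f (z k) = partial k f xi * (y ord0 k - x ord0 k).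
  by move=> k; have [xi ? ?] := key k; exists xi.
exists xi; split=> [k|]; first by have [] := hxi k.
under eq_bigr => k _ do rewrite -(proj2 (hxi k)).
rewrite -(big_mkord predT (fun k => f (z k.+1) - f (z k))) telescope_sumr//.
congr (f _ - f _); apply/rowP => i; rewrite mxE ?ltn_ord//.
Qed.

Lemma cvg_sumR (T : Type) (F : set_system T) (FF : Filter F) (I : Type)
    (r : seq I) (P : pred I) (f : I -> T -> R) (l : I -> R) :
  (forall i, P i -> f i x @[x --> F] --> l i) ->
  \sum_(i <- r | P i) f i x @[x --> F] --> \sum_(i <- r | P i) l i.
Proof. by move=> fl; apply: cvg_big => //; exact: add_continuous. Qed.

Lemma cvg_rV (T : Type) (F : set_system T) (FF : Filter F) n
    (c : T -> 'rV[R]_n) (l : 'rV[R]_n) :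
  (forall k, c s ord0 k @[s --> F] --> l ord0 k) -> c s @[s --> F] --> l.
Proof.
move=> cl; apply/cvg_ballP => e e0.
suff : \forall s \near F, forall i, `|l ord0 i - c s ord0 i| < e.
  by apply: filterS => s ls; apply/ball_rVP.
apply: (@filter_forall _ _ (fun i s => `|l ord0 i - c s ord0 i| < e)) => i.
by move/cvgrPdist_lt : (cl i) => /(_ e e0).
Qed.

Lemma is_derive_continuous (f : R -> R) (t df : R) : is_derive t 1 f df ->
  {for t, continuous f}.
Proof.
by move=> [fd _]; apply: differentiable_continuous; apply/derivable1_diffP.
Qed.

(** In the decomposition of [mvt_rV] between c t and c (h + t), the intermediate points tend to c t,
    and continuity of the partial derivatives passes to the limit in the difference quotient. *)
Lemma is_derive_curve n (U : set 'rV[R]_n) (f : 'rV[R]_n -> R)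
    (c : R -> 'rV[R]_n) (dc : 'I_n -> R) (t : R) :
  open U -> isC1 U f -> U (c t) ->
  (forall k, is_derive t 1 (fun s => c s ord0 k) (dc k)) ->
  is_derive t 1 (fun s => f (c s)) (\sum_k partial k f (c t) * dc k).
Proof.
move=> oU fU Uct cd.
have /nbhs_ballP[r /= r0 rU] : nbhs (c t) U by exact: open_nbhs_nbhs.
have ct : c s @[s --> t] --> c t.
  by apply: cvg_rV => k; have /is_derive_continuous := cd k.
have ct0 : c (h + t) @[h --> 0^'] --> c t.
  apply: cvg_trans (cvg_app _ (@cvg_within _ _ _ _)) _.
  have ht : (h + t) @[h --> (0 : R)] --> t.
    by rewrite -[X in _ --> X]add0r; apply: cvgD => //; exact: cvg_cst.
  exact: cvg_comp ht ct.
have /choice[xi xiP] : forall h : R, exists xi : 'I_n -> 'rV[R]_n,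
    ball (c t) r (c (h + t)) -> (forall k, `|xi k - c t| <= `|c (h + t) - c t|) /\
    f (c (h + t)) - f (c t) = \sum_k partial k f (xi k) * (c (h + t) ord0 k - c t ord0 k).
  move=> h; have [hr|] := pselect (ball (c t) r (c (h + t))); last first.
    by exists (fun=> 0).
  have [z zh i|xi [xih e]] := @mvt_rV n f (c t) (c (h + t)).
    suff /(fU i)[] : U z by [].
    apply: rU; rewrite -ball_normE /= distrC (le_lt_trans (hull_dist zh))//.
    by move: hr; rewrite -ball_normE /= distrC.
  by exists xi => _; split=> // k; apply: hull_dist.
have nb : \forall h \near 0^', ball (c t) r (c (h + t)).
  by move/cvg_ballP : ct0 => /(_ r r0).
have xic k : xi h k @[h --> 0^'] --> c t.
  apply/cvgrPdist_lt => e e0; move/cvgrPdist_lt : ct0 => /(_ e e0).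
  apply: filterS2 nb => h /xiP[/(_ k) h1 _] h2.
  by rewrite distrC (le_lt_trans h1)// distrC.
have main : h^-1 *: (f (c (h + t)) - f (c t)) @[h --> 0^'] -->
    \sum_k partial k f (c t) * dc k.
  have S : \sum_k partial k f (xi h k) * (h^-1 *: (c (h + t) ord0 k - c t ord0 k))
      @[h --> 0^'] --> \sum_k partial k f (c t) * dc k.
    apply: cvg_sumR => k _; apply: cvgM.
      by apply: cvg_comp (xic k) _; have [] := fU k _ Uct.
    have [/cvg_ex[l cl] <-] := cd k; rewrite /derive.
    have e : (fun h : R => h^-1 *: (((fun s => c s ord0 k) \o shift t) (h *: 1) - c t ord0 k)) =
        (fun h => h^-1 *: (c (h + t) ord0 k - c t ord0 k)).
      by apply/funext => h /=; rewrite [h *: 1]mulr1.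
    by rewrite e in cl *; rewrite (cvg_lim _ cl).
  apply: cvg_trans S; apply: near_eq_cvg; apply: filterS nb => h /xiP[_ ->].
  by rewrite scaler_sumr; apply: eq_bigr => k _; exact: mulrCA.
have e : (fun h : R => h^-1 *: (((fun s => f (c s)) \o shift t) (h *: 1) - f (c t))) =
    (fun h => h^-1 *: (f (c (h + t)) - f (c t))).
  by apply/funext => h /=; rewrite [h *: 1]mulr1.
by split; rewrite /derivable /derive e; [apply/cvg_ex; eexists; exact: main|exact: cvg_lim].
Qed.

Lemma isC1_continuous n (U : set 'rV[R]_n) (f : 'rV[R]_n -> R) x :
  open U -> isC1 U f -> U x -> {for x, continuous f}.
Proof.
move=> oU fU Ux; have /nbhs_ballP[r /= r0 rU] : nbhs x U by exact: open_nbhs_nbhs.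
have /choice[xi xiP] : forall y, exists xi : 'I_n -> 'rV[R]_n,
    ball x r y -> (forall k, `|xi k - x| <= `|y - x|) /\
    f y - f x = \sum_k partial k f (xi k) * (y ord0 k - x ord0 k).
  move=> y; have [hr|] := pselect (ball x r y); last by exists (fun=> 0).
  have [z zh i|xi [xih e]] := @mvt_rV n f x y.
    suff /(fU i)[] : U z by [].
    apply: rU; rewrite -ball_normE /= distrC (le_lt_trans (hull_dist zh))//.
    by move: hr; rewrite -ball_normE /= distrC.
  by exists xi => _; split=> // k; apply: hull_dist.
have FFx : Filter (nbhs x) by exact: nbhs_filter.
have nb : \forall y \near x, ball x r y by exact: nbhsx_ballx.
have xic k : xi y k @[y --> x] --> x.
  apply/cvgrPdist_lt => e e0; have := @nbhsx_ballx _ _ x e e0.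
  apply: filterS2 nb => y /xiP[/(_ k) h1 _]; rewrite -ball_normE /= => h2.
  by rewrite distrC (le_lt_trans h1)// distrC.
have S : f x + \sum_k partial k f (xi y k) * (y ord0 k - x ord0 k)
      @[y --> x] --> f x + \sum_k partial k f x * (x ord0 k - x ord0 k).
  apply: cvgD; first exact: cvg_cst.
  apply: cvg_sumR => k _; apply: cvgM.
    by apply: cvg_comp (xic k) _; have [] := fU k _ Ux.
  by apply: cvgB; [exact: coord_continuous|exact: cvg_cst].
rewrite (_ : f x + _ = f x) in S; last first.
  by rewrite big1 ?addr0// => k _; rewrite subrr mulr0.
apply: cvg_trans S; apply: near_eq_cvg; apply: filterS nb => y /xiP[_ <-].
by rewrite addrC subrK.
Qed.

End calculus.

(** * Graphs over coordinate hyperplanes and the implicit function theorem in a cylinder *)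

Section insert_calculus.
Context {R : realType} {n : nat}.
Implicit Types (i : 'I_n.+1) (y : 'rV[R]_n).

Lemma sum_insert i (F : 'I_n.+1 -> R) :
  \sum_k F k = F i + \sum_j F (lift i j).
Proof. by rewrite (bigD1_ord i). Qed.

Lemma insert_col' i (x : 'rV[R]_n.+1) : insert i (col' i x) (x ord0 i) = x.
Proof.
apply/rowP => k; case: (unliftP i k) => [j|] ->; last by rewrite insert_i.
by rewrite insert_lift mxE.
Qed.

Lemma col'_insert i y t : col' i (insert i y t) = y.
Proof. by apply/rowP => j; rewrite mxE insert_lift. Qed.

Lemma cvg_insert (T : Type) (F : set_system T) (FF : Filter F) i
    (y : T -> 'rV[R]_n) (t : T -> R) y0 t0 :
  y x @[x --> F] --> y0 -> t x @[x --> F] --> t0 ->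
  insert i (y x) (t x) @[x --> F] --> insert i y0 t0.
Proof.
move=> yy0 tt0; apply: cvg_rV => k; case: (unliftP i k) => [j|] ->.
  under eq_cvg do rewrite insert_lift.
  rewrite insert_lift; apply: (cvg_comp y (fun z => z ord0 j) yy0).
  exact: coord_continuous.
by under eq_cvg do rewrite insert_i; rewrite insert_i.
Qed.

Lemma is_derive_insert (U : set 'rV[R]_n.+1) (w : 'rV[R]_n.+1 -> R) i y t :
  open U -> isC1 U w -> U (insert i y t) ->
  is_derive t 1 (fun s => w (insert i y s)) (partial i w (insert i y t)).
Proof.
move=> oU wU Uyt.
have -> : partial i w (insert i y t) =
    \sum_k partial k w (insert i y t) * (k == i)%:R.
  rewrite (bigD1 i)//= eqxx mulr1 big1 ?addr0// => k /negbTE ->.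
  by rewrite mulr0.
apply: (is_derive_curve oU wU) => // k.
case: (unliftP i k) => [j|] ->.
  under eq_fun do rewrite insert_lift.
  by rewrite eq_sym (negbTE (neq_lift i j)); exact: is_derive_cst.
under eq_fun do rewrite insert_i.
by rewrite eqxx; exact: is_derive_id.
Qed.

Lemma is_derive_affine (a b t : R) : is_derive t 1 (fun s : R => s * a + b) a.
Proof.
have H : is_derive t 1 ((fun s : R => s) * cst a + cst b) ((t *: 0 + a *: 1) + 0).
  by apply: is_deriveD; apply: is_deriveM.
by apply: is_derive_eq H _; rewrite scaler0 add0r addr0 [a *: 1]mulr1.
Qed.

(* Implicit differentiation of w (y, g y) = c. *)
Lemma chart_grad (U : set 'rV[R]_n.+1) (w : 'rV[R]_n.+1 -> R) i
    (O : set 'rV[R]_n) (g : 'rV[R]_n -> R) (c : R) :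
  open U -> isC1 U w -> open O -> isC1 O g ->
  (forall y, O y -> U (insert i y (g y)) /\ w (insert i y (g y)) = c) ->
  forall y, O y -> forall j, partial (lift i j) w (insert i y (g y)) +
    partial i w (insert i y (g y)) * partial j g y = 0.
Proof.
move=> oU wU oO gO wgc y Oy j.
have [gd _] := gO j y Oy.
pose e : 'rV[R]_n := delta_mx 0 j.
have ye : 0 *: e + y = y by rewrite scale0r add0r.
have dg : is_derive (0 : R) 1 (fun s : R => g (s *: e + y)) (partial j g y).
  by have := @is_derive_line R n g y e 0; rewrite ye; apply.
have := @is_derive_curve R n.+1 U w (fun s => insert i (s *: e + y) (g (s *: e + y)))
  (fun k => if unlift i k is Some k' then (k' == j)%:R else partial j g y) 0 oU wU.
rewrite ye => /(_ (proj1 (wgc y Oy))) H.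
have {}H : is_derive (0 : R) 1
    (fun s => w (insert i (s *: e + y) (g (s *: e + y))))
    (\sum_k partial k w (insert i y (g y)) *
        (if unlift i k is Some k' then (k' == j)%:R else partial j g y)).
  apply: H => k; case: (unliftP i k) => [k'|] ->.
    under eq_fun do rewrite insert_lift !mxE /=.
    exact: is_derive_affine.
  by under eq_fun do rewrite insert_i.
move: H; rewrite (sum_insert i) unlift_none.
under eq_bigr do rewrite liftK.
rewrite (bigD1 j)//= eqxx mulr1 big1 ?addr0; last first.
  by move=> k /negbTE ->; rewrite mulr0.
move=> [_ H]; rewrite addrC -H.
have : \forall s \near (0 : R), cst c s = w (insert i (s *: e + y) (g (s *: e + y))).
  have : \forall s \near (0 : R), O (s *: e + y).
    have : (s *: e + y) @[s --> (0 : R)] --> y.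
      rewrite -[X in _ --> X]ye; apply: cvgD; last exact: cvg_cst.
      by apply: cvgZr_tmp; exact: cvg_id.
    by apply; exact: open_nbhs_nbhs.
  by apply: filterS => s /wgc[].
move/(near_eq_derive (1 : R)) => <-.
by rewrite derive_cst.
Qed.

End insert_calculus.

Section implicit_function.
Context {R : realType} {n : nat}.
Variables (i : 'I_n.+1) (U : set 'rV[R]_n.+1) (w : 'rV[R]_n.+1 -> R).
Variables (a b : 'rV[R]_n) (p q : R).

Definition cylinder : set 'rV[R]_n.+1 :=
  [set x | box a b (col' i x) /\ p < x ord0 i < q].

Hypotheses (oU : open U) (wU : isC1 U w).
Hypothesis hw : forall y t, cbox a b y -> p <= t <= q ->
  U (insert i y t) /\ 0 < partial i w (insert i y t).

(** Over these base points the level set {w = c} meets the open cylinder, and exactly once since w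
    increases along the axis; [gfun c] is the height of that point. *)
Definition gdom (c : R) : set 'rV[R]_n :=
  [set y | box a b y /\ exists2 t, p < t < q & w (insert i y t) = c].
Definition gfun (c : R) (y : 'rV[R]_n) : R :=
  xget p [set t | p < t < q /\ w (insert i y t) = c].

Lemma gfunP c y : gdom c y -> p < gfun c y < q /\ w (insert i y (gfun c y)) = c.
Proof. by move=> [_ [t pq wt]]; apply: (@xgetPex _ p [set t | p < t < q /\ w (insert i y t) = c]); exists t. Qed.

Lemma insert_mono y s t : cbox a b y -> p <= s -> s < t -> t <= q ->
  w (insert i y s) < w (insert i y t).
Proof.
move=> yab ps st tq.
have der r : p <= r <= q ->
    is_derive r 1 (fun s => w (insert i y s)) (partial i w (insert i y r)).
  by move=> rpq; apply: is_derive_insert oU wU _; have [] := hw yab rpq.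
have [r||r] := @MVT R (fun s => w (insert i y s))
  (fun r => partial i w (insert i y r)) s t st.
- rewrite in_itv/= => /andP[sr rt]; apply: der.
  by rewrite (le_trans ps (ltW sr)) (le_trans (ltW rt)).
- apply: derivable_within_continuous => r; rewrite in_itv/= => /andP[sr rt].
  by apply: ex_derive; apply: der; rewrite (le_trans ps sr) (le_trans rt).
rewrite in_itv/= => /andP[sr rt] e; rewrite -subr_gt0 e mulr_gt0 ?subr_gt0//.
have [|//] := @hw y r yab; rewrite (le_trans ps (ltW sr)) (le_trans (ltW rt))//.
Qed.

Lemma insert_inj y s t : cbox a b y -> p <= s <= q -> p <= t <= q ->
  w (insert i y s) = w (insert i y t) -> s = t.
Proof.
move=> yab /andP[ps sq] /andP[pt tq] e; case: (ltgtP s t) => // st.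
  by have := insert_mono yab ps st tq; rewrite e ltxx.
by have := insert_mono yab pt st sq; rewrite e ltxx.
Qed.

Lemma gfun_unique c y t : box a b y -> p < t < q -> w (insert i y t) = c ->
  gfun c y = t.
Proof.
move=> yab pq wt; have yc := box_cbox yab.
have [|/andP[? ?] e] := @gfunP c y; first by split=> //; exists t.
case/andP : pq => ? ?.
by apply: (insert_inj yc); rewrite ?ltW ?e ?wt//; apply/andP; split; exact: ltW.
Qed.

Lemma insert_continuous_fst t y : cbox a b y -> p <= t <= q ->
  {for y, continuous (fun y => w (insert i y t))}.
Proof.
move=> yab pq; have [Uyt _] := hw yab pq.
have := isC1_continuous oU wU Uyt.
apply: (cvg_comp (fun y => insert i y t)).
by apply: (@cvg_insert _ _ _ (nbhs y) (nbhs_filter y)); [exact: cvg_id|exact: cvg_cst].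
Qed.

(* Membership of the implicit function in an interval is an open condition,
   detected by countably many strict inequalities. *)
Lemma gdom_rat c y r r' : box a b y -> p <= r -> r' <= q ->
  (exists2 t, r < t < r' & w (insert i y t) = c) <->
  (exists2 s : rat * rat, [/\ r < ratr s.1, (ratr s.1 : R) < ratr s.2 & ratr s.2 < r'] &
    w (insert i y (ratr s.1)) < c < w (insert i y (ratr s.2))).
Proof.
move=> yab pr rq; have yc := box_cbox yab; split.
  move=> [t /andP[rt tr'] wt].
  have [s1] := rat_in_itvoo rt; rewrite in_itv/= => /andP[rs1 s1t].
  have [s2] := rat_in_itvoo tr'; rewrite in_itv/= => /andP[ts2 s2r'].
  exists (s1, s2); first by split=> //=; exact: lt_trans s1t ts2.
  rewrite /= -wt; apply/andP; split; apply: insert_mono => //.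
  - exact: le_trans pr (ltW rs1).
  - exact: le_trans (ltW tr') rq.
  - exact: le_trans pr (ltW rt).
  - exact: le_trans (ltW s2r') rq.
move=> [[s1 s2] /= [rs1 s12 s2r'] /andP[w1 w2]].
have /IVT : {within `[ratr s1, ratr s2], continuous (fun t => w (insert i y t))}.
  apply: derivable_within_continuous => t; rewrite in_itv/= => /andP[t1 t2].
  apply: ex_derive; apply: is_derive_insert oU wU _.
  have [|//] := @hw y t yc; rewrite (le_trans (le_trans pr (ltW rs1)) t1)/=.
  exact: le_trans t2 (le_trans (ltW s2r') rq).
move=> /(_ c (ltW s12)); rewrite min_l ?max_r ?(ltW (lt_trans w1 w2))//.
rewrite (ltW w1) (ltW w2) => /(_ isT)[t]; rewrite in_itv/= => /andP[t1 t2] wt.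
by exists t => //; rewrite (lt_le_trans rs1 t1) (le_lt_trans t2).
Qed.

(** With the whole interval ]p, q[ this gives the openness of [gdom c]; with a short interval around
    [gfun c y] it gives the continuity of [gfun c]. *)
Lemma near_gdom c y r r' : box a b y -> p <= r -> r' <= q ->
  (exists2 t, r < t < r' & w (insert i y t) = c) ->
  \forall z \near y, box a b z /\ exists2 t, r < t < r' & w (insert i z t) = c.
Proof.
move=> yab pr rq /(gdom_rat _ yab pr rq)[[s1 s2] /= [rs1 s12 s2r'] /andP[w1 w2]].
have yc := box_cbox yab.
have s1q : p <= ratr s1 <= q.
  rewrite (le_trans pr (ltW rs1)) (le_trans (ltW s12))//.
  exact: le_trans (ltW s2r') rq.
have s2q : p <= ratr s2 <= q.
  by rewrite (le_trans (le_trans pr (ltW rs1)) (ltW s12)) (le_trans (ltW s2r') rq).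
have n1 : \forall z \near y, w (insert i z (ratr s1)) < c.
  by have /(_ [set r | r < c]) := insert_continuous_fst yc s1q; apply; exact: lt_nbhsl.
have n2 : \forall z \near y, c < w (insert i z (ratr s2)).
  by have /(_ [set r | c < r]) := insert_continuous_fst yc s2q; apply; exact: lt_nbhsr.
have n3 : \forall z \near y, box a b z.
  by apply: open_nbhs_nbhs; split => //; exact: box_open.
have FF := nbhs_filter y.
move: n1 n2 n3; apply: filterS3 => z z1 z2 zab; split=> //.
by apply/(gdom_rat _ zab pr rq); exists (s1, s2) => //=; rewrite z1.
Qed.

Lemma gdom_open c : open (gdom c).
Proof.
rewrite openE => y [yab ht].
exact: near_gdom yab (lexx p) (lexx q) ht.
Qed.

Lemma gfun_continuous c y : gdom c y -> {for y, continuous (gfun c)}.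
Proof.
move=> yc; have [yab _] := yc; have [/andP[pg gq] wg] := gfunP yc.
apply/(@cvgrPdist_lt _ _ _ _ (nbhs_filter y)) => e e0.
set t0 := gfun c y in pg gq wg *.
have H := @near_gdom c y (Num.max p (t0 - e)) (Num.min q (t0 + e)) yab.
have {H} : \forall z \near y, box a b z /\
   exists2 t, Num.max p (t0 - e) < t < Num.min q (t0 + e) & w (insert i z t) = c.
  apply: H; rewrite ?le_max ?ge_min ?lexx//.
  by exists t0 => //; rewrite gt_max lt_min pg gq/= ltrBlDr ltrDl e0.
apply: (@filterS _ _ (nbhs_filter y)) => z [zab [t]].
rewrite gt_max lt_min => /andP[/andP[pt te] /andP[tq te']] wt.
rewrite (gfun_unique zab _ wt) ?pt//.
by rewrite distrC ltr_distl te te'.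
Qed.

(** The increment of w along its own level is 0, and [mvt_rV] writes it as A D + B h, where D is the
    increment of [gfun c], and A, B are partial derivatives at intermediate points. Hence D / h = -
    B / A, and A, B converge because the intermediate points do. *)
Lemma gfun_derive c y j : gdom c y ->
  is_derive y (delta_mx 0 j) (gfun c)
   (- (partial (lift i j) w (insert i y (gfun c y)) / partial i w (insert i y (gfun c y)))).
Proof.
move=> yc; have [yab _] := yc; have [/andP[pg gq] wg] := gfunP yc.
set x0 := insert i y (gfun c y).
pose e : 'rV[R]_n := delta_mx 0 j; pose z h := insert i (h *: e + y) (gfun c (h *: e + y)).
have [Ux0 wi0] : U x0 /\ 0 < partial i w x0.
  by apply: hw; [exact: box_cbox|rewrite !ltW].
have /nbhs_ballP[r /= r0 rU] : nbhs x0 U by exact: open_nbhs_nbhs.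
have hy : (h *: e + y) @[h --> 0^'] --> y.
  apply: cvg_trans (cvg_app _ (@cvg_within _ _ _ _)) _.
  have E0 : 0 *: e + y = y by rewrite scale0r add0r.
  rewrite -[X in _ --> X]E0.
  by apply: cvgD; [apply: cvgZr_tmp; exact: cvg_id|exact: cvg_cst].
have zx0 : z h @[h --> 0^'] --> x0.
  apply: cvg_insert => //.
  by apply: (cvg_comp (fun h => h *: e + y) (gfun c) hy); exact: gfun_continuous.
have /choice[xi xiP] : forall h : R, exists xi : 'I_n.+1 -> 'rV[R]_n.+1,
    ball x0 r (z h) -> (forall k, `|xi k - x0| <= `|z h - x0|) /\
    w (z h) - w x0 = \sum_k partial k w (xi k) * (z h ord0 k - x0 ord0 k).
  move=> h; have [hr|] := pselect (ball x0 r (z h)); last by exists (fun=> 0).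
  have [v vh k|xi [xih exi]] := @mvt_rV R _ w x0 (z h).
    suff /(wU k)[] : U v by [].
    apply: rU; rewrite -ball_normE /= distrC (le_lt_trans (hull_dist vh))//.
    by move: hr; rewrite -ball_normE /= distrC.
  by exists xi => _; split=> // k; apply: hull_dist.
have nb : \forall h \near 0^', ball x0 r (z h).
  by move/cvg_ballP : zx0 => /(_ r r0).
have xic k : xi h k @[h --> 0^'] --> x0.
  apply/cvgrPdist_lt => d d0; move/cvgrPdist_lt : zx0 => /(_ d d0).
  apply: filterS2 nb => h /xiP[/(_ k) h1 _] h2.
  by rewrite distrC (le_lt_trans h1)// distrC.
have wxi k l : partial k w (xi h l) @[h --> 0^'] --> partial k w x0.
  by apply: (cvg_comp (xi^~ l) (partial k w) (xic l)); have [] := wU k Ux0.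
have n1 : \forall h \near 0^', 0 < partial i w (xi h i).
  by have /(_ [set r | 0 < r]) := wxi i i; apply; exact: lt_nbhsr.
have n2 : \forall h \near 0^', gdom c (h *: e + y).
  by have /(_ (gdom c)) := hy; apply; apply: open_nbhs_nbhs; split => //; exact: gdom_open.
have n3 : \forall h \near (0 : R)^', h != 0 by exact: nbhs_dnbhs_neq.
have S : - (partial (lift i j) w (xi h (lift i j)) / partial i w (xi h i))
   @[h --> 0^'] --> - (partial (lift i j) w x0 / partial i w x0).
  apply: cvgN; apply: cvgM; first exact: wxi.
  by apply: cvgV; [rewrite gt_eqF|exact: wxi].
have {S} main : h^-1 *: ((gfun c \o shift y) (h *: e) - gfun c y) @[h --> 0^'] -->
    - (partial (lift i j) w x0 / partial i w x0).
  apply: cvg_trans S; apply: near_eq_cvg.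
  have n4 : \forall h \near (0 : R)^', ball x0 r (z h) /\ h != 0.
    by apply: filterS2 nb n3 => h.
  apply: filterS3 n1 n2 n4 => h h1 h2 [/xiP[_ h3] h4].
  move: h3; have [_ ->] := gfunP h2; rewrite wg subrr (sum_insert i) !insert_i.
  rewrite (bigD1 j) // big1 => [|k kj]; last first.
    by rewrite !insert_lift !mxE (negbTE kj) mulr0 add0r subrr mulr0.
  rewrite /= addr0 !insert_lift !mxE !eqxx mulr1 addrK => h5.
  have aux (A B D : R) : A != 0 -> 0 = A * D + B * h -> - (B / A) = h^-1 * D.
    move=> A0 E; have -> : D = - (B * h) / A; last by field; rewrite A0 h4.
    by apply: (mulfI A0); rewrite mulrCA divff// mulr1; lra.
  by apply: aux => //; rewrite gt_eqF.
by split; [apply/cvg_ex; eexists; exact: main|exact: cvg_lim].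
Qed.

Lemma gfun_isC1 c : isC1 (gdom c) (gfun c).
Proof.
move=> j y yc; have [yd ye] := gfun_derive j yc; split=> //.
have [yab _] := yc; have [/andP[pg gq] wg] := gfunP yc.
have [Ux0 wi0] : U (insert i y (gfun c y)) /\ 0 < partial i w (insert i y (gfun c y)).
  by apply: hw; [exact: box_cbox|rewrite !ltW].
have FF := nbhs_filter y.
have zc : insert i z (gfun c z) @[z --> y] --> insert i y (gfun c y).
  apply: (@cvg_insert _ _ _ _ FF); first exact: cvg_id.
  exact: gfun_continuous.
have pc k : partial k w (insert i z (gfun c z)) @[z --> y] -->
    partial k w (insert i y (gfun c y)).
  by apply: (cvg_comp (fun z => insert i z (gfun c z)) _ zc); have [] := wU k Ux0.
rewrite /prop_for /continuous_at /partial ye.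
have S : - (partial (lift i j) w (insert i z (gfun c z)) /
            partial i w (insert i z (gfun c z))) @[z --> y] -->
    - (partial (lift i j) w (insert i y (gfun c y)) /
       partial i w (insert i y (gfun c y))).
  apply: (@cvgN _ _ _ _ FF); apply: (@cvgM _ _ _ FF); first exact: pc.
  by apply: (@cvgV _ _ _ FF); [rewrite gt_eqF|exact: pc].
apply: cvg_trans S; apply: (@near_eq_cvg _ _ _ FF).
have : nbhs y (gdom c) by apply: open_nbhs_nbhs; split => //; exact: gdom_open.
by apply: filterS => z /(gfun_derive j)[_ <-].
Qed.

End implicit_function.

(** * Functionals determined by indicators, densities, and change of variable on the line *)

Section nonneg_functionals.
Local Open Scope ereal_scope.
Context {R : realType}.

Definition nnmeas d (T : measurableType d) (f : T -> \bar R) :=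
  measurable_fun setT f /\ forall x, 0 <= f x.

(* The properties of the integral that determine it from its values on
   indicator functions. *)
Definition nnfunctional d (T : measurableType d) (Phi : (T -> \bar R) -> \bar R) :=
  [/\ forall f g, nnmeas f -> nnmeas g -> Phi (fun x => f x + g x) = Phi f + Phi g,
      forall (c : R) f, (0 <= c)%R -> nnmeas f ->
        Phi (fun x => c%:E * f x) = c%:E * Phi f,
      forall f_ : nat -> T -> \bar R, (forall k, nnmeas (f_ k)) ->
        (forall x, {homo f_^~ x : m n / (m <= n)%N >-> m <= n}) ->
        Phi (fun x => limn (f_^~ x)) = limn (fun k => Phi (f_ k)) &
      forall f g, nnmeas f -> nnmeas g -> (forall x, f x <= g x) -> Phi f <= Phi g].

Lemma nnmeas_indic d (T : measurableType d) (A : set T) :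
  measurable A -> nnmeas (fun x => (\1_A x : R)%:E).
Proof.
move=> mA; split; last by move=> x; rewrite lee_fin.
exact/measurable_EFinP/measurable_indic.
Qed.

Lemma nnmeas_scale d (T : measurableType d) (c : R) (f : T -> \bar R) :
  (0 <= c)%R -> nnmeas f -> nnmeas (fun x => c%:E * f x).
Proof.
move=> c0 [mf f0]; split; first exact: measurable_funeM.
by move=> x; rewrite mule_ge0.
Qed.

Lemma nnmeasD d (T : measurableType d) (f g : T -> \bar R) :
  nnmeas f -> nnmeas g -> nnmeas (fun x => f x + g x).
Proof.
move=> [mf f0] [mg g0]; split; first exact: emeasurable_funD.
by move=> x; rewrite adde_ge0.
Qed.

Lemma nnmeasM d (T : measurableType d) (f g : T -> \bar R) :
  nnmeas f -> nnmeas g -> nnmeas (fun x => f x * g x).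
Proof.
move=> [mf f0] [mg g0]; split; first exact: emeasurable_funM.
by move=> x; rewrite mule_ge0.
Qed.

Lemma nnmeas_comp d d' (T : measurableType d) (T' : measurableType d')
    (phi : T' -> T) (f : T -> \bar R) :
  measurable_fun setT phi -> nnmeas f -> nnmeas (fun x => f (phi x)).
Proof. by move=> mphi [mf f0]; split => //; exact: measurableT_comp. Qed.

Import HBNNSimple.

(** Additivity and homogeneity carry the equality from indicators to simple functions, and
    continuity along increasing sequences carries it to all nonnegative measurable functions. *)
Lemma nnfunctional_ext d (T : measurableType d) (Phi Psi : (T -> \bar R) -> \bar R) :
  nnfunctional Phi -> nnfunctional Psi ->
  (forall A, measurable A -> Phi (fun x => (\1_A x : R)%:E) = Psi (fun x => (\1_A x : R)%:E)) ->
  forall f, nnmeas f -> Phi f = Psi f.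
Proof.
move=> [PhiD PhiZ PhiL _] [PsiD PsiZ PsiL _] e f [mf f0].
have z0 : nnmeas (fun _ : T => 0 : \bar R) by split => //; exact: measurable_cst.
have e0 : Phi (fun=> 0) = Psi (fun=> 0).
  have := PhiZ 0%R _ (lexx _) z0; have := PsiZ 0%R _ (lexx _) z0.
  by rewrite !mul0e => -> ->.
have sumP (s : seq R) (A : R -> set T) : (forall y, (0 <= y)%R \/ A y = set0) ->
    (forall y, measurable (A y)) ->
    nnmeas (fun x => (\sum_(y <- s) (y * \1_(A y) x))%R%:E) /\
    Phi (fun x => (\sum_(y <- s) (y * \1_(A y) x))%R%:E) =
    Psi (fun x => (\sum_(y <- s) (y * \1_(A y) x))%R%:E).
  move=> A0 mA; elim: s => [|y s [IH1 IH2]].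
    by under eq_fun do rewrite big_nil.
  have [y0|Ay] := A0 y.
    have E : (fun x => (\sum_(z <- y :: s) (z * \1_(A z) x))%R%:E) =
       (fun x => y%:E * (\1_(A y) x)%:E + (\sum_(z <- s) (z * \1_(A z) x))%R%:E).
      by apply/funext => x; rewrite big_cons EFinD EFinM.
    have n1 := nnmeas_indic (mA y); have n2 := nnmeas_scale y0 n1.
    rewrite E; split; first exact: nnmeasD.
    by rewrite PhiD// PsiD// PhiZ// PsiZ// IH2 e.
  have E : (fun x => (\sum_(z <- y :: s) (z * \1_(A z) x))%R%:E) =
       (fun x => (\sum_(z <- s) (z * \1_(A z) x))%R%:E).
    by apply/funext => x; rewrite big_cons Ay indic0 mulr0 add0r.
  by rewrite E.
have simple (h : {nnsfun T >-> R}) : Phi (EFin \o h) = Psi (EFin \o h).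
  have E : EFin \o h = (fun x => (\sum_(y <- finmap.enum_fset (fset_set (range h))) (y * \1_(h @^-1` [set y]) x))%R%:E).
    apply/funext => x; rewrite /= [in LHS]fimfunE; congr EFin.
    by rewrite fsbig_finite.
  rewrite E; apply: (proj2 (sumP _ _ _ _)) => y; last exact: measurable_funPTI.
  have [y0|y0] := leP 0%R y; [by left|right].
  by apply/seteqP; split => // x /= hx; move: y0; rewrite -hx ltNge fun_ge0.
pose g := nnsfun_approx measurableT mf.
have gf x : f x = limn (fun k => (g k x)%:E).
  by apply/esym/cvg_lim => //; exact: cvg_nnsfun_approx.
have -> : f = (fun x => limn (fun k => (EFin \o g k) x)) by apply/funext.
have ng k : nnmeas (EFin \o g k).
  split; first exact/measurable_EFinP/measurable_funP.
  by move=> x /=; rewrite lee_fin fun_ge0.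
have ndg x : {homo (fun k => (EFin \o g k) x) : m n / (m <= n)%N >-> m <= n}.
  by move=> m n mn /=; rewrite lee_fin; exact/lefP/nd_nnsfun_approx.
rewrite (PhiL (fun k => EFin \o g k))// (PsiL (fun k => EFin \o g k))//.
by congr (limn _); apply/funext => k; exact: simple.
Qed.

Lemma nnfunctional_integral d (T : measurableType d) (mu : {measure set T -> \bar R}) :
  nnfunctional (fun f => \int[mu]_x f x).
Proof.
split.
- by move=> f g [mf f0] [mg g0]; rewrite ge0_integralD.
- by move=> c f c0 [mf f0]; rewrite ge0_integralZl.
- move=> f_ nf nd; rewrite monotone_convergence//.
  + by move=> k; have [] := nf k.
  + by move=> k x _; have [] := nf k.
- move=> f g [mf f0] [mg g0] fg; exact: ge0_le_integral.
Qed.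

(** Weighting by a density, and below composing with a measurable map, preserve the four properties;
    two integration formulas built in this way need only be compared on indicators. *)
Lemma nnfunctional_weight d (T : measurableType d) (Phi : (T -> \bar R) -> \bar R)
    (g : T -> R) :
  nnfunctional Phi -> nnmeas (EFin \o g) ->
  nnfunctional (fun f => Phi (fun x => (g x)%:E * f x)).
Proof.
move=> [PhiD PhiZ PhiL Phi_le] ng; have [mg g0] := ng; split.
- move=> f1 f2 nf1 nf2; have [_ f10] := nf1; have [_ f20] := nf2.
  rewrite -PhiD; [|exact: (nnmeasM ng nf1)|exact: (nnmeasM ng nf2)].
  by congr Phi; apply/funext => x; rewrite ge0_muleDr.
- move=> c f c0 nf; rewrite -PhiZ//; last exact: (nnmeasM ng nf).
  by congr Phi; apply/funext => x; rewrite muleCA.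
- move=> f_ nf nd; rewrite -PhiL; last 2 first.
  + by move=> k; exact: (nnmeasM ng (nf k)).
  + by move=> x m n mn; apply: lee_pmul => //; [exact: (g0 x)|have [] := nf m|exact: nd].
  congr Phi; apply/funext => x; rewrite -limeMl//.
  exact: ereal_nondecreasing_is_cvgn.
- move=> f h nf nh fh; apply: Phi_le; [exact: (nnmeasM ng nf)|exact: (nnmeasM ng nh)|].
  by move=> x; apply: lee_pmul => //; [exact: (g0 x)|have [_] := nf; exact].
Qed.

Lemma nnfunctional_comp d d' (T : measurableType d) (T' : measurableType d')
    (Phi : (T' -> \bar R) -> \bar R) (phi : T' -> T) :
  nnfunctional Phi -> measurable_fun setT phi ->
  nnfunctional (fun f => Phi (fun x => f (phi x))).
Proof.
move=> [PhiD PhiZ PhiL Phi_le] mphi; split.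
- by move=> f g nf ng; rewrite -PhiD//; exact: nnmeas_comp.
- by move=> c f c0 nf; rewrite -PhiZ//; exact: nnmeas_comp.
- move=> f_ nf nd; rewrite -(PhiL (fun k x => f_ k (phi x)))//.
  by move=> k; exact: nnmeas_comp.
- by move=> f g nf ng fg; apply: Phi_le => //; exact: nnmeas_comp.
Qed.

End nonneg_functionals.

Section density.
Local Open Scope ereal_scope.
Context {R : realType} d (T : measurableType d).
Variables (mu : {measure set T -> \bar R}) (g : T -> \bar R).
Hypothesis ng : nnmeas g.

Definition dens (A : set T) : \bar R := \int[mu]_(x in A) g x.

Let dens0 : dens set0 = 0. Proof. by rewrite /dens integral_set0. Qed.

Let dens_ge0 A : 0 <= dens A.
Proof. by apply: integral_ge0 => x _; apply: (proj2 ng). Qed.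

Let dens_additive : semi_sigma_additive dens.
Proof.
move=> F mF tF mUF; rewrite /dens ge0_integral_bigcup//; last 2 first.
- exact: measurable_funTS (proj1 ng).
- by move=> x _; apply: (proj2 ng).
by apply: is_cvg_ereal_nneg_natsum => k _; apply: integral_ge0 => x _; apply: (proj2 ng).
Qed.

Definition dens_measure : {measure set T -> \bar R} :=
  let M := isMeasure.Build _ _ _ dens dens0 dens_ge0 dens_additive in
  HB.pack dens M.

Lemma densE A : dens_measure A = \int[mu]_(x in A) g x.
Proof. by []. Qed.

End density.

Section dens_integral.
Local Open Scope ereal_scope.
Context {R : realType} d (T : measurableType d).

Lemma integral_dens (mu : {measure set T -> \bar R}) (g : T -> R)
    (ng : nnmeas (EFin \o g)) (f : T -> \bar R) : nnmeas f ->
  \int[dens_measure mu ng]_x f x = \int[mu]_x ((g x)%:E * f x).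
Proof.
move=> nf.
apply: (nnfunctional_ext (nnfunctional_integral (dens_measure mu ng))
  (nnfunctional_weight (nnfunctional_integral mu) ng)) => // A mA.
rewrite integral_indic// setIT densE integral_mkcond; apply: eq_integral => x _.
by rewrite patchE indicE; case: ifP => _; rewrite ?mule1 ?mule0.
Qed.

End dens_integral.

Section real_line.
Local Open Scope ereal_scope.
Context {R : realType}.

Lemma R_measure_unique (m1 m2 : {measure set (measurableTypeR R) -> \bar R}) :
  (forall a b : R, m1 `]a, b[%classic = m2 `]a, b[%classic) ->
  (forall a b : R, m1 `]a, b[%classic < +oo) ->
  forall A, measurable A -> m1 A = m2 A.
Proof.
move=> m12 m1oo A mA.
have {}mA : <<s (@RGenOpens.G R) >> A by move: mA; rewrite RGenOpens.measurableE.
move: A mA; apply: (@g_sigma_algebra_measure_unique _ _ (measurableTypeR R) (@RGenOpens.G R) _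
  (fun k => `](- k%:R)%R, k%:R[%classic)) => //.
- by move=> _ [a [b ->]].
- by move=> k; exists (- k%:R)%R, k%:R.
- apply/seteqP; split => // x _; exists (Num.trunc `|x|).+1 => //=.
  by rewrite in_itv/= -ltr_norml truncnS_gt.
- move=> _ _ [a [b ->]] [c [e ->]]; exists (Num.max a c), (Num.min b e).
  apply/seteqP; split=> x /=; rewrite !in_itv/= gt_max lt_min.
    by move=> [/andP[-> ->] /andP[-> ->]].
  by move=> /andP[/andP[-> ->] /andP[-> ->]].
- by move=> _ [a [b ->]]; exact: m12.
Qed.

Variables (W dW : R -> R) (p q : R).
Hypothesis pq : (p < q)%R.
Hypothesis WdW : forall t, (p <= t <= q)%R -> is_derive t 1%R W (dW t).
Hypothesis dW0 : forall t, (p <= t <= q)%R -> (0 < dW t)%R.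
Hypothesis dWc : {within `[p, q], continuous dW}.

Lemma dW_mono s t : (p <= s)%R -> (s < t)%R -> (t <= q)%R -> (W s < W t)%R.
Proof.
move=> ps st tq.
have [r||r] := @MVT R W dW s t st.
- rewrite in_itv/= => /andP[sr rt]; apply: WdW.
  by rewrite (le_trans ps (ltW sr)) (le_trans (ltW rt)).
- apply: derivable_within_continuous => r; rewrite in_itv/= => /andP[sr rt].
  by apply: ex_derive; apply: WdW; rewrite (le_trans ps sr) (le_trans rt).
rewrite in_itv/= => /andP[sr rt] e; rewrite -subr_gt0 e mulr_gt0 ?subr_gt0//.
by apply: dW0; rewrite (le_trans ps (ltW sr)) (le_trans (ltW rt)).
Qed.

Lemma dW_ge s t : (p <= s)%R -> (t <= q)%R -> (p <= t)%R -> (s <= q)%R -> (W s < W t)%R = (s < t)%R.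
Proof.
move=> ps tq pt sq; case: (ltgtP s t) => st; first exact: dW_mono.
  by apply/negbTE; rewrite -leNgt ltW// dW_mono.
by rewrite st ltxx.
Qed.

Lemma W_continuous : {within `[p, q], continuous W}.
Proof.
apply: derivable_within_continuous => r; rewrite in_itv/= => h.
by apply: ex_derive; exact: WdW.
Qed.

Lemma dW_FTC s t : (p <= s)%R -> (s < t)%R -> (t <= q)%R ->
  \int[lebesgue_measure]_(r in `]s, t[) (dW r)%:E = (W t - W s)%:E.
Proof.
move=> ps st tq.
have sub : [set` `[s, t]] `<=` [set` `[p, q]].
  by move=> r /=; rewrite !in_itv/= => /andP[? ?]; rewrite (le_trans ps)// (le_trans _ tq).
have cW := continuous_subspaceW sub W_continuous.
have cdW := continuous_subspaceW sub dWc.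
have mdW : measurable_fun `[s, t] dW by exact: subspace_continuous_measurable_fun.
rewrite -(@integral_itv_bndoo _ _ _ _ true false); last first.
  apply/measurable_EFinP; apply: measurable_funS mdW => //.
  by move=> r /=; rewrite !in_itv/= => /andP[? ?]; rewrite !ltW.
rewrite EFinB; apply: continuous_FTC2 => //.
  have /(continuous_within_itvP _ st)[cWo cWl cWr] := cW.
  split => // r; rewrite in_itv/= => /andP[sr rt]; apply: ex_derive; apply: WdW.
  by rewrite (le_trans ps (ltW sr)) (le_trans (ltW rt) tq).
move=> r; rewrite in_itv/= => /andP[sr rt]; rewrite derive1E.
have [|_] := @WdW r; last by [].
by rewrite (le_trans ps (ltW sr)) (le_trans (ltW rt) tq).
Qed.

Let J : set R := `]W p, W q[%classic.
(** Both functions are extended by 0 so as to be measurable on the whole line. The value of [W0] off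
    ]p, q[ does not matter, as the density [g0] vanishes there. *)
Let g0 : R -> R := dW \_ `]p, q[.
Let W0 : R -> R := W \_ `]p, q[.

Let mW0 : measurable_fun setT (W0 : measurableTypeR R -> measurableTypeR R).
Proof.
apply/(measurable_restrictT _ _).1 => //.
apply: (@measurable_funS _ _ _ _ `[p, q]) => //.
  by move=> r /=; rewrite !in_itv/= => /andP[? ?]; rewrite !ltW.
exact: subspace_continuous_measurable_fun W_continuous.
Qed.

Let ng0 : nnmeas (EFin \o g0).
Proof.
split.
  apply/measurable_EFinP/(measurable_restrictT _ _).1 => //.
  apply: (@measurable_funS _ _ _ _ `[p, q]) => //.
    by move=> r /=; rewrite !in_itv/= => /andP[? ?]; rewrite !ltW.
  exact: subspace_continuous_measurable_fun.
move=> t /=; rewrite lee_fin /g0 patchE; case: ifPn => //.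
by rewrite inE/= in_itv/= => /andP[? ?]; rewrite ltW// dW0// !ltW.
Qed.

(** The image under W of the measure dW dt on ]p, q[ is Lebesgue measure on ]W p, W q[. It suffices
    to test intervals: after truncation their end points are values of W by the intermediate value
    theorem, and the fundamental theorem of calculus gives their length. *)
Lemma change_of_variable (k : R -> \bar R) : nnmeas (k : measurableTypeR R -> \bar R) ->
  \int[lebesgue_measure]_(c in J) k c =
  \int[lebesgue_measure]_(t in `]p, q[) ((dW t)%:E * k (W t)).
Proof.
move=> nk.
have mJ : measurable (J : set (measurableTypeR R)) by exact: measurable_itv.
have nJ : nnmeas (EFin \o (\1_J : measurableTypeR R -> R)) by exact: (nnmeas_indic mJ).
have H := nnfunctional_ext
  (nnfunctional_weight (nnfunctional_integral (@lebesgue_measure R)) nJ)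
  (nnfunctional_comp (nnfunctional_weight (nnfunctional_integral (@lebesgue_measure R)) ng0) mW0).
transitivity (\int[lebesgue_measure]_c ((\1_J c)%:E * k c)).
  rewrite integral_mkcond; apply: eq_integral => c _.
  by rewrite patchE indicE; case: ifP; rewrite ?mul1e ?mul0e.
transitivity (\int[lebesgue_measure]_t ((g0 t)%:E * k (W0 t))); last first.
  rewrite [RHS]integral_mkcond; apply: eq_integral => t _.
  by rewrite patchE /g0 /W0 !patchE; case: ifP; rewrite ?mul0e.
apply: H => // {k nk} A mA.
have := @R_measure_unique (mrestr lebesgue_measure (measurable_itv `]W p, W q[))
  (measure_function_pushforward__canonical__measure_function_Measure
    (dens_measure lebesgue_measure ng0) mW0) _ _ A mA.
rewrite /= /mrestr /pushforward.
have -> : \int[lebesgue_measure]_t ((g0 t)%:E * (\1_A (W0 t))%:E) =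
    dens_measure lebesgue_measure ng0 (W0 @^-1` A).
  rewrite densE [RHS]integral_mkcond; apply: eq_integral => t _.
  rewrite patchE indicE /=; case: ifPn; rewrite ?inE/= => h.
    by rewrite mem_set// mule1.
  by rewrite memNset ?mule0// => /mem_set; apply/negP.
have -> : \int[lebesgue_measure]_c ((\1_J c)%:E * (\1_A c)%:E) =
    lebesgue_measure (A `&` J).
  transitivity (\int[lebesgue_measure]_c (\1_(A `&` J) c : R)%:E).
    by apply: eq_integral => c _; rewrite -EFinM indicI /= mulrC.
  by rewrite integral_indic ?setIT//; exact: measurableI.
apply => u v; last first.
  rewrite (@le_lt_trans _ _ (lebesgue_measure J))//; last first.
    by rewrite lebesgue_measure_itv/=; case: ifP; rewrite ltry.
  by apply: le_measure; rewrite ?inE//; exact: measurableI.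
rewrite /dens.
pose u' := Num.max u (W p); pose v' := Num.min v (W q).
have WpWq : (W p < W q)%R by exact: dW_mono.
have E1 : `]u, v[ `&` `]W p, W q[ = `]u', v'[%classic.
  apply/seteqP; split=> x /=; rewrite !in_itv/= gt_max lt_min.
    by move=> [/andP[-> ->] /andP[-> ->]].
  by move=> /andP[/andP[-> ->] /andP[-> ->]].
have gt0 t : (p < t < q)%R -> ((u < W t < v) = (u' < W t < v'))%R.
  move=> /andP[pt tq]; rewrite gt_max lt_min.
  by rewrite dW_mono ?lexx ?(ltW tq)// dW_mono ?(ltW pt)// !andbT.
rewrite E1; have [uv|uv] := leP v' u'.
  rewrite set_itv_ge ?bnd_simp -?leNgt// measure0; apply/esym/integral0_eq => t /=.
  rewrite in_itv/= /g0 /W0 !patchE; case: ifPn => //; rewrite inE/= in_itv/= => tpq.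
  rewrite gt0// => /andP[h1 h2].
  by have := lt_trans h1 h2; rewrite ltNge uv.
have ivt y : (W p <= y <= W q)%R -> exists2 t, (p <= t <= q)%R & W t = y.
  move=> h; have := @IVT R W p q y (ltW pq) W_continuous.
  rewrite min_l ?max_r ?(ltW WpWq)// h => /(_ isT)[t]; rewrite in_itv => ? ?.
  by exists t.
have [|s /andP[ps sq] Ws] := ivt u'.
  by rewrite le_max lexx orbT/= (le_trans (ltW uv))// ge_min lexx orbT.
have [|t /andP[pt tq] Wt] := ivt v'.
  by rewrite ge_min lexx orbT andbT (le_trans _ (ltW uv))// le_max lexx orbT.
have st : (s < t)%R by rewrite -dW_ge// Ws Wt.
rewrite lebesgue_measure_itv/= lte_fin uv -EFinB -Ws -Wt -(dW_FTC ps st tq).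
rewrite [LHS]integral_mkcond [RHS]integral_mkcond; apply: eq_integral => r _.
rewrite !patchE /=.
have [rpq|rpq] := boolP (r \in `]p, q[%classic); last first.
  rewrite memNset; last first.
    move=> /=; rewrite in_itv/= => /andP[sr rt]; move/negP : rpq; apply.
    by rewrite inE/= in_itv/= (le_lt_trans ps sr) (lt_le_trans rt tq).
  by rewrite /g0 patchE (negbTE rpq); case: ifP.
have rpq' : (p < r < q)%R by move: rpq; rewrite inE/= in_itv.
have -> : (r \in W0 @^-1` `]u, v[) = (r \in `]s, t[%classic).
  apply/idP/idP; rewrite !inE/= !in_itv/= /W0 patchE rpq gt0// -Ws -Wt;
    by case/andP : rpq' => /ltW pr /ltW rq; rewrite !dW_ge.
by rewrite /g0 patchE rpq.
Qed.

End real_line.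

(** * The coarea formula in one cylinder *)

Section coarea_box.
Context {R : realType} {n : nat}.
Variables (i : 'I_n.+1) (U : set 'rV[R]_n.+1) (w : 'rV[R]_n.+1 -> R).
Variables (a b : 'rV[R]_n) (p q : R).
Hypotheses (oU : open U) (wU : isC1 U w).
Hypothesis hw : forall y t, cbox a b y -> p <= t <= q ->
  U (insert i y t) /\ 0 < partial i w (insert i y t).

Local Notation gdom := (gdom i w a b p q).
Local Notation gfun := (gfun i w p q).
Local Notation T := (measurableTypeR R * rVborel R n)%type.

(** The level c is part of the variable: Tonelli in the coarea formula needs joint measurability in
    the level and the base point. *)
Definition gdom_in (r r' : R) : set T :=
  [set cy | box a b cy.2 /\ exists2 t, r < t < r' & w (insert i cy.2 t) = cy.1].

Lemma measurable_lt_set d (S : measurableType d) (f g : S -> R) :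
  measurable_fun setT f -> measurable_fun setT g -> measurable [set x | f x < g x].
Proof.
move=> mf mg; have mgf : measurable_fun setT (g \- f) by exact: measurable_funB.
rewrite (_ : mkset _ = (g \- f) @^-1` `]0, +oo[%classic).
  by rewrite -[X in measurable X]setTI; apply: mgf => //; exact: measurable_itv.
by apply/seteqP; split=> x /=; rewrite in_itv/= andbT subr_gt0.
Qed.

(** By [gdom_rat] the set is a countable union, over rational pairs of heights, of sets given by
    strict inequalities between c and continuous functions of the base point. *)
Lemma measurable_gdom_in r r' : p <= r -> r' <= q -> measurable (gdom_in r r').
Proof.
move=> pr rq.
pose ws (s : rat) : rVborel R n -> R := (fun y => w (insert i y (ratr s))) \_ (box a b).
pose P := [set s : rat * rat | [/\ r < ratr s.1, (ratr s.1 : R) < ratr s.2 & ratr s.2 < r']].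
have mws s : P s -> forall k, k = s.1 \/ k = s.2 -> measurable_fun setT (ws k).
  move=> [rs1 s12 s2r'] k ks.
  have kpq : p <= ratr k <= q.
    case: ks => ->.
      by rewrite (le_trans pr (ltW rs1)) (le_trans (ltW (lt_trans s12 s2r')) rq).
    by rewrite (le_trans pr (ltW (lt_trans rs1 s12))) (le_trans (ltW s2r') rq).
  apply/(measurable_restrictT _ _).1; first exact: box_measurable.
  apply: continuous_in_measurable_rV; first exact: box_open.
  by move=> y yab; apply: (insert_continuous_fst oU wU hw _ kpq); exact: box_cbox.
rewrite (_ : gdom_in r r' = \bigcup_(s in P)
   ((@snd _ _ @^-1` box a b) `&` ([set cy : T | ws s.1 cy.2 < cy.1] `&`
     [set cy : T | cy.1 < ws s.2 cy.2]))); last first.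
  apply/seteqP; split=> -[c y].
    move=> [/= yab /(gdom_rat oU wU hw _ yab pr rq)[s sP /andP[w1 w2]]].
    by exists s => //; rewrite /= /ws !patchE mem_set.
  move=> [s sP [/= yab []]]; rewrite /ws !patchE mem_set// => w1 w2.
  by split=> //; apply/(gdom_rat oU wU hw _ yab pr rq); exists s => //; rewrite w1.
rewrite bigcup_mkcond; apply: countable_bigcupT_measurable; first exact: countableP.
move=> s; case: ifPn => //; rewrite inE => sP.
apply: measurableI.
  by rewrite -[X in measurable X]setTI; apply: measurable_snd => //; exact: box_measurable.
apply: measurableI; apply: measurable_lt_set.
- by apply: measurableT_comp measurable_snd; apply: (mws s) => //; left.
- exact: measurable_fst.
- exact: measurable_fst.
- by apply: measurableT_comp measurable_snd; apply: (mws s) => //; right.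
Qed.

Definition gdom2 : set T := [set cy | gdom cy.1 cy.2].

Lemma measurable_gdom2 : measurable gdom2.
Proof. exact: (measurable_gdom_in (lexx p) (lexx q)). Qed.

Definition gam_t : T -> R := (fun cy => gfun cy.1 cy.2) \_ gdom2.

Lemma measurable_gam_t : measurable_fun setT gam_t.
Proof.
apply/(measurable_restrictT _ _).1; first exact: measurable_gdom2.
apply: (measurability _ (RGenOInfty.measurableE R)).
move=> _ [_ [r ->] <-].
rewrite (_ : _ `&` _ = gdom_in (Num.max p r) q).
  by apply: measurable_gdom_in => //; rewrite le_max lexx.
apply/seteqP; split=> -[c y].
  move=> [yc /=]; rewrite in_itv/= andbT => rg.
  have [/andP[pg gq] wg] := gfunP yc; split; first by case: yc.
  by exists (gfun c y) => //; rewrite gt_max pg rg gq.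
move=> [/= yab [t]]; rewrite gt_max => /andP[/andP[pt rt] tq] wt.
split; first by split=> //; exists t => //; rewrite pt.
by rewrite /= in_itv/= (gfun_unique oU wU hw yab _ wt) ?pt// rt.
Qed.

Definition gam (cy : T) : rVborel R n.+1 := insert i cy.2 (gam_t cy).

Lemma measurable_gam : measurable_fun setT gam.
Proof.
have mp : measurable_fun setT (fun cy : T => (gam_t cy, cy.2)).
  by apply: measurable_fun_pair; [exact: measurable_gam_t|exact: measurable_snd].
exact: (measurableT_comp (@measurable_insertp R n i) mp).
Qed.

Definition invd : rVborel R n.+1 -> R :=
  (fun x => `|partial i w x|^-1) \_ (U `&` [set x | partial i w x != 0]).

Lemma open_partial_neq0 : open (U `&` [set x | partial i w x != 0]).
Proof.
rewrite openE => x [Ux wx]; apply: filterI; first exact: open_nbhs_nbhs.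
have [_ /(_ [set r | r != 0])] := wU i Ux; apply; by apply: open_nbhs_nbhs; split => //.
Qed.

Lemma nnmeas_invd : nnmeas (EFin \o invd).
Proof.
split; last first.
  by move=> x /=; rewrite lee_fin /invd patchE; case: ifP => // _; rewrite invr_ge0.
apply/measurable_EFinP/(measurable_restrictT _ _).1.
  by apply: open_measurable_rV; exact: open_partial_neq0.
apply: continuous_in_measurable_rV; first exact: open_partial_neq0.
move=> x [Ux wx]; have FF := nbhs_filter x.
apply: (@cvgV _ _ _ FF); first by rewrite normr_eq0.
by apply: (@cvg_norm _ _ _ _ FF); have [] := wU i Ux.
Qed.

(** On a level graph g one has sqrt(1 + |grad g|^2) = |grad w| / |partial_i w|, so dsigma / |grad w|
    projects onto the hyperplane with density 1 / |partial_i w|. *)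
Definition gweight (cy : T) : R := \1_gdom2 cy * invd (gam cy).

Lemma nnmeas_gweight : nnmeas (EFin \o gweight).
Proof.
have -> : EFin \o gweight = (fun cy => (\1_gdom2 cy)%:E * (EFin \o invd) (gam cy))%E.
  by apply/funext => cy.
apply: nnmeasM; first exact: (nnmeas_indic measurable_gdom2).
exact: (nnmeas_comp measurable_gam nnmeas_invd).
Qed.

Lemma nnmeas_gweight1 c : nnmeas (EFin \o (fun y => gweight (c, y))).
Proof. exact: (nnmeas_comp (pair1_measurable c) nnmeas_gweight). Qed.

Lemma measurable_gam1 c : measurable_fun setT (fun y => gam (c, y)).
Proof. exact: (measurableT_comp measurable_gam (pair1_measurable c)). Qed.

(* The measure d sigma / |grad w| on the level set {w = c} inside the cylinder. *)
Definition slice_measure (c : R) : {measure set (rVborel R n.+1) -> \bar R} :=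
  measure_function_pushforward__canonical__measure_function_Measure
    (dens_measure (leb n) (nnmeas_gweight1 c)) (measurable_gam1 c).

Lemma integral_slice c (k : rVborel R n.+1 -> \bar R) : nnmeas k ->
  (\int[slice_measure c]_x k x = \int[leb n]_y ((gweight (c, y))%:E * k (gam (c, y))))%E.
Proof.
move=> nk; have [mk k0] := nk.
rewrite (ge0_integral_pushforward (measurable_gam1 c))//.
rewrite preimage_setT integral_dens//.
exact: (nnmeas_comp (measurable_gam1 c) nk).
Qed.

Lemma gam_gdom c y : gdom c y -> gam (c, y) = insert i y (gfun c y).
Proof. by move=> yc; rewrite /gam /gam_t patchE mem_set. Qed.

Lemma measurable_integral_slice k : nnmeas k ->
  measurable_fun setT (fun c : measurableTypeR R => \int[slice_measure c]_x k x)%E.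
Proof.
move=> nk; under eq_fun do rewrite integral_slice//.
apply: (@measurable_fun_fubini_tonelli_F _ _ _ _ _ (leb n)
  (fun cy => (gweight cy)%:E * k (gam cy))%E).
- exact: (proj1 (nnmeasM nnmeas_gweight (nnmeas_comp measurable_gam nk))).
- exact: (proj2 (nnmeasM nnmeas_gweight (nnmeas_comp measurable_gam nk))).
Qed.

Lemma measurable_cylinder : measurable (cylinder i a b p q : set (rVborel R n.+1)).
Proof.
rewrite (_ : cylinder i a b p q = (fun x : rVborel R n.+1 => (x ord0 i : measurableTypeR R,
   (col' i x : rVborel R n))) @^-1` (`]p, q[ `*` box a b)); last first.
  by apply/seteqP; split=> x /=; rewrite /cylinder/= in_itv/= => -[].
rewrite -[X in measurable X]setTI.
have : measurable_fun setT (fun x : rVborel R n.+1 => (x ord0 i : measurableTypeR R,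
   (col' i x : rVborel R n))).
  apply: measurable_fun_pair; first exact: coord_measurable.
  apply: measurable_fun_rV => // j; under eq_fun do rewrite mxE.
  exact: coord_measurable.
apply => //; apply: measurableX; [exact: measurable_itv|exact: box_measurable].
Qed.

Lemma cylinder_insert y t : cylinder i a b p q (insert i y t) <-> box a b y /\ p < t < q.
Proof. by rewrite /cylinder /= col'_insert insert_i. Qed.

(** After Tonelli the base point is fixed, and the substitution c = w (insert i y t) along the axis
    of the cylinder has Jacobian partial_i w, which cancels the weight. *)
Lemma coarea_box k : nnmeas k ->
  (\int[lebesgue_measure]_c \int[slice_measure c]_x k x =
   \int[leb n.+1]_(x in cylinder i a b p q) k x)%E.
Proof.
move=> nk; have [mk k0] := nk.
rewrite [RHS]integral_mkcond (tonelli_insert2 i); last 2 first.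
- by apply/(measurable_restrictT _ _).1; [exact: measurable_cylinder|exact: measurable_funTS].
- by move=> x; rewrite patchE; case: ifP.
under eq_integral do rewrite integral_slice//.
have nH := nnmeasM nnmeas_gweight (nnmeas_comp measurable_gam nk).
have := @fubini_tonelli _ _ _ _ _ (@lebesgue_measure R) (leb n)
  (fun cy => (gweight cy)%:E * k (gam cy))%E (proj1 nH) (proj2 nH).
rewrite /= => ->; apply: eq_integral => y _.
have [yab|yab] := pselect (box a b y); last first.
  rewrite !integral0_eq// => [t _|c _].
    by rewrite patchE memNset// => /cylinder_insert[].
  by rewrite /gweight indicE memNset ?mul0r ?mul0e// => -[].
have yc := box_cbox yab.
(* Empty height intervals do occur, as the dummy entries of the covering used later; both sides are
   then 0. *)
have [pq|qp] := ltP p q; last first.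
  rewrite !integral0_eq// => [t _|c _].
    rewrite patchE memNset// => /cylinder_insert[_ /andP[h1 h2]].
    by have := lt_trans h1 h2; rewrite ltNge qp.
  rewrite /gweight indicE memNset ?mul0r ?mul0e// => -[_ [t /andP[h1 h2]]].
  by have := lt_trans h1 h2; rewrite ltNge qp.
pose W t := w (insert i y t); pose dW t := partial i w (insert i y t).
have WdW t : p <= t <= q -> is_derive t 1 W (dW t).
  by move=> tpq; apply: is_derive_insert oU wU _; have [] := hw yc tpq.
have dW0 t : p <= t <= q -> 0 < dW t by move=> tpq; have [] := hw yc tpq.
have dWc : {within `[p, q], continuous dW}.
  apply: continuous_in_subspaceT => t; rewrite inE/= in_itv/= => tpq.
  have [Uyt _] := hw yc tpq; have [_ cw] := wU i Uyt.
  apply: (cvg_comp (fun t => insert i y t) _ _ cw).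
  by apply: cvg_insert; [exact: cvg_cst|exact: cvg_id].
have gdomW c : gdom c y -> W p < c < W q.
  move=> [_ [t /andP[pt tq] <-]].
  by rewrite /W !(insert_mono oU wU hw)//; exact: ltW.
transitivity (\int[lebesgue_measure]_(c in `]W p, W q[) ((gweight (c, y))%:E * k (gam (c, y))))%E.
  rewrite [RHS]integral_mkcond; apply: eq_integral => c _; rewrite patchE.
  case: ifPn => // h; rewrite /gweight indicE memNset ?mul0r ?mul0e// => /gdomW cW.
  by move/negP : h; apply; rewrite inE/= in_itv.
rewrite (change_of_variable pq WdW dW0 dWc); last first.
  exact: (nnmeas_comp (pair2_measurable y) nH).
rewrite integral_mkcond; apply: eq_integral => t _; rewrite !patchE.
have -> : (insert i y t \in cylinder i a b p q) = (t \in `]p, q[%classic).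
  apply/idP/idP; rewrite !inE/= in_itv/=; first by move/cylinder_insert => [].
  by move=> ?; apply/cylinder_insert.
case: ifPn => //; rewrite inE/= in_itv/= => tpq.
have tpq' : p <= t <= q by case/andP : tpq => /ltW -> /ltW ->.
have [Uyt wt0] := hw yc tpq'.
have yt : gdom (W t) y by split => //; exists t.
rewrite /gweight indicE mem_set// mul1r (gam_gdom yt) (gfun_unique oU wU hw yab tpq erefl).
rewrite /invd patchE mem_set; last by split => //=; rewrite gt_eqF.
by rewrite muleA -EFinM gtr0_norm// divff ?gt_eqF// mul1e.
Qed.

End coarea_box.

(** * The Euclidean norm, and auxiliary facts on measures *)

Section euclid.
Context {R : realType}.

Lemma dot_ge0 n (u : 'rV[R]_n) : 0 <= dot u u.
Proof. by apply: sumr_ge0 => i _; rewrite -expr2 sqr_ge0. Qed.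

Lemma enorm_ge0 n (u : 'rV[R]_n) : 0 <= enorm u.
Proof. exact: sqrtr_ge0. Qed.

Lemma sqr_enorm n (u : 'rV[R]_n) : enorm u ^+ 2 = dot u u.
Proof. by rewrite sqr_sqrtr// dot_ge0. Qed.

Lemma enorm_eq0 n (u : 'rV[R]_n) : (enorm u == 0) = (u == 0).
Proof.
apply/idP/idP => [|/eqP ->]; last first.
  by rewrite /enorm /dot big1 ?sqrtr0// => i _; rewrite mxE mul0r.
rewrite -sqrf_eq0 sqr_enorm psumr_eq0 => [/allP h|i _]; last by rewrite -expr2 sqr_ge0.
apply/eqP/rowP => i; have := h i; rewrite mem_index_enum => /(_ isT) /=.
by rewrite mxE -expr2 sqrf_eq0 => /eqP.
Qed.

Lemma cvg_enorm (T : Type) (F : set_system T) (FF : Filter F) n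
    (f : T -> 'rV[R]_n) (l : 'rV[R]_n) :
  (forall i, f x ord0 i @[x --> F] --> l ord0 i) -> enorm (f x) @[x --> F] --> enorm l.
Proof.
move=> fl; apply: (@cvg_comp _ _ _ (fun x => dot (f x) (f x)) Num.sqrt F (nbhs (dot l l))).
  by apply: cvg_sumR => i _; apply: (@cvgM _ _ _ FF); exact: fl.
exact: sqrt_continuous.
Qed.

Lemma grad_continuous n (U : set 'rV[R]_n) f : isC1 U f -> forall x, U x ->
  enorm (grad f y) @[y --> x] --> enorm (grad f x).
Proof.
move=> fU x Ux; apply: (@cvg_enorm _ _ (nbhs_filter x)) => i.
rewrite mxE; under eq_fun do rewrite mxE.
by have [_ ] := fU i _ Ux.
Qed.

Lemma measurable_enorm_grad n (U : set 'rV[R]_n) f : open U -> isC1 U f ->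
  measurable_fun setT ((fun x => enorm (grad f x)) \_ U : rVborel R n -> R).
Proof.
move=> oU fU; apply/(measurable_restrictT _ _).1; first exact: open_measurable_rV.
apply: continuous_in_measurable_rV => // x Ux; exact: (grad_continuous fU Ux).
Qed.

Lemma measurable_col' n i : measurable_fun setT (col' i : rVborel R n.+1 -> rVborel R n).
Proof.
apply: measurable_fun_rV => // j; under eq_fun do rewrite mxE.
exact: coord_measurable.
Qed.

End euclid.

Section measure_aux.
Context {R : realType}.
Local Open Scope ereal_scope.

Lemma integral_mrestr d (T : measurableType d) (m : {measure set T -> \bar R})
    (D : set T) (mD : measurable D) (f : T -> \bar R) : nnmeas f ->
  \int[mrestr m mD]_x f x = \int[m]_(x in D) f x.
Proof.
move=> nf; transitivity (\int[m]_x ((\1_D x)%:E * f x)); last first.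
  rewrite [RHS]integral_mkcond; apply: eq_integral => x _.
  by rewrite patchE indicE; case: ifP; rewrite ?mul1e ?mul0e.
apply: (nnfunctional_ext (nnfunctional_integral (mrestr m mD))
  (nnfunctional_weight (nnfunctional_integral m) (nnmeas_indic mD))) => // A mA.
rewrite integral_indic// setIT /mrestr.
transitivity (\int[m]_x (\1_(A `&` D) x)%:E).
  by rewrite integral_indic ?setIT//; exact: measurableI.
by apply: eq_integral => x _; rewrite -EFinM indicI /= mulrC.
Qed.

Lemma integral_reflect (s : bool) (f : R -> \bar R) :
  nnmeas (f : measurableTypeR R -> \bar R) ->
  \int[lebesgue_measure]_a f ((-1) ^+ s * a)%R = \int[lebesgue_measure]_a f a.
Proof.
case: s => -[mf f0]; last by under eq_integral do rewrite mul1r.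
under eq_integral do rewrite mulN1r.
have mN : measurable_fun setT (-%R : measurableTypeR R -> measurableTypeR R).
  exact: oppr_measurable.
rewrite [RHS](eq_measure_integral
  (measure_function_pushforward__canonical__measure_function_Measure
    (@lebesgue_measure R) mN)) => [|A mA _].
  by rewrite (ge0_integral_pushforward mN)//.
by apply/esym; exact: lebesgue_measureN.
Qed.

Lemma nnmeas_patch d (T : measurableType d) (D : set T) (f : T -> \bar R) :
  measurable D -> nnmeas f -> nnmeas (f \_ D).
Proof.
move=> mD [mf f0]; split; last by move=> x; rewrite patchE; case: ifP.
by apply/(measurable_restrictT _ _).1 => //; exact: measurable_funTS.
Qed.

(** Testing only countably many boxes allows the hypothesis to be an equality that holds, box by
    box, for almost every value of a parameter. *)
Lemma rV_measure_unique_rat n (m1 m2 : {measure set (rVborel R n) -> \bar R}) :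
  (forall p, m1 (rbox p) = m2 (rbox p)) -> (forall p, m1 (rbox p) < +oo) ->
  forall A, measurable A -> m1 A = m2 A.
Proof.
move=> m12 m1oo A mA.
pose G : set (set (rVborel R n)) := [set B | exists p, B = rbox p].
have mG : G `<=` measurable by move=> _ [p ->]; exact: box_measurable.
have GE : @measurable _ (rVborel R n) `<=` <<s G >>.
  apply: smallest_sub; first exact: smallest_sigma_algebra.
  move=> U oU; rewrite (open_bigcup_rbox oU) bigcup_mkcond.
  apply: (@countable_bigcupT_measurable _ (g_sigma_algebraType G)) => [|p].
    exact: countableP.
  by case: ifP => // _; apply: sub_sigma_algebra; exists p.
apply: (g_sigma_algebra_measure_unique G mG
  (fun k => rbox (const_mx (- k%:R)%R, const_mx k%:R))) => //.
- by move=> k; eexists.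
- apply/seteqP; split=> // x _; exists (Num.trunc `|x|).+1 => // i.
  rewrite !mxE ratr_nat rmorphN /= ratr_nat -ltr_norml (le_lt_trans (coord_le_norm _ _))//.
  exact: truncnS_gt.
- move=> _ _ [p ->] [r ->].
  exists (\row_i Num.max (p.1 ord0 i) (r.1 ord0 i), \row_i Num.min (p.2 ord0 i) (r.2 ord0 i)).
  rewrite /rbox boxI; congr box; apply/rowP => i; rewrite !mxE/=.
    by rewrite !maxEle ler_rat; case: ifP.
  by rewrite !minEle ler_rat; case: ifP.
- by move=> _ [p ->]; exact: m12.
- exact: GE.
Qed.

Lemma ae_forall_count d (T : measurableType d) (mu : {measure set T -> \bar R})
    (I : countType) (P : I -> T -> Prop) :
  (forall i, {ae mu, forall x, P i x}) -> {ae mu, forall x, forall i, P i x}.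
Proof.
move=> h; pose N j : set T := if unpickle j is Some i then ~` [set x | P i x] else set0.
have HN : mu.-negligible (\bigcup_j N j).
  apply: negligible_bigcup => j; rewrite /N.
  by case: unpickle => [i|]; [exact: h|exact: negligible_set0].
apply: negligibleS HN => x /= /existsNP[i xi].
by exists (pickle i) => //; rewrite /N pickleK.
Qed.

End measure_aux.

(** * A countable covering of the regular points by cylinders *)

Section regular_boxes.
Context {R : realType} {n : nat}.
Variables (Omega : set 'rV[R]_n.+1) (psi : 'rV[R]_n.+1 -> R).
Hypotheses (oO : open Omega) (psiC1 : isC1 Omega psi).

(** A cylinder with axis direction [fi], base box from [fa] to [fb] and height interval from [fp] to
    [fq]. The sign [fs] replaces psi by -psi where its partial derivative is negative, so that only
    increasing functions are met. *)
Record fbox := FBox { fi : 'I_n.+1; fs : bool; fa : 'rV[R]_n; fb : 'rV[R]_n;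
  fp : R; fq : R }.

Definition signed (s : bool) (x : 'rV[R]_n.+1) : R := (-1) ^+ s * psi x.

Lemma partial_signed s i x : Omega x ->
  partial i (signed s) x = (-1) ^+ s * partial i psi x.
Proof.
by move=> Ox; have [dpsi _] := psiC1 i Ox; rewrite /partial /signed deriveMl.
Qed.

Lemma signed_isC1 s : isC1 Omega (signed s).
Proof.
move=> i x Ox; have [dpsi cpsi] := psiC1 i Ox; split.
  exact: (@derivableZ _ _ _ psi ((-1) ^+ s)).
rewrite /prop_for /continuous_at partial_signed//; have FF := nbhs_filter x.
have S : (-1) ^+ s * partial i psi y @[y --> x] --> (-1) ^+ s * partial i psi x.
  by apply: (@cvgM _ _ _ FF) => //; exact: cvg_cst.
apply: cvg_trans S; apply: (@near_eq_cvg _ _ _ FF).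
have : nbhs x Omega by exact: open_nbhs_nbhs.
by apply: filterS => y Oy; rewrite partial_signed.
Qed.

Definition fvalid (k : fbox) := forall y t, cbox (fa k) (fb k) y -> fp k <= t <= fq k ->
  Omega (insert (fi k) y t) /\ 0 < partial (fi k) (signed (fs k)) (insert (fi k) y t).

Definition fcyl (k : fbox) := cylinder (fi k) (fa k) (fb k) (fp k) (fq k).

(** A cylinder is coded by a direction, a sign and a rational box, hence by an integer. A point with
    nonzero i-th partial derivative has a rational box around it whose closure lies in the open set
    where the signed partial derivative is positive. *)
Lemma ex_fboxes : exists kappa : nat -> fbox, (forall k, fvalid (kappa k)) /\
  forall i x, Omega x -> partial i psi x != 0 ->
    exists2 k, fi (kappa k) = i & fcyl (kappa k) x.
Proof.
pose I := ('I_n.+1 * bool * ('rV[rat]_n.+1 * 'rV[rat]_n.+1))%type.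
pose mk (c : I) := let: (i, s, (u, v)) := c in
  FBox i s (map_mx ratr (col' i u)) (map_mx ratr (col' i v))
    (ratr (u ord0 i)) (ratr (v ord0 i)).
(* The height interval from 1 to 0 is empty, so this cylinder is valid vacuously; it fills the codes
   that describe no valid cylinder. *)
pose dummy := FBox ord0 false 0 0 1 0.
have dummyP : fvalid dummy.
  by move=> y t _ /= /andP[t1 t0]; have := le_trans t1 t0; rewrite ler10.
pose kappa k := if unpickle k is Some c then
  if pselect (fvalid (mk c)) then mk c else dummy else dummy.
exists kappa; split=> [k|i x Ox px].
  by rewrite /kappa; case: unpickle => // c; case: pselect.
pose s := partial i psi x < 0.
have sx : 0 < partial i (signed s) x.
  rewrite partial_signed//; rewrite /s; case: (ltgtP (partial i psi x) 0) px => //= h _.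
    by rewrite expr1 mulN1r oppr_gt0.
  by rewrite expr0 mul1r.
pose V := Omega `&` [set x | 0 < partial i (signed s) x].
have oV : open V.
  rewrite openE => z [Oz sz]; apply: filterI; first exact: open_nbhs_nbhs.
  have [_ /(_ [set r | 0 < r])] := @signed_isC1 s i z Oz.
  by apply; exact: lt_nbhsr.
have [[u v] [xuv uvV]] := open_rbox oV (conj Ox sx).
pose c : I := (i, s, (u, v)).
have vc : fvalid (mk c).
  move=> y t /= yuv tuv; apply: uvV => j /=.
  case: (unliftP i j) => [j'|] ->; last by rewrite insert_i !mxE.
  by have := yuv j'; rewrite insert_lift !mxE.
have kc : kappa (pickle c) = mk c by rewrite /kappa pickleK; case: pselect.
exists (pickle c); rewrite kc //; split=> [j|] /=.
  by have := xuv (lift i j); rewrite !mxE.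
by have := xuv i; rewrite !mxE.
Qed.

Definition regular_set : set 'rV[R]_n.+1 := Omega `&` [set x | grad psi x != 0].

End regular_boxes.

(** * The measures dsigma / |grad psi| on levels, and the surface measure *)

Section total_slice.
Context {R : realType} {n : nat}.
Variables (Omega : set 'rV[R]_n.+1) (psi : 'rV[R]_n.+1 -> R).
Hypotheses (oO : open Omega) (psiC1 : isC1 Omega psi).
Variable kappa : nat -> @fbox R n.
Hypothesis kvalid : forall k, fvalid Omega psi (kappa k).
Hypothesis kcover : forall i x, Omega x -> partial i psi x != 0 ->
  exists2 k, fi (kappa k) = i & fcyl (kappa k) x.

Local Notation cyl k := (fcyl (kappa k)).
Local Notation B := (rVborel R n.+1).

Lemma measurable_cyl k : measurable (cyl k : set B).
Proof. exact: measurable_cylinder. Qed.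

Lemma cyl_sub k : cyl k `<=` Omega.
Proof.
move=> x [xab /andP[px xq]]; rewrite -(insert_col' (fi (kappa k)) x).
by have [|] := kvalid (box_cbox xab) (t := x ord0 (fi (kappa k))); rewrite ?(ltW px) ?(ltW xq).
Qed.

Lemma cyl_partial k x : cyl k x -> partial (fi (kappa k)) psi x != 0.
Proof.
move=> cx; have Ox := cyl_sub cx; case: cx => [xab /andP[px xq]].
have [|_] := @kvalid k (col' (fi (kappa k)) x) (x ord0 (fi (kappa k))) (box_cbox xab).
  by rewrite !ltW.
rewrite insert_col' (partial_signed psiC1)//; apply: contraTneq => ->.
by rewrite mulr0 ltxx.
Qed.

Definition piece k : set B := seqDU (fun k => cyl k) k.

Lemma measurable_piece k : measurable (piece k).
Proof.
apply: measurableD; first exact: measurable_cyl.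
by apply: bigsetU_measurable => j _; exact: measurable_cyl.
Qed.

Lemma piece_cyl k : piece k `<=` cyl k.
Proof. by move=> x []. Qed.

Lemma bigcup_piece : \bigcup_k piece k = regular_set Omega psi.
Proof.
rewrite -seqDU_bigcup_eq; apply/seteqP; split=> x.
  move=> [k _ cx]; split; first exact: cyl_sub cx.
  apply: contraNN (cyl_partial cx) => /eqP /rowP /(_ (fi (kappa k))).
  by rewrite !mxE => ->.
move=> [Ox gx]; have [i gi] : exists i, partial i psi x != 0.
  apply: contrapT => /forallNP h; move/negP : gx; apply; apply/eqP/rowP => i.
  by rewrite !mxE; apply/eqP/negPn/negP; exact: h.
by have [k _ kx] := kcover Ox gi; exists k.
Qed.

Lemma measurable_regular_set : measurable (regular_set Omega psi : set B).
Proof. by rewrite -bigcup_piece; apply: bigcupT_measurable => k; exact: measurable_piece. Qed.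

Definition slk k (a : R) : {measure set B -> \bar R} :=
  slice_measure oO (@signed_isC1 R n Omega psi oO psiC1 (fs (kappa k))) (@kvalid k)
    ((-1) ^+ fs (kappa k) * a).

(** The cylinders overlap, so the slice measure of each is restricted to its own disjoint piece
    before summation. This is dsigma / |grad psi| on the regular part of the level. *)
Definition tot (a : R) : {measure set B -> \bar R} :=
  mseries (fun k => mrestr (slk k a) (measurable_piece k)) 0.

Local Open Scope ereal_scope.

Lemma measurable_reflect (s : bool) (f : R -> \bar R) :
  measurable_fun setT (f : measurableTypeR R -> \bar R) ->
  measurable_fun setT ((fun a => f ((-1) ^+ s * a)%R) : measurableTypeR R -> \bar R).
Proof. by move=> mf; apply: (measurableT_comp mf); exact: mulrl_measurable. Qed.

Lemma measurable_slk k h : nnmeas h ->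
  measurable_fun setT (fun a : measurableTypeR R => \int[slk k a]_x h x).
Proof.
move=> nh.
have := measurable_integral_slice oO (@signed_isC1 R n Omega psi oO psiC1 (fs (kappa k)))
  (@kvalid k) nh.
by move/(@measurable_reflect (fs (kappa k))).
Qed.

Lemma coarea_slk k h : nnmeas h ->
  \int[lebesgue_measure]_a \int[slk k a]_x h x = \int[leb n.+1]_(x in cyl k) h x.
Proof.
move=> nh; have E := coarea_box oO (@signed_isC1 R n Omega psi oO psiC1 (fs (kappa k)))
  (@kvalid k) nh.
apply: etrans E.
have := @integral_reflect R (fs (kappa k)) (fun c => \int[slice_measure oO
  (@signed_isC1 R n Omega psi oO psiC1 (fs (kappa k))) (@kvalid k) c]_x h x).
apply; split; first exact: measurable_integral_slice.
by move=> a; apply: integral_ge0 => x _; apply: (proj2 nh).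
Qed.

Lemma integral_tot a h : nnmeas h ->
  \int[tot a]_x h x = \sum_(0 <= k <oo) \int[slk k a]_x (h \_ (piece k)) x.
Proof.
move=> [mh h0].
have := @ge0_integral_measure_series _ B R (fun k => mrestr (slk k a) (measurable_piece k))
  setT measurableT h (fun x _ => h0 x) mh.
move=> E; apply: (etrans E); apply: eq_eseriesr => k _.
by rewrite (integral_mrestr (slk k a) (measurable_piece k) (conj mh h0)) integral_mkcond.
Qed.

Lemma measurable_tot h : nnmeas h ->
  measurable_fun setT (fun a : measurableTypeR R => \int[tot a]_x h x).
Proof.
move=> nh; under eq_fun do rewrite integral_tot//.
apply: ge0_emeasurable_sum => k.
- move=> a _ _; apply: integral_ge0 => x _.
  by apply: (proj2 (nnmeas_patch (measurable_piece k) nh)).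
- by move=> _; apply: measurable_slk; exact: (nnmeas_patch (measurable_piece k)).
Qed.

Lemma coarea_tot h : nnmeas h ->
  \int[lebesgue_measure]_a \int[tot a]_x h x =
  \int[leb n.+1]_(x in regular_set Omega psi) h x.
Proof.
move=> nh; have [mh h0] := nh; under eq_integral do rewrite integral_tot//.
rewrite integral_nneseries//; last 2 first.
- by move=> k; apply: measurable_slk; exact: (nnmeas_patch (measurable_piece k)).
- move=> k a _; apply: integral_ge0 => x _.
  by apply: (proj2 (nnmeas_patch (measurable_piece k) nh)).
rewrite -bigcup_piece ge0_integral_bigcup//; last 3 first.
- exact: measurable_piece.
- exact: measurable_funTS.
- exact: trivIset_seqDU.
apply: eq_eseriesr => k _; rewrite coarea_slk; last exact: (nnmeas_patch (measurable_piece k)).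
rewrite [LHS]integral_mkcond [RHS]integral_mkcond; apply: eq_integral => x _.
rewrite !patchE; case: ifPn => //; case: ifPn => //; rewrite !notin_setE inE.
by move=> px []; exact: piece_cyl px.
Qed.

Local Open Scope ring_scope.

Local Notation ii k := (fi (kappa k)).
Local Notation cc k a := ((-1) ^+ fs (kappa k) * a)%R.
Local Notation ww k := (signed psi (fs (kappa k))).
Local Notation sC k := (@signed_isC1 R n Omega psi oO psiC1 (fs (kappa k))).

Definition gd k (a : R) : set 'rV[R]_n :=
  gdom (ii k) (ww k) (fa (kappa k)) (fb (kappa k)) (fp (kappa k)) (fq (kappa k)) (cc k a).
Definition gf k (a : R) : 'rV[R]_n -> R :=
  gfun (ii k) (ww k) (fp (kappa k)) (fq (kappa k)) (cc k a).
Definition gw k (a : R) (y : rVborel R n) : R :=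
  gweight (ii k) Omega (ww k) (fa (kappa k)) (fb (kappa k)) (fp (kappa k)) (fq (kappa k))
    (cc k a, y).
Definition gm k (a : R) (y : rVborel R n) : B :=
  gam (ii k) (ww k) (fa (kappa k)) (fb (kappa k)) (fp (kappa k)) (fq (kappa k)) (cc k a, y).

Lemma integral_slk k a h : nnmeas h ->
  (\int[slk k a]_x h x = \int[leb n]_y ((gw k a y)%:E * h (gm k a y)))%E.
Proof. exact: integral_slice. Qed.

Lemma gw_gd k a y : gw k a y != 0 -> gd k a y.
Proof.
rewrite /gw /gweight indicE => h; apply: contrapT => h'; move: h.
by rewrite memNset ?mul0r ?eqxx.
Qed.

Lemma gd_cyl k a y : gd k a y ->
  cyl k (insert (ii k) y (gf k a y)) /\ psi (insert (ii k) y (gf k a y)) = a.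
Proof.
move=> ya; have [pq wg] := gfunP ya; have [yab _] := ya; split.
  by apply/cylinder_insert.
by move: wg; rewrite /signed; apply: (can_inj (signrMK (fs (kappa k)))).
Qed.

Lemma gmE k a y : gd k a y -> gm k a y = insert (ii k) y (gf k a y).
Proof. exact: gam_gdom. Qed.

Lemma gwE k a y : gd k a y ->
  gw k a y = `|partial (ii k) psi (insert (ii k) y (gf k a y))|^-1.
Proof.
move=> ya; have [cy _] := gd_cyl ya; have Oy := cyl_sub cy.
rewrite /gw /gweight indicE mem_set// mul1r -[gam _ _ _ _ _ _ _]/(gm k a y) gmE//.
have e : partial (ii k) (ww k) (insert (ii k) y (gf k a y)) =
    (-1) ^+ fs (kappa k) * partial (ii k) psi (insert (ii k) y (gf k a y)).
  exact: (partial_signed psiC1).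
have cp := cyl_partial cy.
rewrite /invd patchE mem_set ?e ?normrM ?normrX ?normrN1 ?expr1n ?mul1r//.
by split=> //=; rewrite e mulf_neq0// signr_eq0.
Qed.

Lemma cyl_gd k x : cyl k x ->
  gd k (psi x) (col' (ii k) x) /\ gf k (psi x) (col' (ii k) x) = x ord0 (ii k).
Proof.
move=> [xab pq].
have wx : ww k (insert (ii k) (col' (ii k) x) (x ord0 (ii k))) = cc k (psi x).
  by rewrite insert_col'.
split; first by split=> //; exists (x ord0 (ii k)).
exact: (gfun_unique oO (sC k) (@kvalid k) xab pq wx).
Qed.

Local Open Scope ereal_scope.

Lemma eq_integral_slk k a (h h' : B -> \bar R) : nnmeas h -> nnmeas h' ->
  (forall x, cyl k x -> psi x = a -> h x = h' x) ->
  \int[slk k a]_x h x = \int[slk k a]_x h' x.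
Proof.
move=> nh nh' hh'; rewrite !integral_slk//; apply: eq_integral => y _.
have [->|/gw_gd ya] := eqVneq (gw k a y) 0%R; first by rewrite !mul0e.
by have [cy py] := gd_cyl ya; rewrite gmE// hh'.
Qed.

Lemma eq_integral_tot a (h h' : B -> \bar R) : nnmeas h -> nnmeas h' ->
  (forall x, regular_set Omega psi x -> psi x = a -> h x = h' x) ->
  \int[tot a]_x h x = \int[tot a]_x h' x.
Proof.
move=> nh nh' hh'; rewrite !integral_tot//; apply: eq_eseriesr => k _.
apply: eq_integral_slk; try exact: (nnmeas_patch (measurable_piece k)).
move=> x cx xa; rewrite !patchE; case: ifPn => //; rewrite inE => px; apply: hh' => //.
by rewrite -bigcup_piece; exists k.
Qed.

Definition psiO : B -> R := (psi : B -> R) \_ Omega.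

Lemma measurable_psiO : measurable_fun setT psiO.
Proof.
apply/(measurable_restrictT _ _).1; first exact: open_measurable_rV.
apply: continuous_in_measurable_rV => // x Ox; exact: isC1_continuous oO psiC1 Ox.
Qed.

(* Almost every level has the same slice measure in every box containing it,
   so the choice of the disjoint pieces is irrelevant. *)
Definition consistent (a : R) := forall k (C : set B), measurable C -> C `<=` cyl k ->
  slk k a C = tot a C.

Lemma nnmeas_preimage (C : set B) (A : set (measurableTypeR R)) : measurable C ->
  measurable A -> nnmeas (fun x : B => (\1_(C `&` psiO @^-1` A) x : R)%:E).
Proof.
move=> mC mA; apply: nnmeas_indic; apply: measurableI => //.
by rewrite -[X in measurable X]setTI; exact: measurable_psiO.
Qed.

Lemma integral_slk_preimage k (C : set B) (A : set (measurableTypeR R)) : measurable C ->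
  C `<=` cyl k -> measurable A ->
  \int[lebesgue_measure]_(a in A) slk k a C = leb n.+1 (C `&` psiO @^-1` A).
Proof.
move=> mC Ck mA; have mCA : measurable (C `&` psiO @^-1` A).
  apply: measurableI => //; rewrite -[X in measurable X]setTI; exact: measurable_psiO.
have := coarea_slk k (nnmeas_preimage mC mA); rewrite [X in _ = X]integral_mkcond.
rewrite (_ : \int[leb n.+1]_x _ = leb n.+1 (C `&` psiO @^-1` A)); last first.
  rewrite -[X in leb _ X]setIT -integral_indic//; apply: eq_integral => x _.
  rewrite patchE; case: ifPn => //; rewrite notin_setE => ncx.
  by rewrite indicE memNset// => -[/Ck].
move=> <-; rewrite integral_mkcond; apply: eq_integral => a _; rewrite patchE.
case: ifPn => [|]; rewrite ?notin_setE ?inE => aA.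
  rewrite -[X in slk k a X]setIT -integral_indic//.
  apply: eq_integral_slk; try exact: nnmeas_indic.
  move=> x cx xa; rewrite !indicE in_setI; congr (_ _)%:E.
  rewrite [X in _ && X]mem_set ?andbT//= /psiO patchE mem_set ?xa//; exact: cyl_sub cx.
rewrite (@eq_integral_slk _ _ _ (fun=> 0)) ?integral0//; try exact: nnmeas_preimage.
move=> x cx xa; rewrite indicE memNset// => -[_] /=.
by rewrite /psiO patchE mem_set ?xa//; exact: cyl_sub cx.
Qed.

Lemma integral_tot_preimage (C : set B) (A : set (measurableTypeR R)) : measurable C ->
  C `<=` regular_set Omega psi -> measurable A ->
  \int[lebesgue_measure]_(a in A) tot a C = leb n.+1 (C `&` psiO @^-1` A).
Proof.
move=> mC Ck mA; have mCA : measurable (C `&` psiO @^-1` A).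
  apply: measurableI => //; rewrite -[X in measurable X]setTI; exact: measurable_psiO.
have := coarea_tot (nnmeas_preimage mC mA); rewrite [X in _ = X]integral_mkcond.
rewrite (_ : \int[leb n.+1]_x _ = leb n.+1 (C `&` psiO @^-1` A)); last first.
  rewrite -[X in leb _ X]setIT -integral_indic//; apply: eq_integral => x _.
  rewrite patchE; case: ifPn => //; rewrite notin_setE => ncx.
  by rewrite indicE memNset// => -[/Ck].
move=> <-; rewrite integral_mkcond; apply: eq_integral => a _; rewrite patchE.
case: ifPn => [|]; rewrite ?notin_setE ?inE => aA.
  rewrite -[X in tot a X]setIT -integral_indic//.
  apply: eq_integral_tot; try exact: nnmeas_indic.
  move=> x [cx _] xa; rewrite !indicE in_setI; congr (_ _)%:E.
  by rewrite [X in _ && X]mem_set ?andbT//= /psiO patchE mem_set ?xa.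
rewrite (@eq_integral_tot _ _ (fun=> 0)) ?integral0//; try exact: nnmeas_preimage.
move=> x [cx _] xa; rewrite indicE memNset// => -[_] /=.
by rewrite /psiO patchE mem_set ?xa.
Qed.

Lemma cyl_regular k : cyl k `<=` regular_set Omega psi.
Proof.
move=> x cx; split; first exact: cyl_sub cx.
apply: contraNN (cyl_partial cx) => /eqP /rowP /(_ (ii k)).
by rewrite !mxE => ->.
Qed.

Lemma measurable_slk_set k (C : set B) : measurable C ->
  measurable_fun setT (fun a : measurableTypeR R => slk k a C).
Proof.
move=> mC; have -> : (fun a => slk k a C) = (fun a => \int[slk k a]_x (\1_C x : R)%:E).
  by apply/funext => a; rewrite (integral_indic _ measurableT mC) setIT.
by apply: measurable_slk; exact: nnmeas_indic.
Qed.

Lemma measurable_tot_set (C : set B) : measurable C ->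
  measurable_fun setT (fun a : measurableTypeR R => tot a C).
Proof.
move=> mC; have -> : (fun a => tot a C) = (fun a => \int[tot a]_x (\1_C x : R)%:E).
  by apply/funext => a; rewrite (integral_indic _ measurableT mC) setIT.
by apply: measurable_tot; exact: nnmeas_indic.
Qed.

(** Integrated over any Borel set A of levels, both masses of C give the volume of C intersected
    with {psi in A}, by the coarea formula; hence they agree for almost every level. This is done
    for the countably many intersections of a rational box with a cylinder, and uniqueness of
    measures gives all C at once. *)
Lemma ae_consistent : {ae @lebesgue_measure R, forall a, consistent a}.
Proof.
have H (k : nat) (p : 'rV[rat]_n.+1 * 'rV[rat]_n.+1) :
    {ae @lebesgue_measure R, forall a,
      slk k a (rbox p `&` cyl k) = tot a (rbox p `&` cyl k) /\
      slk k a (rbox p `&` cyl k) < +oo}.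
  have mC : measurable (rbox p `&` cyl k : set B).
    by apply: measurableI; [exact: box_measurable|exact: measurable_cyl].
  have Ck : rbox p `&` cyl k `<=` cyl k by move=> x [].
  have mf := measurable_slk_set k mC; have mg := measurable_tot_set mC.
  have If : (@lebesgue_measure R).-integrable setT (fun a => slk k a (rbox p `&` cyl k)).
    apply/integrableP; split=> //; under eq_integral do rewrite gee0_abs//.
    rewrite integral_slk_preimage//; apply: le_lt_trans (leb_box_lty (map_mx ratr p.1) (map_mx ratr p.2)).
    apply: le_measure; rewrite ?inE.
    - by apply: measurableI => //; rewrite -[X in measurable X]setTI; exact: measurable_psiO.
    - exact: box_measurable.
    - by move=> x [[]].
  have E : {ae @lebesgue_measure R, forall a, setT a ->
      slk k a (rbox p `&` cyl k) = tot a (rbox p `&` cyl k)}.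
    apply: integral_ae_eq => // A _ mA; rewrite integral_slk_preimage//.
    by rewrite integral_tot_preimage// => x /Ck; exact: cyl_regular.
  have I := integrable_ae measurableT If.
  have FF := @ae_filter_ringOfSetsType _ (measurableTypeR R) R (@lebesgue_measure R).
  apply: (@filterS2 _ _ FF _ _ _ _ E I) => a e i; split; first exact: e.
  by have := i Logic.I; rewrite fin_num_abs gee0_abs.
have H' : {ae @lebesgue_measure R, forall a,
   forall kp : nat * ('rV[rat]_n.+1 * 'rV[rat]_n.+1),
      slk kp.1 a (rbox kp.2 `&` cyl kp.1) = tot a (rbox kp.2 `&` cyl kp.1) /\
      slk kp.1 a (rbox kp.2 `&` cyl kp.1) < +oo}.
  by apply: ae_forall_count => -[k p]; exact: H.
have FF := @ae_filter_ringOfSetsType _ (measurableTypeR R) R (@lebesgue_measure R).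
apply: (@filterS _ _ FF _ _ _ H') => a h k C mC Ck.
have mCk := @measurable_cyl k.
have := @rV_measure_unique_rat _ _ (mrestr (slk k a) mCk) (mrestr (tot a) mCk).
move=> /(_ (fun p => proj1 (h (k, p))) (fun p => proj2 (h (k, p))) C mC).
move=> h2; have : slk k a (C `&` cyl k) = tot a (C `&` cyl k) by exact: h2.
by rewrite (setIidl Ck).
Qed.
Definition gradO : B -> R := (fun x => enorm (grad psi x)) \_ Omega.

Lemma nnmeas_gradO : nnmeas (EFin \o gradO).
Proof.
split; first by apply/measurable_EFinP; exact: measurable_enorm_grad.
by move=> x; rewrite lee_fin /gradO patchE; case: ifP => // _; exact: enorm_ge0.
Qed.

(* The measure |grad psi| d tot a is the surface measure of the level set. *)
Definition surf a := dens_measure (tot a) nnmeas_gradO.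
Definition surfk k a := dens_measure (slk k a) nnmeas_gradO.

Lemma surfkE k a (C : set B) : consistent a -> measurable C -> C `<=` cyl k ->
  surfk k a C = surf a C.
Proof.
move=> ca mC Ck; rewrite !densE; apply: eq_setfun_integral => D mD DC.
by apply: ca => //; exact: subset_trans Ck.
Qed.

Section chart.
Variables (a : R) (S : set 'rV[R]_n.+1) (i : 'I_n.+1) (O : set 'rV[R]_n) (g : 'rV[R]_n -> R).
Hypotheses (ca : consistent a) (Sr : S `<=` regular_set Omega psi)
  (Sa : forall x, S x -> psi x = a) (Sch : chart S i O g).

Let oOg : open O. Proof. by case: Sch. Qed.
Let gC1 : isC1 O g. Proof. by case: Sch. Qed.

Lemma chartS y : O y -> S (insert i y (g y)).
Proof. by case: Sch => _ _ gS Oy; apply: gS; exists y. Qed.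

Definition chartfun : rVborel R n -> R := (g : rVborel R n -> R) \_ O.

Lemma measurable_chartfun : measurable_fun setT chartfun.
Proof.
apply/(measurable_restrictT _ _).1; first exact: open_measurable_rV.
by apply: continuous_in_measurable_rV => // y Oy; exact: isC1_continuous oOg gC1 Oy.
Qed.

Definition chartmap (y : rVborel R n) : B := insert i y (chartfun y).

Lemma measurable_chartmap : measurable_fun setT chartmap.
Proof.
apply: (measurableT_comp (@measurable_insertp R n i)
  (_ : measurable_fun setT (fun y => (chartfun y, y)))).
by apply: measurable_fun_pair => //; exact: measurable_chartfun.
Qed.

Lemma measurable_graph (D : set (rVborel R n)) : measurable D -> D `<=` O ->
  measurable (graph i g D : set B).
Proof.
move=> mD DO.
have -> : graph i g D = ((col' i : B -> rVborel R n) @^-1` D) `&`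
   ((fun x : B => x ord0 i - chartfun (col' i x))%R @^-1` [set 0%R]).
  apply/seteqP; split=> [_ [y Dy <-]|x [/= Dx /eqP]].
    split; rewrite /= col'_insert// insert_i /chartfun patchE mem_set ?subrr//; exact: DO.
  rewrite subr_eq0 => /eqP; rewrite /chartfun patchE mem_set; last exact: DO.
  by move=> xg; exists (col' i x) => //; rewrite -xg insert_col'.
apply: measurableI; rewrite -[X in measurable X]setTI.
  exact: measurable_col'.
have mf : measurable_fun setT (fun x : B => x ord0 i - chartfun (col' i x))%R.
  apply: measurable_funB; first exact: coord_measurable.
  exact: (measurableT_comp measurable_chartfun (measurable_col' i)).
by apply: mf => //; exact: measurable_set1.
Qed.

Definition areaw : rVborel R n -> R :=
  (fun y => Num.sqrt (1 + enorm (grad g y) ^+ 2))%R \_ O.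

Lemma nnmeas_areaw : nnmeas (EFin \o areaw).
Proof.
split; last first.
  by move=> y; rewrite lee_fin /areaw patchE; case: ifP => // _; exact: sqrtr_ge0.
apply/measurable_EFinP/(measurable_restrictT _ _).1; first exact: open_measurable_rV.
apply: continuous_in_measurable_rV => // y Oy; have FF := nbhs_filter y.
apply: (@cvg_comp _ _ _ (fun x => 1 + enorm (grad g x) ^+ 2)%R Num.sqrt); last exact: sqrt_continuous.
apply: (@cvgD _ _ _ _ FF); first exact: cvg_cst.
by apply: (@cvgM _ _ _ FF); exact: (grad_continuous gC1 Oy).
Qed.

Lemma graph_areaE (D : set (rVborel R n)) : measurable D -> D `<=` O ->
  graph_area g D = dens_measure (leb n) nnmeas_areaw D.
Proof.
move=> mD DO; rewrite densE /graph_area integral_lebE; apply: eq_integral => y.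
by rewrite inE => Dy; rewrite /areaw /= patchE mem_set//; exact: DO.
Qed.

(** Implicit differentiation expresses every partial derivative of psi on the chart through the i-th
    one; were that one zero, the whole gradient would vanish at a regular point. *)
Lemma chart_partial y : O y -> partial i psi (insert i y (g y)) != 0%R /\
  enorm (grad psi (insert i y (g y))) =
  (`|partial i psi (insert i y (g y))| * Num.sqrt (1 + enorm (grad g y) ^+ 2))%R.
Proof.
move=> Oy; set x := insert i y (g y).
have H j : (partial (lift i j) psi x = - partial i psi x * partial j g y)%R.
  apply/eqP; rewrite mulNr -addr_eq0; apply/eqP.
  apply: (chart_grad oO psiC1 oOg gC1 _ Oy) => z Oz; have Sz := chartS Oz.
  by split; [case: (Sr Sz)|exact: Sa].
split.
  have [_ /=] := Sr (chartS Oy); apply: contraNN => /eqP e.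
  apply/eqP/rowP => k; rewrite !mxE; case: (unliftP i k) => [j|] -> //.
  by rewrite [LHS]H e oppr0 mul0r.
rewrite -sqrtr_sqr -sqrtrM ?sqr_ge0//; congr Num.sqrt.
rewrite sqr_enorm /dot (sum_insert i) !mxE mulrDr mulr1 -expr2; congr (_ + _)%R.
rewrite big_distrr; apply: eq_bigr => j _; rewrite !mxE H /=; ring.
Qed.

(** Chart and cylinder share the direction i, so by uniqueness of the implicit function g coincides
    with [gf k a] on D, and the factors |partial_i psi| and its inverse cancel. *)
Lemma chart_area1 k (D : set (rVborel R n)) : ii k = i -> measurable D -> D `<=` O ->
  (forall y, D y -> cyl k (insert i y (g y))) ->
  graph_area g D = surfk k a (graph i g D).
Proof.
move=> ki mD DO Dk; have mG := measurable_graph mD DO.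
rewrite densE integral_mkcond integral_slk; last exact: (nnmeas_patch mG nnmeas_gradO).
rewrite /graph_area integral_lebE integral_mkcond; apply: eq_integral => y _.
rewrite patchE; case: ifPn => [|]; rewrite ?inE ?notin_setE => Dy; last first.
  have [->|/gw_gd ya] := eqVneq (gw k a y) 0%R; first by rewrite mul0e.
  rewrite gmE// patchE memNset ?mule0// => -[z Dz].
  rewrite ki => /(congr1 (col' i)); rewrite !col'_insert => zy.
  by apply: Dy; rewrite -zy.
have Oy := DO _ Dy; have cy := Dk y Dy; have Sy := chartS Oy.
have [] := cyl_gd cy; rewrite (Sa Sy) ki col'_insert insert_i => ya gy.
rewrite (gmE ya) (gwE ya) ki gy patchE mem_set; last by exists y.
have [pn0 ge] := chart_partial Oy.
have Ox : Omega (insert i y (g y)) by case: (Sr Sy).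
by rewrite /= /gradO patchE mem_set// ge -EFinM mulKf// normr_eq0.
Qed.

(** D is cut into pieces each lying over one cylinder. The area of each is a mass for the slice
    measure of its cylinder, which consistency of the level turns into a mass for [surf]. *)
Lemma chart_area (D : set (rVborel R n)) : measurable D -> D `<=` O ->
  graph_area g D = surf a (graph i g D).
Proof.
(* Only the cylinders of direction i are kept, so that chart and level are graphs over the same
   hyperplane. They still cover the chart, since the i-th partial derivative does not vanish on
   it. *)
move=> mD DO; pose Q k : set B := seqDU (fun k => if ii k == i then cyl k else set0) k.
have mQ0 k : measurable ((if ii k == i then cyl k else set0) : set B).
  by case: ifP => // _; exact: measurable_cyl.
have mQ k : measurable (Q k).
  by apply: measurableD => //; apply: bigsetU_measurable => j _.
have tQ : trivIset setT Q := trivIset_seqDU _.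
pose Dk k : set (rVborel R n) := D `&` chartmap @^-1` Q k.
have mDk k : measurable (Dk k).
  apply: measurableI => //; rewrite -[X in measurable X]setTI.
  by apply: measurable_chartmap.
have chE y : O y -> chartmap y = insert i y (g y).
  by move=> Oy; rewrite /chartmap /chartfun patchE mem_set.
have coverQ y : O y -> exists k, Q k (insert i y (g y)).
  move=> Oy; have [pn0 _] := chart_partial Oy; have [Ox _] := Sr (chartS Oy).
  have [k ki kc] := kcover Ox pn0.
  have : (\bigcup_k (if ii k == i then cyl k else set0)) (insert i y (g y)).
    by exists k => //; rewrite ki eqxx.
  by rewrite seqDU_bigcup_eq => -[j _ Qj]; exists j.
have DE : D = \bigcup_k Dk k.
  apply/seteqP; split=> [y Dy|y [k _ []]//].
  have [k Qk] := coverQ y (DO _ Dy); exists k => //; split=> //=; rewrite chE//; exact: DO.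
have GE : graph i g D = \bigcup_k graph i g (Dk k).
  apply/seteqP; split=> [_ [y Dy <-]|_ [k _ [y [Dy _] <-]]]; last by exists y.
  by move: (Dy); rewrite {1}DE => -[k _ Dky]; exists k => //; exists y.
have DkO k : Dk k `<=` O by move=> y [/DO].
rewrite graph_areaE// GE [in LHS]DE !measure_bigcup//; first last.
- by move=> j k _ _ [x [[_ Qj] [_ Qk]]]; apply: tQ => //; exists (chartmap x).
- move=> j k _ _ [_ [[y [Dy Qj] <-] [z [Dz Qk] yz]]].
  have zy : z = y by have := congr1 (col' i) yz; rewrite !col'_insert.
  by apply: tQ => //; exists (chartmap y); split=> //; rewrite -zy.
- by move=> k _; apply: measurable_graph.
apply: eq_eseriesr => k _; rewrite -graph_areaE//.
have DkQ y : Dk k y -> ii k = i /\ cyl k (insert i y (g y)).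
  move=> Dky; have := DkO _ _ Dky; case: Dky => Dy [+ _] => /[swap] Oy; rewrite chE//.
  by case: ifPn => // /eqP.
have [[y0 Dy0]|Dk0] := pselect (exists y, Dk k y); last first.
  have -> : Dk k = set0 by apply/seteqP; split=> // y Dy; apply: Dk0; exists y.
  rewrite graph_areaE// measure0 (_ : graph i g set0 = set0) ?measure0//.
  by apply/seteqP; split=> // x [].
have [ki _] := DkQ _ Dy0.
rewrite (chart_area1 ki)//; last by move=> y /DkQ[].
apply: surfkE => //; first exact: measurable_graph.
by move=> _ [y /DkQ[_ cy] <-].
Qed.

End chart.

(** For the upper bound, the area of an admissible family is the [surf] mass of a disjoint union
    contained in Bs. For the lower bound, the traces of Bs on the pieces of the covering are
    themselves admissible. *)
Lemma surface_tot a (S Bs : set B) : consistent a ->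
  S = [set x | Omega x /\ psi x = a] -> S `<=` regular_set Omega psi ->
  measurable Bs -> Bs `<=` S -> surface_measure S Bs = surf a Bs.
Proof.
move=> ca SE Sr mBs BsS.
have Sa x : S x -> psi x = a by rewrite SE => -[].
apply/eqP; rewrite eq_le; apply/andP; split.
  apply: ge_ereal_sup => _ [m [i [ O [D [g [hch mD GB tG ->]]]]]].
  have mG k : measurable (graph (i k) (g k) (D k) : set B).
    by apply: (measurable_graph (hch k)); case: (mD k).
  rewrite (eq_bigr (fun k => surf a (graph (i k) (g k) (D k)))); last first.
    move=> k _; have [? ?] := mD k; exact: (chart_area ca Sr Sa (hch k)).
  rewrite -measure_semi_additive_ord//; last by apply: bigsetU_measurable.
  apply: le_measure; rewrite ?inE//; first exact: bigsetU_measurable.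
  by rewrite -bigcup_seq => x [k _]; exact: GB.
have mBp k : measurable (Bs `&` piece k) by apply: measurableI => //; exact: measurable_piece.
have -> : Bs = \bigcup_k (Bs `&` piece k).
  by rewrite -setI_bigcupr bigcup_piece setIidl//; exact: subset_trans Sr.
rewrite measure_bigcup//; last first.
  move=> j k _ _ [x [[_ Qj] [_ Qk]]].
  by apply: (@trivIset_seqDU _ (fun k => cyl k)) => //; exists x.
rewrite -setI_bigcupr bigcup_piece setIidl//; last exact: subset_trans Sr.
(* Definition by finite families: the first m pieces already form one, and the series is the limit
   of their total areas. *)
apply: lime_le; first by apply: is_cvg_nneseries => k _ _; exact: measure_ge0.
apply: nearW => m; rewrite big_mkord; apply: ereal_sup_ubound.
pose D (k : 'I_m) : set (rVborel R n) := gd k a `&` gm k a @^-1` (Bs `&` piece k).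
have GD (k : 'I_m) : graph (ii k) (gf k a) (D k) = Bs `&` piece k.
  apply/seteqP; split=> [_ [y [yd yB] <-]|x [Bx px]]; first by rewrite -(gmE yd).
  have xa := Sa _ (BsS _ Bx); have [] := cyl_gd (piece_cyl px); rewrite xa => dx gx.
  exists (col' (ii k) x); last by rewrite gx insert_col'.
  by split=> //=; rewrite (gmE dx) gx insert_col'.
have och (k : 'I_m) : chart S (ii k) (gd k a) (gf k a).
  split.
  - exact: (gdom_open oO (sC k) (@kvalid k)).
  - exact: (gfun_isC1 oO (sC k) (@kvalid k)).
  - by move=> _ [y yd <-]; have [cy py] := gd_cyl yd; rewrite SE; split=> //; exact: cyl_sub cy.
have mD (k : 'I_m) : measurable (D k).
  apply: measurableI; first by apply: open_measurable_rV; case: (och k).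
  rewrite -[X in measurable X]setTI.
  by apply: (measurable_gam1 oO (sC k) (@kvalid k)).
exists m, (fun k : 'I_m => ii k), (fun k : 'I_m => gd k a), D, (fun k : 'I_m => gf k a); split=> //.
- by move=> k; split=> // y [].
- by move=> k; rewrite GD => x [].
- move=> j k _ _ [x]; rewrite !GD => -[[_ Qj] [_ Qk]]; apply/val_inj.
  by apply: (@trivIset_seqDU _ (fun k => cyl k)) => //; exists x.
rewrite (eq_bigl xpredT) => [|k]; last by rewrite in_setT.
apply: eq_bigr => k _; rewrite (chart_area ca Sr Sa (och k) (mD k)) ?GD//; by move=> y [].
Qed.

End total_slice.

(** The interface of the measures dsigma / |grad psi| that hides the covering by cylinders. The
    coarea formula sees regular points only, and the link with the surface measure is asked for
    almost every level, with the null set chosen before S and C. *)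
Record level_measures {R : realType} {n : nat} (Omega : set 'rV[R]_n.+1)
    (psi : 'rV[R]_n.+1 -> R) (tau : R -> {measure set (rVborel R n.+1) -> \bar R}) := {
  level_measurable : forall h : rVborel R n.+1 -> \bar R, nnmeas h ->
    measurable_fun setT (fun a : measurableTypeR R => \int[tau a]_x h x)%E;
  level_coarea : forall h : rVborel R n.+1 -> \bar R, nnmeas h ->
    (\int[lebesgue_measure]_a \int[tau a]_x h x =
     \int[leb n.+1]_(x in regular_set Omega psi) h x)%E;
  level_concentrated : forall a (h h' : rVborel R n.+1 -> \bar R), nnmeas h -> nnmeas h' ->
    (forall x, regular_set Omega psi x -> psi x = a -> h x = h' x) ->
    (\int[tau a]_x h x = \int[tau a]_x h' x)%E;
  level_surface : {ae @lebesgue_measure R, forall a, forall S C : set (rVborel R n.+1),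
    S = [set x | Omega x /\ psi x = a] -> S `<=` regular_set Omega psi ->
    measurable C -> C `<=` S ->
    (surface_measure S C = \int[tau a]_(x in C) (enorm (grad psi x))%:E)%E} }.

Lemma ex_level_measures {R : realType} {n : nat} (Omega : set 'rV[R]_n.+1)
    (psi : 'rV[R]_n.+1 -> R) : open Omega -> isC1 Omega psi ->
  exists tau, level_measures Omega psi tau.
Proof.
move=> oO psiC1; have [kappa [kvalid kcover]] := ex_fboxes oO psiC1.
exists (tot oO psiC1 kvalid); split.
- exact: measurable_tot.
- exact: coarea_tot.
- exact: eq_integral_tot.
have FF := @ae_filter_ringOfSetsType _ (measurableTypeR R) R (@lebesgue_measure R).
apply: (@filterS _ _ FF _ _ _ (ae_consistent oO psiC1 kvalid kcover)) => a ca S C SE Sr mC CS.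
rewrite (surface_tot kcover ca SE Sr mC CS) densE; apply: eq_integral => x; rewrite inE => Cx.
have [Ox _] := Sr _ (CS _ Cx).
by rewrite /= /gradO patchE mem_set.
Qed.

(** * Analytic functions are smooth *)

Section smooth.
Context {R : realType} {n : nat}.
Implicit Types (U : set 'rV[R]_n) (f : 'rV[R]_n -> R).

(** Infinite differentiability encoded by membership in a class of C^1 functions stable under
    partial derivatives on U; no order of differentiation has to be counted. *)
Definition deriv_closed U (S : set ('rV[R]_n -> R)) := forall h, S h ->
  isC1 U h /\ forall i, exists2 h', S h' & forall x, U x -> partial i h x = h' x.

Definition smooth_on U f := exists2 S, S f & deriv_closed U S.

End smooth.

Section cube_sums.
Context {R : realType} {n : nat}.
Implicit Types t : {ffun 'I_n -> nat} -> R.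

Definition cube_sum N t : R := \sum_(a : {ffun 'I_n -> 'I_N}) t [ffun i => a i : nat].

(** The smaller cube of exponents embeds into the larger one, and the remaining terms are
    nonnegative. *)
Lemma cube_sum_le N M t : (forall e, 0 <= t e) -> (N <= M)%N -> cube_sum N t <= cube_sum M t.
Proof.
move=> t0 NM; pose w (a : {ffun 'I_n -> 'I_N}) : {ffun 'I_n -> 'I_M} :=
  [ffun i => widen_ord NM (a i)].
have wI : injective w.
  move=> a b /ffunP ab; apply/ffunP => i; have := ab i; rewrite !ffunE => /(congr1 val) /=.
  exact: val_inj.
rewrite /cube_sum (eq_bigr (fun a => t [ffun i => w a i : nat])); last first.
  by move=> a _; congr t; apply/ffunP => i; rewrite !ffunE.
rewrite -(big_imset (fun b : {ffun 'I_n -> 'I_M} => t [ffun i => b i : nat]))/=; last by move=> a b _ _; exact: wI.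
rewrite [leRHS](bigID (fun b => b \in [set w x | x in xpredT]%SET))/= lerDl.
by apply: sumr_ge0.
Qed.

Lemma cube_sumD N t u : cube_sum N (fun e => t e + u e) = cube_sum N t + cube_sum N u.
Proof. exact: big_split. Qed.

Lemma cube_sumZ N k t : cube_sum N (fun e => k * t e) = k * cube_sum N t.
Proof. by rewrite /cube_sum -big_distrr. Qed.

Lemma cube_sum_mono N t u : (forall e, t e <= u e) -> cube_sum N t <= cube_sum N u.
Proof. by move=> tu; apply: ler_sum. Qed.

Lemma cube_sum_norm N t : `|cube_sum N t| <= cube_sum N (fun e => `|t e|).
Proof. exact: ler_norm_sum. Qed.

Lemma cube_sum_cvg t K : (forall N, cube_sum N (fun e => `|t e|) <= K) ->
  cvgn (fun N => cube_sum N t).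
Proof.
move=> tK.
have nonneg u : (forall e, 0 <= u e) -> (forall e, u e <= `|t e|) -> cvgn (fun N => cube_sum N u).
  move=> u0 ut; apply: nondecreasing_is_cvgn.
    by move=> N M NM; exact: cube_sum_le.
  exists K => _ [N _ <-]; apply: le_trans (tK N); exact: cube_sum_mono.
have -> : (fun N => cube_sum N t) = (fun N => cube_sum N (fun e => Num.max (t e) 0)) \-
    (fun N => cube_sum N (fun e => Num.max (- t e) 0)).
  apply/funext => N /=; rewrite -mulN1r -cube_sumZ -cube_sumD; apply: eq_bigr => e _.
  set x := t _; rewrite mulN1r; have [x0|x0] := leP x 0.
    by rewrite max_l ?oppr_ge0// opprK add0r.
  by rewrite max_r ?oppr_le0 ?ltW// subr0.
apply: is_cvgB; apply: nonneg => e; rewrite ?le_max ?lexx ?orbT// ge_max normr_ge0 andbT.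
  exact: ler_norm.
by rewrite -normrN ler_norm.
Qed.

Lemma limn_norm_le (u : R^nat) B : cvgn u -> (forall N, `|u N| <= B) -> `|limn u| <= B.
Proof.
move=> cu uB; rewrite -(cvg_lim _ (cvg_norm cu))//.
by apply: limr_le; [apply: is_cvg_norm|exact: nearW].
Qed.

End cube_sums.

Section monomials.
Context {R : realType}.

(** The b-th derivative of t^k. *)
Definition dmono (b k : nat) (t : R) : R := (k ^_ b)%:R * t ^+ (k - b).

Lemma is_derive_dmono b k (t : R) : is_derive t (1 : R) (dmono b k) (dmono b.+1 k t).
Proof.
have H : is_derive t (1 : R) ((k ^_ b)%:R *: (fun t : R => t) ^+ (k - b))
    ((k ^_ b)%:R *: ((k - b)%:R * t ^+ (k - b).-1 *: (1 : R))).
  by apply: is_deriveZ.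
have -> : dmono b k = (k ^_ b)%:R *: (fun t : R => t) ^+ (k - b).
  by apply/funext => x; rewrite /dmono /= exprfctE.
apply: is_derive_eq H _; rewrite /dmono ffactnSr natrM -subnS -mulrA.
by rewrite [_ *: 1]mulr1.
Qed.

Lemma mvt_between (g dg : R -> R) (x y : R) :
  (forall s, is_derive s (1 : R) g (dg s)) ->
  exists2 s, Num.min x y <= s <= Num.max x y & g y - g x = dg s * (y - x).
Proof.
move=> gd; have gc z : {for z, continuous g} := is_derive_continuous (gd z).
wlog xy : x y / x <= y.
  move=> H; have [xy|yx] := leP x y; first by have [s] := H _ _ xy; rewrite min_l// max_r//; exists s.
  have [s] := H _ _ (ltW yx); rewrite (min_l (ltW yx)) (max_r (ltW yx)) => sb e; exists s => //.
  by rewrite -[LHS]opprB e -mulrN opprB.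
have [s|s sb e] := @MVT_segment R g dg x y xy (fun s _ => gd s).
  by apply: continuous_subspaceT => z; exact: gc.
by exists s => //; move: sb; rewrite in_itv/= min_l// max_r.
Qed.

Lemma between_norm (x y s s0 : R) : Num.min x y <= s <= Num.max x y ->
  `|x| <= s0 -> `|y| <= s0 -> `|s| <= s0.
Proof.
rewrite !ler_norml => /andP[h1 h2] /andP[x1 x2] /andP[y1 y2]; apply/andP; split.
  by apply: le_trans h1; rewrite le_min x1.
by apply: (le_trans h2); rewrite ge_max x2.
Qed.

Lemma between_dist (x y s : R) : Num.min x y <= s <= Num.max x y -> `|s - x| <= `|y - x|.
Proof.
have [xy|xy] := leP x y => /andP[h1 h2].
  by rewrite !ger0_norm ?subr_ge0// lerD2r.
by rewrite !ler0_norm ?subr_le0 ?(ltW xy)// lerN2 lerD2r.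
Qed.

(** Two applications of the mean value theorem; the constant is M rather than M / 2, and only the
    quadratic order in s matters. *)
Lemma taylor2 (g g1 g2 : R -> R) (s0 M t s : R) :
  (forall u, is_derive u (1 : R) g (g1 u)) -> (forall u, is_derive u (1 : R) g1 (g2 u)) ->
  (forall u, `|u| <= s0 -> `|g2 u| <= M) -> `|t| <= s0 -> `|t + s| <= s0 ->
  `|g (t + s) - g t - s * g1 t| <= s ^+ 2 * M.
Proof.
move=> dg dg1 g2M ts0 tss0.
have [u ub ->] := mvt_between t (t + s) dg.
have [v vb] := mvt_between t u dg1.
have us : `|u - t| <= `|s| by have := between_dist ub; rewrite [t + s]addrC addrK.
have -> : t + s - t = s by ring.
rewrite [g1 u * s]mulrC -mulrBr => ->.
rewrite -[s ^+ 2]real_normK ?num_real// !normrM expr2 -mulrA ler_wpM2l//.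
have M0 : 0 <= M by apply: le_trans (g2M t ts0).
rewrite mulrC ler_pM//.
exact: (g2M _ (between_norm vb ts0 (between_norm ub ts0 tss0))).
Qed.

(** The falling factorial is binom(k, b) b!, and binom(k, b) s^(k-b) d^b is a single term of the
    expansion of (s + d)^k. A derivative thus costs a constant and an enlargement of the radius by
    d. *)
Lemma dmono_bound b k (s d t : R) : 0 <= s -> 0 < d -> `|t| <= s ->
  `|dmono b k t| <= (b`!%:R / d ^+ b) * (s + d) ^+ k.
Proof.
move=> s0 d0 ts; have [kb|bk] := ltnP k b.
  rewrite /dmono ffact_small// mul0r normr0 mulr_ge0// ?exprn_ge0 ?addr_ge0 ?(ltW d0)//.
  by rewrite divr_ge0// exprn_ge0// ltW.
rewrite /dmono normrM ger0_norm// -bin_ffact mulnC natrM -!mulrA ler_wpM2l//.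
rewrite [leRHS]mulrC ler_pdivlMr ?exprn_gt0//.
rewrite exprDn (bigD1 (Ordinal (bk : b < k.+1)%N))//= -[leLHS]addr0 lerD//; last first.
  by apply: sumr_ge0 => i _; rewrite mulrn_wge0// mulr_ge0// exprn_ge0// ltW.
rewrite -[leRHS]mulr_natr [leRHS]mulrC -mulrA ler_wpM2l// ler_wpM2r ?exprn_ge0 ?(ltW d0)//.
by rewrite normrX lerXn2r// nnegrE.
Qed.

End monomials.
Section analytic_smooth.
Context {R : realType} {n : nat}.
Variables (c : {ffun 'I_n -> nat} -> R) (x : 'rV[R]_n) (d K : R).
Hypothesis d0 : 0 < d.
Hypothesis cK : forall N, cube_sum N (fun e => `|c e| * \prod_i (d + d) ^+ e i) <= K.
Implicit Types (b e : {ffun 'I_n -> nat}) (y : 'rV[R]_n).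

Let B := ball x d.

(** The term of multi-exponent e of the power series at x, differentiated b i times in the i-th
    variable. Summability is assumed at the radius 2d and used on the ball of radius d. *)
Definition psterm b y e : R := c e * \prod_i dmono (b i) (e i) (y ord0 i - x ord0 i).
Definition psum b y : R := limn (fun N => cube_sum N (psterm b y)).
Definition psC b : R := \prod_i ((b i)`!%:R / d ^+ b i).

Lemma psC_ge0 b : 0 <= psC b.
Proof. by apply: prodr_ge0 => i _; rewrite divr_ge0// exprn_ge0// ltW. Qed.

Lemma ball_coord y i : B y -> `|y ord0 i - x ord0 i| <= d.
Proof.
rewrite /B -ball_normE /= => /ltW; apply: le_trans; rewrite distrC.
by have := coord_le_norm (x - y) i; rewrite !mxE.
Qed.

Lemma psterm_bound b y e : B y ->
  `|psterm b y e| <= psC b * (`|c e| * \prod_i (d + d) ^+ e i).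
Proof.
move=> By; rewrite /psterm normrM mulrCA ler_wpM2l// /psC normr_prod -big_split /=.
apply: ler_prod => i _; rewrite normr_ge0 /=; apply: dmono_bound => //; first exact: ltW.
exact: ball_coord.
Qed.

Lemma cube_sum_psC (C : R) (t : {ffun 'I_n -> nat} -> R) N : 0 <= C ->
  (forall e, `|t e| <= C * (`|c e| * \prod_i (d + d) ^+ e i)) ->
  cube_sum N (fun e => `|t e|) <= C * K.
Proof.
move=> C0 h; apply: (le_trans (cube_sum_mono N h)).
by rewrite cube_sumZ ler_wpM2l.
Qed.

Lemma psum_cvg b y : B y -> cvgn (fun N => cube_sum N (psterm b y)).
Proof.
move=> By; apply: (cube_sum_cvg (K := psC b * K)) => N.
by apply: cube_sum_psC; [exact: psC_ge0|move=> e; exact: psterm_bound].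
Qed.

Lemma psum_bound b y : B y -> `|psum b y| <= psC b * K.
Proof.
move=> By; apply: limn_norm_le; first exact: psum_cvg.
move=> N; apply: (le_trans (cube_sum_norm _ _)).
by apply: cube_sum_psC; [exact: psC_ge0|move=> e; exact: psterm_bound].
Qed.

Definition incr b (i : 'I_n) : {ffun 'I_n -> nat} := [ffun k => (b k + (k == i))%N].

Lemma psterm_taylor b i y s e : B y -> B (s *: delta_mx 0 i + y) ->
  `|psterm b (s *: delta_mx 0 i + y) e - psterm b y e - s * psterm (incr b i) y e| <=
  s ^+ 2 * psC (incr (incr b i) i) * (`|c e| * \prod_i (d + d) ^+ e i).
Proof.
move=> By Bys; rewrite /psterm /psC.
set v := s *: _ + y.
have vi : v ord0 i - x ord0 i = (y ord0 i - x ord0 i) + s.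
  by rewrite !mxE !eqxx mulr1; ring.
have vk k : k != i -> v ord0 k - x ord0 k = y ord0 k - x ord0 k.
  by move=> ki; rewrite !mxE (negbTE ki) andbF mulr0 add0r.
rewrite (bigD1 i)//= [X in _ - c e * X - _](bigD1 i)//= [X in s * (c e * X)](bigD1 i)//=.
rewrite [X in _ <= s ^+ 2 * X * _](bigD1 i)//= [X in _ <= _ * (_ * X)](bigD1 i)//=.
under eq_bigr => k ki do rewrite (vk k ki).
under [X in s * (c e * (_ * X))]eq_bigr => k ki do rewrite ffunE (negbTE ki) addn0.
under [X in s ^+ 2 * (_ * X)]eq_bigr => k ki do rewrite !ffunE (negbTE ki) !addn0.
rewrite !ffunE eqxx !addn1 vi; set t := y ord0 i - x ord0 i.
set P := \prod_(_ < _ | _) dmono _ _ _; set Q := \prod_(_ < _ | _) (_ / _).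
set D := \prod_(_ < _ | _) (d + d) ^+ _.
have PQD : `|P| <= Q * D.
  rewrite /P /Q /D normr_prod -big_split /=; apply: ler_prod => k _; rewrite normr_ge0 /=.
  by apply: dmono_bound => //; [exact: ltW|exact: ball_coord].
have T := @taylor2 R (dmono (b i) (e i)) _ _ d
  (((b i).+2)`!%:R / d ^+ (b i).+2 * (d + d) ^+ e i) t s
  (is_derive_dmono (b i) (e i)) (is_derive_dmono (b i).+1 (e i)).
have {}T := T (fun u ud => dmono_bound _ _ (ltW d0) d0 ud) (ball_coord i By).
have {}T : `|dmono (b i) (e i) (t + s) - dmono (b i) (e i) t - s * dmono (b i).+1 (e i) t| <=
    s ^+ 2 * (((b i).+2)`!%:R / d ^+ (b i).+2 * (d + d) ^+ e i).
  by apply: T; rewrite -vi; exact: ball_coord.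
have -> : c e * (dmono (b i) (e i) (t + s) * P) - c e * (dmono (b i) (e i) t * P) -
    s * (c e * (dmono (b i).+1 (e i) t * P)) =
    c e * ((dmono (b i) (e i) (t + s) - dmono (b i) (e i) t - s * dmono (b i).+1 (e i) t) * P).
  by ring.
rewrite !normrM; apply: (@le_trans _ _ (`|c e| *
  (s ^+ 2 * (((b i).+2)`!%:R / d ^+ (b i).+2 * (d + d) ^+ e i) * (Q * D)))).
  by rewrite ler_wpM2l// ler_pM.
rewrite [leLHS](_ : _ = s ^+ 2 * (((b i).+2)`!%:R / d ^+ (b i).+2 * Q) *
  (`|c e| * ((d + d) ^+ e i * D)))//; ring.
Qed.

(** Each term satisfies the second-order estimate with an error dominated by the convergent series
    at radius 2d, so the errors sum to a multiple of s^2. This is what allows differentiation term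
    by term. *)
Lemma psum_taylor b i y s : B y -> B (s *: delta_mx 0 i + y) ->
  `|psum b (s *: delta_mx 0 i + y) - psum b y - s * psum (incr b i) y| <=
  s ^+ 2 * (psC (incr (incr b i) i) * K).
Proof.
move=> By Bys; rewrite /psum.
have c1 := psum_cvg (b := b) Bys; have c2 := psum_cvg (b := b) By; have c3 := psum_cvg (b := incr b i) By.
have -> : limn (fun N => cube_sum N (psterm b (s *: delta_mx 0 i + y))) -
    limn (fun N => cube_sum N (psterm b y)) -
    s * limn (fun N => cube_sum N (psterm (incr b i) y)) =
    limn (fun N => cube_sum N (fun e => psterm b (s *: delta_mx 0 i + y) e - psterm b y e -
      s * psterm (incr b i) y e)).
  apply/esym/cvg_lim => //.
  have -> : (fun N => cube_sum N (fun e => psterm b (s *: delta_mx 0 i + y) e - psterm b y e -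
      s * psterm (incr b i) y e)) =
    (fun N => cube_sum N (psterm b (s *: delta_mx 0 i + y)) - cube_sum N (psterm b y) -
      s * cube_sum N (psterm (incr b i) y)).
    by apply/funext => N; rewrite -cube_sumZ /cube_sum -!sumrB.
  by apply: cvgB; [apply: cvgB|apply: cvgM => //; exact: cvg_cst].
apply: limn_norm_le.
  apply: (cube_sum_cvg (K := s ^+ 2 * psC (incr (incr b i) i) * K)) => N.
  apply: cube_sum_psC => [|e]; first by rewrite mulr_ge0 ?sqr_ge0 ?psC_ge0.
  exact: psterm_taylor.
move=> N; apply: (le_trans (cube_sum_norm _ _)); rewrite mulrA.
apply: cube_sum_psC => [|e]; first by rewrite mulr_ge0 ?sqr_ge0 ?psC_ge0.
exact: psterm_taylor.
Qed.

Lemma is_derive_psum b i y : B y -> is_derive y (delta_mx 0 i) (psum b) (psum (incr b i) y).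
Proof.
move=> By; set C := psC (incr (incr b i) i) * K.
suff H : h^-1 *: (psum b (h *: delta_mx 0 i + y) - psum b y) @[h --> 0^'] --> psum (incr b i) y.
  by split; [apply/cvg_ex; eexists; exact: H|exact: cvg_lim H].
apply/cvgrPdist_le => eps eps0.
have nB : \forall h \near 0^', B (h *: delta_mx 0 i + y).
  have : (h *: delta_mx 0 i + y) @[h --> (0 : R)] --> y.
    rewrite -[X in _ --> X]add0r -[X in X + y](scale0r (delta_mx 0 i)).
    by apply: cvgD; [apply: cvgZr_tmp; exact: cvg_id|exact: cvg_cst].
  move=> /(_ B) H; have : \forall h \near (0 : R), B (h *: delta_mx 0 i + y).
    by apply: H; apply: open_nbhs_nbhs; split=> //; exact: ball_open.
  exact: nbhs_dnbhs.
have C0 : 0 < `|C| + 1 by rewrite ltr_wpDl.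
have nE : \forall h \near (0 : R)^', `|h| * (`|C| + 1) <= eps.
  near=> h; rewrite -ler_pdivlMr//; near: h; apply: dnbhs0_le; exact: divr_gt0.
have nN : \forall h \near (0 : R)^', h != 0 by exact: nbhs_dnbhs_neq.
near=> h.
have h0 : h != 0 by near: h.
have := @psum_taylor b i y h By; rewrite -/C => /(_ _) T.
rewrite distrC -[X in _ - X](mulKf h0) -mulrBr normrM.
rewrite normfV mulrC ler_pdivrMr ?normr_gt0//.
apply: (le_trans (T _)); first by near: h.
apply: (@le_trans _ _ (`|h| * (`|C| + 1) * `|h|)).
  have -> : `|h| * (`|C| + 1) * `|h| = `|h| ^+ 2 * (`|C| + 1) by ring.
  rewrite real_normK ?num_real// ler_wpM2l ?sqr_ge0//.
  by rewrite (le_trans (ler_norm _))// lerDl.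
by rewrite ler_wpM2r//; near: h.
Unshelve. all: by end_near. Qed.

Lemma psum_continuous b y : B y -> {for y, continuous (psum b)}.
Proof.
move=> By; have oB : open B by exact: ball_open.
have /nbhs_ballP[r /= r0 rB] : nbhs y B by exact: open_nbhs_nbhs.
pose C := \sum_i psC (incr b i) * `|K| + 1.
have C0 : 0 < C.
  by rewrite ltr_wpDl//; apply: sumr_ge0 => i _; rewrite mulr_ge0 ?psC_ge0.
apply/(@cvgrPdist_le _ _ _ _ (nbhs_filter y)) => eps eps0.
have e1 : 0 < Num.min r (eps / C) by rewrite lt_min r0 divr_gt0.
apply: (@filterS _ _ (nbhs_filter y) _ _ _ (@nbhsx_ballx _ _ y _ e1)) => z.
rewrite -ball_normE /= lt_min => /andP[zr ze].
have hB u : hull y z u -> B u.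
  move=> hu; apply: rB; rewrite -ball_normE /= distrC.
  by rewrite (le_lt_trans (hull_dist hu))// distrC.
have [u hu i|xi [hxi E]] := @mvt_rV R n (psum b) y z.
  by have [] := is_derive_psum b i (hB _ hu).
rewrite distrC E; apply: (le_trans (ler_norm_sum _ _ _)).
apply: (@le_trans _ _ (C * `|y - z|)); last first.
  by rewrite mulrC -ler_pdivlMr// ltW.
rewrite /C mulrDl mul1r big_distrl /= -[leLHS]addr0 lerD//; apply: ler_sum => i _.
rewrite normrM ler_pM//.
  have [_] := is_derive_psum b i (hB _ (hxi i)); rewrite /partial => ->.
  apply: (le_trans (psum_bound _ (hB _ (hxi i)))).
  by rewrite ler_wpM2l ?psC_ge0// ler_norm.
by rewrite distrC; have := coord_le_norm (y - z) i; rewrite !mxE.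
Qed.

Lemma psum_closed : deriv_closed B (fun h => exists b, h = psum b).
Proof.
move=> _ [b ->]; split; last first.
  move=> i; exists (psum (incr b i)); first by exists (incr b i).
  by move=> y /(is_derive_psum b i)[_].
move=> i y By; have [dy _] := is_derive_psum b i By; split=> //.
have FF := nbhs_filter y; rewrite /prop_for /continuous_at.
have -> : partial i (psum b) y = psum (incr b i) y by have [_] := is_derive_psum b i By.
have S := psum_continuous (b := incr b i) By; apply: cvg_trans S.
apply: (@near_eq_cvg _ _ _ FF); have : nbhs y B.
  by apply: open_nbhs_nbhs; split=> //; exact: ball_open.
by apply: filterS => z /(is_derive_psum b i)[_].
Qed.

End analytic_smooth.

Lemma smooth_on_eq {R : realType} {n} (U : set 'rV[R]_n) (f g : 'rV[R]_n -> R) : open U ->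
  (forall x, U x -> f x = g x) -> smooth_on U f -> smooth_on U g.
Proof.
move=> oU fg [S Sf cS]; exists (fun h => exists2 h', S h' & forall x, U x -> h' x = h x).
  by exists f.
move=> h [h' Sh' hh']; have [h'C ch'] := cS _ Sh'.
have near x : U x -> \forall y \near x, h' y = h y.
  move=> Ux; have : nbhs x U by exact: open_nbhs_nbhs.
  exact: filterS.
have pE i x : U x -> partial i h x = partial i h' x.
  by move=> Ux; apply/esym; apply: near_eq_derive; exact: near.
split=> [i x Ux|i]; last first.
  have [k Sk kE] := ch' i; exists k; first by exists k.
  by move=> x Ux; rewrite pE// kE.
have [dx cx] := h'C i x Ux; split.
  by apply: near_eq_derivable dx; exact: near.
have FF := nbhs_filter x; rewrite /prop_for /continuous_at (pE _ _ Ux); apply: cvg_trans cx.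
apply: (@near_eq_cvg _ _ _ FF); have : nbhs x U by exact: open_nbhs_nbhs.
by apply: filterS => y Uy; rewrite pE.
Qed.

Lemma analytic_smooth {R : realType} {n} (f : 'rV[R]_n -> R) x : analytic_at f x ->
  exists2 d : R, 0 < d & smooth_on (ball x d) f.
Proof.
(* With a third of the radius, the vector with all coordinates 2d still has norm less than r;
   absolute convergence there provides the bound K. *)
move=> [c [r [r0 H]]]; pose d := r / 3; have d0 : 0 < d by rewrite divr_gt0.
exists d => //.
have norm_lt : `|const_mx (d + d) : 'rV[R]_n| < r.
  apply: (@le_lt_trans _ _ (d + d)); last by rewrite /d; lra.
  rewrite [leLHS]mx_normrE; apply/bigmax_leP; split=> /=; first by rewrite addr_ge0 ?ltW.
  by move=> [i j] _ /=; rewrite mxE ger0_norm// addr_ge0// ltW.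
have [[K HK] _] := H _ norm_lt.
have cK N : cube_sum N (fun e => `|c e| * \prod_i (d + d) ^+ e i) <= K.
  apply: le_trans (HK N); apply: ler_sum => a _.
  rewrite normrM ler_wpM2l// normr_prod; rewrite le_eqVlt; apply/orP; left; apply/eqP; apply: eq_bigr => i _.
  by rewrite ffunE mxE normrX ger0_norm// addr_ge0// ltW.
pose b0 : {ffun 'I_n -> nat} := [ffun=> 0%N].
apply: (@smooth_on_eq _ _ _ (psum c x b0)).
- exact: ball_open.
- move=> y By; have yr : `|y - x| < r.
    move: By; rewrite -ball_normE /= distrC => /lt_trans; apply; rewrite /d; lra.
  have [_ S] := H _ yr; have xy : x + (y - x) = y by rewrite addrC subrK.
  rewrite xy in S; apply/cvg_lim => //.
  apply: cvg_trans S; apply: near_eq_cvg; apply: nearW => N.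
  apply: eq_bigr => a _; rewrite /psterm; congr (_ * _); apply: eq_bigr => i _.
  by rewrite /dmono !ffunE ffactn0 mul1r subn0 !mxE.
- exists (fun h => exists b, h = psum c x b); first by exists b0.
  exact: (psum_closed d0 cK).
Qed.

(** * Sard's theorem for functions in a class closed under derivatives *)

Section smooth_algebra.
Context {R : realType} {n : nat}.
Implicit Types (U : set 'rV[R]_n) (f g h : 'rV[R]_n -> R).

Lemma isC1_intro U h (k : 'I_n -> 'rV[R]_n -> R) : open U ->
  (forall i x, U x -> is_derive x (delta_mx 0 i) h (k i x)) ->
  (forall i x, U x -> {for x, continuous (k i)}) ->
  isC1 U h /\ forall i x, U x -> partial i h x = k i x.
Proof.
move=> oU hk kc; have E i x : U x -> partial i h x = k i x.
  by move=> /(hk i)[_].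
split=> // i x Ux; split; first by have [] := hk i x Ux.
have FF := nbhs_filter x; rewrite /prop_for /continuous_at (E _ _ Ux).
apply: cvg_trans (kc i x Ux); apply: (@near_eq_cvg _ _ _ FF).
have : nbhs x U by exact: open_nbhs_nbhs.
by apply: filterS => y Uy; rewrite E.
Qed.

Lemma isC1_is_derive U h i x : isC1 U h -> U x ->
  is_derive x (delta_mx 0 i) h (partial i h x).
Proof. by move=> hU Ux; have [dh _] := hU i x Ux; apply: DeriveDef. Qed.

Variable (S : set ('rV[R]_n -> R)) (v : 'rV[R]_n -> R).

(** The algebra generated by S and v = 1 / u. It is stable under derivatives because the derivative
    of 1 / u is - u' v^2. It contains the derivatives of implicit functions, which are quotients
    with denominator u. *)
Inductive gen_alg : ('rV[R]_n -> R) -> Prop :=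
| gen_base f : S f -> gen_alg f
| gen_inv : gen_alg v
| gen_add f g : gen_alg f -> gen_alg g -> gen_alg (f \+ g)
| gen_mul f g : gen_alg f -> gen_alg g -> gen_alg (f \* g)
| gen_opp f : gen_alg f -> gen_alg (fun x => - f x).

Variables (U U' : set 'rV[R]_n) (u : 'rV[R]_n -> R).
Hypotheses (oU : open U) (oU' : open U') (U'U : U' `<=` U) (cS : deriv_closed U S)
  (Su : S u) (u0 : forall x, U' x -> u x != 0) (vE : v = fun x => (u x)^-1).

Let base_cont f : S f -> forall x, U' x -> {for x, continuous f}.
Proof.
move=> /cS [fC _] x /U'U; exact: isC1_continuous oU fC.
Qed.

Lemma gen_cont f : gen_alg f -> forall x, U' x -> {for x, continuous f}.
Proof.
elim=> {f}[f Sf|x Ux|f g _ IHf _ IHg x Ux|f g _ IHf _ IHg x Ux|f _ IHf x Ux].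
- exact: base_cont.
- rewrite vE; apply: (@cvgV _ _ _ (nbhs_filter x)); first exact: u0.
  exact: base_cont.
- by apply: (@cvgD _ _ _ _ (nbhs_filter x)); [exact: IHf|exact: IHg].
- by apply: (@cvgM _ _ _ (nbhs_filter x)); [exact: IHf|exact: IHg].
- by apply: (@cvgN _ _ _ _ (nbhs_filter x)); exact: IHf.
Qed.

Lemma gen_derive f : gen_alg f -> forall i, exists2 k, gen_alg k &
  forall x, U' x -> is_derive x (delta_mx 0 i) f (k x).
Proof.
elim=> {f}[f Sf i|i|f g _ IHf _ IHg i|f g gf IHf gg IHg i|f _ IHf i].
- have [fC /(_ i)[k Sk kE]] := cS Sf; exists k; first exact: gen_base.
  by move=> x /U'U Ux; rewrite -kE//; exact: isC1_is_derive fC Ux.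
- have [uC /(_ i)[k Sk kE]] := cS Su.
  exists (fun x => - ((k \* v) \* v) x).
    by apply: gen_opp; apply: gen_mul gen_inv; apply: gen_mul gen_inv; exact: gen_base.
  move=> x U'x; have [dx ex] := isC1_is_derive i uC (U'U U'x).
  rewrite vE; split; first by apply: derivableV => //; exact: u0.
  rewrite deriveV ?u0// -[in LHS]/(partial i u x) kE; last exact: U'U.
  by rewrite /= [_ *: _]mulNr mulrC -exprVn expr2 mulrA.
- have [k gk kE] := IHf i; have [l gl lE] := IHg i.
  exists (k \+ l); first exact: gen_add.
  by move=> x U'x; apply: is_deriveD; [exact: kE|exact: lE].
- have [k gk kE] := IHf i; have [l gl lE] := IHg i.
  exists ((f \* l) \+ (g \* k)); first by apply: gen_add; exact: gen_mul.
  by move=> x U'x; apply: is_deriveM; [exact: kE|exact: lE].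
- have [k gk kE] := IHf i; exists (fun x => - k x); first exact: gen_opp.
  by move=> x U'x; apply: is_deriveN; exact: kE.
Qed.

Lemma gen_closed : deriv_closed U' gen_alg.
Proof.
move=> f gf; have /choice[k hk] : forall i, exists k, gen_alg k /\
    forall x, U' x -> is_derive x (delta_mx 0 i) f (k x).
  by move=> i; have [k ? ?] := gen_derive gf i; exists k.
have [fC fE] := @isC1_intro U' f k oU' (fun i => proj2 (hk i)) (fun i => gen_cont (proj1 (hk i))).
by split=> // i; exists (k i); [exact: (proj1 (hk i))|exact: fE].
Qed.

End smooth_algebra.

Section graph_composition.
Context {R : realType} {n : nat}.

Lemma is_derive_of_line m (F : 'rV[R]_m -> R) y v d :
  is_derive (0 : R) 1 (fun s => F (s *: v + y)) d -> is_derive y v F d.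
Proof.
move=> [dF <-].
have e : (fun h : R => h^-1 *: (((fun s => F (s *: v + y)) \o shift 0) (h *: 1) - F (0 *: v + y)))
    = (fun h => h^-1 *: ((F \o shift y) (h *: v) - F y)).
  by apply/funext => h /=; rewrite addr0 [h *: 1]mulr1 scale0r add0r.
by split; rewrite /derivable /derive; [rewrite -e|rewrite e].
Qed.

Lemma is_derive_graph i (U : set 'rV[R]_n.+1) h (g : 'rV[R]_n -> R) y j dg :
  open U -> isC1 U h -> U (insert i y (g y)) -> is_derive y (delta_mx 0 j) g dg ->
  is_derive y (delta_mx 0 j) (fun y => h (insert i y (g y)))
    (partial (lift i j) h (insert i y (g y)) + partial i h (insert i y (g y)) * dg).
Proof.
move=> oU hU Uy [gd <-]; apply: is_derive_of_line.
pose e : 'rV[R]_n := delta_mx 0 j.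
have ye : 0 *: e + y = y by rewrite scale0r add0r.
have dg' : is_derive (0 : R) 1 (fun s : R => g (s *: e + y)) (partial j g y).
  by have := @is_derive_line R n g y e 0; rewrite ye; apply.
have := @is_derive_curve R n.+1 U h (fun s => insert i (s *: e + y) (g (s *: e + y)))
  (fun k => if unlift i k is Some k' then (k' == j)%:R else partial j g y) 0 oU hU.
rewrite ye => /(_ Uy) H.
have {}H : is_derive (0 : R) 1
    (fun s => h (insert i (s *: e + y) (g (s *: e + y))))
    (\sum_k partial k h (insert i y (g y)) *
        (if unlift i k is Some k' then (k' == j)%:R else partial j g y)).
  apply: H => k; case: (unliftP i k) => [k'|] ->.
    under eq_fun do rewrite insert_lift !mxE /=.
    exact: is_derive_affine.
  by under eq_fun do rewrite insert_i.
apply: is_derive_eq H _.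
rewrite (sum_insert i) unlift_none addrC; congr (_ + _).
under eq_bigr do rewrite liftK.
rewrite (bigD1 j)//= eqxx mulr1 big1 ?addr0//.
by move=> k /negbTE ->; rewrite mulr0.
Qed.

End graph_composition.

Lemma negligible_small d (T : measurableType d) (R : realType) (mu : {measure set T -> \bar R})
    (A : set T) :
  (forall e : R, 0 < e -> exists2 C : set T, measurable C /\ A `<=` C & (mu C <= e%:E)%E) ->
  mu.-negligible A.
Proof.
move=> h; have /choice[C hC] : forall k : nat, exists C : set T,
    [/\ measurable C, A `<=` C & (mu C <= (k.+1%:R^-1)%:E)%E].
  by move=> k; have [C [? ?] ?] := h (k.+1%:R^-1) (ltac:(by rewrite invr_gt0)); exists C.
exists (\bigcap_k C k); split.
- by apply: bigcapT_measurable => k; have [] := hC k.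
- apply/eqP; rewrite eq_le measure_ge0 andbT; apply/lee_addgt0Pr => e e0.
  rewrite add0e; pose k := Num.truncn e^-1.
  have [mC _ le] := hC k; apply: (@le_trans _ _ (mu (C k))).
    by apply: le_measure; rewrite ?inE//; [apply: bigcapT_measurable => j; case: (hC j)|move=> x; apply].
  apply: (le_trans le); rewrite lee_fin -[leRHS]invrK lef_pV2 ?posrE ?invr_gt0//.
  exact/ltW/truncnS_gt.
- by move=> x Ax k _; have [_ + _] := hC k; apply.
Qed.

Lemma negligible_countable d (T : measurableType d) (R : realType)
    (mu : {measure set T -> \bar R}) (I : countType) (A : I -> set T) :
  (forall i, mu.-negligible (A i)) -> mu.-negligible (\bigcup_i A i).
Proof.
move=> h; have : mu.-negligible (\bigcup_j (if unpickle j is Some i then A i else set0)).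
  by apply: negligible_bigcup => j; case: unpickle => [i|]; [exact: h|exact: negligible_set0].
by apply: negligibleS => x [i _ Ax]; exists (pickle i) => //; rewrite pickleK.
Qed.

Section flat_points.
Context {R : realType} {n : nat}.
Variables (U : set 'rV[R]_n) (S : set ('rV[R]_n -> R)) (f : 'rV[R]_n -> R).
Hypotheses (oU : open U) (cS : deriv_closed U S) (Sf : S f).
Variable der : ('rV[R]_n -> R) * 'I_n -> 'rV[R]_n -> R.
Hypothesis derP : forall h i, S h -> S (der (h, i)) /\
  forall x, U x -> partial i h x = der (h, i) x.

Definition dword (s : seq 'I_n) : 'rV[R]_n -> R := foldr (fun i h => der (h, i)) f s.

Lemma dword_S s : S (dword s).
Proof. by elim: s => //= i s IH; have [] := derP i IH. Qed.

Lemma dword_partial s i x : U x -> partial i (dword s) x = dword (i :: s) x.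
Proof. by move=> Ux; have [_ ->] := derP i (dword_S s). Qed.

(** Points where all derivatives of positive order vanish; a word of indices codes an iterated
    partial derivative. *)
Definition flat : set 'rV[R]_n := [set x | forall s, s != [::] -> dword s x = 0].

Lemma compact_cbox (a b : 'rV[R]_n) : compact (cbox a b).
Proof.
have -> : cbox a b = [set v | forall i, `[a ord0 i, b ord0 i]%classic (v ord0 i)].
  by apply/seteqP; split=> x h i; have := h i; rewrite /= in_itv.
exact: (@rV_compact R n (fun i => `[a ord0 i, b ord0 i]%classic) (fun i => @segment_compact R _ _)).
Qed.

Lemma dword_bound (a b : 'rV[R]_n) s : cbox a b `<=` U ->
  exists2 M, 0 <= M & forall x, cbox a b x -> `|dword s x| <= M.
Proof.
move=> QU; have [sC _] := cS (dword_S s).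
have : compact (dword s @` cbox a b).
  apply: continuous_compact (@compact_cbox a b).
  by apply: continuous_in_subspaceT => x; rewrite inE => /QU; exact: isC1_continuous oU sC.
move=> /compact_bounded [M [_ HM]]; exists (`|M| + 1); first by rewrite addr_ge0.
move=> x Qx; apply: (HM (`|M| + 1)); last by exists x.
by rewrite (le_lt_trans (ler_norm _))// ltrDl.
Qed.

(** Induction on the number m of orders left below K + 1. The derivatives of top order are bounded
    by M, and each use of the mean value formula gains a factor n |y - x|, the derivatives at the
    flat point x being 0. *)
Lemma flat_estimate (a b : 'rV[R]_n) K M x : cbox a b `<=` U -> cbox a b x -> flat x -> 0 <= M ->
  (forall s, size s = K.+1 -> forall y, cbox a b y -> `|dword s y| <= M) ->
  forall m s, (size s + m)%N = K.+1 -> forall y, cbox a b y ->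
    `|dword s y - dword s x| <= (n%:R ^+ m * M) * `|y - x| ^+ m.
Proof.
move=> QU Qx Fx M0 HM; elim=> [s|m IH s] sK y Qy.
  rewrite (Fx s) ?subr0 ?expr0 ?mul1r ?mulr1; last by case: s sK.
  by apply: HM => //; rewrite addn0 in sK.
have [sC _] := cS (dword_S s).
have [z hz i|xi [hxi ->]] := @mvt_rV R n (dword s) x y.
  by have [] := sC i z (QU _ (hull_cbox Qx Qy hz)).
apply: (le_trans (ler_norm_sum _ _ _)).
apply: (@le_trans _ _ (\sum_(k < n) (n%:R ^+ m * M) * `|y - x| ^+ m.+1)); last first.
  rewrite sumr_const card_ord [leRHS](_ : _ = (n%:R ^+ m * M * `|y - x| ^+ m.+1) *+ n)//.
  by rewrite -[RHS]mulr_natl ![in RHS]mulrA -exprS.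
apply: ler_sum => k _; have Qxi := hull_cbox Qx Qy (hxi k).
rewrite normrM exprSr mulrA ler_pM//.
  rewrite dword_partial; last exact: QU.
  have -> : dword (k :: s) (xi k) = dword (k :: s) (xi k) - dword (k :: s) x.
    by rewrite (Fx (k :: s))// subr0.
  apply: (le_trans (IH _ _ _ Qxi)); first by rewrite /= addSnnS.
  by rewrite ler_wpM2l ?mulr_ge0 ?exprn_ge0// lerXn2r ?nnegrE// hull_dist.
by have := coord_le_norm (y - x) k; rewrite !mxE.
Qed.

(** Near a flat point f varies by at most a constant times the (n+1)-th power of the distance.
    Cutting the box into about k^n cells of side L / k covers the values by intervals of total
    length of order 1 / k. *)
Lemma flat_values_box (a b : 'rV[R]_n) : cbox a b `<=` U ->
  (@lebesgue_measure R).-negligible (f @` (flat `&` cbox a b)).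
Proof.
move=> QU.
have /choice[Mf HMf] : forall s : n.+1.-tuple 'I_n, exists M, 0 <= M /\
    forall x, cbox a b x -> `|dword s x| <= M.
  by move=> s; have [M ? ?] := @dword_bound a b s QU; exists M.
pose M := \sum_s Mf s.
have M0 : 0 <= M by apply: sumr_ge0 => s _; have [] := HMf s.
have HM s : size s = n.+1 -> forall y, cbox a b y -> `|dword s y| <= M.
  move=> /eqP sn y Qy; have [_ /(_ y Qy)] := HMf (Tuple sn); move/le_trans; apply.
  rewrite /M (bigD1 (Tuple sn))//= lerDl; apply: sumr_ge0 => t _; by have [] := HMf t.
pose L : R := \sum_i `|b ord0 i - a ord0 i| + 1.
have L0 : 0 < L by rewrite ltr_wpDl// sumr_ge0.
have LE i : `|b ord0 i - a ord0 i| <= L.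
  by rewrite /L (bigD1 i)//= -addrA lerDl addr_ge0// sumr_ge0.
pose C := n%:R ^+ n.+1 * M.
have C0 : 0 <= C by rewrite mulr_ge0// exprn_ge0.
apply: negligible_small => e e0.
pose D := 2 ^+ n * (2 * (C * L ^+ n.+1)) + 1.
have D0 : 0 < D by rewrite ltr_wpDl// mulr_ge0 ?exprn_ge0// mulr_ge0// mulr_ge0// exprn_ge0// ltW.
(* [k] exceeds [D / e]. There are (k+1)^n <= (2k)^n cells, each giving an interval of length 2 C
   (L/k)^(n+1), so the total is at most [D / k]. *)
pose k := (Num.truncn (D / e)).+1.
have k0 : (0 : R) < k%:R by rewrite ltr0n.
(* There are k + 1 indices for each coordinate, because a point on the far face may have truncated
   index k. *)
pose cell (j : {ffun 'I_n -> 'I_k.+1}) : set 'rV[R]_n := [set x | flat x /\ cbox a b x /\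
  forall i, (j i)%:R * (L / k%:R) <= x ord0 i - a ord0 i <= (j i).+1%:R * (L / k%:R)].
have /choice[A HA] : forall j, exists A : set (measurableTypeR R), [/\ measurable A, f @` cell j `<=` A &
    (lebesgue_measure A <= (2 * (C * (L / k%:R) ^+ n.+1))%:E)%E].
  move=> j; have [[x [Fx [Qx xj]]]|nx] := pselect (exists x, cell j x); last first.
    exists set0; split=> //; first by move=> z [x jx _]; case: nx; exists x.
    rewrite measure0 lee_fin !mulr_ge0// exprn_ge0// divr_ge0// ltW//.
  pose r := C * (L / k%:R) ^+ n.+1.
  have r0 : 0 <= r by rewrite mulr_ge0// exprn_ge0// divr_ge0// ltW.
  exists `[f x - r, f x + r]%classic; split; first exact: measurable_itv.
    move=> _ [y [Fy [Qy yj]] <-]; rewrite /= in_itv/= -ler_distlC.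
    have := flat_estimate QU Qx Fx M0 HM (m := n.+1) (s := [::]) erefl Qy.
    rewrite distrC => /le_trans; apply; rewrite ler_wpM2l// lerXn2r ?nnegrE//.
      by rewrite divr_ge0// ltW.
    rewrite [leLHS]mx_normrE; apply/bigmax_leP; split=> [|[i0 i] _ /=].
      by rewrite divr_ge0// ltW.
    rewrite !mxE (ord1 i0) ler_norml; have := xj i; have := yj i.
    by rewrite -natr1 mulrDl mul1r => /andP[? ?] /andP[? ?]; apply/andP; split; lra.
  rewrite lebesgue_measure_itv/= lte_fin; case: ifP => _; last by rewrite lee_fin mulr_ge0.
  by rewrite -EFinD lee_fin -/r; lra.
have mA j : measurable (A j) by have [] := HA j.
exists (\big[setU/set0]_j A j).
  split; first by apply: bigsetU_measurable => j _.
  rewrite -bigcup_seq.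
  move=> _ [x [Fx Qx] <-].
  have t0 i : 0 <= (x ord0 i - a ord0 i) / (L / k%:R).
    by rewrite divr_ge0 ?divr_ge0 ?(ltW L0) ?(ltW k0)// subr_ge0; have /andP[] := Qx i.
  have tk i : (Num.truncn ((x ord0 i - a ord0 i) / (L / k%:R)) < k.+1)%N.
    rewrite ltnS -(ler_nat R); move: (t0 i); rewrite -truncn_le => /le_trans; apply.
    rewrite ler_pdivrMr ?divr_gt0// mulrCA divff ?gt_eqF// mulr1.
    apply: le_trans (LE i); apply: le_trans (ler_norm _).
    by rewrite lerD2r; have /andP[] := Qx i.
  pose j : {ffun 'I_n -> 'I_k.+1} := [ffun i => Ordinal (tk i)].
  exists j; first by rewrite /= mem_index_enum.
  have [_ + _] := HA j; apply; exists x => //; split=> //; split=> // i.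
  rewrite ffunE /= -ler_pdivlMr ?divr_gt0// -[X in _ && X]ler_pdivrMr ?divr_gt0//.
  by apply/andP; split; [rewrite truncn_le|exact/ltW/truncnS_gt].
apply: (@le_trans _ _ (\sum_(j : {ffun 'I_n -> 'I_k.+1}) lebesgue_measure (A j))%E).
  suff : measurable (\big[setU/set0]_j A j) /\ (lebesgue_measure (\big[setU/set0]_j A j) <=
      \sum_(j : {ffun 'I_n -> 'I_k.+1}) lebesgue_measure (A j))%E by case.
  elim/big_ind2 : _ => [|C1 u C2 v [mC1 h1] [mC2 h2]|j _].
  - by rewrite measure0.
  - by split; [exact: measurableU|apply: (le_trans (measureU2 _ mC1 mC2)); exact: leeD].
  - by split.
apply: (@le_trans _ _ (\sum_(j : {ffun 'I_n -> 'I_k.+1}) (2 * (C * (L / k%:R) ^+ n.+1))%:E)%E).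
  by apply: lee_sum => j _; have [] := HA j.
rewrite sumEFin lee_fin sumr_const card_ffun !card_ord -[leLHS]mulr_natr natrX.
apply: (@le_trans _ _ (2 * (C * (L / k%:R) ^+ n.+1) * (2 * k%:R) ^+ n)).
  rewrite ler_wpM2l ?mulr_ge0 ?exprn_ge0 ?divr_ge0 ?(ltW L0) ?(ltW k0)//.
  have k1 : (1 : R) <= k%:R by rewrite ler1n.
  by rewrite lerXn2r ?nnegrE ?mulr_ge0// -natr1; lra.
have -> : 2 * (C * (L / k%:R) ^+ n.+1) * (2 * k%:R) ^+ n =
   (2 ^+ n * (2 * (C * L ^+ n.+1))) / k%:R.
  rewrite !exprMn !exprS exprVn; field.
  by rewrite expf_neq0 ?gt_eqF// !gt_eqF.
rewrite ler_pdivrMr// -ler_pdivrMl//; apply: (@le_trans _ _ (D / e)).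
  by rewrite mulrC ler_wpM2r ?invr_ge0 ?(ltW e0)// /D lerDl.
exact/ltW/truncnS_gt.
Qed.

Lemma flat_values : (@lebesgue_measure R).-negligible (f @` (flat `&` U)).
Proof.
pose P : set ('rV[rat]_n * 'rV[rat]_n) :=
  [set p | cbox (map_mx ratr p.1) (map_mx ratr p.2) `<=` U].
pose Q p : set 'rV[R]_n := if pselect (P p) then cbox (map_mx ratr p.1) (map_mx ratr p.2) else set0.
have H p : (@lebesgue_measure R).-negligible (f @` (flat `&` Q p)).
  rewrite /Q; case: (pselect (P p)) => [Pp|_] /=; first exact: flat_values_box.
  by rewrite setI0 image_set0; exact: negligible_set0.
apply: negligibleS (negligible_countable H) => _ [x [Fx Ux] <-]; have [p [xp pU]] := open_rbox oU Ux.
exists p => //; exists x => //; split=> //; rewrite /Q; case: (pselect (P p)) => [?|//] /=; exact: box_cbox.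
Qed.

End flat_points.
Section sard_step.
Context {R : realType} {n : nat}.
Hypothesis IH : forall (U : set 'rV[R]_n) S f, open U -> deriv_closed U S -> S f ->
  (@lebesgue_measure R).-negligible (f @` [set y | U y /\ forall j, partial j f y = 0]).
Variables (U : set 'rV[R]_n.+1) (S : set ('rV[R]_n.+1 -> R)) (f : 'rV[R]_n.+1 -> R).
Hypotheses (oU : open U) (cS : deriv_closed U S) (Sf : S f).

Let crit x := U x /\ forall i, partial i f x = 0.

(** Where w = 0 and grad w is not 0, the zero set of w lies in countably many graphs. Restricted to
    such a graph, f becomes a function of n variables, critical where f is, and the induction
    hypothesis in dimension n applies. *)
Lemma crit_chart w : S w -> (@lebesgue_measure R).-negligible
  (f @` [set x | crit x /\ w x = 0 /\ exists i, partial i w x != 0]).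
Proof.
move=> Sw; have [wC wd] := cS Sw; have [fC _] := cS Sf.
have [kappa [kvalid kcover]] := ex_fboxes oU wC.
pose gg k := gf w kappa k 0.
pose F k y := f (insert (fi (kappa k)) y (gg k y)).
have och k : open (gd w kappa k 0).
  exact: (gdom_open oU (signed_isC1 oU wC (fs (kappa k))) (@kvalid k)).
have gC k : isC1 (gd w kappa k 0) (gg k).
  exact: (gfun_isC1 oU (signed_isC1 oU wC (fs (kappa k))) (@kvalid k)).
have H k : (@lebesgue_measure R).-negligible
    (F k @` [set y | gd w kappa k 0 y /\ forall j, partial j (F k) y = 0]).
  set i := fi (kappa k).
  have [u Su uE] := wd i.
  have uC := (cS Su).1.
  pose U' := U `&` [set x | u x != 0].
  have oU' : open U'.
    rewrite openE => x [Ux ux]; apply: filterI; first exact: open_nbhs_nbhs.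
    have := isC1_continuous oU uC Ux.
    by move=> /(_ [set r | r != 0]); apply; apply: open_nbhs_nbhs; split => //.
  have cG := gen_closed oU oU' (fun x => @proj1 _ _) cS Su (fun x => @proj2 _ _) erefl.
  have gU' y : gd w kappa k 0 y -> U' (insert i y (gg k y)).
    move=> yd; have [cy _] := gd_cyl yd; have Uy := cyl_sub kvalid cy.
    by split=> //=; rewrite -uE//; exact: (cyl_partial wC kvalid cy).
  (* Restrictions to the graph of elements of the generated algebra. The chain rule along the graph
     keeps them in this class, since the derivatives of the graph function are quotients by u. *)
  pose S2 := [set h | exists2 h1, gen_alg S (fun x => (u x)^-1) h1 &
     h = fun y => h1 (insert i y (gg k y))].
  apply: (IH (S := S2)) => //; last by exists f => //; exact: gen_base.
  move=> _ [h gh ->]; have [hC hd] := cG _ gh.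
  have Hd j : exists kj, gen_alg S (fun x => (u x)^-1) kj /\
      forall y, gd w kappa k 0 y -> is_derive y (delta_mx 0 j)
        (fun y => h (insert i y (gg k y))) (kj (insert i y (gg k y))).
    have [a ga aE] := hd (lift i j); have [b gb bE] := hd i.
    have [c Sc cE] := wd (lift i j).
    exists (a \+ (b \* (fun x => - (c \* (fun x => (u x)^-1)) x))); split.
      apply: gen_add => //; apply: gen_mul => //; apply: gen_opp; apply: gen_mul (gen_inv _ _).
      exact: gen_base.
    move=> y yd; have U'y := gU' _ yd; have [Uy _] := U'y.
    have D := is_derive_graph oU' hC U'y
      (gfun_derive oU (signed_isC1 oU wC (fs (kappa k))) (@kvalid k) j yd).
    apply: is_derive_eq D _; rewrite aE// bE//; congr (_ + _ * - _).
    rewrite (partial_signed wC (fs (kappa k)) (lift i j) Uy) (partial_signed wC (fs (kappa k)) i Uy).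
    by rewrite -mulf_div divff ?signr_eq0// mul1r cE// uE.
  have /choice[kj hkj] := Hd.
  have kC j y : gd w kappa k 0 y -> {for y, continuous (fun y => kj j (insert i y (gg k y)))}.
    move=> yd; have [kjC _] := cG _ (hkj j).1.
    have c1 : insert i y (gg k y) @[y --> y] --> insert i y (gg k y).
      apply: (cvg_insert (nbhs_filter y)); first exact: cvg_id.
      exact: isC1_continuous (och k) (gC k) yd.
    exact: cvg_comp c1 (isC1_continuous oU' kjC (gU' _ yd)).
  have [Ck Ek] := isC1_intro (och k) (fun j => (hkj j).2) kC.
  split=> // j; exists (fun y => kj j (insert i y (gg k y))); last exact: Ek.
  by exists (kj j); [exact: (hkj j).1|].
apply: negligibleS (negligible_countable H) => _ [x [[Ux cx] [wx [i wi]]] <-].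
have [k ki cx0] := kcover i x Ux wi; exists k => //.
have [] := cyl_gd oU wC kvalid cx0; rewrite wx => dx gx.
exists (col' (fi (kappa k)) x); last by rewrite /F /gg gx insert_col'.
split=> // j.
have gxx : insert (fi (kappa k)) (col' (fi (kappa k)) x) (gg k (col' (fi (kappa k)) x)) = x.
  by rewrite /gg gx insert_col'.
have := is_derive_graph (i := fi (kappa k)) oU fC _ (isC1_is_derive j (gC k) dx).
by rewrite gxx => /(_ Ux)[_]; rewrite !cx mul0r addr0.
Qed.

(** If a critical point is not flat, letters are stripped from the word of a nonzero derivative
    until the remaining derivative w vanishes; then w = 0 and one partial derivative of w is not 0
    there. Words being countable, this leaves countably many sets handled by [crit_chart], and the
    flat points. *)
Lemma sard_step : (@lebesgue_measure R).-negligible (f @` [set x | crit x]).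
Proof.
have /choice[der derP] : forall hi : ('rV[R]_n.+1 -> R) * 'I_n.+1, exists h', S hi.1 ->
    S h' /\ forall x, U x -> partial hi.2 hi.1 x = h' x.
  move=> [h i]; have [Sh|nS] := pselect (S h); last by exists h.
  by have [_ /(_ i)[h' ? ?]] := cS Sh; exists h'.
have derP' h i : S h -> S (der (h, i)) /\ forall x, U x -> partial i h x = der (h, i) x.
  exact: (derP (h, i)).
have Sw := dword_S Sf derP'; have Pw := dword_partial Sf derP'.
pose N (o : option (seq 'I_n.+1)) := if o is Some s then
   f @` [set x | crit x /\ dword f der s x = 0 /\ exists i, partial i (dword f der s) x != 0]
   else f @` (flat f der `&` U).
have HN o : (@lebesgue_measure R).-negligible (N o).
  by case: o => [s|]; [apply: crit_chart; exact: Sw|exact: (flat_values oU cS Sf derP')].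
apply: negligibleS (negligible_countable HN) => _ [x [Ux cx] <-].
have [Fx|/existsNP[s]] := pselect (flat f der x); first by exists None => //; exists x.
(* The stripping cannot reach the empty word: a word of length one is a first derivative, which is 0
   at a critical point. *)
move=> /not_implyP[]; elim: s => // i s IHs _ /eqP nz.
have [s0|s0] := eqVneq s [::].
  by move: nz; rewrite s0 -(Pw [::] i x Ux) /= cx eqxx.
have [e|e] := pselect (dword f der s x = 0); last by apply: IHs.
exists (Some s) => //; exists x => //; split=> //; split=> //; exists i.
by rewrite Pw//; apply/eqP.
Qed.

End sard_step.

Theorem sard {R : realType} n : forall (U : set 'rV[R]_n) S f, open U -> deriv_closed U S -> S f ->
  (@lebesgue_measure R).-negligible (f @` [set y | U y /\ forall j, partial j f y = 0]).
Proof.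
elim: n => [|n IH] U S f oU cS Sf; last exact: (sard_step IH oU cS Sf).
have : (@lebesgue_measure R).-negligible [set f 0].
  by apply/negligibleP; [exact: measurable_set1|exact: lebesgue_measure_set1].
by apply: negligibleS => _ [x _ <-]; rewrite (thinmx0 x).
Qed.

(** * Null sets: regular levels and zero sets of polynomials *)

Section null_sets.
Context {R : realType}.

Definition rV_null n (A : set (rVborel R n)) := (leb n).-negligible A.

(** A Lindelof principle: among the countably many rational boxes, those whose trace on A belongs to
    the ideal already cover A. *)
Lemma local_ideal n (F : set (set 'rV[R]_n)) (A : set 'rV[R]_n) :
  (forall B C, B `<=` C -> F C -> F B) -> F set0 ->
  (forall (I : countType) (B : I -> set 'rV[R]_n), (forall i, F (B i)) -> F (\bigcup_i B i)) ->
  (forall x, A x -> exists2 U, open U /\ U x & F (A `&` U)) -> F A.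
Proof.
move=> Fsub F0 FU hA.
pose Q (p : 'rV[rat]_n * 'rV[rat]_n) := if pselect (F (A `&` rbox p)) then A `&` rbox p else set0.
apply: (Fsub _ (\bigcup_p Q p)).
  move=> x Ax; have [U [oU Ux] FAU] := hA x Ax; have [p [xp pU]] := open_rbox oU Ux.
  exists p => //; rewrite /Q; case: (pselect _) => [?|[]] //=.
  apply: Fsub FAU => y [Ay py]; split=> //; apply: pU; exact: box_cbox.
by apply: FU => p; rewrite /Q; case: (pselect _).
Qed.

(** By the coarea formula the volume of this set is the integral over b of its mass on the level b,
    which is 0 for every b other than a. *)
Lemma negligible_regular_level n (Omega : set 'rV[R]_n.+1) u a : open Omega -> isC1 Omega u ->
  rV_null [set x | regular_set Omega u x /\ u x = a].
Proof.
move=> oO uC; have [tau tauP] := ex_level_measures oO uC.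
have [kappa [kvalid kcover]] := ex_fboxes oO uC.
have mr : measurable (regular_set Omega u : set (rVborel R n.+1)).
  exact: (measurable_regular_set uC kvalid kcover).
have mC : measurable ([set x | regular_set Omega u x /\ u x = a] : set (rVborel R n.+1)).
  rewrite (_ : mkset _ = regular_set Omega u `&` (psiO Omega u) @^-1` [set a]); last first.
    apply/seteqP; split=> x /= [rx]; have [Ox _] := rx; rewrite /psiO patchE mem_set//.
  apply: measurableI => //; rewrite -[X in measurable X]setTI.
  by apply: measurable_psiO.
apply/negligibleP => //.
have := level_coarea tauP (nnmeas_indic mC).
rewrite integral_indic//= setIidl; last by move=> x [].
move=> <-; have ma := level_measurable tauP (nnmeas_indic mC).
rewrite (ae_eq_integral (cst 0%E)) ?integral0//.
exists [set a]; split; [exact: measurable_set1|exact: lebesgue_measure_set1|].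
move=> b /= /not_implyP[_] h; apply: contrapT => ba; apply: h.
rewrite (level_concentrated tauP (nnmeas_indic mC) (h' := cst 0%E)) ?integral0//.
move=> x rx xb; rewrite indicE memNset// => -[_] xa; apply: ba; by rewrite /= -xb xa.
Qed.

Definition mpoly_fun n (p : mpoly.mpoly n R) (x : 'rV[R]_n) : R :=
  mpoly.meval (fun i => x 0 i) p.

Definition mpoly_derivable n (p : mpoly.mpoly n R) :=
  (forall x, {for x, continuous (mpoly_fun p)}) /\
  forall i x, is_derive x (delta_mx 0 i) (mpoly_fun p) (mpoly_fun (mpoly.mderiv i p) x).

Lemma mpoly_derivableC n c : mpoly_derivable (@mpoly.mpolyC n R c).
Proof.
have e d : mpoly_fun (@mpoly.mpolyC n R d) = cst d.
  by apply/funext => x; rewrite /mpoly_fun mpoly.mevalC.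
split=> [x|i x]; rewrite e; first exact: cst_continuous.
rewrite mpoly.mderivC /mpoly_fun mpoly.meval0; exact: is_derive_cst.
Qed.

Lemma mpoly_derivableD n p q : @mpoly_derivable n p -> mpoly_derivable q ->
  mpoly_derivable (p + q).
Proof.
move=> [pc pd] [qc qd].
have e a b : mpoly_fun (a + b) = @mpoly_fun n a + mpoly_fun b.
  by apply/funext => x; rewrite /mpoly_fun mpoly.mevalD.
split=> [x|i x]; rewrite e; first by apply: (@cvgD _ _ _ _ (nbhs_filter x)); [exact: pc|exact: qc].
by rewrite mpoly.mderivD e; apply: is_deriveD.
Qed.

Lemma mpoly_derivableM n p q : @mpoly_derivable n p -> mpoly_derivable q ->
  mpoly_derivable (p * q).
Proof.
move=> [pc pd] [qc qd].
have e a b : mpoly_fun (a * b) = @mpoly_fun n a * mpoly_fun b.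
  by apply/funext => x; rewrite /mpoly_fun mpoly.mevalM.
split=> [x|i x]; rewrite e; first by apply: (@cvgM _ _ _ (nbhs_filter x)); [exact: pc|exact: qc].
have D := @is_deriveM _ _ _ _ x (delta_mx 0 i) _ _ (pd i x) (qd i x).
apply: is_derive_eq D _; rewrite mpoly.mderivM /mpoly_fun mpoly.mevalD !mpoly.mevalM.
by rewrite addrC; congr (_ + _); exact: mulrC.
Qed.

Lemma mpoly_derivableX n i : mpoly_derivable (@mpoly.mpolyX n R (mpoly.mnm1 i)).
Proof.
have e : mpoly_fun (@mpoly.mpolyX n R (mpoly.mnm1 i)) = fun x => x 0 i.
  by apply/funext => x; rewrite /mpoly_fun mpoly.mevalXU.
split=> [x|j x]; rewrite e; first exact: coord_continuous.
apply: is_derive_of_line.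
have -> : (fun s : R => (s *: (delta_mx 0 j : 'rV[R]_n) + x) 0 i) =
    fun s => s * (i == j)%:R + x 0 i.
  by apply/funext => s; rewrite !mxE.
apply: is_derive_eq (is_derive_affine _ _ _) _.
rewrite mpoly.mderivX /mpoly_fun mpoly.mevalZ mpoly.mnm1E.
have [->|ij] := eqVneq i j; last by rewrite mul0r.
rewrite mul1r mpoly.mevalX big1 // => k _.
by rewrite mpoly.mnmBE mpoly.mnm1E subnn expr0.
Qed.

Lemma mpoly_derivable_all n (p : mpoly.mpoly n R) : mpoly_derivable p.
Proof.
elim/mpoly.mpolyind: p => [|c m p _ _ IH].
  by rewrite -mpoly.mpolyC0; exact: mpoly_derivableC.
apply: mpoly_derivableD => //; rewrite -mpoly.mul_mpolyC.
apply: mpoly_derivableM; first exact: mpoly_derivableC.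
rewrite mpoly.mpolyXE_id; have D1 : mpoly_derivable (1 : mpoly.mpoly n R).
  by rewrite -mpoly.mpolyC1; exact: mpoly_derivableC.
elim/big_ind : _ => // [q r|i _]; first exact: mpoly_derivableM.
elim: (mpoly.fun_of_multinom m i) => [|k IHk]; first by rewrite expr0.
by rewrite exprS; apply: mpoly_derivableM IHk; exact: mpoly_derivableX.
Qed.

Lemma mpoly_fun_isC1 n (p : mpoly.mpoly n R) : isC1 setT (mpoly_fun p) /\
  forall i x, partial i (mpoly_fun p) x = mpoly_fun (mpoly.mderiv i p) x.
Proof.
have [C E] := @isC1_intro R n setT (mpoly_fun p) (fun i => mpoly_fun (mpoly.mderiv i p)) openT
  (fun i x _ => proj2 (mpoly_derivable_all p) i x)
  (fun i x _ => proj1 (mpoly_derivable_all (mpoly.mderiv i p)) x).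
by split=> // i x; exact: E.
Qed.

(** Induction on a bound k of the degree. If some derivative of p is a nonzero polynomial, a zero of
    p is either a regular point of the level 0 or a zero of that derivative. If all derivatives are
    zero, p is a nonzero constant, the characteristic being 0. *)
Lemma mpoly_zeros_null n (p : mpoly.mpoly n.+1 R) : p != 0 -> rV_null [set x | mpoly_fun p x = 0].
Proof.
move=> p0; have [k hk] : exists k, forall m, (k <= mpoly.mdeg m)%N -> mpoly.mcoeff m p = 0.
  have lt m := @mpoly.msize_mdeg_lt n.+1 R p m.
  eexists => m km; apply/eqP; rewrite -[_ == 0]negbK -mpoly.mcoeff_msupp.
  by apply/negP => /lt; rewrite ltnNge => /negP; apply; exact: km.
elim: k p p0 hk => [|k IH] p p0 hk.
  by case/eqP: p0; apply/mpoly.mpolyP => m; rewrite hk// mpoly.mcoeff0.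
have [[i di]|nd] := pselect (exists i, mpoly.mderiv i p != 0).
  have [C E] := mpoly_fun_isC1 p.
  have N1 := negligible_regular_level 0 openT C.
  have N2 : rV_null [set x | mpoly_fun (mpoly.mderiv i p) x = 0].
    apply: IH => // m km; rewrite mpoly.mcoeff_deriv hk ?mul0rn//.
    by rewrite mpoly.mdegD mpoly.mdeg1 addn1.
  apply: negligibleS (negligibleU N1 N2) => x /= px.
  have [g0|g0] := eqVneq (grad (mpoly_fun p) x) 0; last by left.
  by right; rewrite /= -E; move/rowP : g0 => /(_ i); rewrite !mxE.
have pC : p = mpoly.mpolyC n.+1 (mpoly.mcoeff (@mpoly.mnm0 n.+1) p).
  apply/mpoly.mpolyP => m; rewrite mpoly.mcoeffC.
  have [->|m0] := eqVneq m (@mpoly.mnm0 n.+1); first by rewrite mulr1.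
  rewrite mulr0; have [i mi] : exists i, mpoly.fun_of_multinom m i != 0%N.
    apply/existsP; rewrite -negb_forall; apply: contra m0 => /forallP h.
    by apply/eqP/mpoly.mnmP => i; rewrite mpoly.mnm0E; apply/eqP; exact: h.
  have [/eqP /mpoly.mpolyP /(_ (mpoly.mnm_sub m (mpoly.mnm1 i)))|d] := boolP (mpoly.mderiv i p == 0).
    rewrite mpoly.mcoeff_deriv mpoly.mcoeff0 mpoly.submK ?mpoly.lep1mP//.
    by move=> /eqP; rewrite mulrn_eq0 /= => /eqP.
  by case: nd; exists i.
have c0 : mpoly.mcoeff (@mpoly.mnm0 n.+1) p != 0.
  by apply: contraNneq p0 => c0; rewrite pC c0 mpoly.mpolyC0.
rewrite (_ : mkset _ = set0); first exact: negligible_set0.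
apply/seteqP; split=> // x /=; rewrite pC /mpoly_fun mpoly.mevalC => h.
by rewrite h eqxx in c0.
Qed.

End null_sets.

(** * Critical values and critical points of the analytic function *)

Section critical_set.
Context {R : realType} {n : nat}.
Variables (Omega : set 'rV[R]_n.+1) (psi : 'rV[R]_n.+1 -> R).
Hypotheses (oO : open Omega) (psiC1 : isC1 Omega psi)
  (psi_analytic : forall x, Omega x -> analytic_at psi x).

Lemma isC1_local U (h : 'rV[R]_n.+1 -> R) :
  (forall x, U x -> exists V, [/\ open V, V x & isC1 V h]) -> isC1 U h.
Proof. by move=> hU i x Ux; have [V [_ Vx hV]] := hU x Ux; exact: hV. Qed.

Lemma isC1_eq U (h k : 'rV[R]_n.+1 -> R) : open U -> (forall x, U x -> h x = k x) ->
  isC1 U h -> isC1 U k.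
Proof.
move=> oU hk hU; have D i x : U x -> is_derive x (delta_mx 0 i) k (partial i h x).
  move=> Ux; have [dh eh] := isC1_is_derive i hU Ux.
  have nhk : \near x, h x = k x.
    have : nbhs x U by exact: open_nbhs_nbhs.
    exact: filterS.
  split; first by apply: near_eq_derivable dh; exact: nhk.
  by rewrite -eh; apply/esym; apply: near_eq_derive; exact: nhk.
by have [] := isC1_intro oU D (fun i x Ux => proj2 (hU i x Ux)).
Qed.

Lemma analytic_partial_isC1 i : isC1 Omega (partial i psi).
Proof.
apply: isC1_local => x Ox; have [d d0 [S Sp cS]] := analytic_smooth (psi_analytic Ox).
have oB : open (ball x d) by exact: ball_open.
have [_ /(_ i)[h Sh hE]] := cS _ Sp; have [hC _] := cS _ Sh.
exists (ball x d); split=> //; first exact: ballxx.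
by apply: (isC1_eq oB _ hC) => y /hE.
Qed.

Definition crit_set := [set x | Omega x /\ grad psi x = 0].

(** Sets whose image under psi is negligible form an ideal stable under countable unions, so Sard's
    theorem is needed only on the balls of convergence of the power series. *)
Lemma critical_image_negligible : (@lebesgue_measure R).-negligible (psi @` crit_set).
Proof.
apply: (@local_ideal R n.+1 (fun B => (@lebesgue_measure R).-negligible (psi @` B))).
- by move=> B C BC; apply: negligibleS; exact: image_subset.
- by rewrite image_set0; exact: negligible_set0.
- by move=> I B HB; rewrite image_bigcup; exact: negligible_countable HB.
move=> x [Ox _]; have [d d0 [S Sp cS]] := analytic_smooth (psi_analytic Ox).
exists (ball x d); first by split; [exact: ball_open|exact: ballxx].
have oB : open (ball x d) by exact: ball_open.
apply: negligibleS (sard oB cS Sp) => _ [y [[Oy gy] By] <-]; exists y => //; split=> // j.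
by move/rowP : gy => /(_ j); rewrite !mxE.
Qed.

(** At these points every term of the divergence of A grad psi vanishes; they will be zeros of the
    polynomial f. *)
Definition flat2 := [set x | Omega x /\ grad psi x = 0 /\
  forall i, grad (partial i psi) x = 0].

(** If some second derivative is nonzero at a critical point, the point lies on the zero level of a
    first derivative, at a regular point of that first derivative. *)
Lemma crit_set_flat2 : rV_null (crit_set `\` flat2).
Proof.
have H (i : 'I_n.+1) : rV_null [set x | regular_set Omega (partial i psi) x /\ partial i psi x = 0].
  exact: (negligible_regular_level 0 oO (analytic_partial_isC1 i)).
apply: negligibleS (negligible_countable H) => x [[Ox gx] nf].
have [i gi] : exists i, grad (partial i psi) x != 0.
  apply: contrapT => /forallNP h; apply: nf; split=> //; split=> // i.
  by apply/eqP/negPn/negP; exact: h.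
exists i => //; split; first by split.
by move/rowP : gx => /(_ i); rewrite !mxE.
Qed.

End critical_set.

(** * The Prekopa-Leindler and Brunn-Minkowski inequalities *)

Lemma integral_scale_indic d (T : measurableType d) (R : realType) (mu : {measure set T -> \bar R})
    (a : R) (X : set T) : (0 <= a)%R -> measurable X ->
  (\int[mu]_t (a%:E * (\1_X t)%:E) = a%:E * mu X)%E.
Proof.
move=> a0 mX; have [_ PhiZ _ _] := nnfunctional_integral mu.
by rewrite (PhiZ a _ a0 (nnmeas_indic mX)) (integral_indic _ measurableT mX) setIT.
Qed.

Section brunn_minkowski.
Context {R : realType}.
Local Notation mu := (@lebesgue_measure R).

(** Take a0 in A close to its supremum and b0 in B close to its infimum. The translates A + b0 and B
    + a0 both lie in C, and after the removal of small intervals they are separated by the point a0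
    + b0. *)
Lemma brunn_minkowski1 (A B C : set (measurableTypeR R)) (K : R) :
  measurable A -> measurable B -> measurable C ->
  (forall x, A x -> `|x| <= K) -> (forall x, B x -> `|x| <= K) -> A !=set0 -> B !=set0 ->
  (forall x y, A x -> B y -> C (x + y)) -> (mu A + mu B <= mu C)%E.
Proof.
move=> mA mB mC AK BK A0 B0 ABC; apply/lee_addgt0Pr => e e0.
have d0 : 0 < e / 2 by rewrite divr_gt0.
have supA : has_sup A.
  by split=> //; exists K => x /AK; exact: le_trans (ler_norm _).
have infB : has_inf B.
  by split=> //; exists (- K) => x /BK; rewrite ler_norml => /andP[].
have [a0 Aa0 a0P] := sup_adherent d0 supA.
have [b0 Bb0 b0P] := inf_adherent d0 infB.
(* Each truncation loses at most e / 2, because a0 and b0 are within e / 2 of the supremum and the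
   infimum. *)
pose A1 := A `&` `]-oo, a0[%classic; pose B1 := B `&` `[b0, +oo[%classic.
have mA1 : measurable A1 by apply: measurableI => //; exact: measurable_itv.
have mB1 : measurable B1 by apply: measurableI => //; exact: measurable_itv.
have mshift (v : R) (D : set (measurableTypeR R)) : measurable D ->
    measurable ([set c | D (c - v)] : set (measurableTypeR R)).
  move=> mD; rewrite -[X in measurable X]setTI.
  have : measurable_fun setT ((fun c : R => c - v) : measurableTypeR R -> measurableTypeR R).
    by apply: measurable_funB.
  exact.
have shiftE (v : R) (D : set (measurableTypeR R)) : measurable D ->
    mu [set c | D (c - v)] = mu D.
  move=> mD; rewrite (@lebesgue_measure_affine R 1 v _ ltr01 (mshift v D mD)) mul1e.
  by congr (mu _); apply/seteqP; split=> x /=; rewrite mul1r addrK.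
have A1E : (mu A <= mu A1 + (e / 2)%:E)%E.
  have AU : A `<=` A1 `|` `[a0, a0 + e / 2]%classic.
    move=> x Ax; have [xa|ax] := ltP x a0; [left; split=> //=; by rewrite in_itv|right].
    rewrite /= in_itv/= ax /=; apply: (@le_trans _ _ (sup A)); first exact: ub_le_sup supA.2 _ Ax.
    by rewrite ltW// -ltrBlDr.
  have : (mu A <= mu A1 + mu `[a0, (a0 + e / 2)%R]%classic)%E.
    apply: le_trans (measureU2 _ mA1 (measurable_itv _)).
    by apply: le_measure; rewrite ?inE//; apply: measurableU => //; exact: measurable_itv.
  rewrite lebesgue_measure_itv/= lte_fin ltrDl d0 -EFinB.
  by have -> : a0 + e / 2 - a0 = e / 2 by ring.
have B1E : (mu B <= mu B1 + (e / 2)%:E)%E.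
  have BU : B `<=` B1 `|` `[b0 - e / 2, b0]%classic.
    move=> x Bx; have [xb|bx] := ltP x b0; last by left; split=> //=; rewrite in_itv/= bx.
    right; rewrite /= in_itv/= (ltW xb) andbT; apply: (@le_trans _ _ (inf B)).
      by rewrite lerBlDr ltW.
    exact: ge_inf infB.2 _ Bx.
  have : (mu B <= mu B1 + mu `[(b0 - e / 2)%R, b0]%classic)%E.
    apply: le_trans (measureU2 _ mB1 (measurable_itv _)).
    by apply: le_measure; rewrite ?inE//; apply: measurableU => //; exact: measurable_itv.
  rewrite lebesgue_measure_itv/= lte_fin ltrBlDr ltrDl d0 -EFinB.
  by have -> : b0 - (b0 - e / 2) = e / 2 by ring.
apply: (le_trans (leeD A1E B1E)).
rewrite addeACA -EFinD -splitr leeD2r// -(shiftE b0 A1)// -(shiftE a0 B1)//.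
rewrite -measureU//; last 3 first.
- exact: mshift.
- exact: mshift.
- apply/seteqP; split=> // c [[_ /=]]; rewrite in_itv/= => h1 [_ /=].
  by rewrite in_itv/= andbT => h2; lra.
apply: le_measure; rewrite ?inE//; first by apply: measurableU; exact: mshift.
move=> c [[/= Ac _]|[/= Bc _]].
  by rewrite -(subrK b0 c); exact: ABC.
by rewrite -(subrK a0 c) addrC; exact: ABC.
Qed.

Lemma brunn_minkowski1_convex (p q : R) (A B C : set (measurableTypeR R)) (K : R) :
  0 < p -> 0 < q -> measurable A -> measurable B -> measurable C ->
  (forall x, A x -> `|x| <= K) -> (forall x, B x -> `|x| <= K) -> A !=set0 -> B !=set0 ->
  (forall x y, A x -> B y -> C (p * x + q * y)) -> (p%:E * mu A + q%:E * mu B <= mu C)%E.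
Proof.
move=> p0 q0 mA mB mC AK BK [a Aa] [b Bb] ABC.
have mscale' (c : R) (D : set (measurableTypeR R)) : measurable D ->
    measurable ([set x | D (x / c)] : set (measurableTypeR R)).
  move=> mD; rewrite -[X in measurable X]setTI.
  have : measurable_fun setT ((fun x : R => x / c) : measurableTypeR R -> measurableTypeR R).
    by apply: measurable_funM.
  exact.
have scaleE (c : R) (D : set (measurableTypeR R)) : 0 < c -> measurable D ->
    mu [set x | D (x / c)] = (c%:E * mu D)%E.
  move=> c0 mD; rewrite (@lebesgue_measure_affine R c 0 _ c0 (mscale' c D mD)); congr (_ * mu _)%E.
  by apply/seteqP; split=> x /=; rewrite addr0 mulrC mulKf// gt_eqF.
rewrite -!scaleE//.
have K0 : 0 <= K by apply: le_trans (AK _ Aa).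
apply: (@brunn_minkowski1 _ _ _ (K * (p + q))) => //; do ?exact: mscale'.
- move=> x /AK; rewrite normrM normfV (gtr0_norm p0) ler_pdivrMr// => /le_trans; apply.
  by rewrite ler_wpM2l// lerDl ltW.
- move=> x /BK; rewrite normrM normfV (gtr0_norm q0) ler_pdivrMr// => /le_trans; apply.
  by rewrite ler_wpM2l// lerDr ltW.
- by exists (a * p) => /=; rewrite mulfK// gt_eqF.
- by exists (b * q) => /=; rewrite mulfK// gt_eqF.
move=> x y /= Ax By; have := ABC _ _ Ax By.
by rewrite !(mulrC _ (_ / _)) !divfK// gt_eqF.
Qed.

(** The layer-cake formula with heights normalised by the bound a, so that the level sets of
    functions with different maxima are compared at the same tau in ]0, 1[. *)
Lemma layer (a : R) (F : measurableTypeR R -> R) : 0 < a -> measurable_fun setT F ->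
  (forall t, 0 <= F t <= a) ->
  (\int[mu]_t (F t)%:E = \int[mu]_(tau in `]0%R, 1%R[) (a%:E * mu [set t | (a * tau < F t)%R]))%E.
Proof.
move=> a0 mF Fa.
pose S : set (measurableTypeR R * measurableTypeR R) :=
  [set z | 0 < z.1 < 1 /\ a * z.1 < F z.2].
have mS : measurable S.
  rewrite (_ : S = (`]0, 1[%classic `*` setT) `&` [set z | a * z.1 < F z.2]); last first.
    by apply/seteqP; split=> z /=; rewrite in_itv/=; [move=> []|move=> [[? _] ?]].
  apply: measurableI; first by apply: measurableX => //; exact: measurable_itv.
  apply: measurable_lt_set; first exact: measurable_funM.
  exact: measurableT_comp mF measurable_snd.
pose h : measurableTypeR R * measurableTypeR R -> \bar R := fun z => (a%:E * (\1_S z)%:E)%E.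
have nh : nnmeas h by apply: nnmeas_scale (ltW a0) (nnmeas_indic mS).
have := @fubini_tonelli _ _ _ _ _ mu mu h (proj1 nh) (proj2 nh); rewrite /= => FT.
rewrite [RHS]integral_mkcond.
transitivity (\int[mu]_tau \int[mu]_t h (tau, t))%E; last first.
  apply: eq_integral => tau _; rewrite patchE.
  rewrite (_ : (fun t => h (tau, t)) = (fun t => a%:E * (\1_(xsection S tau) t)%:E)%E); last first.
    apply/funext => t; rewrite /h !indicE; congr (_ * (_)%:E)%E.
    by rewrite mem_xsection.
  have mX : measurable (xsection S tau) by exact: measurable_xsection.
  rewrite (integral_scale_indic mu (ltW a0) mX).
  have XE t : xsection S tau t <-> S (tau, t) := xsectionP tau t S.
  clear FT nh mS.
  case: ifPn; rewrite ?inE ?notin_setE /= in_itv /= => h0.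
    congr (_ * mu _)%E; apply/seteqP; split=> t; first by move=> /XE[].
    by move=> ?; apply/XE; split.
  have -> : xsection S tau = set0 by apply/seteqP; split=> t // /XE[].
  by rewrite measure0 mule0.
rewrite FT; apply: eq_integral => t _; have /andP[F0 FA] := Fa t.
rewrite (_ : (fun tau => h (tau, t)) = (fun tau => a%:E * (\1_(ysection S t) tau)%:E)%E); last first.
  apply/funext => tau; rewrite /h !indicE; congr (_ * (_)%:E)%E.
  by rewrite mem_ysection.
have mY : measurable (ysection S t) by exact: measurable_ysection.
rewrite (integral_scale_indic mu (ltW a0) mY).
have YE tau : ysection S t tau <-> S (tau, t) := ysectionP tau t S.
clear FT nh mS.
have -> : ysection S t = `]0, F t / a[%classic.
  apply/seteqP; split=> tau; rewrite /= in_itv/=.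
    by move=> /YE[/andP[-> _] /= h1]; rewrite ltr_pdivlMr// mulrC.
  rewrite ltr_pdivlMr// mulrC => /andP[t0 h1]; apply/YE; split=> //=; rewrite t0 /=.
  by rewrite -(ltr_pM2l a0) mulr1 (lt_le_trans h1).
have := @lebesgue_measure_itv R `]0, F t / a[; rewrite /= lte_fin => ->; case: ifPn => [_|].
  by rewrite -EFinD subr0 -EFinM mulrCA divff ?mulr1// gt_eqF.
rewrite -leNgt mule0 => h0; congr (_%:E); apply/eqP; rewrite eq_le F0 andbT.
by move: h0; rewrite ler_pdivrMr// mul0r.
Qed.

(** Young's inequality for u^p and v^q with the conjugate exponents 1 / p and 1 / q. *)
Lemma weighted_amgm (p q u v : R) : 0 < p -> 0 < q -> p + q = 1 -> 0 <= u -> 0 <= v ->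
  u `^ p * v `^ q <= p * u + q * v.
Proof.
move=> p0 q0 pq u0 v0.
have := @conjugate_powR R (u `^ p) (v `^ q) p^-1 q^-1 (powR_ge0 _ _) (powR_ge0 _ _).
rewrite !invr_gt0 !invrK => /(_ p0 q0 pq).
by rewrite -!powRrM !divff ?gt_eqF// !powRr1// ![_ * p]mulrC ![_ * q]mulrC.
Qed.

(** Let a and b be the suprema of F and G, and c = a^p b^q. For tau < 1 the sets {F > a tau} and {G
    > b tau} are nonempty, and their convex combination lies in {H > c tau}. One-dimensional
    Brunn-Minkowski at each tau, integration over tau, and the weighted mean inequality for x / a
    and y / b conclude. *)
Lemma prekopa1 (p q K : R) (F G H : measurableTypeR R -> R) (M : R) :
  0 < p -> 0 < q -> p + q = 1 ->
  measurable_fun setT F -> measurable_fun setT G -> measurable_fun setT H ->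
  (forall t, 0 <= F t <= M) -> (forall t, 0 <= G t <= M) -> (forall t, 0 <= H t) ->
  (forall t, 0 < F t -> `|t| <= K) -> (forall t, 0 < G t -> `|t| <= K) ->
  (exists t, 0 < F t) -> (exists t, 0 < G t) ->
  (forall s t, 0 < F s -> 0 < G t -> F s `^ p * G t `^ q <= H (p * s + q * t)) ->
  forall x y, (\int[mu]_t (F t)%:E = x%:E)%E -> (\int[mu]_t (G t)%:E = y%:E)%E ->
  ((x `^ p * y `^ q)%:E <= \int[mu]_t (H t)%:E)%E.
Proof.
move=> p0 q0 pq mF mG mH FM GM H0 FK GK exF exG FGH x y xE yE.
have M_ub (L : R -> R) : (forall t, 0 <= L t <= M) -> has_ubound (range L).
  by move=> LM; exists M => _ [t _ <-]; case/andP: (LM t).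
have supP (L : R -> R) : (forall t, 0 <= L t <= M) -> (exists t, 0 < L t) ->
    0 < sup (range L) /\ (forall t, 0 <= L t <= sup (range L)) /\
    (forall tau, 0 < tau < 1 -> exists t, sup (range L) * tau < L t).
  move=> LM [t0 Lt0]; have ub := M_ub L LM.
  have le t : L t <= sup (range L) by apply: ub_le_sup => //; exists t.
  have s0 : 0 < sup (range L) by exact: lt_le_trans (le t0).
  split=> //; split=> [t|tau /andP[tau0 tau1]]; first by rewrite le andbT; case/andP: (LM t).
  have e0 : 0 < sup (range L) * (1 - tau) by rewrite mulr_gt0// subr_gt0.
  have hs : has_sup (range L) by split=> //; exists (L t0), t0.
  have [_ [t _ <-] h] := sup_adherent e0 hs; exists t.
  by move: h; rewrite mulrBr mulr1 opprB addrCA subrr addr0.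
have [a0 [Fa Fex]] := supP F FM exF; have [b0 [Gb Gex]] := supP G GM exG.
set a := sup (range F) in a0 Fa Fex; set b := sup (range G) in b0 Gb Gex.
pose c := a `^ p * b `^ q; have c0 : 0 < c by rewrite mulr_gt0// powR_gt0.
(* Truncation at c provides the upper bound required by the layer-cake formula, and loses nothing
   since the heights c tau stay below c. *)
pose H' t := Num.min (H t) c.
have mH' : measurable_fun setT H' by exact: measurable_minr.
have H'c t : 0 <= H' t <= c by rewrite /H' le_min H0 (ltW c0) ge_min lexx orbT.
have mthr (L : measurableTypeR R -> R) (r : R) : measurable_fun setT L ->
    measurable [set t | r < L t].
  by move=> mL; apply: measurable_lt_set.
have LF := layer a0 mF Fa; have LG := layer b0 mG Gb; have LH := layer c0 mH' H'c.
rewrite xE in LF; rewrite yE in LG.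
have key (tau : R) : 0 < tau < 1 ->
    (p%:E * mu [set t | (a * tau < F t)%R] + q%:E * mu [set t | (b * tau < G t)%R] <=
     mu [set t | (c * tau < H' t)%R])%E.
  move=> tau01; have /andP[tau0 tau1] := tau01.
  have at0 : 0 < a * tau by rewrite mulr_gt0.
  have bt0 : 0 < b * tau by rewrite mulr_gt0.
  apply: (@brunn_minkowski1_convex p q _ _ _ K) => //; do ?exact: mthr.
  - by move=> t /= /(lt_trans at0); exact: FK.
  - by move=> t /= /(lt_trans bt0); exact: GK.
  - by have [t ht] := Fex _ tau01; exists t.
  - by have [t ht] := Gex _ tau01; exists t.
  move=> s t /= hs ht; rewrite /H' lt_min gtr_pMr// tau1 andbT.
  apply: lt_le_trans (FGH s t (lt_trans at0 hs) (lt_trans bt0 ht)).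
  have -> : c * tau = (a * tau) `^ p * (b * tau) `^ q.
    rewrite !powRM ?ltW// mulrACA -powRD ?pq ?powRr1 ?ltW//.
    by rewrite oner_eq0.
  apply: ltr_pM; rewrite ?powR_ge0//; apply: gt0_ltr_powR => //; rewrite ?nnegrE ltW//.
    by rewrite (lt_trans at0).
  by rewrite (lt_trans bt0).
apply: (@le_trans _ _ (\int[mu]_t (H' t)%:E)%E); last first.
  apply: ge0_le_integral => //.
  - by move=> t _; rewrite lee_fin; case/andP: (H'c t).
  - exact/measurable_EFinP.
  - exact/measurable_EFinP.
  - by move=> t _; rewrite lee_fin /H' ge_min lexx.
have mea (L : measurableTypeR R -> R) (r : R) : measurable_fun setT L -> 0 < r ->
    measurable_fun setT (fun tau : measurableTypeR R => (r%:E * mu [set t | (r * tau < L t)%R])%E).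
  move=> mL r0; apply: measurable_funeM.
  pose S : set (measurableTypeR R * measurableTypeR R) := [set z | r * z.1 < L z.2].
  have mS : measurable S.
    apply: measurable_lt_set; first exact: measurable_funM.
    exact: measurableT_comp mL measurable_snd.
  have := measurable_fun_xsection mu mS.
  apply: eq_measurable_fun => tau _; congr (mu _); apply/seteqP; split=> t; first by move/xsectionP.
  by move=> Lt; apply/xsectionP.
rewrite LH.
have ca0 : 0 <= c * p / a := divr_ge0 (mulr_ge0 (ltW c0) (ltW p0)) (ltW a0).
have cb0 : 0 <= c * q / b := divr_ge0 (mulr_ge0 (ltW c0) (ltW q0)) (ltW b0).
have Zl (k : R) (f : measurableTypeR R -> \bar R) : 0 <= k -> measurable_fun setT f ->
    (forall t, 0 <= f t)%E -> (\int[mu]_(tau in `]0%R, 1%R[) (k%:E * f tau) =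
    k%:E * \int[mu]_(tau in `]0%R, 1%R[) f tau)%E.
  move=> k0 mf f0; rewrite ge0_integralZl//; first exact: measurable_funTS.
have muL (L : measurableTypeR R -> R) (r : R) : 0 < r ->
    forall tau, (0 <= r%:E * mu [set t | (r * tau < L t)%R])%E.
  by move=> r0 tau; rewrite mule_ge0// lee_fin ltW.
have e1 : ((c * (p * (x / a) + q * (y / b)))%:E <=
    \int[mu]_(tau in `]0%R, 1%R[) (c%:E * mu [set t | (c * tau < H' t)%R]))%E.
  have -> : ((c * (p * (x / a) + q * (y / b)))%:E =
     \int[mu]_(tau in `]0%R, 1%R[) ((c * p / a)%:E * (a%:E * mu [set t | (a * tau < F t)%R]) +
       (c * q / b)%:E * (b%:E * mu [set t | (b * tau < G t)%R])))%E.
    rewrite ge0_integralD//; first last.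
    - by apply: measurable_funTS; apply: measurable_funeM; exact: mea.
    - by move=> tau _; apply: mule_ge0; rewrite ?lee_fin// mule_ge0// lee_fin ltW.
    - by apply: measurable_funTS; apply: measurable_funeM; exact: mea.
    - by move=> tau _; apply: mule_ge0; rewrite ?lee_fin// mule_ge0// lee_fin ltW.
    rewrite (Zl _ _ ca0 (mea _ _ mF a0) (muL _ _ a0)) (Zl _ _ cb0 (mea _ _ mG b0) (muL _ _ b0)).
    rewrite -LF -LG -!EFinM -EFinD; congr (_%:E).
    by field; rewrite !gt_eqF.
  apply: ge0_le_integral => //; first last.
  - move=> tau; rewrite /= in_itv/= => tau01.
    rewrite muleA -EFinM divfK ?gt_eqF// muleA -EFinM divfK ?gt_eqF//.
    rewrite (EFinM c p) (EFinM c q) -!muleA -ge0_muleDr; last 2 first.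
      by rewrite mule_ge0// lee_fin ltW.
      by rewrite mule_ge0// lee_fin ltW.
    by rewrite lee_pmul2l// ?lte_fin//; exact: key.
  - by apply: measurable_funTS; exact: mea.
  - by apply: measurable_funTS; apply: emeasurable_funD; apply: measurable_funeM; exact: mea.
  - by move=> tau _; apply: adde_ge0; apply: mule_ge0; rewrite ?lee_fin// mule_ge0// lee_fin ltW.
apply: le_trans e1; rewrite lee_fin.
have x0 : 0 <= x.
  by rewrite -lee_fin -xE; apply: integral_ge0 => t _; rewrite lee_fin; case/andP: (FM t).
have y0 : 0 <= y.
  by rewrite -lee_fin -yE; apply: integral_ge0 => t _; rewrite lee_fin; case/andP: (GM t).
have xa : x / a * a = x by rewrite divfK// gt_eqF.
have yb : y / b * b = y by rewrite divfK// gt_eqF.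
have xa0 : 0 <= x / a by rewrite divr_ge0// ltW.
have yb0 : 0 <= y / b by rewrite divr_ge0// ltW.
have -> : x `^ p * y `^ q = c * ((x / a) `^ p * (y / b) `^ q).
  by rewrite /c -{1}xa -{1}yb (powRM _ xa0 (ltW a0)) (powRM _ yb0 (ltW b0)); ring.
rewrite ler_wpM2l ?(ltW c0)//.
exact: weighted_amgm.
Qed.

(** Induction on the dimension: the volumes of the slices of A, B, C orthogonal to the first axis
    satisfy, by the induction hypothesis, the assumption of the one-dimensional functional
    inequality. *)
Lemma brunn_minkowski_mult n (p q K : R) : 0 < p -> 0 < q -> p + q = 1 ->
  forall (A B C : set (rVborel R n)), measurable A -> measurable B -> measurable C ->
  (forall x, A x -> `|x| <= K) -> (forall x, B x -> `|x| <= K) -> (forall x, C x -> `|x| <= K) ->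
  (forall x y, A x -> B y -> C (p *: x + q *: y)) ->
  (fine (leb n A)) `^ p * (fine (leb n B)) `^ q <= fine (leb n C).
Proof.
move=> p0 q0 pq; elim: n => [|n IH] A B C mA mB mC AK BK CK ABC.
  rewrite /= !indicE.
  have [A0|A0] := boolP (_ \in A); last by rewrite powR0 ?gt_eqF// mul0r.
  have [B0|B0] := boolP (_ \in B); last by rewrite powR0 ?gt_eqF// mulr0.
  rewrite !powR1 mulr1; rewrite !inE in A0 B0; have := ABC _ _ A0 B0.
  by rewrite !scaler0 addr0 => C0; rewrite mem_set.
have bK m (D : set (rVborel R m)) : measurable D -> (forall x, D x -> `|x| <= K) ->
    (leb m D <= leb m (box (const_mx (- K - 1)%R) (const_mx (K + 1)%R)))%E.
  move=> mD DK; apply: le_measure; rewrite ?inE//; first exact: box_measurable.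
  move=> x /DK xK i; rewrite !mxE; have := le_trans (coord_le_norm x i) xK.
  by rewrite ler_norml => /andP[h1 h2]; apply/andP; split; lra.
have bKfin m (D : set (rVborel R m)) : measurable D -> (forall x, D x -> `|x| <= K) ->
    leb m D \is a fin_num.
  by move=> mD DK; rewrite ge0_fin_numE// (le_lt_trans (bK _ _ mD DK))// leb_box_lty.
have DE (D : set (rVborel R n.+1)) : measurable D -> (forall x, D x -> `|x| <= K) ->
   exists L : measurableTypeR R -> R, [/\ measurable_fun setT L,
     forall t, leb n [set y | D (insert ord0 y t)] = (L t)%:E,
     forall t, 0 <= L t <= fine (leb n (box (const_mx (- K - 1)%R) (const_mx (K + 1)%R))),
     forall t, 0 < L t -> `|t| <= K &
     leb n.+1 D = (\int[mu]_t (L t)%:E)%E] /\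
     forall t, measurable ([set y | D (insert ord0 y t)] : set (rVborel R n)) /\
       forall y, D (insert ord0 y t) -> `|y| <= K.
  move=> mD DK.
  have mDt t : measurable ([set y | D (insert ord0 y t)] : set (rVborel R n)).
    have mf := measurableT_comp (@measurable_insertp R n ord0) (pair1_measurable t).
    by rewrite -[X in measurable X]setTI; exact: mf.
  have DKt t y : D (insert ord0 y t) -> `|y| <= K.
    move=> /DK; apply: le_trans; rewrite [leLHS]mx_normrE; apply/bigmax_leP; split=> //=.
    move=> [i j] _ /=; rewrite (ord1 i); apply: le_trans (coord_le_norm _ (lift ord0 j)).
    by rewrite insert_lift.
  exists (fun t => fine (leb n [set y | D (insert ord0 y t)])); split; last by move=> t; split=> // y; exact: DKt.
  have LE t : leb n [set y | D (insert ord0 y t)] = (fine (leb n [set y | D (insert ord0 y t)]))%:E.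
    by rewrite fineK//; apply: bKfin => // y; exact: DKt.
  have mL : measurable_fun setT (fun t : measurableTypeR R => leb n [set y | D (insert ord0 y t)]).
    have mS : measurable ((@insertp R n ord0) @^-1` D).
      by rewrite -[X in measurable X]setTI; apply: measurable_insertp.
    have := measurable_fun_xsection (leb n) mS.
    apply: eq_measurable_fun => t _; congr (leb n _); apply/seteqP; split=> y; first by move/xsectionP.
    by move=> Dy; apply/xsectionP.
  split=> //.
  - by apply/measurable_EFinP; apply: eq_measurable_fun mL => t _ /=; rewrite -LE.
  - move=> t; rewrite fine_ge0//= fine_le//; first by apply: bKfin => // y; exact: DKt.
      by rewrite ge0_fin_numE// leb_box_lty.
    by apply: bK => // y; exact: DKt.
  - move=> t Lt; have [[y Dy]|nD] := pselect (exists y, D (insert ord0 y t)).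
      have := le_trans (coord_le_norm _ ord0) (DK _ Dy).
      by rewrite insert_i.
    move: Lt; rewrite (_ : [set y | _] = set0) ?measure0 ?ltxx//.
    by apply/seteqP; split=> // y Dy; apply: nD; exists y.
  - rewrite -[D in LHS]setIT -(integral_indic _ measurableT mD).
    rewrite (tonelli_insert1 ord0 (proj1 (nnmeas_indic mD)) (proj2 (nnmeas_indic mD))).
    apply: eq_integral => t _; rewrite -LE -[X in leb n X]setIT.
    by rewrite -(integral_indic _ measurableT (mDt t)); apply: eq_integral => y _; rewrite !indicE.
have [F [[mF FE FM FK FI] FS]] := DE A mA AK.
have [G [[mG GE GM GK GI] GS]] := DE B mB BK.
have [H [[mH HE HM HK HI] HS]] := DE C mC CK.
have zero (L : measurableTypeR R -> R) : (forall t, 0 <= L t) -> ~ (exists t, 0 < L t) ->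
    (\int[mu]_t (L t)%:E = 0)%E.
  move=> L0 nL; apply: integral0_eq => t _; congr (_%:E); apply/eqP; rewrite eq_le L0 andbT leNgt.
  by apply/negP => Lt; apply: nL; exists t.
have [exF|nF] := pselect (exists t, 0 < F t); last first.
  by rewrite FI zero//= ?powR0 ?gt_eqF ?mul0r ?fine_ge0// => t; case/andP: (FM t).
have [exG|nG] := pselect (exists t, 0 < G t); last first.
  by rewrite GI zero//= ?powR0 ?gt_eqF ?mulr0 ?fine_ge0// => t; case/andP: (GM t).
rewrite -lee_fin fineK; last exact: bKfin.
rewrite HI; apply: (prekopa1 p0 q0 pq mF mG mH FM GM _ FK GK exF exG).
- by move=> t; case/andP: (HM t).
- move=> s t Fs Gt; have [mAs AsK] := FS s; have [mBt BtK] := GS t.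
  have [mCst CstK] := HS (p * s + q * t).
  have := IH _ _ _ mAs mBt mCst AsK BtK CstK; rewrite FE GE HE; apply.
  move=> x y /= Ax By; have := ABC _ _ Ax By; congr C.
  apply/rowP => j; case: (unliftP ord0 j) => [k|] ->; rewrite !mxE ?liftK ?unlift_none//.
  by rewrite !mxE.
- by rewrite -FI fineK//; exact: bKfin.
- by rewrite -GI fineK//; exact: bKfin.
Qed.

End brunn_minkowski.

(** * Euclidean balls and the volume of dilations *)

Section euclid2.
Context {R : realType} {n : nat}.
Implicit Types u v : 'rV[R]_n.

Lemma dotC u v : dot u v = dot v u.
Proof. by apply: eq_bigr => i _; rewrite mulrC. Qed.

Lemma dotDl u v w : dot (u + v) w = dot u w + dot v w.
Proof. by rewrite /dot -big_split; apply: eq_bigr => i _ /=; rewrite mxE mulrDl. Qed.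

Lemma dotZl c u v : dot (c *: u) v = c * dot u v.
Proof. by rewrite /dot big_distrr; apply: eq_bigr => i _ /=; rewrite mxE mulrA. Qed.

Lemma dot_le_enorm u v : dot u v <= enorm u * enorm v.
Proof.
have [->|v0] := eqVneq v 0.
  by rewrite {1}/dot big1 ?mulr_ge0 ?enorm_ge0// => i _; rewrite mxE mulr0.
have vv : 0 < dot v v.
  by rewrite -sqr_enorm exprn_gt0// lt_def enorm_eq0 v0 enorm_ge0.
have := dot_ge0 (dot v v *: u + (- dot u v) *: v).
rewrite dotDl !dotZl [dot u (_ + _)]dotC [dot v (_ + _)]dotC !dotDl !dotZl (dotC v u) => h.
have h2 : dot u v ^+ 2 <= dot u u * dot v v.
  rewrite -subr_ge0 -(pmulr_rge0 _ vv); apply: (le_trans h).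
  by rewrite le_eqVlt; apply/orP; left; apply/eqP; ring.
have [uv|uv] := leP 0 (dot u v); last first.
  by rewrite (le_trans (ltW uv))// mulr_ge0 ?enorm_ge0.
rewrite -(@ler_pXn2r _ 2) ?nnegrE ?mulr_ge0 ?enorm_ge0//.
by rewrite exprMn !sqr_enorm.
Qed.

Lemma enormZ c u : enorm (c *: u) = `|c| * enorm u.
Proof.
rewrite /enorm dotZl dotC dotZl mulrA -expr2 sqrtrM ?sqr_ge0// sqrtr_sqr//.
Qed.

Lemma enorm_ge_norm u : `|u| <= enorm u.
Proof.
rewrite [leLHS]mx_normrE; apply/bigmax_leP; split=> [|[i j] _ /=]; first exact: enorm_ge0.
rewrite (ord1 i) -sqrtr_sqr ler_wsqrtr// /dot (bigD1 j)//= -expr2 lerDl.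
by apply: sumr_ge0 => k _; rewrite -expr2 sqr_ge0.
Qed.

Lemma enormN u : enorm (- u) = enorm u.
Proof. by rewrite -scaleN1r enormZ normrN1 mul1r. Qed.

Lemma enorm_continuous (x : 'rV[R]_n) : {for x, continuous (@enorm R n)}.
Proof.
apply: (@cvg_enorm _ _ _ (nbhs_filter x)) => i; exact: coord_continuous.
Qed.

Lemma open_eball (r : R) : open [set x : 'rV[R]_n | enorm x < r].
Proof.
rewrite openE => x /= xr; have /(_ [set t | t < r]) := @enorm_continuous x.
by apply; exact: lt_nbhsl.
Qed.

Lemma open_leb_gt0 (U : set 'rV[R]_n) x : open U -> U x -> (0 < leb n U)%E.
Proof.
move=> oU Ux; have [p [xp pU]] := open_rbox oU Ux.
apply: (@lt_le_trans _ _ (leb n (rbox p))); last first.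
  apply: le_measure; rewrite ?inE; [exact: box_measurable|exact: open_measurable_rV|].
  by move=> y py; apply: pU; exact: box_cbox.
rewrite leb_box; elim/big_ind : _ => // [a b a0 b0|i _]; first exact: mule_gt0.
rewrite lebesgue_measure_itv /= lte_fin.
by case/andP: (xp i) => h1 h2; rewrite (lt_trans h1 h2) -EFinB lte_fin subr_gt0 (lt_trans h1 h2).
Qed.

End euclid2.

Section dilation.
Context {R : realType} {n : nat}.

Lemma leb_bounded_fin (D : set (rVborel R n)) K : measurable D -> (forall x, D x -> `|x| <= K) ->
  leb n D \is a fin_num.
Proof.
move=> mD DK; rewrite ge0_fin_numE//.
apply: le_lt_trans (leb_box_lty (const_mx (- K - 1)) (const_mx (K + 1))).
apply: le_measure; rewrite ?inE//; first exact: box_measurable.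
move=> x /DK xK i; rewrite !mxE; have := le_trans (coord_le_norm x i) xK.
by rewrite ler_norml => /andP[h1 h2]; apply/andP; split; lra.
Qed.

Definition dilation (A : set 'rV[R]_n) (e : R) : set 'rV[R]_n :=
  [set x | exists2 y, A y & enorm (x - y) < e].

Lemma open_dilation A e : open (dilation A e).
Proof.
rewrite openE => x [y Ay xy].
have : (z - y) @[z --> x] --> x - y.
  by apply: (@cvgB _ _ _ _ (nbhs_filter x)); [exact: cvg_id|exact: cvg_cst].
move=> /(_ [set u | enorm u < e]) H.
have : nbhs x [set z | enorm (z - y) < e].
  by apply: H; apply: open_nbhs_nbhs; split=> //; exact: open_eball.
by apply: (@filterS _ _ (nbhs_filter x)) => z zy; exists y.
Qed.

End dilation.

Section dilation_volume.
Context {R : realType} {n : nat}.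

Lemma alphaE : @alpha R n = fine (leb n.+1 [set x | enorm x < 1]).
Proof. by rewrite /alpha lebE//; apply: open_measurable_rV; exact: open_eball. Qed.

Lemma alpha_gt0 : 0 < @alpha R n.
Proof.
rewrite alphaE -lte_fin fineK; last first.
  apply: (@leb_bounded_fin _ _ _ 1); first by apply: open_measurable_rV; exact: open_eball.
  by move=> x /= x1; apply: le_trans (enorm_ge_norm x) (ltW x1).
apply: (@open_leb_gt0 _ _ _ 0); first exact: open_eball.
by rewrite /= (eqP (_ : enorm 0 == 0))// enorm_eq0.
Qed.

Lemma volume_radius_ge0 (A : set 'rV[R]_n.+1) : 0 <= volume_radius A.
Proof. exact: powR_ge0. Qed.

Lemma volume_radiusE (A : set 'rV[R]_n.+1) : measurable (A : set (rVborel R n.+1)) ->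
  fine (leb n.+1 A) = @alpha R n * volume_radius A ^+ n.+1.
Proof.
move=> mA; rewrite /volume_radius lebE//.
have d0 : 0 <= fine (leb n.+1 A) / @alpha R n by exact: (divr_ge0 (fine_ge0 (measure_ge0 _ _)) (ltW alpha_gt0)).
rewrite -powR_mulrn ?powR_ge0// -powRrM mulVf ?pnatr_eq0// powRr1//.
by rewrite mulrCA divff ?mulr1// gt_eqF// alpha_gt0.
Qed.

Lemma volume_radius_leb (A : set 'rV[R]_n.+1) K : measurable (A : set (rVborel R n.+1)) ->
  (forall x, A x -> `|x| <= K) -> leb n.+1 A = (@alpha R n * volume_radius A ^+ n.+1)%:E.
Proof. by move=> mA AK; rewrite -volume_radiusE// fineK//; exact: leb_bounded_fin AK. Qed.

(** With r the volume radius, A / r and the unit ball have the same volume alpha. Their convex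
    combination with weights r / (r + e) and e / (r + e) lies in the dilation of A divided by r + e,
    so the multiplicative inequality bounds the volume of that set below by alpha. *)
Lemma dilation_volume (A : set 'rV[R]_n.+1) K e x0 : open A -> A x0 ->
  (forall x, A x -> `|x| <= K) -> 0 < e ->
  @alpha R n * (volume_radius A + e) ^+ n.+1 <= fine (leb n.+1 (dilation A e)).
Proof.
move=> oA Ax0 AK e0; set r := volume_radius A; set al := @alpha R n.
have mA : measurable (A : set (rVborel R n.+1)) by exact: open_measurable_rV.
have al0 : 0 < al := alpha_gt0.
have AE : leb n.+1 A = (al * r ^+ n.+1)%:E := volume_radius_leb mA AK.
have r0 : 0 < r.
  rewrite lt_def volume_radius_ge0 andbT; apply/eqP => r0.
  by have := open_leb_gt0 oA Ax0; rewrite AE r0 exprS mul0r mulr0 ltxx.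
have m0 : 0 < r + e by rewrite addr_gt0.
pose BB : set 'rV[R]_n.+1 := [set x | enorm x < 1].
have mB : measurable (BB : set (rVborel R n.+1)) by apply: open_measurable_rV; exact: open_eball.
have mC : measurable (dilation A e : set (rVborel R n.+1)).
  by apply: open_measurable_rV; exact: open_dilation.
have mscale (c : R) (D : set (rVborel R n.+1)) : measurable D -> measurable ([set x | D (c *: x)] : set (rVborel R n.+1)).
  move=> mD; rewrite -[X in measurable X]setTI.
  have : measurable_fun setT ((fun x => c *: x) : rVborel R n.+1 -> rVborel R n.+1).
    apply: measurable_fun_rV => // i; under eq_fun do rewrite mxE.
    by apply: measurable_funM => //; exact: coord_measurable.
  exact.
have scE (c : R) (D : set (rVborel R n.+1)) : 0 < c -> measurable D ->
    leb n.+1 D = ((c ^+ n.+1)%:E * leb n.+1 [set x | D (c *: x)])%E.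
  move=> c0 mD; rewrite (leb_affine 0 c0 mD); congr (_ * leb _ _)%E.
  by apply/seteqP; split=> x /=; rewrite addr0.
have CK x : dilation A e x -> `|x| <= K + e.
  move=> [y Ay xy]; rewrite -(subrK y x) addrC (le_trans (ler_normD _ _))// lerD ?AK//.
  exact: le_trans (enorm_ge_norm _) (ltW xy).
have K0 : 0 <= K by apply: le_trans (AK _ Ax0).
pose A1 : set (rVborel R n.+1) := [set x | A (r *: x)].
pose C1 : set (rVborel R n.+1) := [set x | dilation A e ((r + e) *: x)].
have Zb c (D : set 'rV[R]_n.+1) k : 0 < c -> (forall x, D x -> `|x| <= k) ->
    forall x, D (c *: x) -> `|x| <= c^-1 * k.
  move=> c0 Dk x /Dk; rewrite normrZ gtr0_norm// => h.
  by rewrite mulrC ler_pdivlMr// mulrC.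
have A1K := Zb r A K r0 AK; have C1K := Zb _ _ _ m0 CK.
pose KK := Num.max 1 (Num.max (r^-1 * K) ((r + e)^-1 * (K + e))).
have pq : r / (r + e) + e / (r + e) = 1 by rewrite -mulrDl divff// gt_eqF.
have p0 : 0 < r / (r + e) by rewrite divr_gt0.
have q0 : 0 < e / (r + e) by rewrite divr_gt0.
have := @brunn_minkowski_mult R n.+1 _ _ KK p0 q0 pq A1 BB C1 (mscale _ _ mA) mB (mscale _ _ mC).
have A1E : fine (leb n.+1 A1) = al.
  have := scE r A r0 mA; rewrite AE -/A1.
  rewrite -(fineK (leb_bounded_fin (mscale _ _ mA) A1K)) -EFinM => -[].
  rewrite mulrC => /(mulfI _) -> //; by rewrite expf_neq0// gt_eqF.
rewrite A1E -/BB -[fine (leb n.+1 BB)]alphaE -/al -powRD; last by rewrite pq oner_eq0.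
rewrite pq powRr1 ?(ltW al0)// => BM.
rewrite (scE (r + e) _ m0 mC) -/C1 -(fineK (leb_bounded_fin (mscale _ _ mC) C1K)) -EFinM /=.
rewrite mulrC ler_wpM2l ?exprn_ge0 ?(ltW m0)//; apply: BM.
- by move=> x /A1K h; rewrite /KK !le_max h !orbT.
- by move=> x /= /ltW x1; rewrite /KK !le_max (le_trans (enorm_ge_norm _)).
- by move=> x /C1K h; rewrite /KK !le_max h !orbT.
move=> x y Ax By; exists (r *: x) => //.
have -> : (r + e) *: ((r / (r + e)) *: x + (e / (r + e)) *: y) - r *: x = e *: y.
  rewrite scalerDr !scalerA ![(r + e) * _]mulrC !divfK ?gt_eqF//.
  by rewrite addrAC subrr add0r.
by rewrite enormZ gtr0_norm// -ltr_pdivlMl// mulVf ?gt_eqF.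
Qed.

(** Bernoulli's inequality (r + e)^(n+1) >= r^(n+1) + (n+1) r^n e isolates the part linear in e,
    which is e times the area of the sphere of radius r. *)
Lemma dilation_volume_linear (A : set 'rV[R]_n.+1) K e x0 : open A -> A x0 ->
  (forall x, A x -> `|x| <= K) -> 0 < e ->
  ((n.+1%:R * @alpha R n * volume_radius A ^+ n * e)%:E <= leb n.+1 (dilation A e `\` A))%E.
Proof.
move=> oA Ax0 AK e0.
have mA : measurable (A : set (rVborel R n.+1)) by exact: open_measurable_rV.
have mC : measurable (dilation A e : set (rVborel R n.+1)).
  by apply: open_measurable_rV; exact: open_dilation.
have CK x : dilation A e x -> `|x| <= K + e.
  move=> [y Ay xy]; rewrite -(subrK y x) addrC (le_trans (ler_normD _ _))// lerD ?AK//.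
  exact: le_trans (enorm_ge_norm _) (ltW xy).
have AC : A `<=` dilation A e.
  by move=> x Ax; exists x => //; rewrite subrr (eqP (_ : enorm 0 == 0)) ?enorm_eq0.
rewrite measureD//; last by rewrite -ge0_fin_numE//; exact: leb_bounded_fin CK.
rewrite [X in (_ - X)%E](_ : _ = (@alpha R n * volume_radius A ^+ n.+1)%:E); last first.
  by rewrite (setIidr AC); exact: (volume_radius_leb mA AK).
rewrite [X in (X - _)%E](_ : _ = (fine (leb n.+1 (dilation A e)))%:E); last first.
  by apply/esym; exact: (fineK (leb_bounded_fin mC CK)).
rewrite -EFinB lee_fin.
rewrite lerBrDr; apply: le_trans (dilation_volume oA Ax0 AK e0).
set r := volume_radius A; have r0 : 0 <= r := volume_radius_ge0 A.
have bern m : r ^+ m.+1 + m.+1%:R * r ^+ m * e <= (r + e) ^+ m.+1.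
  elim: m => [|m IH]; first by rewrite expr0 !expr1 !mul1r.
  rewrite [leRHS]exprSr; apply: le_trans (ler_wpM2r (addr_ge0 r0 (ltW e0)) IH).
  have -> : (r ^+ m.+1 + m.+1%:R * r ^+ m * e) * (r + e) =
      r ^+ m.+2 + m.+2%:R * r ^+ m.+1 * e + m.+1%:R * r ^+ m * e * e.
    by rewrite -[m.+2%:R]natr1 !exprS; ring.
  by rewrite lerDl !mulr_ge0 ?exprn_ge0// ltW.
have -> : n.+1%:R * @alpha R n * r ^+ n * e + @alpha R n * r ^+ n.+1 =
    @alpha R n * (r ^+ n.+1 + n.+1%:R * r ^+ n * e) by ring.
by rewrite ler_wpM2l// ltW// alpha_gt0.
Qed.

End dilation_volume.

(** * The isoperimetric inequality integrated over an interval of levels *)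

Lemma half_triangle {R : realType} (u v w m : R) :
  `|u - v| < m / 2 -> `|u - w| < m / 2 -> v - w < m.
Proof. by rewrite !ltr_norml => /andP[? ?] /andP[? ?]; lra. Qed.

(** A Lebesgue number argument: a ball of half the local radius around a nearby centre is still
    inside the local ball. *)
Lemma unif_radius {R : realType} n (K : set 'rV[R]_n) (Q : 'rV[R]_n -> 'rV[R]_n -> Prop) :
  compact K ->
  (forall x, K x -> exists2 r : R, 0 < r & forall z w, ball x r z -> ball x r w -> Q z w) ->
  exists2 d : R, 0 < d & forall x, K x -> forall z w, ball x d z -> ball x d w -> Q z w.
Proof.
move=> /compact_near_coveringP cK hK.
have := cK R (0 : R)^'+ (fun d x => forall z w, ball x d z -> ball x d w -> Q z w) _.
move=> /(_ _) [].
  move=> x Kx; have [r r0 hr] := hK x Kx; have r20 : 0 < r / 2 by rewrite divr_gt0.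
  exists (ball x (r / 2), [set d | 0 < d < r / 2]) => /=.
    split; first exact: nbhsx_ballx.
    by near=> d; apply/andP; split => //; near: d; exact: nbhs_right_lt.
  move=> [y d] /= [xy /andP[d0 dr]] z w yz yw.
  have sub u : ball y d u -> ball x r u.
    move=> yu; rewrite (splitr r); apply: ball_triangle xy _; apply: le_ball yu; exact: ltW.
  by apply: hr; exact: sub.
move=> e /= e0 he; exists (e / 2); first by rewrite divr_gt0.
apply: (he (e / 2)) => /=; last by rewrite divr_gt0.
by rewrite sub0r normrN gtr0_norm ?divr_gt0// ltr_pdivrMr// ltr_pMr// ltr1n.
Unshelve. all: by end_near. Qed.

Section isoperimetric.
Context {R : realType} {n : nat}.
Variables (Omega : set 'rV[R]_n.+1) (psi : 'rV[R]_n.+1 -> R) (K : R).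
Hypotheses (oO : open Omega) (OK : forall x, Omega x -> `|x| <= K) (psiC1 : isC1 Omega psi)
  (psi_pos : forall x, Omega x -> 0 < psi x).

(** The extension by zero; it is continuous on the whole space when psi vanishes on the boundary,
    and its superlevel sets above a nonnegative level are those of psi in Omega. *)
Definition psib : 'rV[R]_n.+1 -> R := psi \_ Omega.
Hypothesis psib_cont : continuous psib.

Local Notation gr := (fun x => enorm (grad psi x)).
Local Notation sl s := (superlevel Omega psi s).

Lemma psib_Omega x : 0 < psib x -> Omega x.
Proof. by rewrite /psib patchE; case: ifPn; rewrite ?ltxx// inE. Qed.

Lemma psibE x : Omega x -> psib x = psi x.
Proof. by move=> Ox; rewrite /psib patchE mem_set. Qed.

Lemma superlevelE s : 0 <= s -> sl s = [set x | s < psib x].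
Proof.
move=> s0; apply/seteqP; split=> x /=; first by move=> [Ox]; rewrite psibE.
by move=> sx; have Ox := psib_Omega (le_lt_trans s0 sx); split=> //; rewrite -psibE.
Qed.

Lemma open_superlevel s : 0 <= s -> open (sl s).
Proof.
move=> s0; rewrite superlevelE//; rewrite openE => x /= sx.
by have /(_ [set r | s < r]) := @psib_cont x; apply; exact: lt_nbhsr.
Qed.

Lemma compact_psib_ge a : 0 < a -> compact [set x | a <= psib x].
Proof.
move=> a0; apply: (@subclosed_compact _ _ (cbox (const_mx (- K)) (const_mx K))).
- have : closed (psib @^-1` [set r | a <= r]).
    by apply: preimage_closed; [move=> x _; exact: psib_cont|exact: closed_ge].
  exact.
- exact: compact_cbox.
- move=> x /= ax i; rewrite !mxE -ler_norml; apply: le_trans (coord_le_norm _ _) _.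
  by apply: OK; apply: psib_Omega; exact: lt_le_trans ax.
Qed.

(** Mean value theorem on the segment from x to y and Cauchy-Schwarz. The gradient at the
    intermediate point is replaced by the gradient at x up to eta, with a radius uniform over the
    compact set {psib >= a}. *)
Lemma psi_increment a a' eta : 0 < a' -> a' < a -> 0 < eta ->
  exists2 d : R, 0 < d & forall e x y, 0 < e -> e <= d -> enorm (x - y) < e -> a <= psib y ->
    a' < psib x /\ psib y <= psib x + e * (gr x + eta).
Proof.
move=> a'0 a'a eta0; have a0 := lt_trans a'0 a'a.
pose Q (z w : 'rV[R]_n.+1) := [/\ Omega z, psib z - psib w < a - a' & gr z <= gr w + eta].
have [d d0 hd] : exists2 d : R, 0 < d & forall x, a <= psib x ->
    forall z w, ball x d z -> ball x d w -> Q z w.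
  apply: (unif_radius (compact_psib_ge a0)) => x /= ax.
  have Ox : Omega x by apply: psib_Omega; exact: lt_le_trans ax.
  have FF := nbhs_filter x.
  have n1 : nbhs x Omega by exact: open_nbhs_nbhs.
  have e1 : 0 < (a - a') / 2 by rewrite divr_gt0// subr_gt0.
  have e2 : 0 < eta / 2 by rewrite divr_gt0.
  have n2 : \forall z \near x, `|psib x - psib z| < (a - a') / 2.
    by have /cvgrPdist_lt := @psib_cont x; apply.
  have n3 : \forall z \near x, `|gr x - gr z| < eta / 2.
    by have /(@cvgrPdist_lt _ _ _ _ FF) := grad_continuous psiC1 Ox; apply.
  have : \forall z \near x, [/\ Omega z, `|psib x - psib z| < (a - a') / 2 & `|gr x - gr z| < eta / 2].
    apply: (@filterS3 _ _ FF _ _ _ _ _ n1 n2 n3) => z h1 h2 h3; by split.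
  move=> /nbhs_ballP[r /= r0 hr]; exists r => // z w /hr[Oz + +] /hr[Ow + +].
  move=> w1 w2 z1 z2; split=> //; first exact: half_triangle w1 z1.
  by rewrite -lerBlDl ltW//; exact: half_triangle w2 z2.
exists d => // e x y e0 ed xye ay; have By := hd y ay.
have yd : ball y d y by exact: ballxx.
have inball t : 0 <= t <= 1 -> ball y d (t *: (y - x) + x).
  move=> /andP[t0 t1]; rewrite -ball_normE /=.
  have -> : y - (t *: (y - x) + x) = (1 - t) *: (y - x).
    by rewrite scalerBl scale1r opprD addrA addrAC.
  rewrite normrZ ger0_norm ?subr_ge0//; apply: (@le_lt_trans _ _ `|y - x|).
    by rewrite ler_piMl// gerBl.
  by rewrite -normrN opprB (le_lt_trans (enorm_ge_norm _))// (lt_le_trans xye).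
have xd : ball y d x by have := inball 0; rewrite scale0r add0r lexx ler01; apply.
have [Ox xy1 _] := By x y xd yd; have [Oy yx1 _] := By y x yd xd.
split; first by lra.
have der (t : R) : 0 <= t <= 1 -> is_derive t (1 : R) (fun t => psi (t *: (y - x) + x))
    (\sum_k partial k psi (t *: (y - x) + x) * (y - x) ord0 k).
  move=> t01; have [Ot _ _] := By _ _ (inball t t01) yd.
  apply: (is_derive_curve (c := fun t => t *: (y - x) + x) (dc := fun k => (y - x) ord0 k) oO psiC1 Ot).
  move=> k; rewrite (_ : (fun _ => _) = fun s => s * (y - x) ord0 k + x ord0 k).
    exact: is_derive_affine.
  by apply/funext => s; rewrite !mxE.
have [t] := @mvt_from0 R (fun t => psi (t *: (y - x) + x)) _ 1
  (fun t ht => der t (ltac:(by move: ht; rewrite min_l// max_r))).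
rewrite min_l// max_r// => t01; rewrite scale1r scale0r add0r subrK mulr1 => E.
have [Ot _ gt] := By _ _ (inball t t01) xd.
rewrite (psibE Oy) (psibE Ox) -lerBlDl E.
apply: (@le_trans _ _ (gr (t *: (y - x) + x) * enorm (y - x))).
  apply: le_trans (dot_le_enorm _ _); rewrite /dot le_eqVlt; apply/orP; left; apply/eqP.
  by apply: eq_bigr => k _; rewrite [grad _ _ _ _]mxE.
rewrite mulrC ler_pM ?enorm_ge0//.
by rewrite -enormN opprB ltW.
Qed.

Local Notation mu := (@lebesgue_measure R).
Local Notation B := (rVborel R n.+1).

(** The area of the sphere bounding the ball with the volume of the superlevel set: the lower bound
    that isoperimetry gives for the perimeter. *)
Definition per (s : R) : R := n.+1%:R * @alpha R n * volume_radius (sl s) ^+ n.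

Lemma per_ge0 s : 0 <= per s.
Proof. by rewrite !mulr_ge0 ?exprn_ge0 ?volume_radius_ge0// ltW// alpha_gt0. Qed.

Lemma measurable_psib : measurable_fun setT (psib : B -> R).
Proof. by apply: continuous_measurable_rV. Qed.

Lemma measurable_leb_sl : measurable_fun setT (fun s : measurableTypeR R => leb n.+1 [set x | (s < psib x)%R]).
Proof.
pose S : set (measurableTypeR R * B) := [set z | z.1 < psib z.2].
have mS : measurable S.
  apply: measurable_lt_set; first exact: measurable_fst.
  exact: measurableT_comp measurable_psib measurable_snd.
have := measurable_fun_xsection (leb n.+1) mS.
apply: eq_measurable_fun => s _; congr (leb _ _); apply/seteqP; split=> x h.
  by have := proj1 (xsectionP s x S) h.
by apply: (proj2 (xsectionP s x S)).
Qed.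

Lemma measurable_volume_radius_sl :
  measurable_fun (`]0, +oo[%classic : set (measurableTypeR R)) (fun s : measurableTypeR R => volume_radius (sl s)).
Proof.
have mf : measurable_fun setT (fun s : measurableTypeR R =>
    (fine (leb n.+1 [set x | (s < psib x)%R]) / @alpha R n) `^ (n.+1%:R^-1)).
  apply: (measurableT_comp (measurable_powR _)); apply: measurable_funM => //.
  exact: (measurableT_comp (fine_measurable _) measurable_leb_sl).
apply: eq_measurable_fun (measurable_funTS mf) => s; rewrite inE/= in_itv/= andbT => s0.
rewrite /volume_radius lebE; first by rewrite superlevelE// ltW.
by apply: open_measurable_rV; apply: open_superlevel; exact: ltW.
Qed.

Lemma measurable_per : measurable_fun (`]0, +oo[%classic : set (measurableTypeR R)) (per : measurableTypeR R -> R).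
Proof.
apply: measurable_funM => //; apply: measurable_funX; exact: measurable_volume_radius_sl.
Qed.

(** The measure of a set S of pairs (s, x) is computed in two ways. At fixed s the slice contains
    the e-dilation of the superlevel set minus that set, of volume at least e times [per s]; at
    fixed x it lies in an interval of length e (|grad psi| + eta). The dilation may reach values
    slightly below a, hence the margin a'. *)
Lemma per_integral_le_eta a' a b eta x0 : 0 < a' -> a' < a -> Omega x0 -> b <= psi x0 -> 0 < eta ->
  (\int[mu]_(s in `]a, b[) (per s)%:E <=
   \int[leb n.+1]_(x in [set x | (a' < psib x < b)%R]) (gr x + eta)%:E)%E.
Proof.
move=> a'0 a'a Ox0 bx0 eta0; have a0 := lt_trans a'0 a'a.
(* A single e suffices: it appears as a factor on both sides and cancels, so no limit is taken. *)
have [e e0 he] := psi_increment a'0 a'a eta0.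
pose gO : B -> R := (fun x => gr x) \_ Omega.
have mg : measurable_fun setT gO by exact: measurable_enorm_grad.
have gO0 x : 0 <= gO x by rewrite /gO patchE; case: ifP => // _; exact: enorm_ge0.
have gOE x : Omega x -> gO x = gr x by move=> Ox; rewrite /gO patchE mem_set.
pose D : set B := [set x | (a' < psib x < b)%R].
have mD : measurable D.
  rewrite (_ : D = psib @^-1` `]a', b[%classic); last by apply/seteqP; split=> x /=; rewrite in_itv.
  rewrite -[X in measurable X]setTI; apply: measurable_psib => //; exact: measurable_itv.
pose S : set (measurableTypeR R * B) := [set z | [/\ a < z.1 < b, a' < psib z.2 < b,
   psib z.2 <= z.1 & z.1 < psib z.2 + e * (gO z.2 + eta)]].
have m2 : measurable_fun setT (fun z : measurableTypeR R * B => psib z.2).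
  exact: measurableT_comp measurable_psib measurable_snd.
have mS : measurable S.
  rewrite (_ : S = (`]a, b[%classic `*` D) `&` (~` [set z | z.1 < psib z.2] `&`
      [set z | z.1 < psib z.2 + e * (gO z.2 + eta)])); last first.
    apply/seteqP; split=> z /=; rewrite in_itv/=.
      by move=> [h1 h2 h3 h4]; split=> //; split=> //; apply/negP; rewrite -leNgt.
    by move=> [[h1 h2] [/negP h3 h4]]; split=> //; rewrite leNgt.
  apply: measurableI; first by apply: measurableX => //; exact: measurable_itv.
  apply: measurableI.
    by apply: measurableC; apply: measurable_lt_set => //; exact: measurable_fst.
  apply: measurable_lt_set; first exact: measurable_fst.
  apply: measurable_funD => //; apply: measurable_funM => //; apply: measurable_funD => //.
  exact: measurableT_comp mg measurable_snd.
have key s : a < s < b -> ((e * per s)%:E <= leb n.+1 (xsection S s))%E.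
  move=> sab; have /andP[as_ sb] := sab; have s0 := lt_trans a0 as_.
  have slx0 : sl s x0 by split=> //; exact: lt_le_trans bx0.
  have slK x : sl s x -> `|x| <= K by move=> [/OK].
  have oS := open_superlevel (ltW s0).
  rewrite mulrC; apply: le_trans (dilation_volume_linear oS slx0 slK e0) _.
  apply: le_measure; rewrite ?inE.
  - by apply: measurableD; apply: open_measurable_rV => //; exact: open_dilation.
  - exact: measurable_xsection.
  move=> x [[y + xy] nx]; rewrite superlevelE ?(ltW s0)//= => sy; apply: (proj2 (xsectionP s x S)).
  have ay : a <= psib y by rewrite (le_trans (ltW as_))// ltW.
  have [a'x yx] := he e x y e0 (lexx e) xy ay.
  have xs : psib x <= s.
    rewrite leNgt; apply/negP => sx; apply: nx; rewrite superlevelE//; exact: ltW.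
  split=> //=; first by rewrite a'x (le_lt_trans xs).
  rewrite gOE; first exact: lt_le_trans yx.
  by apply: psib_Omega; exact: lt_trans a'x.
have mX := measurable_fun_xsection (leb n.+1) mS.
have mper : measurable_fun (`]a, b[%classic : set (measurableTypeR R)) (fun s : measurableTypeR R => (per s)%:E).
  apply/measurable_EFinP; apply: measurable_funS measurable_per; first exact: measurable_itv.
  by move=> s /=; rewrite !in_itv/= andbT => /andP[/(lt_trans a0)].
have I1 : (e%:E * \int[mu]_(s in `]a, b[) (per s)%:E <= \int[mu]_s leb n.+1 (xsection S s))%E.
  rewrite -ge0_integralZl//; last 2 first.
  - by move=> s _; rewrite lee_fin per_ge0.
  - by rewrite lee_fin ltW.
  rewrite [X in (X <= _)%E]integral_mkcond; apply: ge0_le_integral => //.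
  - move=> s _; rewrite patchE; case: ifP => // _.
    by rewrite -EFinM lee_fin mulr_ge0 ?per_ge0// ltW.
  - by apply/(measurable_restrictT _ _).1; [exact: measurable_itv|exact: measurable_funeM].
  - move=> s _; rewrite patchE; case: ifPn; last by move=> _; exact: measure_ge0.
    by rewrite inE/= in_itv/= -EFinM; exact: key.
have I2 : (\int[mu]_s leb n.+1 (xsection S s) <=
    e%:E * \int[leb n.+1]_(x in D) (gr x + eta)%:E)%E.
  have nS : nnmeas (fun z => (\1_S z : R)%:E) := nnmeas_indic mS.
  have -> : (\int[mu]_s leb n.+1 (xsection S s) = \int[mu]_s \int[leb n.+1]_x (\1_S (s, x))%:E)%E.
    apply: eq_integral => s _; have mXs := measurable_xsection s mS.
    rewrite -[X in leb _ X]setIT -(integral_indic _ measurableT mXs).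
    by apply: eq_integral => x _; rewrite !indicE mem_xsection.
  have := @fubini_tonelli _ _ _ _ _ mu (leb n.+1) (fun z => (\1_S z : R)%:E) (proj1 nS) (proj2 nS).
  rewrite /= => ->.
  have mgD : measurable_fun D (fun x => (gO x + eta)%:E).
    by apply: measurable_funTS; apply/measurable_EFinP; exact: measurable_funD.
  have -> : (\int[leb n.+1]_(x in D) (gr x + eta)%:E = \int[leb n.+1]_(x in D) (gO x + eta)%:E)%E.
    apply: eq_integral => x; rewrite inE => /andP[ax _]; rewrite gOE//.
    by apply: psib_Omega; exact: lt_trans ax.
  have EY x : (\int[mu]_s (\1_S (s, x))%:E = mu (ysection S x))%E.
    rewrite -[X in mu X]setIT -(integral_indic _ measurableT (measurable_ysection x mS)).
    by apply: eq_integral => s _; rewrite !indicE mem_ysection.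
  rewrite -ge0_integralZl//; last 2 first.
  - by move=> x _; rewrite lee_fin addr_ge0// ltW.
  - by rewrite lee_fin ltW.
  rewrite [X in (_ <= X)%E]integral_mkcond; apply: ge0_le_integral => //.
  - by move=> x _; apply: integral_ge0 => s _; rewrite lee_fin.
  - by apply: eq_measurable_fun (measurable_fun_ysection mu mS) => x _; rewrite EY.
  - by apply/(measurable_restrictT _ _).1 => //; exact: measurable_funeM.
  move=> x _; have mYx := measurable_ysection x mS.
  rewrite EY patchE; case: ifPn; rewrite ?inE ?notin_setE => Dx; last first.
    rewrite (_ : ysection S x = set0) ?measure0//.
    by apply/seteqP; split=> // s h; have [_ h2] := proj1 (ysectionP s x S) h; case: Dx.
  apply: (@le_trans _ _ (mu `[psib x, (psib x + e * (gO x + eta))%R[%classic)).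
    apply: le_measure; rewrite ?inE//.
    by move=> s h; have [_ _ h3 h4] := proj1 (ysectionP s x S) h; rewrite /= in_itv/= h3.
  rewrite lebesgue_measure_itv/= lte_fin; case: ifP => _.
    by rewrite -EFinB lee_fin addrAC subrr add0r.
  by rewrite -EFinM lee_fin mulr_ge0 ?(ltW e0)// addr_ge0// ltW.
by have := le_trans I1 I2; rewrite lee_pmul2l// lte_fin.
Qed.

End isoperimetric.

(** * From integral inequalities to almost-everywhere ones; integrals off a null set *)

Import HBSimple HBNNSimple.

Section ae_comparison.
Context {R : realType}.
Local Notation mu := (@lebesgue_measure R).

(** The primitive of f is nondecreasing on ]c, d[, and by Lebesgue differentiation its derivative is
    f almost everywhere. *)
Lemma ae_ge0_of_intervals (f : R -> R) (c d : R) : mu.-integrable setT (EFin \o f) ->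
  (forall a b, c < a -> a < b -> b < d -> (0 <= \int[mu]_(x in `]a, b]) (f x)%:E)%E) ->
  {ae mu, forall x, c < x < d -> 0 <= f x}.
Proof.
move=> intf f0.
have iy (i : interval R) : mu.-integrable [set` i] (EFin \o f).
  by apply: integrableS intf => //; exact: measurable_itv.
have locf : locally_integrable setT f by apply: open_integrable_locally => //; exact: openT.
have := @FTC1Ny R f (fun y => iy _) locf; set F := fun x => _ => FTC.
apply: (@filterS _ _ (@ae_filter_ringOfSetsType _ (measurableTypeR R) R mu) _ _ _ FTC).
move=> x [dF <-] /andP[cx xd].
have incr y z : c < y -> y < z -> z < d -> F y <= F z.
  move=> cy yz zd; rewrite -subr_ge0 /F Rintegral_itvB//; first last.
    by rewrite bnd_simp ltW.
  by rewrite fine_ge0//; exact: f0.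
have dFE : derivable F x 1 by exact: dF.
rewrite derive1E; apply: limr_ge; first exact: dFE.
have lx : forall e : R, 0 < e -> \forall h \near (0 : R)^', h != 0 /\ `|h| < e.
  move=> e e0; near=> h; split.
    by near: h; exact: nbhs_dnbhs_neq.
  by near: h; apply: dnbhs0_lt.
have e1 : 0 < Num.min (x - c) (d - x) by rewrite lt_min !subr_gt0 cx xd.
apply: filterS (lx _ e1) => h [h0]; rewrite lt_min !ltr_norml => /andP[/andP[h1 h2] /andP[h3 h4]].
rewrite /GRing.scale/= mulr1; have [hp|hn|h00] := ltgtP 0 h; last by rewrite -h00 eqxx in h0.
  apply: mulr_ge0; first by rewrite invr_ge0 ltW.
  by rewrite subr_ge0; apply: incr; lra.
apply: mulr_le0; first by rewrite invr_le0 ltW.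
by rewrite subr_le0; apply: incr; lra.
Unshelve. all: by end_near.
Qed.

(** No measurability of f or g is assumed. A simple function below f, multiplied by the indicator of
    the complement of N, lies below g and has the same integral, so the two suprema agree. The
    rearranged functions are handled in this way. *)
Lemma ge0_integral_off d (T : measurableType d) (nu : {measure set T -> \bar R}) (D N : set T)
    (f g : T -> \bar R) : measurable N -> nu N = 0%E ->
  (forall x, D x -> (0 <= f x)%E) -> (forall x, D x -> (0 <= g x)%E) ->
  (forall x, D x -> ~ N x -> f x = g x) ->
  (\int[nu]_(x in D) f x = \int[nu]_(x in D) g x)%E.
Proof.
move=> mN N0; pose fg (f g : T -> \bar R) := forall x, ~ N x -> (f x <= g x)%E.
have H (u v : T -> \bar R) : (forall x, (0 <= u x)%E) -> (forall x, (0 <= v x)%E) -> fg u v ->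
    (\int[nu]_x u x <= \int[nu]_x v x)%E.
  move=> u0 v0 uv; rewrite !ge0_integralTE//; apply: ub_ereal_sup => _ [h hu <-].
  apply: ereal_sup_ubound; exists (mul_nnsfun h (indic_nnsfun R (measurableC mN))).
    move=> x; change ((h x * \1_(~` N) x : R)%:E <= v x)%E; rewrite indicE; case: (pselect (N x)) => Nx.
      by rewrite memNset ?mulr0//= => /(_ Nx).
    by rewrite mem_set ?mulr1//=; apply: le_trans (hu x) _; exact: uv.
  rewrite -!integralT_nnsfun; apply: ge0_ae_eq_integral => //.
  - exact/measurable_EFinP.
  - exact/measurable_EFinP.
  - by move=> x _; rewrite lee_fin.
  - by move=> x _; rewrite lee_fin.
  exists N; split=> // x /= /not_implyP[_]; apply: contra_notP => Nx.
  by congr EFin; change (h x * \1_(~` N) x = h x :> R); rewrite indicE mem_set ?mulr1.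
move=> f0 g0 E; rewrite [LHS]integral_mkcond [RHS]integral_mkcond.
apply/eqP; rewrite eq_le; apply/andP; split; apply: H => x; rewrite ?erestrict_ge0//.
  by move=> Nx; rewrite !patchE; case: ifPn => // /set_mem Dx; rewrite E.
by move=> Nx; rewrite !patchE; case: ifPn => // /set_mem Dx; rewrite E.
Qed.

Lemma integral_off d (T : measurableType d) (nu : {measure set T -> \bar R}) (D N : set T)
    (f g : T -> \bar R) : measurable N -> nu N = 0%E ->
  (forall x, D x -> ~ N x -> f x = g x) ->
  (\int[nu]_(x in D) f x = \int[nu]_(x in D) g x)%E.
Proof.
move=> mN N0 E; rewrite [LHS]integralE [RHS]integralE; congr (_ - _)%E.
  by apply: (ge0_integral_off mN N0) => // x Dx Nx; rewrite funeposE E// -funeposE.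
by apply: (ge0_integral_off mN N0) => // x Dx Nx; rewrite funenegE E// -funenegE.
Qed.

End ae_comparison.

(** * Primitives of bounded functions and the weighted energy identity *)

Section primitives.
Context {R : realType}.
Local Notation mu := (@lebesgue_measure R).

Definition bmeas (r0 : R) (a : R -> R) :=
  measurable_fun (`[0, r0]%classic : set (measurableTypeR R)) (a : measurableTypeR R -> R) /\
  exists C, forall x, 0 <= x <= r0 -> `|a x| <= C.

(** A is Lipschitz on [0, r0] with derivative a almost everywhere, stated through integrals so that
    no pointwise derivative appears. *)
Definition prim (r0 : R) (a A : R -> R) := bmeas r0 a /\
  forall s t, 0 <= s -> s <= t -> t <= r0 -> A t - A s = \int[mu]_(x in `[s, t]) a x.

Lemma bmeasD r0 a b : bmeas r0 a -> bmeas r0 b -> bmeas r0 (fun x => a x + b x).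
Proof.
move=> [ma [C aC]] [mb [C' bC]]; split; first exact: measurable_funD.
by exists (C + C') => x xr; apply: le_trans (ler_normD _ _) (lerD (aC x xr) (bC x xr)).
Qed.

Lemma bmeasM r0 a b : bmeas r0 a -> bmeas r0 b -> bmeas r0 (fun x => a x * b x).
Proof.
move=> [ma [C aC]] [mb [C' bC]]; split; first exact: measurable_funM.
by exists (C * C') => x xr; rewrite normrM ler_pM ?aC ?bC.
Qed.

Lemma bmeasN r0 a : bmeas r0 a -> bmeas r0 (fun x => - a x).
Proof.
move=> [ma [C aC]]; split; first exact: measurableT_comp.
by exists C => x xr; rewrite normrN aC.
Qed.

Lemma bmeas_cst r0 c : bmeas r0 (fun=> c).
Proof. by split; [exact: measurable_cst|exists `|c|]. Qed.

Lemma itv_leb (s t : R) : s <= t -> mu `[s, t] = (t - s)%:E.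
Proof. by move=> st; rewrite lebesgue_measure_itv/= lte_fin; case: ltgtP st => // <-; rewrite subrr. Qed.

Lemma bmeas_integrable r0 a s t : bmeas r0 a -> 0 <= s -> t <= r0 ->
  mu.-integrable `[s, t] (EFin \o a).
Proof.
move=> [ma [C aC]] s0 tr.
have sub : (`[s, t]%classic : set R) `<=` `[0, r0]%classic.
  by move=> x /=; rewrite !in_itv/= => /andP[h1 h2]; apply/andP; split; lra.
apply: measurable_bounded_integrable.
- exact: measurable_itv.
- by have [st|ts] := leP s t; [change (mu `[s, t] < +oo)%E; rewrite itv_leb ?ltry|rewrite set_itv_ge ?measure0// bnd_simp -ltNge].
- by apply: measurable_funS ma => //; exact: measurable_itv.
- exists C; split; first exact: num_real.
  move=> z Cz x /= /sub /=; rewrite in_itv/= => xr; exact: le_trans (aC x xr) (ltW Cz).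
Qed.

Lemma Rintegral_itv_bound (a : R -> R) s t C : 0 <= s -> s <= t ->
  mu.-integrable `[s, t] (EFin \o a) -> (forall x, s <= x <= t -> `|a x| <= C) ->
  `|\int[mu]_(x in `[s, t]) a x| <= C * (t - s).
Proof.
move=> s0 st ia aC; apply: (le_trans (@le_normr_Rintegral _ _ _ mu _ _ (measurable_itv `[s, t]) ia)).
have -> : C * (t - s) = \int[mu]_(x in `[s, t]) C.
  by rewrite Rintegral_cst//= itv_leb.
apply: le_Rintegral => //; first exact: integrable_norm.
  by apply: (@bmeas_integrable t (fun=> C)) => //; exact: bmeas_cst.
Qed.

Section on_interval.
Variable r0 : R.
Implicit Types a b A B : R -> R.

Lemma prim_lip a A : prim r0 a A -> exists2 C, 0 <= C & forall s t, 0 <= s -> s <= t -> t <= r0 ->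
  `|A t - A s| <= C * (t - s).
Proof.
move=> [ba Aa]; have [_ [C aC]] := ba; exists `|C| => // s t s0 st tr.
rewrite Aa//; apply: Rintegral_itv_bound => //; first exact: bmeas_integrable ba s0 tr.
move=> x /andP[sx xt]; apply: le_trans (ler_norm C); apply: aC.
by rewrite (le_trans s0 sx) (le_trans xt tr).
Qed.

Lemma lip_bmeas A C : (forall s t, 0 <= s -> s <= t -> t <= r0 -> `|A t - A s| <= C * (t - s)) ->
  bmeas r0 A.
Proof.
move=> AC; have [r00|r00] := leP 0 r0; last first.
  split; last by exists 0 => x /andP[x0 xr]; lra.
  by rewrite set_itv_ge ?bnd_simp -?ltNge//; exact: measurable_fun_set0.
(* Clamping to [0, r0] turns A into a globally Lipschitz function, hence a continuous and measurable
   one. *)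
pose k x := Num.min (Num.max 0 x) r0.
have k0 x : 0 <= k x by rewrite /k le_min le_max lexx r00.
have kr x : k x <= r0 by rewrite /k ge_min lexx orbT.
have kid x : 0 <= x <= r0 -> k x = x.
  by move=> /andP[x0 xr]; rewrite /k (max_idPr x0) (min_idPl xr).
have kl x y : x <= y -> k x <= k y /\ k y - k x <= y - x.
  move=> xy; rewrite /k !minEle !maxEle; do ! case: ifPn; rewrite -?ltNge => *; split; lra.
have C0 x y : `|A (k x) - A (k y)| <= `|C| * `|x - y|.
  wlog xy : x y / y <= x.
    by move=> H; have [|yx] := leP y x; [exact: H|rewrite distrC (distrC x); apply: H; exact: ltW].
  have [k1 k2] := kl _ _ xy.
  apply: le_trans (AC _ _ (k0 _) k1 (kr _)) _; apply: le_trans (ler_norm _) _.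
  by rewrite normrM ler_wpM2l// !ger0_norm ?subr_ge0.
split; last first.
  exists (`|A 0| + `|C| * r0) => x /andP[x0 xr].
  have := AC 0 x (lexx _) x0 xr; rewrite subr0 => H.
  rewrite -[A x](subrK (A 0)) addrC; apply: le_trans (ler_normD _ _) _; rewrite lerD2l.
  apply: le_trans H _; apply: le_trans (ler_norm _) _; rewrite normrM ler_wpM2l//.
  by rewrite ger0_norm.
apply: (eq_measurable_fun (A \o k)).
  by move=> x; rewrite inE/= in_itv/= => xr; rewrite kid.
apply: measurable_funTS; apply: continuous_measurable_fun => x.
apply/cvgrPdist_le => e e0; near=> y.
apply: le_trans (C0 _ _) _.
have : `|x - y| < e / (`|C| + 1).
  near: y; apply: (@cvgr_dist_lt _ _ _ (nbhs x)) => //; by rewrite divr_gt0// ltr_wpDl.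
rewrite ltr_pdivlMr ?ltr_wpDl// mulrDr mulr1 [_ * `|C|]mulrC => H.
by have := normr_ge0 (x - y); lra.
Unshelve. all: by end_near.
Qed.

Lemma prim_bmeas a A : prim r0 a A -> bmeas r0 A.
Proof. by move=> /prim_lip[C _ /lip_bmeas]. Qed.

(** Over N equal steps the increments add up to at most C (t - s)^2 / N, which tends to 0. *)
Lemma quad_const (D : R -> R) C :
  (forall s t, 0 <= s -> s <= t -> t <= r0 -> `|D t - D s| <= C * (t - s) ^+ 2) ->
  forall s t, 0 <= s -> s <= t -> t <= r0 -> D t = D s.
Proof.
move=> DC s t s0 st tr; have H n : `|D t - D s| * n.+1%:R <= C * (t - s) ^+ 2.
  have n0 : (0 : R) < n.+1%:R by [].
  pose d := (t - s) / n.+1%:R.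
  have d0 : 0 <= d by rewrite divr_ge0// subr_ge0.
  have dn : n.+1%:R * d = t - s by rewrite /d mulrCA divff ?mulr1// gt_eqF.
  have G k : (k <= n.+1)%N -> `|D (s + k%:R * d) - D s| <= k%:R * (C * d ^+ 2).
    elim: k => [|k IH] kn; first by rewrite !mul0r addr0 subrr normr0.
    have kd : k.+1%:R * d <= t - s by rewrite -dn ler_wpM2r// ler_nat.
    have kd0 : 0 <= k%:R * d by rewrite mulr_ge0.
    have -> : k.+1%:R = k%:R + 1 :> R by rewrite -natr1.
    rewrite -natr1 mulrDl mul1r in kd.
    have := IH (ltnW kn).
    have := DC (s + k%:R * d) (s + (k%:R + 1) * d) _ _ _.
    rewrite (_ : s + (k%:R + 1) * d - (s + k%:R * d) = d); last by ring.
    move=> /(_ ltac:(lra) ltac:(lra) ltac:(lra)) h1 h2.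
    have -> : D (s + (k%:R + 1) * d) - D s =
      (D (s + (k%:R + 1) * d) - D (s + k%:R * d)) + (D (s + k%:R * d) - D s) by ring.
    apply: le_trans (ler_normD _ _) _; lra.
  have := G n.+1 (leqnn _); rewrite dn (_ : s + (t - s) = t); last by ring.
  move=> H; apply: le_trans (ler_wpM2r (ltW n0) H) _.
  by rewrite -dn le_eqVlt; apply/orP; left; apply/eqP; ring.
apply/eqP; rewrite -subr_eq0 -normr_le0 leNgt; apply/negP => X0.
set X := `|_| in X0 H; set Y := C * _ in H.
have Y0 : 0 <= Y by apply: le_trans (H 0%N); rewrite mulr_ge0// ltW.
have := H (Num.bound (Y / X)); rewrite leNgt => /negP; apply.
rewrite -ltr_pdivrMl// mulrC; apply: lt_le_trans (archi_boundP _) _; first by rewrite divr_ge0// ltW.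
by rewrite ler_nat.
Qed.

(** A quadratic error on short intervals forces no error at all, by [quad_const]. The product and
    exponential rules thus each reduce to one local estimate. *)
Lemma prim_intro a A C : bmeas r0 a ->
  (forall s t, 0 <= s -> s <= t -> t <= r0 ->
    `|A t - A s - \int[mu]_(x in `[s, t]) a x| <= C * (t - s) ^+ 2) -> prim r0 a A.
Proof.
move=> ba AC; split=> // s t s0 st tr.
have i0 u v : 0 <= u -> v <= r0 -> mu.-integrable `[u, v] (EFin \o a).
  exact: bmeas_integrable.
have B u v : 0 <= u -> u <= v -> v <= r0 ->
    \int[mu]_(x in `[0, v]) a x - \int[mu]_(x in `[0, u]) a x = \int[mu]_(x in `[u, v]) a x.
  move=> u0 uv vr; rewrite Rintegral_itvB ?bnd_simp//; last exact: i0.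
  rewrite Rintegral_itv_obnd_cbnd//.
  by apply: integrableS (i0 u v _ _) => //; apply: subset_itvr; rewrite bnd_simp.
have := @quad_const (fun t => A t - \int[mu]_(x in `[0, t]) a x) C _ s t s0 st tr.
have QC u v : 0 <= u -> u <= v -> v <= r0 -> `|(A v - \int[mu]_(x in `[0, v]) a x) -
    (A u - \int[mu]_(x in `[0, u]) a x)| <= C * (v - u) ^+ 2.
  move=> u0 uv vr.
  rewrite (_ : _ - _ = A v - A u - \int[mu]_(x in `[u, v]) a x); first exact: AC.
  by rewrite -B//; ring.
by move=> /(_ QC) E; rewrite -B//; move: E; lra.
Qed.

Lemma primM a A b B : prim r0 a A -> prim r0 b B ->
  prim r0 (fun x => a x * B x + A x * b x) (fun x => A x * B x).
Proof.
move=> pA pB; have [ba Aa] := pA; have [bb Bb] := pB.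
have [C C0 AC] := prim_lip pA; have [C' C'0 BC] := prim_lip pB.
have bA := prim_bmeas pA; have bB := prim_bmeas pB.
have [_ [K aK]] := ba; have [_ [K' bK]] := bb.
apply: (@prim_intro _ _ (K * C' + C * K')).
  by apply: bmeasD; exact: bmeasM.
move=> s t s0 st tr.
have ii f : bmeas r0 f -> mu.-integrable `[s, t] (EFin \o f) by move=> bf; exact: bmeas_integrable bf s0 tr.
(* The increment of A B equals the integral of a B(s) + A(t) b; the error is what freezing B at s
   and A at t costs, which is quadratic as both are Lipschitz. *)
rewrite (_ : _ - _ = \int[mu]_(x in `[s, t]) (a x * (B s - B x) + (A t - A x) * b x)).
  rewrite [leRHS](_ : _ = ((K * C' + C * K') * (t - s)) * (t - s)); last by ring.
  apply: Rintegral_itv_bound => //.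
    by apply: ii; apply: bmeasD; apply: bmeasM => //; apply: bmeasD;
      [exact: bmeas_cst|exact: bmeasN|exact: bmeas_cst|exact: bmeasN].
  move=> x /andP[sx xt].
  have xr : 0 <= x <= r0 by rewrite (le_trans s0 sx) (le_trans xt tr).
  apply: le_trans (ler_normD _ _) _; rewrite !normrM.
  have h1 := BC s x s0 sx (le_trans xt tr); have h2 := AC x t (le_trans s0 sx) xt tr.
  rewrite distrC in h1.
  have k1 := aK x xr; have k2 := bK x xr.
  have h1' : `|B s - B x| <= C' * (t - s) by apply: le_trans h1 _; rewrite ler_wpM2l// lerD2r.
  have h2' : `|A t - A x| <= C * (t - s) by apply: le_trans h2 _; rewrite ler_wpM2l// lerD2l lerN2.
  rewrite [leRHS](_ : _ = K * (C' * (t - s)) + (C * (t - s)) * K'); last by ring.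
  by apply: lerD; apply: ler_pM.
have -> : \int[mu]_(x in `[s, t]) (a x * (B s - B x) + (A t - A x) * b x) =
    \int[mu]_(x in `[s, t]) ((a x * B s + A t * b x) - (a x * B x + A x * b x)).
  by apply: eq_Rintegral => x _; ring.
have ba1 : bmeas r0 (fun x => a x * B s) by apply: bmeasM ba (bmeas_cst _ _).
have ba2 : bmeas r0 (fun x => A t * b x) by apply: bmeasM (bmeas_cst _ _) bb.
rewrite RintegralB//; [|by apply: ii; exact: bmeasD|by apply: ii; apply: bmeasD; exact: bmeasM].
rewrite (RintegralD _ (ii _ ba1) (ii _ ba2))//.
rewrite RintegralZr//; last exact: ii.
rewrite RintegralZl//; last exact: ii.
by rewrite -Aa// -Bb//; ring.
Qed.

(** As u is nondecreasing, the integral of w e^(-u) lies between u(t) - u(s) times the two extreme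
    values of e^(-u), and by convexity so does the decrease of e^(-u). The gap is at most the
    product of two Lipschitz increments. *)
Lemma prim_expN w u : prim r0 w u -> (forall x, 0 <= x <= r0 -> 0 <= w x) ->
  (forall x, 0 <= x <= r0 -> 0 <= u x) ->
  prim r0 (fun x => - (w x * expR (- u x))) (fun x => expR (- u x)).
Proof.
move=> pu w0 u0; have [bw uw] := pu; have [C C0 uC] := prim_lip pu.
have mono s t : 0 <= s -> s <= t -> t <= r0 -> u s <= u t.
  move=> s0 st tr; rewrite -subr_ge0 uw//; apply: Rintegral_ge0 => x /=.
  rewrite in_itv/= => /andP[h1 h2]; apply: w0; rewrite (le_trans s0 h1); exact: le_trans h2 tr.
have E1 x y : expR (- x) - expR (- y) <= (y - x) * expR (- x) :> R.
  have -> : expR (- y) = expR (- x) * expR (x - y) by rewrite -expRD; congr expR; ring.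
  have := expR_ge1Dx (x - y); have := expR_gt0 (- x); nra.
have e1 x : 0 <= x <= r0 -> expR (- u x) <= 1.
  by move=> xr; rewrite -expR0 ler_expR oppr_le0 u0.
have EC s t : 0 <= s -> s <= t -> t <= r0 -> `|expR (- u t) - expR (- u s)| <= C * (t - s).
  move=> s0 st tr; rewrite distrC ger0_norm ?subr_ge0 ?ler_expR ?lerN2 ?mono//.
  apply: le_trans (E1 _ _) _; apply: le_trans (le_trans (ler_norm _) (uC _ _ s0 st tr)).
  rewrite ler_piMr ?subr_ge0 ?mono// e1// s0; exact: le_trans st tr.
have bE := lip_bmeas EC.
have bwE : bmeas r0 (fun x => w x * expR (- u x)) by exact: bmeasM.
apply: (@prim_intro _ _ (C * C)); first exact: bmeasN.
move=> s t s0 st tr.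
have ii f : bmeas r0 f -> mu.-integrable `[s, t] (EFin \o f) by move=> bf; exact: bmeas_integrable bf s0 tr.
have sr : 0 <= s <= r0 by rewrite s0 (le_trans st tr).
have Itv x : s <= x <= t -> 0 <= x <= r0.
  by move=> /andP[h1 h2]; rewrite (le_trans s0 h1) (le_trans h2 tr).
rewrite (_ : \int[mu]_(x in `[s, t]) (- (w x * expR (- u x))) =
   - \int[mu]_(x in `[s, t]) (w x * expR (- u x))); last first.
  rewrite -mulN1r -RintegralZl//; last exact: ii.
  by apply: eq_Rintegral => x _; rewrite mulN1r.
have I1 : \int[mu]_(x in `[s, t]) (w x * expR (- u x)) <= (u t - u s) * expR (- u s).
  rewrite uw// -RintegralZr//; last exact: ii.
  apply: le_Rintegral => //; [exact: ii|by apply: ii; apply: bmeasM bw (bmeas_cst _ _)|].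
  move=> x /=; rewrite in_itv/= => xst; have /andP[sx xt] := xst; rewrite ler_wpM2l ?w0 ?Itv//.
  by rewrite ler_expR lerN2 mono// (le_trans xt tr).
have I2 : (u t - u s) * expR (- u t) <= \int[mu]_(x in `[s, t]) (w x * expR (- u x)).
  rewrite uw// -RintegralZr//; last exact: ii.
  apply: le_Rintegral => //; [by apply: ii; apply: bmeasM bw (bmeas_cst _ _)|exact: ii|].
  move=> x /=; rewrite in_itv/= => xst; have /andP[sx xt] := xst; rewrite ler_wpM2l ?w0 ?Itv//.
  by rewrite ler_expR lerN2 mono// (le_trans s0 sx).
move: I1 I2; set I := \int[mu]_(x in _) _ => I1 I2.
have J1 := E1 (u s) (u t); have J2 := E1 (u t) (u s).
have D0 : 0 <= u t - u s by rewrite subr_ge0 mono.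
have D1 := le_trans (ler_norm _) (uC _ _ s0 st tr); have D2 := e1 _ sr.
have es := expR_gt0 (- u s); have et := expR_gt0 (- u t).
have DD : (u t - u s) * (expR (- u s) - expR (- u t)) <= C * C * (t - s) ^+ 2.
  rewrite [leRHS](_ : _ = (C * (t - s)) * (C * (t - s))); last by ring.
  have h := EC s t s0 st tr; rewrite distrC in h.
  have h' := le_trans (ler_norm _) h.
  apply: ler_pM => //; by rewrite subr_ge0 ler_expR lerN2 mono.
have K1 : (u t - u s) * expR (- u t) <= expR (- u s) - expR (- u t) by move: J2; lra.
rewrite ler_norml; move: I1 I2 J1 K1 DD; rewrite mulrBr.
move: ((u t - u s) * expR (- u s)) ((u t - u s) * expR (- u t)) (C * C * _) (expR _) (expR _).
by move=> *; apply/andP; split; lra.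
Qed.

End on_interval.

(** The derivative of p h e^(-u) is integrated over [0, r0]; its boundary terms vanish because h is
    0 at 0 and p is 0 at r0. *)
Lemma weighted_energy (r0 : R) (g p k h w u : R -> R) : 0 <= r0 ->
  prim r0 (fun x => - g x) p -> p r0 = 0 -> prim r0 k h -> h 0 = 0 ->
  prim r0 w u -> (forall x, 0 <= x <= r0 -> 0 <= w x) -> (forall x, 0 <= x <= r0 -> 0 <= u x) ->
  \int[mu]_(x in `[0, r0]) (g x * h x * expR (- u x)) =
  \int[mu]_(x in `[0, r0]) (p x * (k x - h x * w x) * expR (- u x)).
Proof.
move=> r00 pp p0 ph h0 pu w0 u0.
have pE := prim_expN pu w0 u0.
have pQ := primM pp (primM ph pE).
have [_ /(_ 0 r0 (lexx _) r00 (lexx _))] := pQ; rewrite p0 h0 !mul0r mulr0 subrr.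
have bE := prim_bmeas pE; have bg : bmeas r0 g.
  by have [/bmeasN] := pp; under eq_fun do rewrite opprK.
have b1 : bmeas r0 (fun x => g x * h x * expR (- u x)).
  by apply: bmeasM bE; apply: bmeasM bg (prim_bmeas ph).
have b2 : bmeas r0 (fun x => p x * (k x - h x * w x) * expR (- u x)).
  apply: bmeasM bE; apply: bmeasM (prim_bmeas pp) _; apply: bmeasD; first exact: ph.1.
  by apply: bmeasN; apply: bmeasM (prim_bmeas ph) pu.1.
have ii f : bmeas r0 f -> mu.-integrable `[0, r0] (EFin \o f) by move=> bf; exact: bmeas_integrable bf _ _.
move=> H; apply/eqP; rewrite -subr_eq0 -oppr_eq0 opprB; apply/eqP.
rewrite -RintegralB//; [|exact: ii|exact: ii].
by rewrite [RHS]H; apply: eq_Rintegral => x _; ring.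
Qed.

End primitives.

(** * Polar coordinates for radial functions *)

Section ray_measures.
Context {R : realType}.

Lemma R_measure_unique_gt (m1 m2 : {measure set (measurableTypeR R) -> \bar R}) :
  (forall a : R, m1 `]a, +oo[%classic = m2 `]a, +oo[%classic) ->
  (forall a : R, m1 `]a, +oo[%classic < +oo)%E ->
  forall A, measurable A -> m1 A = m2 A.
Proof.
move=> m12 m1oo A mA.
have {}mA : <<s (@RGenOInfty.G R) >> A by move: mA; rewrite RGenOInfty.measurableE.
move: A mA; apply: (@g_sigma_algebra_measure_unique _ _ (measurableTypeR R) (@RGenOInfty.G R) _
  (fun k => `](- k%:R)%R, +oo[%classic)) => //.
- by move=> _ [a ->].
- by move=> k; exists (- k%:R).
- apply/seteqP; split => // x _; exists (Num.trunc `|x|).+1 => //=.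
  rewrite in_itv/= andbT ltrNl; apply: le_lt_trans (truncnS_gt _).
  by rewrite -normrN ler_norm.
- move=> _ _ [a ->] [c ->]; exists (Num.max a c).
  by apply/seteqP; split=> x /=; rewrite !in_itv/= !andbT gt_max => /andP.
- by move=> _ [a ->]; exact: m12.
Qed.

Lemma R_measure_unique_lt (m1 m2 : {measure set (measurableTypeR R) -> \bar R}) :
  (forall a : R, m1 `]-oo, a[%classic = m2 `]-oo, a[%classic) ->
  (forall a : R, m1 `]-oo, a[%classic < +oo)%E ->
  forall A, measurable A -> m1 A = m2 A.
Proof.
move=> m12 m1oo A mA.
have {}mA : <<s (@RGenInftyO.G R) >> A by move: mA; rewrite RGenInftyO.measurableE.
move: A mA; apply: (@g_sigma_algebra_measure_unique _ _ (measurableTypeR R) (@RGenInftyO.G R) _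
  (fun k => `]-oo, k%:R[%classic)) => //.
- by move=> _ [a ->].
- by move=> k; exists k%:R.
- apply/seteqP; split => // x _; exists (Num.trunc `|x|).+1 => //=.
  rewrite in_itv/=; apply: le_lt_trans (truncnS_gt _); exact: ler_norm.
- move=> _ _ [a ->] [c ->]; exists (Num.min a c).
  by apply/seteqP; split=> x /=; rewrite !in_itv/= lt_min => /andP.
- by move=> _ [a ->]; exact: m12.
Qed.

End ray_measures.

Section polar.
Context {R : realType} {n : nat}.
Local Notation mu := (@lebesgue_measure R).
Local Notation al := (@alpha R n).

Definition sphere_area (r : R) : R := n.+1%:R * al * r ^+ n.

Lemma sphere_area_ge0 r : 0 <= r -> 0 <= sphere_area r.
Proof. by move=> r0; rewrite /sphere_area !mulr_ge0 ?exprn_ge0// ltW ?alpha_gt0. Qed.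

Lemma sphere_area_gt0 r : 0 < r -> 0 < sphere_area r.
Proof. by move=> r0; rewrite /sphere_area !mulr_gt0 ?exprn_gt0// alpha_gt0. Qed.

Lemma is_derive_sphere_area (r : R) : is_derive r 1 (fun r => al * r ^+ n.+1) (sphere_area r).
Proof.
have -> : (fun r : R => al * r ^+ n.+1) = (cst al * (id ^+ n.+1) : R -> R).
  by apply/funext => t; rewrite !fctE.
apply: (is_derive_eq (is_deriveM (is_derive_cst al r 1) (is_deriveX n.+1 (is_derive_id r 1)))).
by rewrite /sphere_area /GRing.scale/= mulr0 addr0 mulr1; ring.
Qed.

Lemma continuous_sphere_area : continuous sphere_area.
Proof. by move=> r; apply: cvgM; [exact: cvg_cst|exact: exprn_continuous]. Qed.

Lemma integral_sphere_area (r : R) : 0 <= r ->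
  (\int[mu]_(t in `[0%R, r]) (sphere_area t)%:E)%E = (al * r ^+ n.+1)%:E.
Proof.
rewrite le_eqVlt => /predU1P[<-|r0].
  by rewrite set_itv1 integral_set1 expr0n mulr0.
rewrite (@continuous_FTC2 _ _ (fun r => al * r ^+ n.+1) 0 r)//.
- by rewrite expr0n mulr0 sube0.
- by apply: continuous_subspaceT; exact: continuous_sphere_area.
- split=> [x _||]; first exact: (@ex_derive _ _ _ _ _ _ _ (is_derive_sphere_area x)).
    apply: cvg_at_right_filter; apply: cvgM; [exact: cvg_cst|exact: exprn_continuous].
  apply: cvg_at_left_filter; apply: cvgM; [exact: cvg_cst|exact: exprn_continuous].
- by move=> x _; rewrite derive1E; exact: (@derive_val _ _ _ _ _ _ _ (is_derive_sphere_area x)).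
Qed.

Lemma leb_eball (r : R) : 0 <= r ->
  leb n.+1 [set x : 'rV[R]_n.+1 | enorm x < r] = (al * r ^+ n.+1)%:E.
Proof.
rewrite le_eqVlt => /predU1P[<-|r0].
  rewrite expr0n mulr0 (_ : [set x | _] = set0) ?measure0//.
  by apply/seteqP; split => // x /=; rewrite ltNge enorm_ge0.
have mb (t : R) : measurable ([set x | enorm x < t] : set (rVborel R n.+1)).
  by apply: open_measurable_rV; exact: open_eball.
rewrite (leb_affine 0 r0)//; set D := _ @^-1` _.
have -> : D = [set x | enorm x < 1].
  by apply/seteqP; split => x /=; rewrite /D /= addr0 enormZ gtr0_norm// -ltr_pdivlMl// mulVf// gt_eqF.
rewrite -[X in (_ * X)%E]fineK; last first.
  apply: (@leb_bounded_fin _ _ _ 1) => // x /= x1; exact: le_trans (enorm_ge_norm x) (ltW x1).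
by rewrite -alphaE -EFinM mulrC.
Qed.

Lemma measurable_enorm : measurable_fun setT (@enorm R n.+1 : rVborel R n.+1 -> measurableTypeR R).
Proof. by have := @continuous_measurable_rV R n.+1 (@enorm R n.+1); apply => x; exact: enorm_continuous. Qed.

(** The law of the Euclidean norm under Lebesgue measure and the measure of density [sphere_area]
    give the same mass alpha a^(n+1) to the ray below a, hence coincide. *)
Lemma polar (g : R -> \bar R) : nnmeas (g : measurableTypeR R -> \bar R) ->
  (\int[leb n.+1]_x g (enorm x) = \int[mu]_(r in `[0%R, +oo[) ((sphere_area r)%:E * g r))%E.
Proof.
move=> ng; have [mg g0] := ng.
pose w (r : measurableTypeR R) : R := (sphere_area \_ `[0, +oo[) r.
have nw : nnmeas (EFin \o w).
  split; last first.
    move=> r; rewrite lee_fin /w patchE; case: ifPn => // /set_mem; rewrite /= in_itv/= andbT.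
    exact: sphere_area_ge0.
  apply/measurable_EFinP/(measurable_restrictT _ _).1 => //.
  apply: measurable_funTS; exact: (continuous_measurable_fun continuous_sphere_area).
(* For negative a the ray carries no mass, which the maximum with 0 encodes. *)
have ray a : dens_measure mu nw `]-oo, a[%classic = (al * Num.max a 0 ^+ n.+1)%:E.
  have b0 : 0 <= Num.max a 0 by rewrite le_max lexx orbT.
  rewrite densE -integral_sphere_area// -integral_itv_bndo_bndc; last first.
    by apply/measurable_EFinP; apply: measurable_funTS; exact: (continuous_measurable_fun continuous_sphere_area).
  rewrite [LHS]integral_mkcond [RHS]integral_mkcond; apply: eq_integral => r _.
  rewrite /w !patchE; have -> : (r \in `[0, Num.max a 0[%classic) =
      (r \in `]-oo, a[%classic) && (r \in `[0, +oo[%classic).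
    rewrite -in_setI; congr (_ \in _); apply/seteqP; split=> t /=; rewrite !in_itv/= andbT lt_max.
      by move=> /andP[t0] /orP[//|]; rewrite ltNge t0.
    by move=> [-> ->].
  by rewrite /= patchE; case: (r \in `]-oo, a[%classic); case: (r \in `[0, +oo[%classic).
have sub a : [set x : 'rV[R]_n.+1 | enorm x < a] = [set x | enorm x < Num.max a 0].
  apply/seteqP; split => x /=; rewrite lt_max; first by move=> ->.
  by move=> /orP[//|]; rewrite ltNge enorm_ge0.
have rayl a : pushforward (leb n.+1) (@enorm R n.+1) `]-oo, a[%classic = (al * Num.max a 0 ^+ n.+1)%:E.
  rewrite /pushforward (_ : _ @^-1` _ = [set x | enorm x < a]); last first.
    by apply/seteqP; split => x /=; rewrite in_itv.
  by rewrite sub leb_eball// le_max lexx orbT.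
pose pm := measure_function_pushforward__canonical__measure_function_Measure (leb n.+1) measurable_enorm
  : {measure set (measurableTypeR R) -> \bar R}.
have E (A : set (measurableTypeR R)) : measurable A -> pm A = dens_measure mu nw A.
  move=> mA; apply: (R_measure_unique_lt _ _ mA).
  - by move=> a; rewrite ray; exact: rayl.
  - by move=> a; apply: (@le_lt_trans _ _ (al * Num.max a 0 ^+ n.+1)%:E); [rewrite -rayl|exact: ltry].
have -> : (\int[leb n.+1]_x g (enorm x) = \int[pm]_r g r)%E.
  have := @ge0_integral_pushforward _ _ _ _ _ _ measurable_enorm (leb n.+1) setT g measurableT mg (fun y _ => g0 y).
  by rewrite preimage_setT => ->.
rewrite (eq_measure_integral (dens_measure mu nw)); last by move=> A mA _; exact: E.
rewrite integral_dens// [RHS]integral_mkcond; apply: eq_integral => r _.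
by rewrite /w !patchE; case: ifPn => //; rewrite mul0e.
Qed.

Lemma dot_delta (v : 'rV[R]_n.+1) i : dot (delta_mx 0 i) v = v 0 i.
Proof.
rewrite /dot (bigD1 i)//= mxE !eqxx mul1r big1 ?addr0// => j ji.
by rewrite mxE (negPf ji) mul0r.
Qed.

(** Along the i-th axis the squared norm is a quadratic polynomial in s, so the chain rule is
    applied to one-variable functions, and p needs a derivative only at the single radius |x|. *)
Lemma grad_radial (p : R -> R) (x : 'rV[R]_n.+1) dp : x != 0 -> is_derive (enorm x) 1 p dp ->
  grad (fun y => p (enorm y)) x = (dp / enorm x) *: x.
Proof.
move=> x0 Dp; have e0 : 0 < enorm x by rewrite lt_def enorm_eq0 x0 enorm_ge0.
apply/rowP => i; rewrite !mxE; apply: derive_val.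
apply: is_derive_of_line; rewrite [X in is_derive _ _ X](_ : _ = p \o
   (Num.sqrt \o (fun s => dot x x + (2 * x 0 i) * s + s ^+ 2))); last first.
  apply/funext => s /=; congr p; congr Num.sqrt.
  rewrite dotDl dotZl dot_delta !(dotC x) dotDl dotZl dot_delta !mxE !eqxx/=; ring.
have q0 : dot x x + (2 * x 0 i) * 0 + 0 ^+ 2 = enorm x ^+ 2 by rewrite sqr_enorm; ring.
have Dq : is_derive (0 : R) 1 (fun s => dot x x + (2 * x 0 i) * s + s ^+ 2) (2 * x 0 i).
  have -> : (fun s => dot x x + (2 * x 0 i) * s + s ^+ 2) =
      cst (dot x x) + cst (2 * x 0 i) * id + id ^+ 2 :> (R -> R) by apply/funext => t; rewrite !fctE.
  have D1 := @is_deriveM _ _ _ _ _ _ _ _ (is_derive_cst (2 * x 0 i) (0 : R) (1 : R)) (is_derive_id (0 : R) (1 : R)).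
  have D2 := @is_deriveD _ _ _ _ _ _ _ _ _ (is_derive_cst (dot x x : R) (0 : R) (1 : R)) D1.
  have D3 := @is_deriveD _ _ _ _ _ _ _ _ _ D2 (is_deriveX 2 (is_derive_id (0 : R) (1 : R))).
  apply: (is_derive_eq D3).
  by rewrite /GRing.scale/= /cst expr1 !mulr0 !mulr1 !addr0 add0r.
have Ds : is_derive (0 : R) 1 (Num.sqrt \o (fun s => dot x x + (2 * x 0 i) * s + s ^+ 2))
    ((2 * enorm x)^-1 * (2 * x 0 i)).
  apply: is_derive1_comp; rewrite q0.
  have := @is_derive1_sqrt _ (enorm x ^+ 2); rewrite sqrtr_sqr gtr0_norm//; apply.
  by rewrite exprn_gt0.
rewrite (_ : dp / _ * _ = dp * ((2 * enorm x)^-1 * (2 * x 0 i))); last by field; rewrite gt_eqF.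
by apply: is_derive1_comp; rewrite /= q0 sqrtr_sqr gtr0_norm.
Qed.

End polar.

(** * The isoperimetric inequality on almost every level *)

Section interval_comparison.
Context {R : realType}.
Local Notation mu := (@lebesgue_measure R).

Lemma ae_le_of_intervals (p q : R -> R) (c d : R) :
  mu.-integrable `]c, d[ (EFin \o p) -> mu.-integrable `]c, d[ (EFin \o q) ->
  (forall a b, c < a -> a < b -> b < d ->
    (\int[mu]_(x in `]a, b]) (p x)%:E <= \int[mu]_(x in `]a, b]) (q x)%:E)%E) ->
  {ae mu, forall x, c < x < d -> p x <= q x}.
Proof.
move=> ip iq pq; pose f := (fun x => q x - p x) \_ `]c, d[.
have mJ : measurable (`]c, d[%classic : set (measurableTypeR R)) by exact: measurable_itv.
have fI : mu.-integrable setT (EFin \o f).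
  rewrite -restrict_EFin; apply/(integrable_mkcond _ mJ).1.
  by have := integrableB mJ iq ip; apply: eq_integrable.
have := @ae_ge0_of_intervals R f c d fI.
move=> H; have {}H : {ae mu, forall x, c < x < d -> 0 <= f x}.
  apply: H => a b ca ab bd.
  have sub : (`]a, b]%classic : set (measurableTypeR R)) `<=` `]c, d[%classic.
    by move=> x /=; rewrite !in_itv/= => /andP[h1 h2]; rewrite (lt_trans ca h1) (le_lt_trans h2 bd).
  have mab : measurable (`]a, b]%classic : set (measurableTypeR R)) by exact: measurable_itv.
  rewrite (_ : integral _ _ _ = \int[mu]_(x in `]a, b]) ((q x)%:E - (p x)%:E))%E; last first.
    by apply: eq_integral => x /set_mem /sub xcd; rewrite /f patchE mem_set.
  have iab r : mu.-integrable `]c, d[ (EFin \o r) -> mu.-integrable `]a, b] (EFin \o r).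
    by move=> ir; apply: integrableS ir.
  rewrite integralB//; [|exact: iab|exact: iab].
  rewrite sube_ge0; first exact: pq.
  by rewrite integrable_fin_num//; exact: iab.
apply: (@filterS _ _ (@ae_filter_ringOfSetsType _ (measurableTypeR R) R mu) _ _ _ H).
move=> x h xcd; have := h xcd; rewrite /f patchE mem_set/= ?in_itv//.
by rewrite subr_ge0.
Qed.

Lemma fine_integrable (D : set (measurableTypeR R)) (Q : measurableTypeR R -> \bar R) : measurable D ->
  mu.-integrable D Q -> [/\ mu.-integrable D (EFin \o (fine \o Q)),
    {ae mu, forall x, D x -> Q x = (fine (Q x))%:E} &
    forall A : set (measurableTypeR R), measurable A -> A `<=` D -> (\int[mu]_(x in A) Q x = \int[mu]_(x in A) (fine (Q x))%:E)%E].
Proof.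
move=> mD iQ.
have ae : {ae mu, forall x, D x -> Q x = (fine (Q x))%:E}.
  have := integrable_ae mD iQ.
  apply: (@filterS _ _ (@ae_filter_ringOfSetsType _ (measurableTypeR R) R mu)) => x h /h Qx.
  by rewrite fineK.
have mQ := measurable_int mu iQ.
have mq : measurable_fun D (EFin \o (fine \o Q)).
  by apply/measurable_EFinP; exact: (measurableT_comp (fine_measurable _) mQ).
split => //.
  apply: (le_integrable mD mq _ iQ) => x Dx /=.
  by case: (Q x) => [r| |] //=; rewrite normr0 leey.
move=> A mA AD; apply: ae_eq_integral => //; [exact: measurable_funS mQ|exact: measurable_funS mq|].
apply: (@filterS _ _ (@ae_filter_ringOfSetsType _ (measurableTypeR R) R mu) _ _ _ ae) => x h Ax.
exact/h/AD.
Qed.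

End interval_comparison.

Section isoperimetric_ae.
Context {R : realType} {n : nat}.
Variables (Omega : set 'rV[R]_n.+1) (psi : 'rV[R]_n.+1 -> R) (K Cg : R).
Hypotheses (oO : open Omega) (OK : forall x, Omega x -> `|x| <= K) (psiC1 : isC1 Omega psi)
  (psib_cont : continuous (psib Omega psi))
  (gradC : forall x, Omega x -> enorm (grad psi x) <= Cg).
Variable tau : R -> {measure set (rVborel R n.+1) -> \bar R}.
Hypothesis tauP : level_measures Omega psi tau.

Local Notation psib := (psib Omega psi).
Local Notation mu := (@lebesgue_measure R).
Local Notation B := (rVborel R n.+1).

Lemma enorm0 m : enorm (0 : 'rV[R]_m) = 0.
Proof. by apply/eqP; rewrite enorm_eq0. Qed.

Lemma measurable_gr : measurable_fun (Omega : set B) (fun x : B => enorm (grad psi x)).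
Proof.
apply/(measurable_restrictT _ _).2; first exact: open_measurable_rV.
exact: measurable_enorm_grad.
Qed.

Lemma measurable_preim (S : set (measurableTypeR R)) : measurable S -> measurable (psib @^-1` S : set B).
Proof. by move=> mS; rewrite -[X in measurable X]setTI; exact: (measurable_psib psib_cont). Qed.

Lemma measurable_regular : measurable (regular_set Omega psi : set B).
Proof.
have mg := measurable_enorm_grad oO psiC1.
have -> : regular_set Omega psi = setT `&` ((fun x => enorm (grad psi x)) \_ Omega : B -> R) @^-1` [set~ 0].
  rewrite setTI; apply/seteqP; split => x; rewrite /= patchE.
    by move=> [Ox gx]; rewrite mem_set// => /eqP; rewrite enorm_eq0 (negPf gx).
  case: ifPn => // /set_mem Ox /eqP; rewrite enorm_eq0 => gx; split=> //.
by apply: mg => //; apply: measurableC; exact: measurable_set1.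
Qed.

(** Since the s-th measure is carried by {psi = s}, multiplying the integrand by the indicator of
    {psib in S} selects exactly the levels s of S. *)
Lemma level_coarea_on (S : set (measurableTypeR R)) (k : B -> \bar R) : measurable S -> nnmeas k ->
  (\int[mu]_(s in S) \int[tau s]_x k x = \int[leb n.+1]_(x in regular_set Omega psi `&` psib @^-1` S) k x)%E.
Proof.
move=> mS nk; have mP := measurable_preim mS.
have nk' := nnmeas_patch mP nk.
have n0 : nnmeas (cst 0%E : B -> \bar R) by split => //; exact: measurable_cst.
rewrite [RHS]integral_mkcondr -(level_coarea tauP nk') [LHS]integral_mkcond.
apply: eq_integral => s _; rewrite patchE; case: ifPn => [/set_mem sS|/negP sS].
  apply: (level_concentrated tauP) => // x [Ox _] xs.
  by rewrite patchE mem_set//= psibE// xs.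
apply/esym; transitivity (\int[tau s]_x (cst 0 x : \bar R))%E; last by rewrite integral0.
apply: (level_concentrated tauP) => // x [Ox _] xs.
rewrite patchE memNset//= psibE// xs => sx; apply: sS; exact: mem_set.
Qed.

Definition grO : B -> \bar R := EFin \o ((fun x => enorm (grad psi x)) \_ Omega).

Lemma nnmeas_grO : nnmeas grO.
Proof.
split; first by apply/measurable_EFinP; exact: measurable_enorm_grad.
by move=> x; rewrite lee_fin patchE; case: ifPn => // _; exact: enorm_ge0.
Qed.

(** The factor |grad psi| undoes the weight of dsigma / |grad psi|: this is the area of the regular
    part of the level. *)
Definition perim (s : R) : \bar R := (\int[tau s]_x grO x)%E.

Lemma perim_ge0 s : (0 <= perim s)%E.
Proof. by apply: integral_ge0 => x _; have [_] := nnmeas_grO; apply. Qed.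

(** Critical points can be included in the right-hand side because the integrand vanishes at
    them. *)
Lemma perim_integral (S : set (measurableTypeR R)) : measurable S -> S `<=` `]0, +oo[%classic ->
  (\int[mu]_(s in S) perim s = \int[leb n.+1]_(x in psib @^-1` S) (enorm (grad psi x))%:E)%E.
Proof.
move=> mS S0; rewrite (level_coarea_on mS nnmeas_grO) setIC.
rewrite integral_mkcondr; apply: eq_integral => x /set_mem /= xS.
have Ox : Omega x by apply: (@psib_Omega _ _ Omega psi); have := S0 _ xS; rewrite /= in_itv/= andbT.
rewrite patchE; case: ifPn => [/set_mem _|/negP nr]; first by rewrite /grO /= patchE mem_set.
rewrite (_ : grad psi x = 0) ?enorm0//.
by apply: contrapT => /eqP g0; apply: nr; exact: mem_set.
Qed.

Lemma preim_bounded (S : set R) x : S `<=` `]0, +oo[%classic -> psib x \in S -> `|x| <= K.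
Proof.
move=> S0 /set_mem/S0; rewrite /= in_itv/= andbT => x0; apply: OK.
exact: (@psib_Omega _ _ Omega psi).
Qed.

Lemma level_integrable (k : B -> \bar R) C b : nnmeas k ->
  (forall x, Omega x -> (k x <= C%:E)%E) ->
  mu.-integrable (`]0, b[%classic : set (measurableTypeR R)) (fun s => \int[tau s]_x k x)%E.
Proof.
move=> nk kC; have mS : measurable (`]0, b[%classic : set (measurableTypeR R)) by exact: measurable_itv.
have S0 : (`]0, b[%classic : set (measurableTypeR R)) `<=` `]0, +oo[%classic.
  by move=> x /=; rewrite !in_itv/= andbT => /andP[].
have k0 x : (0 <= k x)%E by have [_] := nk; apply.
have l0 s : (0 <= \int[tau s]_x k x)%E by exact: integral_ge0.
apply/integrableP; split.
  apply: measurable_funTS; exact: (level_measurable tauP nk).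
under eq_integral do rewrite gee0_abs ?l0//.
rewrite (level_coarea_on mS nk).
have mP := measurable_preim mS.
have mRP := measurableI _ _ measurable_regular mP.
have fP : leb n.+1 (psib @^-1` `]0, b[) \is a fin_num.
  by apply: (leb_bounded_fin (K := K)) => // x xS; apply: (preim_bounded S0); exact: mem_set.
apply: (@le_lt_trans _ _ (\int[leb n.+1]_(x in regular_set Omega psi `&` psib @^-1` `]0%R, b[) C%:E)%E).
  apply: ge0_le_integral => //.
    by apply: measurable_funTS; have [] := nk.
  by move=> x [[Ox _] _]; exact: kC.
have fRP : leb n.+1 (regular_set Omega psi `&` psib @^-1` `]0, b[) \is a fin_num.
  by apply: (leb_bounded_fin (K := K)) => // x [_ xS]; apply: (preim_bounded S0); exact: mem_set.
by rewrite integral_cst// -[X in (_ * X)%E]fineK// -EFinM ltry.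
Qed.

Lemma perim_integrable b : mu.-integrable (`]0, b[%classic : set (measurableTypeR R)) perim.
Proof.
apply: (@level_integrable _ Cg _ nnmeas_grO) => x Ox.
by rewrite /grO lee_fin patchE mem_set// gradC.
Qed.

Lemma per_integral_le a' a b x0 : 0 < a' -> a' < a -> Omega x0 -> b <= psi x0 ->
  (\int[mu]_(s in `]a, b[) (per Omega psi s)%:E <= \int[mu]_(s in `]a', b[) perim s)%E.
Proof.
move=> a'0 a'a Ox0 bx0.
have mS : measurable (`]a', b[%classic : set (measurableTypeR R)) by exact: measurable_itv.
have S0 : (`]a', b[%classic : set (measurableTypeR R)) `<=` `]0, +oo[%classic.
  by move=> x /=; rewrite !in_itv/= andbT => /andP[+ _]; exact: lt_trans.
have mP := measurable_preim mS.
have fP : leb n.+1 (psib @^-1` `]a', b[) \is a fin_num.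
  by apply: (leb_bounded_fin (K := K)) => // x xS; apply: (preim_bounded S0); exact: mem_set.
rewrite (perim_integral mS S0).
set m := fine (leb n.+1 (psib @^-1` `]a', b[)).
have m0 : 0 <= m by exact: fine_ge0.
apply/lee_addgt0Pr => e e0.
have eta0 : 0 < e / (m + 1) by rewrite divr_gt0// ltr_wpDl.
have := per_integral_le_eta oO OK psiC1 psib_cont a'0 a'a Ox0 bx0 eta0.
move=> H; apply: le_trans H _.
have -> : [set x | a' < psib x < b] = psib @^-1` `]a', b[ :> set B.
  by apply/seteqP; split => x /=; rewrite in_itv.
under eq_integral do rewrite EFinD.
rewrite ge0_integralD//; [|by move=> x _; rewrite lee_fin enorm_ge0| |by move=> x _; rewrite lee_fin ltW]; last first.
  apply/measurable_EFinP; apply: measurable_funS measurable_gr; first exact: open_measurable_rV.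
  by move=> x xS; apply: (@psib_Omega _ _ Omega psi); have := S0 _ xS; rewrite /= in_itv/= andbT.
rewrite leeD2l// integral_cst// -[X in (_ * X)%E]fineK// -EFinM lee_fin -/m.
by rewrite mulrAC ler_pdivrMr ?ltr_wpDl// ler_pM2l// lerDl.
Qed.

Lemma superlevel_sub s : superlevel Omega psi s `<=` Omega.
Proof. by move=> x []. Qed.

Lemma volume_radius_le (X Y : set 'rV[R]_n.+1) : open X -> open Y -> X `<=` Y -> Y `<=` Omega ->
  volume_radius X <= volume_radius Y.
Proof.
move=> oX oY XY YO; have mX := open_measurable_rV oX; have mY := open_measurable_rV oY.
rewrite /volume_radius (lebE mX) (lebE mY); apply: ge0_ler_powR.
- by rewrite invr_ge0.
- by rewrite nnegrE; exact: (divr_ge0 (fine_ge0 (measure_ge0 _ _)) (ltW alpha_gt0)).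
- by rewrite nnegrE; exact: (divr_ge0 (fine_ge0 (measure_ge0 _ _)) (ltW alpha_gt0)).
apply: ler_wpM2r; first by rewrite invr_ge0 (ltW alpha_gt0).
rewrite fine_le//; last by apply: le_measure; rewrite ?inE.
- by apply: (leb_bounded_fin (K := K)) => // x /XY/YO; exact: OK.
- by apply: (leb_bounded_fin (K := K)) => // x /YO; exact: OK.
Qed.

(** The inequality on ]a, b[ has the perimeter integrated over the larger ]a', b[. Absolute
    continuity of the integral lets a' tend to a, and the comparison on all intervals gives the
    comparison almost everywhere. *)
Lemma per_le_perim x0 : Omega x0 ->
  {ae mu, forall s, 0 < s < psi x0 -> ((per Omega psi s)%:E <= perim s)%E}.
Proof.
move=> Ox0; set b0 := psi x0.
have mJ : measurable (`]0, b0[%classic : set (measurableTypeR R)) by exact: measurable_itv.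
have [iq aeq qE] := fine_integrable mJ (perim_integrable b0).
have J0 : (`]0, b0[%classic : set (measurableTypeR R)) `<=` `]0, +oo[%classic.
  by move=> x /=; rewrite !in_itv/= andbT => /andP[].
have perJ : measurable_fun (`]0, b0[%classic : set (measurableTypeR R)) (per Omega psi : measurableTypeR R -> R).
  by apply: measurable_funS (measurable_per psib_cont).
have ip : mu.-integrable `]0, b0[ (EFin \o per Omega psi).
  apply: measurable_bounded_integrable => //.
    by change (mu `]0%R, b0[ < +oo)%E; rewrite lebesgue_measure_itv/=; case: ifPn => //; rewrite -EFinB ltry.
  exists (n.+1%:R * @alpha R n * volume_radius Omega ^+ n); split; first exact: num_real.
  move=> z Cz s /=; rewrite in_itv/= => /andP[s0 _]; apply: le_trans (ltW Cz).
  rewrite (ger0_norm (per_ge0 _ _ _)) /per; apply: ler_wpM2l; first exact: (mulr_ge0 (ler0n _ _) (ltW alpha_gt0)).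
  apply: lerXn2r; rewrite ?nnegrE; [exact: volume_radius_ge0|exact: volume_radius_ge0|].
  apply: volume_radius_le => //.
    by apply: open_superlevel => //; exact: ltW.
  exact: superlevel_sub.
have := ae_le_of_intervals ip iq.
move=> H; have {}H : {ae mu, forall s, 0 < s < b0 -> per Omega psi s <= fine (perim s)}.
  apply: H => a b a0 ab bb0.
  have sub a' : 0 < a' -> (`]a', b]%classic : set (measurableTypeR R)) `<=` `]0, b0[%classic.
    move=> a'0 x /=; rewrite !in_itv/= => /andP[h1 h2].
    by rewrite (lt_trans a'0 h1) (le_lt_trans h2 bb0).
  have mi (i : interval R) : measurable ([set` i] : set (measurableTypeR R)) by exact: measurable_itv.
  rewrite -integral_itv_bndo_bndc; last first.
    apply/measurable_EFinP; apply: measurable_funS perJ => // x; move=> /= xab; apply: (sub a a0).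
    by move: xab; rewrite /= !in_itv/= => /andP[-> /ltW].
  pose q0 := (fine \o perim) \_ `]0, b0[.
  have iq0 : mu.-integrable setT (EFin \o q0).
    by rewrite /q0 -restrict_EFin; apply/(integrable_mkcond _ mJ).1.
  apply/lee_addgt0Pr => e e0.
  have [d [d0 hd]] := integral_normr_continuous iq0 e0.
  (* The first term keeps a' positive, the second makes ]a', a] shorter than d. *)
  pose a' := Num.max (a / 2) (a - d / 2).
  have a'0 : 0 < a' by rewrite lt_max divr_gt0.
  have a'a : a' < a by rewrite gt_max ltr_pdivrMr// ltr_pMr// ltr1n/= ltrBlDr ltrDl divr_gt0.
  have := @per_integral_le a' a b x0 a'0 a'a Ox0 (ltW bb0).
  move=> h; apply: le_trans h _.
  apply: le_trans (_ : _ <= \int[mu]_(s in `]a', b]) perim s)%E _.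
    apply: ge0_subset_integral => //.
    - by apply: measurable_funTS; exact: (level_measurable tauP nnmeas_grO).
    - by move=> s _; exact: perim_ge0.
    by move=> s /=; rewrite !in_itv/= => /andP[-> /ltW].
  rewrite (qE _ (mi `]a', b]) (sub _ a'0)).
  have -> : (`]a', b]%classic : set (measurableTypeR R)) = `]a', a]%classic `|` `]a, b]%classic.
    by apply: itv_bndbnd_setU; rewrite bnd_simp ltW.
  have mq : measurable_fun (`]0, b0[%classic : set (measurableTypeR R)) (EFin \o (fine \o perim)).
    exact: measurable_int iq.
  rewrite ge0_integral_setU//; first last.
  - apply/disj_setPS => s /=; rewrite !in_itv/= => -[/andP[_ h1] /andP[h2 _]].
    by move: (le_lt_trans h1 h2); rewrite ltxx.
  - by move=> s _; rewrite lee_fin fine_ge0// perim_ge0.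
  - apply: measurable_funS mq => // x [|] /= xab; apply: (sub a' a'0); move: xab; rewrite /= !in_itv/=.
      by move=> /andP[-> h]; apply: le_trans h (ltW ab).
    by move=> /andP[h ->]; rewrite (lt_trans a'a h).
  rewrite addeC leeD2l//.
  have := hd `]a', a]%classic (mi _).
  move=> h; have {}h : (\int[mu]_(s in `]a', a]) `|q0 s|) < e.
    apply: h; change (mu `]a', a] < d%:E)%E; rewrite lebesgue_measure_itv/= lte_fin a'a -EFinB lte_fin /a'; case: (leP (a / 2) (a - d / 2)) => h1; lra.
  rewrite -[leLHS]fineK; last first.
    by rewrite integrable_fin_num//; apply: integrableS iq => // x xab; apply: (sub a' a'0);
      move: xab; rewrite /= !in_itv/= => /andP[-> h']; apply: le_trans h' (ltW ab).
  rewrite lee_fin; apply: le_trans (ltW h).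
  rewrite le_eqVlt; apply/orP; left; apply/eqP; congr fine; apply: eq_integral => s /set_mem sab.
  rewrite /q0 patchE mem_set ?ger0_norm ?fine_ge0 ?perim_ge0//.
  by apply: (sub a' a'0); move: sab; rewrite /= !in_itv/= => /andP[-> h']; apply: le_trans h' (ltW ab).
have FF := @ae_filter_ringOfSetsType _ (measurableTypeR R) R mu.
apply: (@filterS2 _ _ FF _ _ _ _ H aeq) => s h1 h2 h3.
by rewrite h2/= ?in_itv// lee_fin h1.
Qed.

End isoperimetric_ae.

(** * The divergence theorem for compactly supported fields *)

Section C1_algebra.
Context {R : realType} {n : nat}.
Implicit Types (U : set 'rV[R]_n.+1) (f g h : 'rV[R]_n.+1 -> R).

Lemma isC1_mul U f g : open U -> isC1 U f -> isC1 U g ->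
  isC1 U (fun x => f x * g x) /\
  forall i x, U x -> partial i (fun x => f x * g x) x = partial i f x * g x + f x * partial i g x.
Proof.
move=> oU fU gU; apply: isC1_intro => // i x Ux.
  have := is_deriveM (isC1_is_derive i fU Ux) (isC1_is_derive i gU Ux).
  by move=> D; apply: is_derive_eq; rewrite /GRing.scale/= addrC mulrC.
have FF := nbhs_filter x.
have fc : {for x, continuous f} := isC1_continuous oU fU Ux.
have gc : {for x, continuous g} := isC1_continuous oU gU Ux.
have pf := (fU i x Ux).2; have pg := (gU i x Ux).2.
by apply: (@cvgD _ _ _ _ FF); apply: (@cvgM _ _ _ FF).
Qed.

Lemma isC1_sum U m (f : 'I_m -> 'rV[R]_n.+1 -> R) : open U -> (forall j, isC1 U (f j)) ->
  isC1 U (fun x => \sum_j f j x) /\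
  forall i x, U x -> partial i (fun x => \sum_j f j x) x = \sum_j partial i (f j) x.
Proof.
move=> oU fU; apply: isC1_intro => // i x Ux.
  have -> : (fun x => \sum_j f j x) = \sum_j f j by apply/funext => y; rewrite fct_sumE.
  by apply: is_derive_sum => j; exact: isC1_is_derive.
by apply: (@cvg_sumR _ _ _ (nbhs_filter x)) => j _; exact: (fU j i x Ux).2.
Qed.

Lemma isC1_comp U (phi theta : R -> R) f : open U -> (forall t : R, is_derive t (1 : R) phi (theta t)) ->
  continuous theta -> isC1 U f ->
  isC1 U (fun x => phi (f x)) /\
  forall i x, U x -> partial i (fun x => phi (f x)) x = theta (f x) * partial i f x.
Proof.
move=> oU Dphi ct fU; apply: isC1_intro => // i x Ux.
  apply: is_derive_of_line.
  have e0 : 0 *: delta_mx 0 i + x = x by rewrite scale0r add0r.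
  have Df : is_derive (0 : R) 1 (fun s => f (s *: delta_mx 0 i + x)) (partial i f x).
    have := @is_derive_line _ _ f x (delta_mx 0 i) 0; rewrite e0; apply.
    exact: (fU i x Ux).1.
  by apply: (@is_derive1_comp _ phi (fun s => f (s *: delta_mx 0 i + x))); rewrite e0.
have FF := nbhs_filter x.
have fc : {for x, continuous f} := isC1_continuous oU fU Ux.
have pf := (fU i x Ux).2.
apply: (@cvgM _ _ _ FF) => //.
by apply: (@cvg_comp _ _ _ f theta _ _ _ fc); exact: ct.
Qed.

Lemma isC1_zero U f : open U -> (forall x, U x -> f x = 0) ->
  isC1 U f /\ forall i x, U x -> partial i f x = 0.
Proof.
move=> oU f0; apply: (@isC1_intro _ _ U f (fun _ _ => 0)) => // i x Ux; last exact: cst_continuous.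
have nf : \near x, (cst 0 : 'rV[R]_n.+1 -> R) x = f x.
  have : nbhs x U by exact: open_nbhs_nbhs.
  by apply: filterS => y /f0 ->.
have [d0 e0] := is_derive_cst (0 : R) x (delta_mx 0 i : 'rV[R]_n.+1).
split; first by apply: near_eq_derivable d0; exact: nf.
by rewrite -e0; apply/esym; apply: near_eq_derive; exact: nf.
Qed.

End C1_algebra.

Section compact_support.
Context {R : realType} {n : nat}.
Local Notation mu := (@lebesgue_measure R).
Local Notation B := (rVborel R n.+1).

Lemma open_norm_gt (K : R) : open [set x : 'rV[R]_n.+1 | K < `|x|].
Proof.
have : open ((fun x : 'rV[R]_n.+1 => `|x|) @^-1` [set r | K < r]).
  by apply: open_comp => [x _|]; [exact: norm_continuous|exact: open_gt].
by [].
Qed.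

Lemma support_bounded (g : 'rV[R]_n.+1 -> R) K : continuous g -> (forall x, K < `|x| -> g x = 0) ->
  exists C, forall x, `|g x| <= C.
Proof.
move=> cg g0; pose Q : set 'rV[R]_n.+1 := cbox (const_mx (- `|K|)) (const_mx `|K|).
have cQ : compact Q by exact: compact_cbox.
have : compact (g @` Q) by apply: continuous_compact cQ; exact: continuous_subspaceT.
move=> /compact_bounded[M [_ hM]]; exists (`|M| + 1) => x.
have [xK|xK] := leP `|x| K; last by rewrite g0// normr0.
apply: hM; first by rewrite (le_lt_trans (ler_norm _))// ltrDl.
exists x => // i; rewrite !mxE -ler_norml.
exact: le_trans (coord_le_norm x i) (le_trans xK (ler_norm _)).
Qed.

Variables (W : 'rV[R]_n.+1 -> R) (K : R) (i : 'I_n.+1).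
Hypotheses (W1 : isC1 setT W) (W0 : forall x, K < `|x| -> W x = 0).

Let g := partial i W.

Let g_cont : continuous g. Proof. by move=> x; exact: (W1 i I).2. Qed.

Let g0 x : K < `|x| -> g x = 0.
Proof. by move=> Kx; have [_] := isC1_zero (@open_norm_gt K) W0; apply. Qed.

Let mg : measurable_fun setT (g : B -> R).
Proof. exact: continuous_measurable_rV. Qed.

Lemma integrable_partial : (leb n.+1).-integrable setT (EFin \o (g : B -> R)).
Proof.
have [C gC] := support_bounded g_cont g0.
pose Q : set B := box (const_mx (- `|K| - 1)) (const_mx (`|K| + 1)).
have mQ : measurable Q by exact: box_measurable.
have E : EFin \o (g : B -> R) = (EFin \o (g : B -> R)) \_ Q.
  apply/funext => x; rewrite patchE; case: ifPn => // /negP xQ /=.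
  rewrite g0// ltNge; apply/negP => xK; apply: xQ; apply: mem_set => j; rewrite !mxE -opprD -ltr_norml.
  by rewrite (le_lt_trans (coord_le_norm x j))// (le_lt_trans xK)// (le_lt_trans (ler_norm _))// ltrDl.
rewrite E; apply/(integrable_mkcond _ mQ).1; apply: measurable_bounded_integrable => //.
- exact: leb_box_lty.
- exact: measurable_funTS.
by exists C; split; [exact: num_real|move=> z Cz x _; exact: le_trans (gC x) (ltW Cz)].
Qed.

Lemma integral_line y :
  mu.-integrable setT (fun t => (g (insert i y t))%:E) /\ (\int[mu]_t (g (insert i y t))%:E = 0)%E.
Proof.
pose c := `|K| + 1.
have c0 : 0 < c by rewrite ltr_wpDl.
have far t : c <= `|t| -> K < `|insert i y t|.
  move=> ct; apply: lt_le_trans (coord_le_norm (insert i y t) i); rewrite insert_i.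
  by apply: lt_le_trans ct; rewrite (le_lt_trans (ler_norm _))// ltrDl.
have D (t : R) : is_derive t (1 : R) (fun s => W (insert i y s)) (g (insert i y t)).
  by apply: is_derive_insert W1 _ => //; exact: openT.
have ci : continuous (fun t => g (insert i y t)).
  move=> t; apply: (@cvg_comp _ _ _ (insert i y) g _ (nbhs (insert i y t))); last exact: g_cont.
  by apply: cvg_insert; [exact: cvg_cst|exact: cvg_id].
have mJ : measurable (`[- c, c]%classic : set (measurableTypeR R)) by exact: measurable_itv.
have E : (fun t => (g (insert i y t))%:E) = (fun t => (g (insert i y t))%:E) \_ `[- c, c].
  apply/funext => t; rewrite patchE; case: ifPn => // /negP tc; rewrite g0//; apply: far.
  rewrite leNgt; apply/negP; rewrite ltr_norml => /andP[h1 h2]; apply: tc; apply: mem_set.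
  by rewrite /= in_itv/= !ltW.
have iJ : mu.-integrable `[- c, c] (fun t => (g (insert i y t))%:E).
  apply: continuous_compact_integrable; first exact: segment_compact.
  exact: continuous_subspaceT.
split; first by rewrite E; apply/(integrable_mkcond _ mJ).1.
rewrite E -integral_mkcond (@continuous_FTC2 _ _ (fun s => W (insert i y s)) (- c) c).
- rewrite !W0 ?sube0//; apply: far; first by rewrite normrN ger0_norm// ltW.
  by rewrite ger0_norm// ltW.
- by rewrite gtrN.
- exact: continuous_subspaceT.
- have cW : continuous (fun s => W (insert i y s)).
    by move=> t; apply: differentiable_continuous; apply/derivable1_diffP; have [] := D t.
  split=> [t _||]; first by have [] := D t.
    by apply: cvg_at_right_filter; exact: cW.
  by apply: cvg_at_left_filter; exact: cW.
- by move=> t _; rewrite derive1E; have [] := D t.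
Qed.

(** On every line parallel to the i-th axis the integral is 0 by the fundamental theorem of
    calculus. Tonelli is applied to the positive and negative parts separately. *)
Lemma integral_partial0 : (\int[leb n.+1]_x (g x)%:E = 0)%E.
Proof.
have E : (\int[leb n.+1]_x ((fun x : B => (g x)%:E)^\+ x) = \int[leb n.+1]_x ((fun x : B => (g x)%:E)^\- x))%E.
  have mG : measurable_fun setT (fun x : B => (g x)%:E) by exact/measurable_EFinP.
  rewrite (tonelli_insert2 i (measurable_funepos mG) (funepos_ge0 _)).
  rewrite (tonelli_insert2 i (measurable_funeneg mG) (funeneg_ge0 _)).
  apply: eq_integral => y _.
  have [iy zy] := integral_line y.
  have := zy; rewrite integralE => /eqP; rewrite sube_eq ?add0e.
  - move/eqP => h.
    have e1 t : (fun x : B => (g x)%:E)^\+%E (insert i y t) = (fun t : measurableTypeR R => (g (insert i y t))%:E)^\+%E t.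
      by rewrite !funeposE.
    have e2 t : (fun x : B => (g x)%:E)^\-%E (insert i y t) = (fun t : measurableTypeR R => (g (insert i y t))%:E)^\-%E t.
      by rewrite !funenegE.
    transitivity (\int[mu]_t (fun t : measurableTypeR R => (g (insert i y t))%:E)^\+%E t)%E.
      by apply: eq_integral => t _; exact: e1.
    by rewrite h; apply: eq_integral => t _; exact/esym/e2.
  - exact: integrable_pos_fin_num iy.
  - by rewrite fin_num_adde_defr.
rewrite integralE E subee//.
exact: integrable_neg_fin_num integrable_partial.
Qed.

End compact_support.

Lemma psib_out (R : realType) n (Omega : set 'rV[R]_n.+1) psi x : ~ Omega x -> psib Omega psi x = 0.
Proof. by move=> Ox; rewrite /psib patchE memNset. Qed.

Section divergence_identity.
Context {R : realType} {n : nat}.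
Local Notation mu := (@lebesgue_measure R).
Local Notation B := (rVborel R n.+1).
Variables (Omega : set 'rV[R]_n.+1) (A : 'rV[R]_n.+1 -> 'M[R]_n.+1) (psi : 'rV[R]_n.+1 -> R) (K : R).
Hypotheses (oO : open Omega) (OK : forall x, Omega x -> `|x| <= K) (psiC1 : isC1 Omega psi)
  (psib_cont : continuous (psib Omega psi))
  (psi_pos : forall x, Omega x -> 0 < psi x)
  (psiC2 : forall i, isC1 Omega (partial i psi)) (AC1 : forall i j, isC1 Omega (fun x => A x i j)).
Local Notation psib := (psib Omega psi).

Definition flux i (y : 'rV[R]_n.+1) : R := \sum_j A y i j * partial j psi y.

Definition energy (y : 'rV[R]_n.+1) : R := \sum_i partial i psi y * flux i y.

Lemma flux_isC1 i : isC1 Omega (flux i).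
Proof.
have [] := @isC1_sum R n Omega _ (fun j y => A y i j * partial j psi y) oO _ => //.
by move=> j; have [] := isC1_mul oO (AC1 i j) (psiC2 j).
Qed.

Lemma div_A_gradE x : div_A_grad A psi x = \sum_i partial i (flux i) x.
Proof.
rewrite /div_A_grad /divergence; apply: eq_bigr => i _; congr (partial i _ x).
by apply/funext => y; rewrite !mxE; apply: eq_bigr => j _; rewrite !mxE.
Qed.

Lemma energyE x : energy x = dot (grad psi x) (A x *m (grad psi x)^T)^T.
Proof.
rewrite /energy /dot; apply: eq_bigr => i _; rewrite !mxE; congr (_ * _).
by apply: eq_bigr => j _; rewrite !mxE.
Qed.

(** The integrand is the divergence of phi(psi) A grad psi. As phi vanishes up to the positive level
    a, this field extends by zero to a compactly supported C^1 field on the whole space, and no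
    regularity of a level set is used. *)
Lemma divergence_identity (phi theta : R -> R) a : 0 < a ->
  (forall t : R, is_derive t (1 : R) phi (theta t)) -> continuous theta ->
  (forall t, t <= a -> phi t = 0) -> (forall t, t <= a -> theta t = 0) ->
  (\int[leb n.+1]_x (theta (psib x) * energy x + phi (psib x) * div_A_grad A psi x)%:E = 0)%E.
Proof.
move=> a0 Dphi ct phi0 theta0.
pose W i x := phi (psib x) * flux i x.
have oV : open [set x | psib x < a].
  rewrite openE => x /= xa; have /(_ [set r | r < a]) := @psib_cont x; apply; exact: lt_nbhsl.
(* Omega and {psib < a} are open and cover the space; on the second the field is identically 0,
   which makes it C^1 across the boundary of Omega. *)
have cover x : Omega x \/ psib x < a.
  case: (pselect (Omega x)) => Ox; [by left|right].
  by rewrite psib_out.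
have WO i : isC1 Omega (W i) /\ forall x, Omega x -> partial i (W i) x =
    theta (psi x) * partial i psi x * flux i x + phi (psi x) * partial i (flux i) x.
  have [c1 c2] := isC1_comp oO Dphi ct psiC1.
  have [m1 m2] := isC1_mul oO c1 (flux_isC1 i).
  have E x : Omega x -> phi (psi x) * flux i x = W i x by move=> Ox; rewrite /W psibE.
  split; first exact: isC1_eq oO E m1.
  move=> x Ox; rewrite -c2// -m2//.
  have nx : \near x, W i x = phi (psi x) * flux i x.
    have : nbhs x Omega by exact: open_nbhs_nbhs.
    by apply: filterS => y Oy; rewrite E.
  by rewrite /partial; apply: near_eq_derive; exact: nx.
have WV i : isC1 [set x | psib x < a] (W i) /\ forall j x, psib x < a -> partial j (W i) x = 0.
  by apply: isC1_zero oV _ => x xa; rewrite /W phi0 ?mul0r// ltW.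
have W1 i : isC1 setT (W i).
  apply: isC1_local => x _; have [Ox|xa] := cover x.
    by exists Omega; split=> //; exact: (WO i).1.
  by exists [set x | psib x < a]; split=> //; exact: (WV i).1.
have W0 i x : K < `|x| -> W i x = 0.
  move=> Kx; rewrite /W phi0 ?mul0r//; have [Ox|/ltW//] := cover x.
  by move: Kx; rewrite ltNge OK.
have S x : theta (psib x) * energy x + phi (psib x) * div_A_grad A psi x = \sum_i partial i (W i) x.
  have [Ox|xa] := cover x; last first.
    rewrite phi0 ?theta0 ?(ltW xa)// !mul0r addr0 big1// => i _; exact: (WV i).2.
  rewrite psibE// div_A_gradE /energy !mulr_sumr -big_split/=.
  by apply: eq_bigr => i _; rewrite (WO i).2// mulrA.
under eq_integral do rewrite S -sumEFin.
rewrite integral_sum//; last by move=> i; exact: integrable_partial (W1 i) (W0 i).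
by rewrite big1// => i _; exact: (integral_partial0 i (W1 i) (W0 i)).
Qed.

End divergence_identity.

(** * The divergence theorem on almost every superlevel set *)

Section cutoff.
Context {R : realType}.
Local Notation mu := (@lebesgue_measure R).

(** The last clause writes phi as a superposition of indicators of {s < t}; composed with psib it
    turns an integral against phi into an integral over superlevel sets. *)
Lemma cutoff_primitive (theta : R -> R) a : continuous theta -> (forall t, 0 <= theta t) ->
  (forall t, t <= a -> theta t = 0) -> exists phi : R -> R,
  [/\ forall t : R, is_derive t (1 : R) phi (theta t), forall t, t <= a -> phi t = 0 &
   forall t, (phi t)%:E = (\int[mu]_s (theta s * \1_[set s | (s < t)%R] s)%:E)%E].
Proof.
move=> ct t0 ta; pose phi t : R := \int[mu]_(s in `]-oo, t]) theta s.
have iu u : mu.-integrable `]-oo, u] (EFin \o theta).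
  have -> : EFin \o theta = (EFin \o theta) \_ `[a, +oo[.
    apply/funext => s; rewrite patchE; case: ifPn => // /negP sa /=; rewrite ta//.
    by rewrite leNgt; apply/negP => as_; apply: sa; apply: mem_set; rewrite /= in_itv/= andbT ltW.
  have mA : measurable (`[a, +oo[%classic : set (measurableTypeR R)) by exact: measurable_itv.
  have mU : measurable (`]-oo, u]%classic : set (measurableTypeR R)) by exact: measurable_itv.
  apply/integrable_restrict => //.
  have := @continuous_compact_integrable _ theta `[a, u]%classic (@segment_compact _ _ _) (continuous_subspaceT ct).
  rewrite (_ : `]-oo, u]%classic `&` `[a, +oo[%classic = `[a, u]%classic)//.
  apply/seteqP; split => x /=; rewrite !in_itv/= ?andbT; first by move=> [-> ->].
  by move=> /andP[-> ->].
exists phi; split.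
- move=> t; have t1 : t < t + 1 by rewrite ltrDl.
  have [|d1 d2] := @continuous_FTC1 _ theta -oo%O t (t + 1) t1 (iu _) _ (ct t); first exact: ltNyr.
  by apply: DeriveDef; [exact: d1|rewrite -derive1E; exact: d2].
- move=> t tle; rewrite /phi /Rintegral integral0_eq// => s; rewrite /= in_itv/= => st.
  by rewrite ta// (le_trans st tle).
- move=> t; rewrite /phi /Rintegral fineK; last exact: integrable_fin_num (iu t).
  rewrite -integral_itv_bndo_bndc; last first.
    by apply/measurable_EFinP; apply: measurable_funTS; exact: continuous_measurable_fun.
  rewrite integral_mkcond; apply: eq_integral => s _; rewrite patchE indicE.
  rewrite (_ : (s \in `]-oo, t[%classic) = (s \in [set s | s < t])).
    by case: ifPn; rewrite ?mulr1 ?mulr0.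
  by apply/idP/idP; rewrite !inE /= ?in_itv.
Qed.

(** Continuous functions vanishing off ]a, b[ that increase with k to its indicator; at each point
    the limit is reached for large k. *)
Definition bump (a b : R) (k : nat) (t : R) : R :=
  Num.min 1 (k%:R * Num.max 0 (Num.min (t - a) (b - t))).

Lemma cvg_minmax (f g : R -> R) x : {for x, continuous f} -> {for x, continuous g} ->
  {for x, continuous (fun t => Num.min (f t) (g t))} /\ {for x, continuous (fun t => Num.max (f t) (g t))}.
Proof.
move=> cf cg; have FF := nbhs_filter x.
have h := @cvgB _ _ _ _ FF _ _ _ _ cf cg; have hn := @cvg_norm _ _ _ _ FF _ _ h.
have hs := @cvgD _ _ _ _ FF _ _ _ _ cf cg.
split; rewrite /prop_for /continuous_at.
  rewrite minr_absE; under eq_cvg do rewrite minr_absE.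
  by apply: cvgM (cvg_cst _); apply: cvgB.
rewrite maxr_absE; under eq_cvg do rewrite maxr_absE.
by apply: cvgM (cvg_cst _); apply: cvgD.
Qed.

Lemma bump_continuous a b k : continuous (bump a b k).
Proof.
move=> t; rewrite /bump.
have c1 : {for t, continuous (fun t => t - a)} by apply: cvgB; [exact: cvg_id|exact: cvg_cst].
have c2 : {for t, continuous (fun t => b - t)} by apply: cvgB; [exact: cvg_cst|exact: cvg_id].
have [c3 _] := cvg_minmax c1 c2.
have [_ c4] := @cvg_minmax (fun=> 0) _ t (@cst_continuous R R 0 t) c3.
have c5 : {for t, continuous (fun t => k%:R * Num.max 0 (Num.min (t - a) (b - t)))}.
  by apply: cvgM c4; exact: cvg_cst.
by have [] := @cvg_minmax (fun=> 1) _ t (@cst_continuous R R 1 t) c5.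
Qed.

Lemma bump_ge0 a b k t : 0 <= bump a b k t.
Proof. by rewrite /bump le_min ler01 mulr_ge0// le_max lexx. Qed.

Lemma bump_out a b k t : t <= a -> bump a b k t = 0.
Proof.
move=> ta; rewrite /bump (_ : Num.max _ _ = 0) ?mulr0; first by rewrite minEle ler10.
by apply/max_idPl; rewrite ge_min subr_le0 ta.
Qed.

Lemma bump_nd a b t : {homo (bump a b)^~ t : m n / (m <= n)%N >-> m <= n}.
Proof.
move=> m k mk; rewrite /bump le_min ge_min lexx/= ge_min; apply/orP; right.
by rewrite ler_wpM2r// ?ler_nat// le_max lexx.
Qed.

Lemma bump_near a b t : \forall k \near \oo, bump a b k t = \1_(`]a, b[%classic) t.
Proof.
have tabE : (t \in `]a, b[%classic) = (a < t < b) by apply/idP/idP; rewrite inE/= in_itv.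
rewrite indicE tabE; case: (boolP (a < t < b)) => [/andP[at_ tb]|tab].
  have d0 : 0 < Num.min (t - a) (b - t) by rewrite lt_min !subr_gt0 at_ tb.
  exists (Num.bound (Num.min (t - a) (b - t))^-1) => // k /= kb.
  rewrite /bump (max_idPr (ltW d0)); apply/min_idPl.
  rewrite -[leLHS](mulVf (lt0r_neq0 d0)) ler_wpM2r// ?(ltW d0)//.
  apply: le_trans (ltW (archi_boundP _)) _; first by rewrite invr_ge0 ltW.
  by rewrite ler_nat.
exists 0%N => // k _; rewrite /bump (_ : Num.max _ _ = 0) ?mulr0; first by rewrite minEle ler10.
by apply/max_idPl; rewrite ge_min !subr_le0 !leNgt -negb_and.
Qed.

End cutoff.

Section energy_level.
Context {R : realType} {n : nat}.
Local Notation mu := (@lebesgue_measure R).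
Local Notation B := (rVborel R n.+1).
Variables (Omega : set 'rV[R]_n.+1) (A : 'rV[R]_n.+1 -> 'M[R]_n.+1) (psi : 'rV[R]_n.+1 -> R) (K Cf Ce : R).
Hypotheses (oO : open Omega) (OK : forall x, Omega x -> `|x| <= K) (psiC1 : isC1 Omega psi)
  (psib_cont : continuous (psib Omega psi))
  (psi_pos : forall x, Omega x -> 0 < psi x)
  (psiC2 : forall i, isC1 Omega (partial i psi)) (AC1 : forall i j, isC1 Omega (fun x => A x i j)).
Hypotheses (mf : measurable_fun (Omega : set B) (div_A_grad A psi : B -> R))
  (fC : forall x, Omega x -> `|div_A_grad A psi x| <= Cf)
  (eC : forall x, Omega x -> 0 <= energy A psi x <= Ce).
Variable tau : R -> {measure set B -> \bar R}.
Hypothesis tauP : level_measures Omega psi tau.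
Local Notation psib := (psib Omega psi).
Local Notation f := (div_A_grad A psi).

Let mO : measurable (Omega : set B) := open_measurable_rV oO.

Definition energyO : B -> R := (energy A psi) \_ Omega.
(** The two signs of the divergence are kept on different sides of the identities, so that every
    integral is nonnegative and Tonelli and monotone convergence apply. *)
Definition div_pos : B -> R := (fun x => Num.max 0 (f x)) \_ Omega.
Definition div_neg : B -> R := (fun x => Num.max 0 (- f x)) \_ Omega.

Lemma energy_measurable : measurable_fun (Omega : set B) (energy A psi : B -> R).
Proof.
apply: continuous_in_measurable_rV => // x Ox.
apply: (@cvg_sumR _ _ _ (nbhs_filter x)) => i _; apply: (@cvgM _ _ _ (nbhs_filter x)).
  exact: isC1_continuous (psiC2 i) Ox.
exact: isC1_continuous oO (flux_isC1 oO psiC2 AC1 i) Ox.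
Qed.

Lemma nn_energyO : nnmeas (EFin \o energyO).
Proof.
split; first by apply/measurable_EFinP/(measurable_restrictT _ _).1 => //; exact: energy_measurable.
move=> x; rewrite lee_fin /energyO patchE; case: ifPn => // /set_mem /eC /andP[]//.
Qed.

Lemma nn_div_pos : nnmeas (EFin \o div_pos).
Proof.
split; last by move=> x; rewrite lee_fin /div_pos patchE; case: ifPn => // _; rewrite le_max lexx.
apply/measurable_EFinP/(measurable_restrictT _ _).1 => //.
by apply: measurable_maxr => //; exact: measurable_cst.
Qed.

Lemma nn_div_neg : nnmeas (EFin \o div_neg).
Proof.
split; last by move=> x; rewrite lee_fin /div_neg patchE; case: ifPn => // _; rewrite le_max lexx.
apply/measurable_EFinP/(measurable_restrictT _ _).1 => //.
by apply: measurable_maxr; [exact: measurable_cst|exact: measurableT_comp].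
Qed.

Definition sl_int (k : B -> R) (s : R) : \bar R := (\int[leb n.+1]_(x in [set x | (s < psib x)%R]) (k x)%:E)%E.

Lemma measurable_subgraph : measurable [set z : measurableTypeR R * B | z.1 < psib z.2].
Proof.
apply: measurable_lt_set; first exact: measurable_fst.
exact: measurableT_comp (measurable_psib psib_cont) measurable_snd.
Qed.

Lemma sl_intE k s :
  sl_int k s = (\int[leb n.+1]_x (k x * \1_[set z : measurableTypeR R * B | (z.1 < psib z.2)%R] (s, x))%:E)%E.
Proof.
rewrite /sl_int integral_mkcond; apply: eq_integral => x _; rewrite patchE indicE.
rewrite (_ : ((s, x) \in _) = (x \in [set x | s < psib x])); last by apply/idP/idP; rewrite !inE.
by case: ifPn => _; rewrite ?mulr1 ?mulr0.
Qed.

Lemma nn_subgraph (k : B -> R) (theta : R -> R) : nnmeas (EFin \o k) -> measurable_fun setT (theta : measurableTypeR R -> R) ->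
  (forall t, 0 <= theta t) -> nnmeas (fun z : measurableTypeR R * B =>
    (theta z.1 * (k z.2 * \1_[set z : measurableTypeR R * B | (z.1 < psib z.2)%R] z))%:E).
Proof.
move=> nk mt t0; split; last first.
  move=> z; rewrite lee_fin !mulr_ge0//; have [_ /(_ z.2)] := nk; by rewrite lee_fin.
apply/measurable_EFinP; apply: measurable_funM; first exact: measurableT_comp mt measurable_fst.
apply: measurable_funM; first by apply: measurableT_comp measurable_snd; apply/measurable_EFinP; exact: nk.1.
by apply: measurable_indic; exact: measurable_subgraph.
Qed.

Lemma measurable_sl_int k : nnmeas (EFin \o k) -> measurable_fun setT (sl_int k : measurableTypeR R -> \bar R).
Proof.
move=> nk; have [mh h0] := @nn_subgraph k (fun=> 1) nk (measurable_cst _) (fun _ => ler01).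
have := @measurable_fun_fubini_tonelli_F _ _ _ _ _ (leb n.+1) _ mh h0.
apply: eq_measurable_fun => s _; rewrite sl_intE /fubini_F.
by apply: eq_integral => x _; rewrite /= mul1r.
Qed.

Lemma sl_int_tonelli k (theta : R -> R) : nnmeas (EFin \o k) -> continuous theta -> (forall t, 0 <= theta t) ->
  (\int[leb n.+1]_x ((k x)%:E * \int[mu]_s (theta s * \1_[set s | (s < psib x)%R] s)%:E) =
   \int[mu]_s ((theta s)%:E * sl_int k s))%E.
Proof.
move=> nk ct t0; have k0 x : 0 <= k x by have [_ /(_ x)] := nk; rewrite lee_fin.
have mt : measurable_fun setT (theta : measurableTypeR R -> R) by exact: continuous_measurable_fun.
have [mh h0] := nn_subgraph nk mt t0.
have := @fubini_tonelli _ _ _ _ _ mu (leb n.+1) _ mh h0; rewrite /= => FT.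
have mS := measurable_subgraph.
transitivity (\int[leb n.+1]_x \int[mu]_s
   (theta s * (k x * \1_[set z : measurableTypeR R * B | (z.1 < psib z.2)%R] (s, x)))%:E)%E.
  apply: eq_integral => x _; rewrite -ge0_integralZl//.
  - by apply: eq_integral => s _; rewrite -EFinM !indicE mulrCA; congr ((_ * (_ * _%:R))%:E);
      apply/idP/idP; rewrite !inE.
  - apply/measurable_EFinP; apply: measurable_funM => //; apply: measurable_indic.
    rewrite (_ : [set s | s < psib x] = `]-oo, psib x[%classic); first exact: measurable_itv.
    by apply/seteqP; split => s; rewrite /= in_itv.
  - by move=> s _; rewrite lee_fin mulr_ge0.
  - by rewrite lee_fin.
rewrite -FT; apply: eq_integral => s _; rewrite sl_intE -ge0_integralZl//.
- have := nn_subgraph nk (measurable_cst (1 : R)) (fun _ => ler01) => -[mh1 _].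
  have mp : measurable_fun setT (fun x : B => (s : measurableTypeR R, x)).
    by apply: measurable_fun_pair; [exact: measurable_cst|exact: measurable_id].
  have := measurableT_comp mh1 mp.
  by apply: eq_measurable_fun => x _; rewrite /= mul1r.
- by move=> x _; rewrite lee_fin mulr_ge0.
- by rewrite lee_fin.
Qed.

Lemma integrable_Omega (k : B -> R) C : measurable_fun setT k -> (forall x, `|k x| <= C) ->
  (forall x, ~ Omega x -> k x = 0) -> (leb n.+1).-integrable setT (EFin \o k).
Proof.
move=> mk kC k0; have -> : EFin \o k = (EFin \o k) \_ Omega.
  by apply/funext => x; rewrite patchE; case: ifPn => // /negP xO; rewrite /= k0// => /mem_set.
apply/(integrable_mkcond _ mO).1; apply: measurable_bounded_integrable => //.
- by rewrite ltey_eq (leb_bounded_fin mO OK).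
- exact: measurable_funTS.
by exists C; split; [exact: num_real|move=> z Cz x _; exact: le_trans (kC x) (ltW Cz)].
Qed.

Lemma bounded_comp_psib (theta : R -> R) a : 0 < a -> continuous theta -> (forall t, t <= a -> theta t = 0) ->
  exists C, forall x, `|theta (psib x)| <= C.
Proof.
move=> a0 ct ta; apply: (@support_bounded _ _ _ K).
  by move=> x; apply: (@continuous_comp _ _ _ psib theta); [exact: psib_cont|exact: ct].
move=> x Kx; apply: ta; rewrite psib_out ?ltW// => Ox.
by move: Kx; rewrite ltNge OK.
Qed.

(** The divergence identity with phi the primitive of theta: the energy term becomes an integral
    over levels by the coarea formula, and the terms in phi become integrals over superlevel sets by
    Tonelli. *)
Lemma level_energy_test (theta : R -> R) a : 0 < a -> continuous theta -> (forall t, 0 <= theta t) ->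
  (forall t, t <= a -> theta t = 0) ->
  (\int[mu]_s ((theta s)%:E * (\int[tau s]_x (energyO x)%:E + sl_int div_pos s)) =
   \int[mu]_s ((theta s)%:E * sl_int div_neg s))%E.
Proof.
move=> a0 ct t0 ta; have [phi [Dphi phi0 phiE]] := cutoff_primitive ct t0 ta.
have cphi : continuous phi.
  by move=> t; apply: differentiable_continuous; apply/derivable1_diffP; have [] := Dphi t.
have phi_ge0 t : 0 <= phi t.
  by rewrite -lee_fin phiE integral_ge0// => s _; rewrite lee_fin mulr_ge0.
have [Ct tC] := bounded_comp_psib a0 ct ta; have [Cp pC] := bounded_comp_psib a0 cphi phi0.
have mtp : measurable_fun setT (fun x : B => theta (psib x)).
  exact: (measurableT_comp (continuous_measurable_fun ct) (measurable_psib psib_cont)).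
have mpp : measurable_fun setT (fun x : B => phi (psib x)).
  exact: (measurableT_comp (continuous_measurable_fun cphi) (measurable_psib psib_cont)).
have out x : ~ Omega x -> theta (psib x) = 0 /\ phi (psib x) = 0.
  by move=> Ox; rewrite psib_out//; split; [apply: ta|apply: phi0]; exact: ltW.
have dC x : 0 <= div_pos x <= `|Cf| /\ 0 <= div_neg x <= `|Cf|.
  rewrite /div_pos /div_neg !patchE; case: ifPn => [/set_mem Ox|_]; last by rewrite !lexx !normr_ge0.
  have := le_trans (fC Ox) (ler_norm Cf); rewrite ler_norml => /andP[h1 h2].
  rewrite !le_max !lexx /= !ge_max !normr_ge0 h2/=; split=> //.
  by rewrite lerNl h1.
have eC' x : 0 <= energyO x <= `|Ce|.
  rewrite /energyO patchE; case: ifPn => [/set_mem Ox|_]; last by rewrite lexx normr_ge0.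
  by have /andP[-> h] := eC Ox; exact: le_trans h (ler_norm _).
have mE : measurable_fun setT energyO by apply/measurable_EFinP; exact: nn_energyO.1.
have mp : measurable_fun setT div_pos by apply/measurable_EFinP; exact: nn_div_pos.1.
have mm : measurable_fun setT div_neg by apply/measurable_EFinP; exact: nn_div_neg.1.
have bnd (u v : R) c C : `|u| <= c -> 0 <= v <= C -> `|u * v| <= c * C.
  by move=> uc /andP[v0 vC]; rewrite normrM (ger0_norm v0) ler_pM.
pose uu (x : B) : R := theta (psib x) * energyO x.
pose pp (x : B) : R := phi (psib x) * div_pos x.
pose qq (x : B) : R := phi (psib x) * div_neg x.
have iu : (leb n.+1).-integrable setT (EFin \o uu).
  apply: (@integrable_Omega _ (Ct * `|Ce|)); first exact: measurable_funM.
    by move=> x; exact: bnd (tC x) (eC' x).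
  by move=> x /out[h _]; rewrite /uu h mul0r.
have ip : (leb n.+1).-integrable setT (EFin \o pp).
  apply: (@integrable_Omega _ (Cp * `|Cf|)); first exact: measurable_funM.
    by move=> x; exact: bnd (pC x) (dC x).1.
  by move=> x /out[_ h]; rewrite /pp h mul0r.
have im : (leb n.+1).-integrable setT (EFin \o qq).
  apply: (@integrable_Omega _ (Cp * `|Cf|)); first exact: measurable_funM.
    by move=> x; exact: bnd (pC x) (dC x).2.
  by move=> x /out[_ h]; rewrite /qq h mul0r.
have := divergence_identity oO OK psiC1 psib_cont psiC2 AC1 a0 Dphi ct phi0 ta.
rewrite (_ : integral _ _ _ = \int[leb n.+1]_x ((uu x)%:E + (pp x)%:E - (qq x)%:E))%E; last first.
  apply: eq_integral => x _; rewrite -[RHS]/((uu x + pp x - qq x)%:E) /uu /pp /qq; congr EFin.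
  case: (pselect (Omega x)) => Ox; last by have [-> ->] := out x Ox; rewrite !mul0r addr0 subr0.
  rewrite /energyO /div_pos /div_neg !patchE mem_set//= -addrA -mulrBr; congr (_ + _ * _).
  by rewrite !maxEle; case: ifPn; case: ifPn; lra.
rewrite integralB//; last exact: integrableD.
rewrite integralD// => /eqP; rewrite sube_eq ?add0e; last 2 first.
- by rewrite fin_numD !integrable_fin_num.
- by rewrite fin_num_adde_defr.
move=> /eqP H.
have tonE (k : B -> R) : nnmeas (EFin \o k) -> (\int[leb n.+1]_x (phi (psib x) * k x)%:E =
    \int[mu]_s ((theta s)%:E * sl_int k s))%E.
  move=> nk; rewrite -sl_int_tonelli//; apply: eq_integral => x _.
  by rewrite mulrC EFinM phiE.
rewrite -(tonE _ nn_div_neg) -H (tonE _ nn_div_pos).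
have mt : measurable_fun setT (fun s : measurableTypeR R => (theta s)%:E).
  by apply/measurable_EFinP; exact: continuous_measurable_fun.
have mL := level_measurable tauP nn_energyO.
have mQ := measurable_sl_int nn_div_pos.
have L0 s : (0 <= \int[tau s]_x (energyO x)%:E)%E by apply: integral_ge0 => x _; have [_] := nn_energyO; apply.
have Q0 s : (0 <= sl_int div_pos s)%E by apply: integral_ge0 => x _; have [_] := nn_div_pos; apply.
transitivity (\int[mu]_s ((theta s)%:E * (\int[tau s]_x (energyO x)%:E) + (theta s)%:E * sl_int div_pos s))%E.
  by apply: eq_integral => s _; rewrite ge0_muleDr.
rewrite ge0_integralD//; first last.
- exact: emeasurable_funM.
- by move=> s _; rewrite mule_ge0// lee_fin.
- exact: emeasurable_funM.
- by move=> s _; rewrite mule_ge0// lee_fin.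
congr (_ + _)%E.
have nu : nnmeas (EFin \o uu).
  split; first by apply/measurable_EFinP; exact: measurable_funM.
  by move=> x; rewrite lee_fin /uu mulr_ge0//; have /andP[] := eC' x.
transitivity (\int[mu]_s \int[tau s]_x (EFin \o uu) x)%E; last first.
  (* Where the gradient vanishes the energy vanishes too, so the restriction of the coarea formula
     to regular points loses nothing. *)
  rewrite (level_coarea tauP nu) [LHS]integral_mkcond; apply: eq_integral => x _.
  rewrite patchE; case: ifPn => // /negP nr /=; rewrite /uu /energyO patchE; case: ifPn => [/set_mem Ox|_]; last by rewrite mulr0.
  rewrite (_ : energy A psi x = 0) ?mulr0//.
  have g0 : grad psi x = 0 by apply: contrapT => /eqP g0; apply: nr; exact: mem_set.
  rewrite /energy big1// => i _; move/rowP: g0 => /(_ i); rewrite !mxE => ->; exact: mul0r.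
apply: eq_integral => s _.
have ns : nnmeas (fun x : B => (theta s)%:E * (energyO x)%:E)%E.
  split; first by apply: measurable_funeM; exact: nn_energyO.1.
  by move=> x; rewrite mule_ge0 ?lee_fin//; have /andP[] := eC' x.
transitivity (\int[tau s]_x ((theta s)%:E * (energyO x)%:E))%E.
  by rewrite ge0_integralZl// ?lee_fin//; [exact: nn_energyO.1|move=> x _; rewrite lee_fin; have /andP[] := eC' x].
apply: (level_concentrated tauP) => // x [Ox _] xs.
by rewrite /= /uu EFinM psibE// xs.
Qed.

Lemma level_energy_integral a b : 0 < a ->
  (\int[mu]_(s in `]a, b[) (\int[tau s]_x (energyO x)%:E + sl_int div_pos s) =
   \int[mu]_(s in `]a, b[) sl_int div_neg s)%E.
Proof.
move=> a0; have lim_bump (L : measurableTypeR R -> \bar R) : nnmeas L ->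
    (\int[mu]_(s in `]a, b[) L s = limn (fun k => \int[mu]_s ((bump a b k s)%:E * L s)))%E.
  move=> [mL L0].
  rewrite -(@monotone_convergence _ _ _ mu setT measurableT (fun k s => (bump a b k s)%:E * L s)%E).
  - rewrite [LHS]integral_mkcond; apply: eq_integral => s _; rewrite patchE.
    transitivity ((\1_(`]a, b[%classic) s : R)%:E * L s)%E.
      by rewrite indicE; case: ifPn => _; rewrite ?mul1e ?mul0e.
    apply/esym/cvg_lim => //; apply: cvg_near_cst.
    by apply: filterS (bump_near a b s) => k ->.
  - move=> k; apply: emeasurable_funM => //; apply/measurable_EFinP.
    exact: (continuous_measurable_fun (@bump_continuous _ a b k)).
  - by move=> k s _; rewrite mule_ge0// lee_fin bump_ge0.
  - move=> s _ k m km; apply: lee_wpmul2r => //; rewrite lee_fin; exact: bump_nd.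
have mL := level_measurable tauP nn_energyO.
have mQ := measurable_sl_int nn_div_pos.
have L0 s : (0 <= \int[tau s]_x (energyO x)%:E)%E by apply: integral_ge0 => x _; have [_] := nn_energyO; apply.
have Q0 s : (0 <= sl_int div_pos s)%E by apply: integral_ge0 => x _; have [_] := nn_div_pos; apply.
rewrite !lim_bump; first last.
- split; first exact: emeasurable_funD.
  by move=> s; rewrite adde_ge0.
- split; first exact: (measurable_sl_int nn_div_neg).
  by move=> s; apply: integral_ge0 => x _; have [_] := nn_div_neg; apply.
congr (limn _); apply/funext => k.
apply: (level_energy_test a0); [exact: bump_continuous|exact: bump_ge0|exact: bump_out].
Qed.

Lemma sl_int_le k C s : (forall x, 0 <= k x <= C) -> 0 <= s -> nnmeas (EFin \o k) ->
  (sl_int k s <= C%:E * leb n.+1 Omega)%E.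
Proof.
move=> kC s0 nk; have C0 : 0 <= C by have /andP[h1 h2] := kC 0; exact: le_trans h1 h2.
rewrite -integral_cst//; apply: le_trans (_ : _ <= \int[leb n.+1]_(x in Omega) (k x)%:E)%E _.
  apply: ge0_subset_integral => //.
  - rewrite -superlevelE//; apply: open_measurable_rV; exact: open_superlevel.
  - by apply: measurable_funTS; exact: nk.1.
  - by move=> x _; have [_] := nk; apply.
  - by move=> x /= sx; apply: (@psib_Omega _ _ Omega psi); exact: le_lt_trans sx.
apply: ge0_le_integral => //.
- by move=> x _; have [_] := nk; apply.
- by apply: measurable_funTS; exact: nk.1.
- by move=> x _; have /andP[_] := kC x; rewrite lee_fin.
Qed.

Lemma sl_int_integrable k C b : (forall x, 0 <= k x <= C) -> nnmeas (EFin \o k) ->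
  mu.-integrable (`]0, b[%classic : set (measurableTypeR R)) (sl_int k).
Proof.
move=> kC nk; have k0 s : (0 <= sl_int k s)%E by apply: integral_ge0 => x _; have [_] := nk; apply.
apply/integrableP; split; first by apply: measurable_funTS; exact: measurable_sl_int.
have mJ : measurable (`]0, b[%classic : set (measurableTypeR R)) by exact: measurable_itv.
have fO := leb_bounded_fin mO OK.
apply: (@le_lt_trans _ _ (\int[mu]_(s in `]0%R, b[) (C * fine (leb n.+1 Omega))%:E)%E).
  apply: ge0_le_integral => //.
  - by apply: measurable_funTS; apply: measurableT_comp => //; exact: measurable_sl_int.
  - by move=> s; rewrite /= in_itv/= => /andP[s0 _]; rewrite gee0_abs// EFinM fineK// sl_int_le// ltW.
have mb : mu `]0%R, b[ = (Num.max b 0)%:E; last first.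
  by rewrite integral_cst//; change ((C * fine (leb n.+1 Omega))%:E * mu `]0%R, b[ < +oo)%E; rewrite mb -EFinM ltry.
rewrite lebesgue_measure_itv/= lte_fin; case: (ltP 0 b) => b0; by rewrite ?sube0.
Qed.

(** The equality of the integrals over all intervals of levels, used as two inequalities between
    integrable functions, gives the pointwise equality almost everywhere. *)
Lemma level_energy x0 : Omega x0 -> {ae mu, forall s, 0 < s < psi x0 ->
  (\int[tau s]_x (energyO x)%:E + sl_int div_pos s = sl_int div_neg s)%E}.
Proof.
move=> Ox0; set b0 := psi x0.
have dC x : 0 <= div_pos x <= `|Cf| /\ 0 <= div_neg x <= `|Cf|.
  rewrite /div_pos /div_neg !patchE; case: ifPn => [/set_mem Ox|_]; last by rewrite !lexx !normr_ge0.
  have := le_trans (fC Ox) (ler_norm Cf); rewrite ler_norml => /andP[h1 h2].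
  rewrite !le_max !lexx /= !ge_max !normr_ge0 h2/=; split=> //.
  by rewrite lerNl h1.
have mJ : measurable (`]0, b0[%classic : set (measurableTypeR R)) by exact: measurable_itv.
have iM := sl_int_integrable b0 (fun x => (dC x).2) nn_div_neg.
have iP := sl_int_integrable b0 (fun x => (dC x).1) nn_div_pos.
have iE : mu.-integrable (`]0, b0[%classic : set (measurableTypeR R)) (fun s => \int[tau s]_x (energyO x)%:E)%E.
  apply: (level_integrable oO OK psiC1 psib_cont tauP (C := Ce)); first exact: nn_energyO.
  by move=> x Ox; rewrite lee_fin /energyO patchE mem_set//; have /andP[] := eC Ox.
have iL := integrableD mJ iE iP.
have [iq aeq qE] := fine_integrable mJ iL.
have [iq' aeq' qE'] := fine_integrable mJ iM.
have key a b : 0 < a -> a < b -> b < b0 ->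
   (\int[mu]_(s in `]a, b]) (fine ((\int[tau s]_x (energyO x)%:E) + sl_int div_pos s))%:E =
    \int[mu]_(s in `]a, b]) (fine (sl_int div_neg s))%:E)%E.
  move=> a0 ab bb0.
  have sub : (`]a, b]%classic : set (measurableTypeR R)) `<=` `]0, b0[%classic.
    move=> x /=; rewrite !in_itv/= => /andP[h1 h2].
    by rewrite (lt_trans a0 h1) (le_lt_trans h2 bb0).
  have mi : measurable (`]a, b]%classic : set (measurableTypeR R)) by exact: measurable_itv.
  have oo (L : measurableTypeR R -> \bar R) : mu.-integrable (`]0, b0[%classic : set (measurableTypeR R)) L ->
      (\int[mu]_(s in `]a, b]) L s = \int[mu]_(s in `]a, b[) L s)%E.
    move=> iL'; rewrite -integral_itv_bndo_bndc//.
    apply: measurable_funS (measurable_int mu iL') => //.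
    by move=> x; rewrite /= !in_itv/= => /andP[h1 h2]; rewrite (lt_trans a0 h1) (lt_trans h2 bb0).
  by rewrite -(qE _ mi sub) -(qE' _ mi sub) oo// oo// level_energy_integral.
have H1 := ae_le_of_intervals iq iq' (fun a b a0 ab bb => ltac:(rewrite key//)).
have H2 := ae_le_of_intervals iq' iq (fun a b a0 ab bb => ltac:(rewrite key//)).
have FF := @ae_filter_ringOfSetsType _ (measurableTypeR R) R mu.
have H3 := @filterI _ _ FF _ _ aeq aeq'.
have H4 := @filterI _ _ FF _ _ H1 H2.
apply: (@filterS2 _ _ FF _ _ _ _ H3 H4) => s [h1 h2] [h3 h4] sb.
have sJ : `]0, b0[%classic s by rewrite /= in_itv.
rewrite [LHS]h1// [RHS]h2//; congr EFin; apply/eqP; rewrite eq_le.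
by apply/andP; split; [exact: h3|exact: h4].
Qed.

End energy_level.

(** * Compactness of the closure and behaviour of psi at the boundary *)

Section domain.
Context {R : realType} {n : nat}.
Variable Omega : set 'rV[R]_n.+1.
Hypotheses (oO : open Omega) (bO : bounded_set Omega).

Lemma closure_bounded : exists K, forall x, closure Omega x -> `|x| <= K.
Proof.
have [M [_ hM]] := bO; exists (M + 1) => x cx; rewrite leNgt; apply/negP => Kx.
have : nbhs x [set y : 'rV[R]_n.+1 | M + 1 < `|y|].
  by apply: open_nbhs_nbhs; split=> //; exact: open_norm_gt.
move=> /cx[y [Oy]] /=; rewrite ltNge => /negP; apply.
by apply: hM => //; rewrite ltrDl.
Qed.

Lemma closure_compact : compact (closure Omega).
Proof.
have [K hK] := closure_bounded.
apply: (@subclosed_compact _ _ (cbox (const_mx (- K)) (const_mx K))).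
- exact: closed_closure.
- exact: compact_cbox.
by move=> x cx i; rewrite !mxE -ler_norml; exact: le_trans (coord_le_norm x i) (hK x cx).
Qed.

Lemma isC0_closure_bounded k : isC0_closure Omega k -> exists C, forall x, Omega x -> `|k x| <= C.
Proof.
move=> kc; have : compact (k @` closure Omega) by apply: continuous_compact closure_compact.
move=> /compact_bounded[M [_ hM]]; exists (M + 1) => x Ox; apply: hM; first by rewrite ltrDl.
by exists x => //; exact: subset_closure.
Qed.

Lemma isC0_closure_continuous k x : isC0_closure Omega k -> Omega x -> {for x, continuous k}.
Proof.
move=> kc Ox; have : {within Omega, continuous k}.
  by apply: continuous_subspaceW kc; exact: subset_closure.
by rewrite continuous_open_subspace// => /(_ x (mem_set Ox)).
Qed.

Lemma isC1_closure_isC1 f : isC1_closure Omega f -> isC1 Omega f.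
Proof.
move=> [_ fg] i x Ox; have [g [gc gE]] := fg i; split; first by have [] := gE x Ox.
have gcx := isC0_closure_continuous gc Ox.
rewrite /prop_for /continuous_at (gE x Ox).2.
apply: cvg_trans gcx; apply: (@near_eq_cvg _ _ _ (nbhs_filter x)).
have : nbhs x Omega by exact: open_nbhs_nbhs.
by apply: filterS => y /gE[_ ->].
Qed.

Lemma isC1_closure_grad_bounded f : isC1_closure Omega f ->
  exists C, forall x, Omega x -> enorm (grad f x) <= C.
Proof.
move=> [_ fg].
have /choice[C hC] : forall i, exists C, forall x, Omega x -> `|partial i f x| <= C.
  move=> i; have [g [gc gE]] := fg i; have [C gC] := isC0_closure_bounded gc.
  by exists C => x Ox; rewrite (gE x Ox).2 gC.
exists (Num.sqrt (\sum_i (C i) ^+ 2)) => x Ox; rewrite ler_wsqrtr//.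
apply: ler_sum => i _; rewrite mxE -expr2 -real_normK ?num_real//.
by rewrite lerXn2r ?nnegrE ?normr_ge0 ?(le_trans _ (hC i x Ox)) ?hC.
Qed.

Variable psi : 'rV[R]_n.+1 -> R.
Hypotheses (psiC : isC1_closure Omega psi) (psi_pos : forall x, Omega x -> 0 < psi x)
  (psi_bnd : forall x, boundary Omega x -> psi x = 0).

Lemma closure_cases x : closure Omega x -> Omega x \/ psi x = 0.
Proof.
move=> cx; case: (pselect (Omega x)) => Ox; [by left|right].
by apply: psi_bnd; split => //; rewrite (interior_id Omega).1.
Qed.

(** Outside the closure the extension is locally 0, and inside Omega it is psi. At a boundary point
    the limit along Omega is psi = 0, which matches the value outside. *)
Lemma psib_continuous : continuous (psib Omega psi).
Proof.
have psi0 := psiC.1; move=> x.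
have FF := nbhs_filter x.
case: (pselect (closure Omega x)) => cx; last first.
  have H : \near x, psib Omega psi x = 0.
    have : nbhs x (~` closure Omega) by apply: open_nbhs_nbhs; split=> //; exact: closed_openC (@closed_closure _ _).
    by apply: filterS => y cy; rewrite psib_out// => /subset_closure.
  rewrite /continuous_at psib_out; last by move=> /subset_closure.
  apply/(@cvgrPdist_lt _ _ _ _ FF) => e e0.
  by apply: filterS H => y ->; rewrite subrr normr0.
case: (pselect (Omega x)) => Ox.
  rewrite /continuous_at psibE//; have := isC0_closure_continuous psi0 Ox.
  apply: cvg_trans; apply: (@near_eq_cvg _ _ _ FF).
  have : nbhs x Omega by exact: open_nbhs_nbhs.
  by apply: filterS => y Oy; rewrite psibE.
have p0 : psi x = 0 by case: (closure_cases cx).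
rewrite /continuous_at psib_out//; apply/(@cvgrPdist_lt _ _ _ _ FF) => e e0.
have /(_ x cx) := (subspace_continuousP _ _).1 psi0 => H.
have PF : Filter (within (closure Omega) (nbhs x)) by exact: within_filter.
have {H} := (@cvgrPdist_lt _ _ _ _ PF _ _).1 H e e0.
move=> h; have h' : nbhs x (fun y => closure Omega y -> `|psi x - psi y| < e) := h.
apply: (@filterS _ _ FF _ _ _ h') => y hy; rewrite -p0.
case: (pselect (Omega y)) => Oy; last by rewrite psib_out// p0 subr0 normr0.
by rewrite psibE//; apply: hy; exact: subset_closure.
Qed.

Lemma gradpsiE x : Omega x -> gradpsi Omega psi x = grad psi x.
Proof.
move=> Ox; apply/rowP => i; rewrite !mxE.
have c := (isC1_closure_isC1 psiC i Ox).2.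
have nO : nbhs x Omega by exact: open_nbhs_nbhs.
have PF : ProperFilter (within Omega (nbhs x)).
  by apply: within_nbhs_proper; exact: subset_closure.
apply/cvg_lim => //; apply: cvg_within_filter; exact: c.
Qed.

Lemma levelE a : 0 < a -> level Omega psi a = [set x | Omega x /\ psi x = a].
Proof.
move=> a0; apply/seteqP; split => x [cx xa]; split=> //; last exact: subset_closure.
by have [//|p0] := closure_cases cx; move: a0; rewrite -xa p0 ltxx.
Qed.

Hypothesis O0 : Omega !=set0.

(** The maximum over the compact closure is attained, and not on the boundary, where psi is 0 while
    it is positive at some point of Omega. *)
Lemma psi_max_attained : exists2 x0, Omega x0 & psi x0 = psi_max Omega psi /\
  forall x, Omega x -> psi x <= psi_max Omega psi.
Proof.
have [z Oz] := O0.
have cC : compact (psi @` closure Omega) by apply: continuous_compact closure_compact; exact: psiC.1.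
have n0 : (psi @` closure Omega) !=set0 by exists (psi z), z => //; exact: subset_closure.
have hs : has_sup (psi @` closure Omega).
  by split => //; have [M [_ hM]] := compact_bounded cC; exists (M + 1) => y hy;
    apply: le_trans (ler_norm _) _; apply: hM => //; rewrite ltrDl.
have ub x : closure Omega x -> psi x <= psi_max Omega psi.
  by move=> cx; apply: ub_le_sup; [exact: hs.2|exists x].
have : (psi @` closure Omega) (psi_max Omega psi).
  have cl : closed (psi @` closure Omega) by apply: compact_closed cC; exact: Rhausdorff.
  by apply: cl; exact: (closure_sup n0 hs.2).
move=> [x0 cx0 x0M]; exists x0.
  have [//|p0] := closure_cases cx0.
  have := ub z (subset_closure Oz); rewrite -x0M p0 leNgt psi_pos//.
by split => // x /subset_closure/ub.
Qed.

End domain.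

(** * Integrals over levels *)

Lemma cauchy_schwarz d (T : measurableType d) (R : realType) (nu : {measure set T -> \bar R}) (D : set T)
    (u w : T -> R) : measurable D -> nu.-integrable D (EFin \o (fun x => u x ^+ 2)) ->
  nu.-integrable D (EFin \o (fun x => u x * w x)) -> nu.-integrable D (EFin \o (fun x => w x ^+ 2)) ->
  (\int[nu]_(x in D) (u x * w x)) ^+ 2 <= (\int[nu]_(x in D) (u x ^+ 2)) * \int[nu]_(x in D) (w x ^+ 2).
Proof.
move=> mD iu iuw iw.
set U := \int[nu]_(x in D) (u x ^+ 2); set P := \int[nu]_(x in D) (u x * w x).
set W := \int[nu]_(x in D) (w x ^+ 2).
have key t : 0 <= t ^+ 2 * U - 2 * t * P + W.
  have iZ c f : nu.-integrable D (EFin \o f) -> nu.-integrable D (EFin \o (fun x => c * f x)).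
    by move=> jf; have := integrableZl mD c jf; apply: eq_integrable.
  have i1 := iZ (t ^+ 2) _ iu; have i2 := iZ (2 * t) _ iuw.
  have i12 : nu.-integrable D (EFin \o (fun x => t ^+ 2 * u x ^+ 2 - 2 * t * (u x * w x))).
    by have := integrableB mD i1 i2; apply: eq_integrable.
  rewrite /U /P /W -!RintegralZl// -RintegralB// -RintegralD//; apply: Rintegral_ge0 => x _.
  by rewrite (_ : _ + _ = (t * u x - w x) ^+ 2) ?sqr_ge0//; ring.
have U0 : 0 <= U by apply: Rintegral_ge0 => x _; exact: sqr_ge0.
have [U1|U1] := eqVneq U 0.
  rewrite U1 mul0r in key *; have [->|P0] := eqVneq P 0; first by rewrite expr0n.
  (* When U = 0 the quadratic is affine in t, and this t gives it the value -1 unless P = 0. *)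
  have := key ((W + 1) / (2 * P)); rewrite mulr0 add0r.
  by rewrite (_ : 2 * ((W + 1) / (2 * P)) * P = W + 1); [lra|field].
have U2 : 0 < U by rewrite lt_def U1.
have := key (P / U).
rewrite (_ : (P / U) ^+ 2 * U - 2 * (P / U) * P + W = (W * U - P ^+ 2) / U); last by field.
by rewrite pmulr_lge0 ?invr_gt0// subr_ge0 mulrC.
Qed.

Lemma measurable_invr (R : realType) : measurable_fun setT (GRing.inv : measurableTypeR R -> R).
Proof.
have o0 : open (~` [set (0 : R)]) by apply: closed_openC; exact: closed_eq.
have E : (GRing.inv : measurableTypeR R -> R) = (GRing.inv : R -> R) \_ (~` [set 0]).
  apply/funext => x; rewrite patchE; case: ifPn => // /negP h.
  have -> : x = 0 by apply: contrapT => x0; apply: h; exact: mem_set.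
  by rewrite invr0.
rewrite E; apply/(measurable_restrictT _ _).1; first exact: open_measurable.
apply: open_continuous_measurable_fun => // x; rewrite inE/= => /eqP x0; exact: inv_continuous.
Qed.

Section levels.
Context {R : realType} {n : nat}.
Variables (Omega : set 'rV[R]_n.+1) (psi : 'rV[R]_n.+1 -> R) (K : R).
Hypotheses (oO : open Omega) (OK : forall x, Omega x -> `|x| <= K) (psiC1 : isC1 Omega psi)
  (psib_cont : continuous (psib Omega psi)).
Variable tau : R -> {measure set (rVborel R n.+1) -> \bar R}.
Hypothesis tauP : level_measures Omega psi tau.
Local Notation psib := (psib Omega psi).
Local Notation mu := (@lebesgue_measure R).
Local Notation B := (rVborel R n.+1).
Let mO : measurable (Omega : set B) := open_measurable_rV oO.

(** On such a level the surface measure is |grad psi| times the level measure, and the factor |grad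
    psi|^-1 of [level_integral] cancels. The null set of levels is fixed before k, so one good level
    serves all integrands. *)
Lemma level_integral_tau :
  (forall a, 0 < a -> level Omega psi a = [set x | Omega x /\ psi x = a]) ->
  (forall x, Omega x -> gradpsi Omega psi x = grad psi x) ->
  {ae mu, forall a, 0 < a -> (forall x, Omega x -> psi x = a -> grad psi x != 0) ->
    forall k : B -> R, measurable_fun (Omega : set B) k -> (forall x, Omega x -> 0 <= k x) ->
    level_integral Omega psi k a = \int[tau a]_(x in Omega) k x}.
Proof.
move=> lvE gE; have FF := @ae_filter_ringOfSetsType _ (measurableTypeR R) R mu.
apply: (@filterS _ _ FF _ _ _ (level_surface tauP)) => a ha a0 reg k mk k0.
set S : set B := level Omega psi a.
have SE : S = [set x | Omega x /\ psi x = a] by exact: lvE.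
have mS : measurable S.
  rewrite SE (_ : [set x | _] = psib @^-1` [set a]); last first.
    apply/seteqP; split => x /= => [[Ox xa]|xa]; first by rewrite psibE.
    by have Ox : Omega x by [apply: (@psib_Omega _ _ Omega psi); rewrite xa]; rewrite -xa psibE.
  by apply: (measurable_preim psib_cont); exact: measurable_set1.
have Sreg : S `<=` regular_set Omega psi.
  by rewrite SE => x [Ox xa]; split => //=; exact: reg.
have SO : S `<=` Omega by rewrite SE => x [].
pose g : B -> R := (fun x => enorm (grad psi x)) \_ Omega.
have ng : nnmeas (EFin \o g) by exact: nnmeas_grO.
have gS x : S x -> g x = enorm (grad psi x) by move=> /SO Ox; rewrite /g patchE mem_set.
pose kO : B -> R := k \_ Omega.
have kO0 x : 0 <= kO x by rewrite /kO patchE; case: ifPn => // /set_mem; exact: k0.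
have mkO : measurable_fun setT kO by apply/(measurable_restrictT _ _).1.
pose w : B -> \bar R := (EFin \o (fun x => kO x * (g x)^-1)) \_ S.
have nw : nnmeas w.
  apply: (@nnmeas_patch R) => //; split.
    apply/measurable_EFinP; apply: measurable_funM => //; apply: measurableT_comp.
      exact: measurable_invr.
    by apply/measurable_EFinP; exact: ng.1.
  by move=> x; rewrite lee_fin mulr_ge0// invr_ge0; have [_ /(_ x)] := ng; rewrite lee_fin.
rewrite /level_integral /Defs.Rint /Rintegral -/S; congr fine.
rewrite (@eq_setfun_integral _ _ _ _ (dens_measure (tau a) ng)); last first.
  move=> C mC CS; rewrite densE (ha S C)//; apply: eq_integral => x /set_mem /CS Sx.
  by rewrite /= gS.
transitivity (\int[dens_measure (tau a) ng]_x w x)%E.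
  rewrite integral_mkcond; apply: eq_integral => x _; rewrite /w !patchE.
  case: ifPn => // /set_mem Sx; have Ox := SO _ Sx.
  by rewrite /= gE// -gS// /kO patchE mem_set.
rewrite (integral_dens _ ng nw) [RHS]integral_mkcond.
transitivity (\int[tau a]_x (EFin \o kO) x)%E; last by rewrite -restrict_EFin.
have nk : nnmeas (EFin \o kO) by split; [exact/measurable_EFinP|move=> x; rewrite lee_fin].
apply: (level_concentrated tauP) => //.
  exact: (nnmeasM ng nw).
move=> x [Ox gx] xa; have Sx : S x by rewrite SE.
rewrite /w patchE mem_set//= -EFinM; congr EFin.
rewrite mulrCA divff ?mulr1// gS// enorm_eq0; exact: gx.
Qed.

Hypothesis reg_null : (leb n.+1).-negligible (Omega `\` regular_set Omega psi : set B).

Lemma coarea_full (S : set (measurableTypeR R)) (k : B -> \bar R) : measurable S -> S `<=` `]0, +oo[%classic ->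
  nnmeas k -> (\int[mu]_(s in S) \int[tau s]_x k x = \int[leb n.+1]_(x in psib @^-1` S) k x)%E.
Proof.
move=> mS S0 nk; rewrite (level_coarea_on psib_cont tauP mS nk).
have [N [mN N0 NO]] := reg_null.
have mP := measurable_preim psib_cont mS.
rewrite setIC integral_mkcondr; have [mk k0] := nk.
apply: (ge0_integral_off mN N0) => x xS.
- by rewrite patchE; case: ifPn.
- exact: k0.
move=> xN; rewrite patchE; case: ifPn => // /negP nr; exfalso; apply: xN; apply: NO; split.
  by apply: (@psib_Omega _ _ Omega psi); have := S0 _ xS; rewrite /= in_itv/= andbT.
by move=> rx; apply: nr; exact: mem_set.
Qed.

Definition area (s : R) : R := \int[tau s]_(x in Omega) 1.

Lemma area_ge0 s : 0 <= area s.
Proof. exact: Rintegral_ge0. Qed.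

Definition indO (x : B) : R := (\1_Omega : B -> R) x.

Lemma nn_ind : nnmeas (EFin \o indO).
Proof. exact: (nnmeas_indic mO). Qed.

Lemma indO_restrict : (fun=> 1%E) \_ Omega = EFin \o indO.
Proof. by apply/funext => x; rewrite /= /indO indicE patchE; case: ifPn. Qed.

Lemma areaE s : area s = fine (\int[tau s]_x (indO x)%:E)%E.
Proof. by rewrite /area /Rintegral integral_mkcond indO_restrict. Qed.

Lemma area_fine b : [/\ mu.-integrable `]0, b[ (EFin \o area),
    {ae mu, forall s, 0 < s < b -> (\int[tau s]_(x in Omega) (1 : \bar R) < +oo)%E} &
    forall S : set (measurableTypeR R), measurable S -> S `<=` `]0, b[%classic ->
      (\int[mu]_(s in S) (area s)%:E = leb n.+1 (psib @^-1` S))%E].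
Proof.
have mJ : measurable (`]0, b[%classic : set (measurableTypeR R)) by exact: measurable_itv.
have iL : mu.-integrable (`]0, b[%classic : set (measurableTypeR R))
    (fun s => \int[tau s]_x (indO x)%:E)%E.
  apply: (level_integrable oO OK psiC1 psib_cont tauP (C := 1)); first exact: nn_ind.
  by move=> x Ox; rewrite lee_fin /indO indicE mem_set.
have [iq aeq qE] := fine_integrable mJ iL.
split.
- by apply: eq_integrable iq => // s _; rewrite /= areaE.
- have FF := @ae_filter_ringOfSetsType _ (measurableTypeR R) R mu.
  apply: (@filterS _ _ FF _ _ _ aeq) => s h sb.
  by rewrite integral_mkcond indO_restrict h ?ltry//= in_itv.
move=> S mS Sb; have S0 : S `<=` `]0, +oo[%classic.
  by move=> x /Sb; rewrite /= !in_itv/= andbT => /andP[].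
transitivity (\int[mu]_(s in S) \int[tau s]_x (indO x)%:E)%E.
  by rewrite (qE S mS Sb); apply: eq_integral => s _; rewrite areaE.
rewrite (coarea_full mS S0 nn_ind).
have mP := measurable_preim psib_cont mS.
rewrite -[RHS]mul1e -integral_cst//; apply: eq_integral => x /set_mem xS; rewrite /= /indO indicE mem_set//.
by apply: (@psib_Omega _ _ Omega psi); have := S0 _ xS; rewrite /= in_itv/= andbT.
Qed.

End levels.

(** * The correspondence between levels and radii *)

Lemma itv_mem_aux (R : realType) (r q0 q : R) (b b' : bool) : ((0 <= r < q0) && b') = (0 <= r < q) ->
  (0 <= r < q0 -> b = b') -> (r \in `[0, q[%classic) = (r \in `[0, q0[%classic) && b.
Proof.
have E (c : R) : (r \in `[0, c[%classic) = (0 <= r < c) by apply/idP/idP; rewrite inE/= in_itv.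
by rewrite !E => <- bb; case: (0 <= r < q0) bb => //= ->.
Qed.

Section radial.
Context {R : realType} {n : nat}.
Variables (Omega : set 'rV[R]_n.+1) (psi : 'rV[R]_n.+1 -> R) (K M : R) (x0 : 'rV[R]_n.+1).
Hypotheses (oO : open Omega) (OK : forall x, Omega x -> `|x| <= K) (psiC1 : isC1 Omega psi)
  (psib_cont : continuous (psib Omega psi)) (psi_pos : forall x, Omega x -> 0 < psi x)
  (Ox0 : Omega x0) (psix0 : psi x0 = M) (psiM : forall x, Omega x -> psi x <= M)
  (ME : psi_max Omega psi = M).
Variable tau : R -> {measure set (rVborel R n.+1) -> \bar R}.
Hypothesis tauP : level_measures Omega psi tau.
Hypothesis reg_null : (leb n.+1).-negligible (Omega `\` regular_set Omega psi : set (rVborel R n.+1)).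
Local Notation psib := (psib Omega psi).
Local Notation mu := (@lebesgue_measure R).
Local Notation B := (rVborel R n.+1).
Local Notation sl s := (superlevel Omega psi s).
Local Notation rho := (rho Omega psi).
Local Notation rho_inv := (rho_inv Omega psi).
Local Notation al := (@alpha R n).
Local Notation R0 := (@Defs.radius R n Omega).
Local Notation area := (area Omega tau).
Let mO : measurable (Omega : set B) := open_measurable_rV oO.

Lemma M_gt0 : 0 < M. Proof. by rewrite -psix0 psi_pos. Qed.

Lemma rho0 : rho 0 = R0.
Proof.
rewrite /Defs.rho /Defs.radius (_ : sl 0 = Omega)//; apply/seteqP; split => x; first by case.
by move=> Ox; split => //; exact: psi_pos.
Qed.

Lemma leb_sl s : 0 <= s -> leb n.+1 (sl s) = (al * rho s ^+ n.+1)%:E.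
Proof.
move=> s0; apply: (volume_radius_leb (K := K)); first by apply: open_measurable_rV; exact: open_superlevel.
by move=> x [Ox _]; exact: OK.
Qed.

Lemma rho_ge0 s : 0 <= rho s. Proof. exact: volume_radius_ge0. Qed.

Lemma rho_out s : M <= s -> rho s = 0.
Proof.
move=> Ms; have s0 : 0 <= s by exact: le_trans (ltW M_gt0) Ms.
have := leb_sl s0; rewrite (_ : sl s = set0) ?measure0; last first.
  by apply/seteqP; split => // x [Ox]; rewrite ltNge (le_trans (psiM Ox) Ms).
by move=> [/esym/eqP]; rewrite mulf_eq0 gt_eqF ?alpha_gt0//= expf_eq0/= => /eqP.
Qed.

(** Along a segment from the maximum point to a point outside Omega, psib goes continuously from M
    to 0. *)
Lemma value_between s t : 0 <= s -> s < t -> t <= M -> exists x, s < psib x < t.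
Proof.
move=> s0 st tM; set v := (s + t) / 2.
have vs : s < v < t by rewrite /v; apply/andP; split; lra.
(* The coordinates of x0 are at least -K, so those of [c 1] are at least K + 1 and [c 1] lies
   outside Omega. *)
pose w : 'rV[R]_n.+1 := const_mx (K + K + 1); pose c (u : R) := u *: w + x0.
have K0 : 0 <= K by exact: le_trans (OK Ox0).
have cc : continuous (fun u => psib (c u)).
  move=> u; apply: (@cvg_comp _ _ _ c psib _ (nbhs (c u))); last exact: psib_cont.
  apply: (@cvgD _ _ _ _ (nbhs_filter u)); last exact: cvg_cst.
  by apply: (@cvgZr_tmp _ _ _ _ (nbhs_filter u)) => //; exact: cvg_id.
have c1 : psib (c 1) = 0.
  apply: psib_out => /OK; rewrite leNgt => /negP; apply.
  apply: lt_le_trans (coord_le_norm _ ord0); rewrite !mxE mul1r.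
  have := le_trans (coord_le_norm x0 ord0) (OK Ox0); rewrite ler_norml => /andP[h1 h2].
  by apply: lt_le_trans (ler_norm _); lra.
have c0 : psib (c 0) = M by rewrite /c scale0r add0r psibE.
have [] := @IVT R (fun u => psib (c u)) 0 1 v ler01 (continuous_subspaceT cc).
  rewrite c0 c1 minC maxC; have M0 := M_gt0.
  by rewrite (min_idPl (ltW M0)) (max_idPr (ltW M0)); case/andP: vs => v1 v2; apply/andP; split; lra.
by move=> u _ uv; exists (c u); rewrite uv.
Qed.

(** The band {s < psib < t} is open and nonempty, hence of positive volume. *)
Lemma rho_lt s t : 0 <= s -> s < t -> t <= M -> rho t < rho s.
Proof.
move=> s0 st tM; have t0 := le_trans s0 (ltW st).
have mt : measurable (sl t : set B) by apply: open_measurable_rV; exact: open_superlevel.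
have ms : measurable (sl s : set B) by apply: open_measurable_rV; exact: open_superlevel.
have sub : sl t `<=` sl s by move=> x [Ox tx]; split=> //; exact: lt_trans tx.
have [x /andP[sx xt]] := value_between s0 st tM.
have oU : open [set x | s < psib x < t].
  rewrite openE => y /= yst; have /(_ [set r | s < r < t]) := @psib_cont y; apply.
  case/andP: yst => h1 h2.
  by apply: (@filterS2 _ _ (nbhs_filter _) _ _ _ _ (lt_nbhsr h1) (lt_nbhsl h2)) => z /= -> ->.
have U0 := @open_leb_gt0 _ _ _ x oU (introT andP (conj sx xt)).
have : (leb n.+1 (sl t) < leb n.+1 (sl s))%E.
  have -> : sl s = sl t `|` (sl s `\` sl t) by rewrite setDUK.
  rewrite measureU//; [|exact: measurableD|by rewrite setDIK].
  rewrite lteDl; last by rewrite leb_sl.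
  apply: lt_le_trans U0 _; apply: le_measure; rewrite ?inE; [exact: open_measurable_rV|exact: measurableD|].
  move=> y /= /andP[sy yt]; have Oy := psib_Omega (le_lt_trans s0 sy).
  rewrite psibE// in sy yt; split; first by split.
  by move=> [_]; rewrite ltNge (ltW yt).
rewrite !leb_sl// lte_fin ltr_pM2l ?alpha_gt0//.
by rewrite ltr_pXn2r ?nnegrE ?rho_ge0.
Qed.

Lemma volume_area s : 0 <= s -> s <= M ->
  (al * rho s ^+ n.+1)%:E = (\int[mu]_(t in `]s, M]) (area t)%:E)%E.
Proof.
move=> s0 sM; have [_ _ aE] := area_fine oO OK psiC1 psib_cont tauP reg_null (M + 1).
rewrite aE; last 2 first.
- exact: measurable_itv.
- move=> t; rewrite /= !in_itv/= => /andP[h1 h2]; rewrite (le_lt_trans s0 h1)/=.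
  by apply: le_lt_trans h2 _; rewrite ltrDl.
rewrite -leb_sl// superlevelE//; congr (leb _ _).
apply/seteqP; split => x /=; rewrite in_itv/=; last by move=> /andP[].
move=> sx; rewrite sx/=; have Ox := psib_Omega (le_lt_trans s0 sx).
by rewrite psibE// psiM.
Qed.

(** The volume of the superlevel set is an integral of [area] over levels, hence continuous in the
    level, and the intermediate value theorem applies. *)
Lemma rho_surj r : 0 <= r -> r <= R0 -> exists2 a, 0 <= a <= M & rho a = r.
Proof.
move=> r0 rR; have M0 := M_gt0.
have [ia _ _] := area_fine oO OK psiC1 psib_cont tauP reg_null (M + 1).
have mJ : measurable (`]0, M + 1[%classic : set (measurableTypeR R)) by exact: measurable_itv.
pose f := area \_ `]0, M + 1[.
have if' : mu.-integrable setT (EFin \o f).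
  by rewrite /f -restrict_EFin; apply/(integrable_mkcond _ mJ).1.
have i0 : mu.-integrable `[0, M] (EFin \o f) by exact: integrableS if'.
have cF := @parameterized_integral_continuous R 0 M f (ltW M0) i0.
pose V := \int[mu]_(t in `[0, M]) f t.
have E s : 0 <= s -> s <= M -> al * rho s ^+ n.+1 = V - \int[mu]_(t in `[0, s]) f t.
  move=> s0 sM; rewrite /V Rintegral_itvB ?bnd_simp//.
  apply: EFin_inj; rewrite volume_area// /Rintegral fineK; last first.
    by rewrite integrable_fin_num//; exact: integrableS if'.
  apply: eq_integral => t /set_mem; rewrite /= in_itv/= => /andP[h1 h2].
  by rewrite /f patchE mem_set//= in_itv/= (le_lt_trans s0 h1)/= (le_lt_trans h2)// ltrDl.
have E0 := E 0 (lexx _) (ltW M0); have EM := E M (ltW M0) (lexx _).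
have z0 : \int[mu]_(t in `[0, 0]) f t = 0 by rewrite set_itv1 Rintegral_set1.
rewrite z0 subr0 rho0 in E0.
rewrite rho_out// expr0n mulr0 in EM.
have [] := @IVT R (fun s => \int[mu]_(t in `[0, s]) f t) 0 M (V - al * r ^+ n.+1) (ltW M0) cF.
  have a0 : 0 < al by exact: alpha_gt0.
  have h1 : al * r ^+ n.+1 <= V.
    by rewrite -E0 ler_wpM2l// ?(ltW a0)// lerXn2r ?nnegrE// (le_trans r0 rR).
  have h2 : 0 <= al * r ^+ n.+1 by rewrite mulr_ge0 ?(ltW a0)// exprn_ge0.
  have h3 : \int[mu]_(t in `[0, M]) f t = V by [].
  rewrite z0 h3 (min_idPl _) ?(max_idPr _); try lra.
move=> a; rewrite in_itv/= => /andP[a0 aM] aE; exists a; first by rewrite a0.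
have := E a a0 aM; rewrite aE opprB addrC subrK => /mulfI H.
have {}H : rho a ^+ n.+1 = r ^+ n.+1 by apply: H; rewrite gt_eqF ?alpha_gt0.
by apply/eqP; rewrite -(@eqrXn2 _ n.+1) ?rho_ge0//; apply/eqP.
Qed.

Lemma rho_invP r : 0 <= r -> r <= R0 -> 0 <= rho_inv r <= M /\ rho (rho_inv r) = r.
Proof.
move=> r0 rR; have [a aM ar] := rho_surj r0 rR.
have H : exists a, [set a | 0 <= a <= psi_max Omega psi /\ rho a = r] a by exists a; rewrite /= ME.
by have := xgetPex 0 H; rewrite -/(rho_inv r) /= ME.
Qed.

Lemma rho_inv_gt r s : 0 <= r -> r <= R0 -> 0 <= s -> (s < rho_inv r) = (r < rho s).
Proof.
move=> r0 rR s0; have [/andP[a0 aM] ar] := rho_invP r0 rR.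
have [sM|Ms] := leP M s.
  by rewrite rho_out// ltNge (le_trans aM sM) ltNge r0.
apply/idP/idP => [h|]; first by rewrite -ar rho_lt.
rewrite -{1}ar ltNge => /negP h; rewrite ltNge; apply/negP; rewrite le_eqVlt => /predU1P[E|h'].
  by apply: h; rewrite E; exact: lexx.
by apply: h; apply: ltW; apply: rho_lt => //; exact: ltW.
Qed.

Lemma R0_gt0 : 0 < R0.
Proof. by rewrite -rho0 (le_lt_trans (rho_ge0 M))// rho_lt// M_gt0. Qed.

Definition kinv : measurableTypeR R -> measurableTypeR R := rho_inv \_ `[0, R0[.

Opaque Defs.rho Defs.rho_inv Defs.radius.

Lemma rho_max_le a : rho (Num.max a 0) <= R0.
Proof.
have b0 : 0 <= Num.max a 0 by rewrite le_max lexx orbT.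
rewrite -rho0; have [->|b1] := eqVneq (Num.max a 0) 0; first exact: lexx.
have [Mb|bM] := leP M (Num.max a 0); first by rewrite rho_out//; exact: rho_ge0.
by apply: ltW; apply: rho_lt; [exact: lexx|rewrite lt_def b1|exact: ltW].
Qed.

(** Negative a are allowed: for r below the full radius [rho_inv r] is positive, so replacing a by
    its maximum with 0 changes nothing. *)
Lemma rho_inv_ray a r : ((0 <= r < R0) && (a < rho_inv r)) = (0 <= r < rho (Num.max a 0)).
Proof.
have b0 : 0 <= Num.max a 0 by rewrite le_max lexx orbT.
have gtE : 0 <= r -> r < R0 -> (r < rho (Num.max a 0)) = (a < rho_inv r).
  move=> r0 rR; rewrite -(rho_inv_gt r0 (ltW rR) b0) gt_max.
  have [/andP[h _] E] := rho_invP r0 (ltW rR).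
  have h' : 0 < rho_inv r.
    rewrite lt_neqAle h andbT; apply/negP => /eqP E0.
    by move: rR; rewrite -E -E0 rho0 ltxx.
  by rewrite h' andbT.
apply/andP/andP => -[].
  move=> /andP[r0 rR] ar; split; first exact: r0.
  by rewrite gtE.
move=> r0 rb; have rR := lt_le_trans rb (rho_max_le a).
by split; [apply/andP; split|rewrite -gtE].
Qed.

Lemma kinvE r : 0 <= r < R0 -> kinv r = rho_inv r.
Proof. by move=> rR; rewrite /kinv patchE mem_set//= in_itv. Qed.

Lemma measurable_kinv : measurable_fun setT kinv.
Proof.
apply/(measurable_restrictT _ _).1; first exact: measurable_itv.
have m0 : measurable (`[0, R0[%classic : set (measurableTypeR R)) by exact: measurable_itv.
apply: (measurability _ (RGenOInfty.measurableE R)) => //.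
move=> _ [_ [a ->] <-].
rewrite (_ : _ `&` _ = `[0, rho (Num.max a 0)[%classic); first exact: measurable_itv.
have iE (r : R) : `[0, rho (Num.max a 0)[%classic r = (0 <= r < rho (Num.max a 0)) :> Prop.
  by rewrite /= in_itv.
have jE (r : R) : `[0, R0[%classic r = (0 <= r < R0) :> Prop by rewrite /= in_itv.
have kE (r : R) : (rho_inv @^-1` `]a, +oo[%classic) r = (a < rho_inv r) :> Prop.
  by rewrite /preimage /mkset in_itv /= andbT.
apply/seteqP; split => r.
  by move=> [h1 h2]; rewrite iE -rho_inv_ray; rewrite jE in h1; rewrite kE in h2; rewrite h1 h2.
by rewrite iE -rho_inv_ray => /andP[h1 h2]; split; [rewrite jE|rewrite kE].
Qed.

(** The image under [rho_inv] of the measure [sphere_area] dr is the measure [area] da: on the ray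
    above a both have the mass of the ball, that is of the superlevel set. No derivative of rho is
    taken. *)
Lemma radial_change (g : R -> \bar R) : nnmeas (g : measurableTypeR R -> \bar R) ->
  (\int[mu]_(r in `[0%R, R0[) ((sphere_area (n := n) r)%:E * g (rho_inv r)) =
   \int[mu]_(a in `]0%R, M]) ((area a)%:E * g a))%E.
Proof.
move=> [mg g0]; have M0 := M_gt0.
pose w : measurableTypeR R -> R := sphere_area (n := n) \_ `[0, R0[.
pose z : measurableTypeR R -> R := area \_ `]0, M].
have mI : measurable (`[0, R0[%classic : set (measurableTypeR R)) by exact: measurable_itv.
have mJ : measurable (`]0, M]%classic : set (measurableTypeR R)) by exact: measurable_itv.
have nw : nnmeas (EFin \o w).
  split; last first.
    move=> r; rewrite lee_fin /w patchE; case: ifPn => // /set_mem; rewrite /= in_itv/= => /andP[r0 _].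
    exact: sphere_area_ge0.
  apply/measurable_EFinP/(measurable_restrictT _ _).1 => //.
  apply: measurable_funTS; exact: (continuous_measurable_fun continuous_sphere_area).
have [ia _ aE] := area_fine oO OK psiC1 psib_cont tauP reg_null (M + 1).
have nz : nnmeas (EFin \o z).
  split; last by move=> r; rewrite lee_fin /z patchE; case: ifPn => // _; exact: area_ge0.
  apply/measurable_EFinP/(measurable_restrictT _ _).1 => //.
  have ma : measurable_fun (`]0, M + 1[%classic : set (measurableTypeR R)) (area : measurableTypeR R -> R).
    by apply/measurable_EFinP; exact: measurable_int ia.
  apply: measurable_funS ma; first exact: measurable_itv.
  move=> t; rewrite /= !in_itv/= => /andP[-> h]; exact: le_lt_trans h (ltr_pwDr ltr01 (lexx _)).
pose m1 : {measure set (measurableTypeR R) -> \bar R} :=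
  measure_function_pushforward__canonical__measure_function_Measure (dens_measure mu nw) measurable_kinv.
have b0 (a : R) : 0 <= Num.max a 0 by rewrite le_max lexx orbT.
have m1E a : m1 `]a, +oo[%classic = (al * rho (Num.max a 0) ^+ n.+1)%:E.
  rewrite -integral_sphere_area ?rho_ge0// -integral_itv_bndo_bndc; last first.
    by apply/measurable_EFinP; apply: measurable_funTS; exact: (continuous_measurable_fun continuous_sphere_area).
  rewrite -[LHS]/(dens_measure mu nw (kinv @^-1` `]a, +oo[%classic)) densE [LHS]integral_mkcond [RHS]integral_mkcond.
  apply: eq_integral => r _; rewrite !patchE.
  have kE : 0 <= r < R0 -> (r \in kinv @^-1` `]a, +oo[) = (a < rho_inv r).
    move=> rR; rewrite -(kinvE rR); apply/idP/idP; rewrite inE /preimage /mkset in_itv /= andbT; exact: id.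
  rewrite (itv_mem_aux (rho_inv_ray a r) kE).
  rewrite /w /= patchE; case: (r \in `[0, R0[%classic) => //.
  by rewrite andFb; case: ifPn.
have m2E a : dens_measure mu nz `]a, +oo[%classic = (al * rho (Num.max a 0) ^+ n.+1)%:E.
  pose Sa : set (measurableTypeR R) := `]a, +oo[%classic `&` `]0, M]%classic.
  rewrite densE; transitivity (\int[mu]_(t in Sa) (area t)%:E)%E.
    by rewrite /Sa integral_mkcondr; apply: eq_integral => t _; rewrite /= /z !patchE; case: ifPn.
  have [Mb|bM] := leP M (Num.max a 0).
    rewrite rho_out// expr0n mulr0 (_ : Sa = set0) ?integral_set0//.
    apply/seteqP; split => // t; rewrite /Sa /=; rewrite !in_itv/= andbT => -[h1 /andP[h2 h3]].
    have h4 : Num.max a 0 < t by rewrite gt_max h1.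
    by move: (le_lt_trans h3 (le_lt_trans Mb h4)); rewrite ltxx.
  rewrite (volume_area (b0 a) (ltW bM)) (_ : Sa = `]Num.max a 0, M]%classic)//.
  apply/seteqP; split => t; rewrite /Sa /= !in_itv/= andbT gt_max; first by move=> [-> /andP[-> ->]].
  by move=> /andP[/andP[-> ->] ->].
have E (A : set (measurableTypeR R)) : measurable A -> m1 A = dens_measure mu nz A.
  move=> mA; apply: (R_measure_unique_gt _ _ mA) => a; first by rewrite m1E m2E.
  by rewrite m1E ltry.
have mgk : measurable_fun setT (g \o kinv) by exact: measurableT_comp mg measurable_kinv.
transitivity (\int[m1]_a g a)%E.
  have -> : (\int[m1]_a g a = \int[dens_measure mu nw]_r (g \o kinv) r)%E.
    have := @ge0_integral_pushforward _ _ _ _ _ _ measurable_kinv (dens_measure mu nw) setT g measurableT mg (fun y _ => g0 y).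
    by rewrite preimage_setT => ->.
  rewrite integral_dens//; last by split => // r; exact: g0.
  rewrite [LHS]integral_mkcond; apply: eq_integral => r _.
  by rewrite /w /= /kinv !patchE; case: ifPn => //; rewrite mul0e.
rewrite (eq_measure_integral (dens_measure mu nz)); last by move=> A mA _; exact: E.
rewrite integral_dens// [RHS]integral_mkcond; apply: eq_integral => t _.
by rewrite /z !patchE; case: ifPn => //; rewrite mul0e.
Qed.

End radial.
(* The inequality satisfied by the rearranged data on a level, with
   [D, L, W, Vm, X, P, O, Fl] the integrals over the level of
   [1, 1/Lambda, omega^2/Lambda, V^-, A grad psi . grad psi, |grad psi|,
   |omega| |grad psi|, - div (A grad psi)]
   against [dsigma / |grad psi|]. *)
Lemma level_inequality (R : realType) (c D L W Vm X P O Fl a p omega0 m : R) :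
  0 < c -> 0 < L -> 0 < D -> 0 <= W -> 0 <= X -> 0 <= Vm -> 0 <= O -> c <= P -> P ^+ 2 <= L * X ->
  O ^+ 2 <= W * X ->
  Fl <= O + omega0 * P + (m * (a * D) + a * Vm) -> 0 <= omega0 -> 0 <= m -> a <= p ->
  Fl / D <= (Num.sqrt (W / L) + omega0) * (X * L / (c * D)) + (m + Vm / D) * p.
Proof.
move=> c0 L0 D0 W0 X0 V0 O0 cP P2 O2 hF w0 m0 ap.
set v := Num.sqrt (W / L).
have v0 : 0 <= v := sqrtr_ge0 _.
have v2 : v ^+ 2 = W / L by rewrite sqr_sqrtr// divr_ge0// ltW.
(* In squares: O^2 <= W X and c^2 <= P^2 <= L X, with v^2 = W / L. *)
have h1 : O * c <= v * (X * L).
  have XL0 : 0 <= X * L by rewrite mulr_ge0// ltW.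
  rewrite -ler_sqr ?nnegrE; [|by rewrite mulr_ge0// ltW|by rewrite mulr_ge0].
  rewrite !exprMn v2 (_ : W / L * (X ^+ 2 * L ^+ 2) = (W * X) * (L * X)); last by field; rewrite gt_eqF.
  apply: ler_pM => //; [exact: sqr_ge0|exact: sqr_ge0|].
  apply: le_trans P2; apply: lerXn2r; rewrite ?nnegrE ?(ltW c0)//; exact: le_trans (ltW c0) cP.
(* Here P c <= P^2 <= L X; the isoperimetric bound c <= P is spent once in each of the two
   estimates. *)
have h2 : P * c <= X * L by rewrite [leRHS]mulrC; apply: le_trans P2; rewrite expr2 ler_wpM2l// (le_trans (ltW c0)).
have cD : 0 < c * D by rewrite mulr_gt0.
have E : (Num.sqrt (W / L) + omega0) * (X * L / (c * D)) + (m + Vm / D) * p =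
   ((v * (X * L) + omega0 * (X * L)) / c + (m * D + Vm) * p) / D.
  by rewrite -/v; field; rewrite !gt_eqF.
rewrite E ler_pM2r ?invr_gt0//; apply: le_trans hF _.
apply: lerD.
  rewrite ler_pdivlMr// mulrDl lerD// -mulrA ler_wpM2l//.
rewrite (_ : m * (a * D) + a * Vm = (m * D + Vm) * a); last by ring.
by rewrite ler_wpM2l// addr_ge0 ?mulr_ge0// ltW.
Qed.

(** * Integrals on good levels and the inequalities between them *)

Section good_levels.
Context {R : realType} {n : nat}.
Local Notation mu := (@lebesgue_measure R).
Local Notation B := (rVborel R n.+1).
Variables (Omega : set 'rV[R]_n.+1) (A : 'rV[R]_n.+1 -> 'M[R]_n.+1)
  (Lambda omega V psi : 'rV[R]_n.+1 -> R) (gamma omega0 m : R).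
Hypotheses (oO : open Omega) (bO : bounded_set Omega)
  (hA : forall i j, isC1_closure Omega (fun x => A x i j))
  (hLambda : isC1_closure Omega Lambda)
  (homega : isC0_closure Omega omega) (hV : isC0_closure Omega V)
  (hALambda : forall x : 'rV[R]_n.+1, closure Omega x -> forall xi : 'rV[R]_n.+1,
     Lambda x * dot xi xi <= dot xi (A x *m xi^T)^T)
  (hgamma : 0 < gamma)
  (hLambdagamma : forall x : 'rV[R]_n.+1, closure Omega x -> gamma <= Lambda x)
  (hpsi : isC1_closure Omega psi)
  (hpsi_analytic : forall x : 'rV[R]_n.+1, Omega x -> analytic_at psi x)
  (psi_pos : forall x : 'rV[R]_n.+1, Omega x -> 0 < psi x)
  (psi_bnd : forall x : 'rV[R]_n.+1, boundary Omega x -> psi x = 0)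
  (hf : nonzero_polynomial_on Omega (fun x => - div_A_grad A psi x))
  (homega0 : 0 <= omega0) (hm : 0 <= m)
  (hineq : forall y, Omega y ->
     - div_A_grad A psi y - `|omega y| * enorm (grad psi y)
       - omega0 * enorm (grad psi y) + V y * psi y <= m * psi y).
Variable tau : R -> {measure set B -> \bar R}.
Hypothesis tauP : level_measures Omega psi tau.
Local Notation psib := (psib Omega psi).
Local Notation gr := (fun x => enorm (grad psi x)).
Local Notation f := (div_A_grad A psi).

Let mO : measurable (Omega : set B) := open_measurable_rV oO.

Lemma domain_bound : exists K, forall x, Omega x -> `|x| <= K.
Proof. by have [K hK] := closure_bounded bO; exists K => x /subset_closure/hK. Qed.

Let psiC1 : isC1 Omega psi := isC1_closure_isC1 oO hpsi.
Let psib_cont : continuous psib := psib_continuous oO hpsi psi_bnd.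
Let psiC2 i : isC1 Omega (partial i psi) := analytic_partial_isC1 hpsi_analytic i.
Let AC1 i j : isC1 Omega (fun x => A x i j) := isC1_closure_isC1 oO (hA i j).

(** Bounded measurable integrands on Omega: a class closed under the operations needed, and
    integrable on each level of finite mass. *)
Definition bk (k : B -> R) := measurable_fun (Omega : set B) k /\
  exists C, forall x, Omega x -> `|k x| <= C.

Lemma bkM k l : bk k -> bk l -> bk (fun x => k x * l x).
Proof.
move=> [mk [C kC]] [ml [C' lC]]; split; first exact: measurable_funM.
by exists (C * C') => x Ox; rewrite normrM ler_pM ?kC ?lC.
Qed.

Lemma bkD k l : bk k -> bk l -> bk (fun x => k x + l x).
Proof.
move=> [mk [C kC]] [ml [C' lC]]; split; first exact: measurable_funD.
by exists (C + C') => x Ox; apply: le_trans (ler_normD _ _) (lerD (kC x Ox) (lC x Ox)).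
Qed.

Lemma bk_cst c : bk (fun=> c).
Proof. by split; [exact: measurable_cst|exists `|c|]. Qed.

Lemma bk_norm k : bk k -> bk (fun x => `|k x|).
Proof.
move=> [mk [C kC]]; split; first exact: measurableT_comp.
by exists C => x Ox; rewrite normr_id kC.
Qed.

Lemma bk_C0 k : isC0_closure Omega k -> bk k.
Proof.
move=> kc; split; last exact: isC0_closure_bounded.
by apply: continuous_in_measurable_rV => // x Ox; exact: isC0_closure_continuous kc Ox.
Qed.

Lemma bk_ext k l : (forall x, Omega x -> k x = l x) -> bk k -> bk l.
Proof.
move=> kl [mk [C kC]]; split; last by exists C => x Ox; rewrite -kl// kC.
by apply: eq_measurable_fun mk => x /set_mem; exact: kl.
Qed.

Lemma bk_gr : bk gr.
Proof.
split; last first.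
  have [C hC] := isC1_closure_grad_bounded bO hpsi.
  by exists C => x Ox; rewrite ger0_norm ?enorm_ge0// hC.
exact: measurable_gr oO psiC1.
Qed.

Lemma bk_Linv : bk (fun x => (Lambda x)^-1).
Proof.
have [mL _] := bk_C0 hLambda.1; split; first exact: measurableT_comp (@measurable_invr R) mL.
exists gamma^-1 => x /subset_closure/hLambdagamma gL.
by rewrite ger0_norm ?invr_ge0 ?(le_trans (ltW hgamma))// lef_pV2 ?posrE// (lt_le_trans hgamma).
Qed.

Lemma bk_psi : bk psi. Proof. exact: bk_C0 hpsi.1. Qed.

Lemma bk_Vm : bk (fun x => Num.max 0 (- V x)).
Proof.
have [mV [C VC]] := bk_C0 hV; split.
  by apply: measurable_maxr; [exact: measurable_cst|exact: measurableT_comp].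
exists C => x Ox; have := VC x Ox; rewrite ler_norml => /andP[h1 h2].
have C0 : 0 <= C := le_trans (normr_ge0 _) (VC x Ox).
by case: (leP 0 (- V x)) => h; rewrite ?normr0// normrN; exact: VC.
Qed.

Lemma bk_f : bk f.
Proof.
have [p p0 fp] := hf; have [pc _] := mpoly_fun_isC1 p.
have c : isC0_closure Omega (fun x => - mpoly_fun p x).
  apply: continuous_subspaceT => x; apply: (@cvgN _ _ _ _ (nbhs_filter x)).
  exact: isC1_continuous openT pc I.
apply: bk_ext (bk_C0 c) => x Ox.
by rewrite /mpoly_fun -fp// opprK.
Qed.

Lemma bk_partial i : bk (partial i psi).
Proof.
have [_ /(_ i)[g [gc gE]]] := hpsi.
by apply: bk_ext (bk_C0 gc) => x Ox; rewrite (gE x Ox).2.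
Qed.

Lemma bk_sum N (k : 'I_N -> B -> R) : (forall i, bk (k i)) -> bk (fun x => \sum_i k i x).
Proof.
elim: N k => [|N IH] k kb.
  by apply: bk_ext (bk_cst 0) => x _; rewrite big_ord0.
apply: bk_ext (bkD (IH _ (fun i => kb (widen_ord (leqnSn N) i))) (kb ord_max)) => x _.
by rewrite big_ord_recr.
Qed.

Lemma bk_energy : bk (energy A psi).
Proof.
apply: bk_sum => i; apply: bkM (bk_partial i) _; apply: bk_sum => j.
by apply: bkM (bk_partial j); exact: bk_C0 (hA i j).1.
Qed.

Lemma gr_sqr_energy x : Omega x -> Lambda x * gr x ^+ 2 <= energy A psi x.
Proof. by move=> /subset_closure cx; rewrite sqr_enorm energyE; exact: hALambda. Qed.

Lemma Lambda_gt0 x : Omega x -> 0 < Lambda x.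
Proof. by move=> /subset_closure/hLambdagamma; exact: lt_le_trans. Qed.

Lemma energy_ge0 x : Omega x -> 0 <= energy A psi x.
Proof.
move=> Ox; apply: le_trans (gr_sqr_energy Ox).
by rewrite mulr_ge0 ?sqr_ge0 ?ltW ?Lambda_gt0.
Qed.

(** A critical point is either outside [flat2], a null case, or has vanishing first and second
    derivatives. In the second case the expanded divergence of A grad psi is 0 and the point is a
    zero of the polynomial f. *)
Lemma regular_null : (leb n.+1).-negligible (Omega `\` regular_set Omega psi : set B).
Proof.
have [p p0 fp] := hf.
have h1 := crit_set_flat2 oO hpsi_analytic; have h2 := mpoly_zeros_null p0.
apply: negligibleS (negligibleU h1 h2) => x [Ox nr].
have g0 : grad psi x = 0 by apply: contrapT => /eqP g0; apply: nr.
case: (pselect (flat2 Omega psi x)) => [[_ [_ fl]]|nf]; [right|left]; last by split.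
rewrite /= /mpoly_fun -fp// div_A_gradE big1 ?oppr0// => i _.
have gj j : partial j psi x = 0 by move/rowP: g0 => /(_ j); rewrite !mxE.
have gij j : partial i (partial j psi) x = 0 by have /rowP/(_ i) := fl j; rewrite !mxE.
have [_ sE] := @isC1_sum R n Omega _ (fun j y => A y i j * partial j psi y) oO
  (fun j => (isC1_mul oO (AC1 i j) (psiC2 j)).1).
rewrite /flux sE// big1// => j _.
by rewrite (isC1_mul oO (AC1 i j) (psiC2 j)).2// gj gij !mulr0 addr0.
Qed.

Definition lev (k : B -> R) (a : R) : R := \int[tau a]_(x in Omega) k x.

(** A level at which all the almost-everywhere statements hold together: it is regular, level
    integrals are integrals for the level measure, its mass is finite, and it satisfies the
    isoperimetric inequality and the divergence theorem. *)
Record good (a : R) : Prop := {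
  good_reg : forall x, Omega x -> psi x = a -> grad psi x != 0;
  good_lev : forall k : B -> R, measurable_fun (Omega : set B) k -> (forall x, Omega x -> 0 <= k x) ->
    level_integral Omega psi k a = lev k a;
  good_fin : (\int[tau a]_(x in Omega) (1 : \bar R) < +oo)%E;
  good_per : ((per Omega psi a)%:E <= perim Omega psi tau a)%E;
  good_energy : (\int[tau a]_x (energyO Omega A psi x)%:E + sl_int Omega psi (div_pos Omega A psi) a =
    sl_int Omega psi (div_neg Omega A psi) a)%E }.

Lemma ae_good x0 : Omega x0 -> {ae mu, forall a, 0 < a < psi x0 -> good a}.
Proof.
move=> Ox0; have [K OK] := domain_bound.
have FF := @ae_filter_ringOfSetsType _ (measurableTypeR R) R mu.
have H1 := level_integral_tau oO psiC1 psib_cont tauP (levelE oO psi_bnd) (gradpsiE oO hpsi).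
have [_ H2 _] := area_fine oO OK psiC1 psib_cont tauP regular_null (psi x0).
have [Cg gC] := isC1_closure_grad_bounded bO hpsi.
have H3 := per_le_perim oO OK psiC1 psib_cont gC tauP Ox0.
have [Cf fC] := bk_f.2; have [Ce eC'] := bk_energy.2.
have eC x : Omega x -> 0 <= energy A psi x <= Ce.
  by move=> Ox; rewrite energy_ge0//=; exact: le_trans (ler_norm _) (eC' x Ox).
have H4 := level_energy oO OK psiC1 psib_cont psiC2 AC1 bk_f.1 fC eC tauP Ox0.
have [N [mN N0 NP]] := critical_image_negligible hpsi_analytic.
have H5 : {ae mu, forall a, forall x, Omega x -> psi x = a -> grad psi x != 0}.
  exists N; split => // a /= /existsNP[x /not_implyP[Ox /not_implyP[xa /negP]]].
  by rewrite negbK => /eqP g0; apply: NP; exists x.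
have H12 := @filterI _ _ FF _ _ H1 H2; have H34 := @filterI _ _ FF _ _ H3 H4.
have H125 := @filterI _ _ FF _ _ H12 H5.
apply: (@filterS2 _ _ FF _ _ _ _ H125 H34) => a [[h1 h2] h5] [h3 h4] a0M.
have /andP[a0 aM] := a0M.
split; [exact: h5|by move=> k mk k0; apply: h1|exact: h2|exact: h3|exact: h4].
Qed.

Section at_good.
Variables (a : R).
Hypotheses (a0 : 0 < a) (ga : good a).

Lemma good_integrable k : bk k -> (tau a).-integrable Omega (EFin \o k).
Proof.
move=> [mk [C kC]]; apply: measurable_bounded_integrable => //.
  by have := good_fin ga; rewrite integral_cst// mul1e.
by exists C; split; [exact: num_real|move=> z Cz x Ox; exact: le_trans (kC x Ox) (ltW Cz)].
Qed.

Lemma lev_restrict k : (forall x, Omega x -> 0 <= k x) -> bk k ->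
  (lev k a)%:E = (\int[tau a]_x ((k \_ Omega : B -> R) x)%:E)%E.
Proof.
move=> k0 kb; rewrite /lev /Rintegral fineK; last exact: integrable_fin_num (good_integrable kb).
rewrite integral_mkcond; apply: eq_integral => x _; rewrite !patchE; by case: ifPn.
Qed.

Lemma lev_le k l : bk k -> bk l -> (forall x, Omega x -> k x <= l x) -> lev k a <= lev l a.
Proof. by move=> kb lb kl; apply: le_Rintegral => //; exact: good_integrable. Qed.

Lemma levD k l : bk k -> bk l -> lev (fun x => k x + l x) a = lev k a + lev l a.
Proof. by move=> kb lb; rewrite /lev RintegralD//; exact: good_integrable. Qed.

Lemma levZ c k : bk k -> lev (fun x => c * k x) a = c * lev k a.
Proof. by move=> kb; rewrite /lev RintegralZl//; exact: good_integrable. Qed.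

Lemma lev_ge0 k : (forall x, Omega x -> 0 <= k x) -> 0 <= lev k a.
Proof. by move=> k0; exact: Rintegral_ge0. Qed.

Lemma lev_cs k l : bk k -> bk l ->
  lev (fun x => k x * l x) a ^+ 2 <= lev (fun x => k x ^+ 2) a * lev (fun x => l x ^+ 2) a.
Proof. by move=> kb lb; apply: cauchy_schwarz => //; apply: good_integrable; apply: bkM. Qed.

(* On the level a, psi is the constant a. *)
Lemma lev_psi k : bk k -> (forall x, Omega x -> 0 <= k x) -> lev (fun x => k x * psi x) a = a * lev k a.
Proof.
move=> kb k0; rewrite -levZ//.
have b1 := bkM kb bk_psi; have b2 := bkM (bk_cst a) kb.
have p1 x : Omega x -> 0 <= k x * psi x by move=> Ox; rewrite mulr_ge0 ?k0 ?ltW ?psi_pos.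
have p2 x : Omega x -> 0 <= a * k x by move=> Ox; rewrite mulr_ge0 ?k0 ?ltW.
apply: EFin_inj; rewrite !lev_restrict//.
have nn (l : B -> R) : bk l -> (forall x, Omega x -> 0 <= l x) -> nnmeas (EFin \o (l \_ Omega : B -> R)).
  move=> [ml _] l0; split; first by apply/measurable_EFinP/(measurable_restrictT _ _).1.
  by move=> x; rewrite lee_fin patchE; case: ifPn => // /set_mem; exact: l0.
apply: (level_concentrated tauP (nn _ b1 p1) (nn _ b2 p2)) => x [Ox _] xa.
by rewrite /= !patchE mem_set// xa mulrC.
Qed.

(** Lambda^(-1/2), which splits k |grad psi| into k Lambda^(-1/2) and Lambda^(1/2) |grad psi| for
    Cauchy-Schwarz. *)
Definition sLinv (x : B) : R := Num.sqrt ((Lambda x)^-1).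

Lemma sLinv_sqr x : Omega x -> sLinv x ^+ 2 = (Lambda x)^-1.
Proof. by move=> Ox; rewrite sqr_sqrtr// invr_ge0 ltW// Lambda_gt0. Qed.

Lemma bk_sLinv : bk sLinv.
Proof.
have [mL [C LC]] := bk_Linv; split.
  exact: (measurableT_comp (continuous_measurable_fun (@sqrt_continuous R)) mL).
exists (Num.sqrt C) => x Ox; rewrite ger0_norm ?sqrtr_ge0// ler_wsqrtr//.
exact: le_trans (ler_norm _) (LC x Ox).
Qed.

Lemma bk_Lambda : bk Lambda. Proof. exact: bk_C0 hLambda.1. Qed.

Lemma bk_omega : bk omega. Proof. exact: bk_C0 homega. Qed.

Local Notation Linv := (fun y => (Lambda y)^-1).
Local Notation Wf := (fun y => omega y ^+ 2 * (Lambda y)^-1).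
Local Notation Vm := (fun y => Num.max 0 (- V y)).

Lemma bk_W : bk Wf.
Proof. by apply: bkM bk_Linv; apply: bkM bk_omega bk_omega. Qed.

(** Cauchy-Schwarz followed by ellipticity, Lambda |grad psi|^2 <= A grad psi . grad psi. It is used
    for k = 1, giving the perimeter, and for k = |omega|. *)
Lemma lev_flux_cs k : bk k ->
  lev (fun x => k x * gr x) a ^+ 2 <= lev (fun x => k x ^+ 2 * (Lambda x)^-1) a * lev (energy A psi) a.
Proof.
move=> kb; pose u x := k x * sLinv x; pose l x := gr x * Lambda x * sLinv x.
have ub : bk u by exact: bkM bk_sLinv.
have lb : bk l by apply: bkM bk_sLinv; exact: bkM bk_gr bk_Lambda.
have E1 : lev (fun x => k x * gr x) a = lev (fun x => u x * l x) a.
  apply: eq_Rintegral => x /set_mem Ox; rewrite /u /l.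
  rewrite [RHS](_ : _ = k x * gr x * Lambda x * sLinv x ^+ 2); last by ring.
  by rewrite sLinv_sqr// mulfK// gt_eqF// Lambda_gt0.
have E2 : lev (fun x => k x ^+ 2 * (Lambda x)^-1) a = lev (fun x => u x ^+ 2) a.
  by apply: eq_Rintegral => x /set_mem Ox; rewrite /u exprMn sLinv_sqr.
rewrite E1 E2; apply: le_trans (lev_cs ub lb) _.
apply: ler_wpM2l; first by apply: lev_ge0 => x _; exact: sqr_ge0.
apply: lev_le; [exact: (bkM lb lb)|exact: bk_energy|] => x Ox.
apply: le_trans (gr_sqr_energy Ox); rewrite /l !exprMn sLinv_sqr// expr2 -mulrA.
by rewrite mulfK ?gt_eqF ?Lambda_gt0// mulrC.
Qed.

Lemma per_le_lev : sphere_area (n := n) (Defs.rho Omega psi a) <= lev gr a.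
Proof.
rewrite -lee_fin; apply: le_trans (good_per ga) _.
by rewrite (lev_restrict (fun x _ => enorm_ge0 _) bk_gr).
Qed.

Lemma lev_perim_sqr : lev gr a ^+ 2 <= lev Linv a * lev (energy A psi) a.
Proof.
have := lev_flux_cs (bk_cst 1).
have -> : lev (fun x => 1 * gr x) a = lev gr a by apply: eq_Rintegral => x _; rewrite mul1r.
suff -> : lev (fun x => 1 ^+ 2 * (Lambda x)^-1) a = lev Linv a by [].
by apply: eq_Rintegral => x _; rewrite expr1n mul1r.
Qed.

Lemma lev_omega_sqr : lev (fun x => `|omega x| * gr x) a ^+ 2 <= lev Wf a * lev (energy A psi) a.
Proof.
have := lev_flux_cs (bk_norm bk_omega).
suff -> : lev (fun x => `|omega x| ^+ 2 * (Lambda x)^-1) a = lev Wf a by [].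
by apply: eq_Rintegral => x _; rewrite real_normK ?num_real.
Qed.

Lemma lev_Linv_le : gamma * lev Linv a <= lev (fun=> 1) a.
Proof.
rewrite -levZ; last exact: bk_Linv.
apply: lev_le; [exact: bkM (bk_cst _) bk_Linv|exact: bk_cst|] => x Ox.
by rewrite ler_pdivrMr ?Lambda_gt0// mul1r hLambdagamma//; exact: subset_closure.
Qed.

(** The pointwise hypothesis is integrated over the level, with -V bounded by its negative part; the
    factors psi come out as the constant a. *)
Lemma lev_source_le : lev (fun x => - f x) a <= lev (fun x => `|omega x| * gr x) a + omega0 * lev gr a
  + (m * (a * lev (fun=> 1) a) + a * lev Vm a).
Proof.
have b1 : bk (fun x => `|omega x| * gr x) by apply: bkM bk_gr; exact: bk_norm bk_omega.
have b2 : bk (fun x => omega0 * gr x) := bkM (bk_cst _) bk_gr.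
have b3' : bk (fun x => 1 * psi x) := bkM (bk_cst _) bk_psi.
have b3 : bk (fun x => m * (1 * psi x)) := bkM (bk_cst _) b3'.
have b4 : bk (fun x => Vm x * psi x) := bkM bk_Vm bk_psi.
rewrite -(lev_psi (bk_cst 1)) // -(lev_psi bk_Vm); last by move=> x _; rewrite le_max lexx.
rewrite -(levZ m b3') -(levZ _ bk_gr) -(levD b1 b2) -(levD b3 b4) -(levD (bkD b1 b2) (bkD b3 b4)).
apply: lev_le; [|exact: bkD (bkD b1 b2) (bkD b3 b4)|].
  by apply: bk_ext (bkM (bk_cst (-1)) bk_f) => x _; rewrite mulN1r.
move=> x Ox; have h := hineq Ox; have p := psi_pos Ox.
have : - V x * psi x <= Num.max 0 (- V x) * psi x.
  by apply: ler_wpM2r; [exact: ltW|rewrite le_max lexx orbT].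
by rewrite mulNr mul1r; lra.
Qed.

Lemma lev_source_split : lev (fun x => - f x) a =
  fine (\int[tau a]_x (div_neg Omega A psi x)%:E) - fine (\int[tau a]_x (div_pos Omega A psi x)%:E).
Proof.
have [mf [C fC]] := bk_f.
have bp : bk (fun x => Num.max 0 (f x)).
  split; first by apply: measurable_maxr => //; exact: measurable_cst.
  exists C => x Ox; have C0 : 0 <= C := le_trans (normr_ge0 _) (fC x Ox).
  by case: (leP 0 (f x)) => h; rewrite ?normr0//; exact: fC.
have bn : bk (fun x => Num.max 0 (- f x)).
  split; first by apply: measurable_maxr; [exact: measurable_cst|exact: measurableT_comp].
  exists C => x Ox; have C0 : 0 <= C := le_trans (normr_ge0 _) (fC x Ox).
  by case: (leP 0 (- f x)) => h; rewrite ?normr0// normrN; exact: fC.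
rewrite /div_neg /div_pos -(lev_restrict _ bn); last by move=> x _; rewrite le_max lexx.
rewrite -(lev_restrict _ bp); last by move=> x _; rewrite le_max lexx.
rewrite [fine _]/= [X in _ - X]/= /lev -RintegralB//; [|exact: good_integrable|exact: good_integrable].
apply: eq_Rintegral => x _; case: (leP 0 (f x)) => h1; case: (leP 0 (- f x)) => h2; lra.
Qed.

Lemma lev_W_le C : (forall x, Omega x -> `|omega x| <= C) -> lev Wf a <= C ^+ 2 * lev Linv a.
Proof.
move=> oC; rewrite -levZ; last exact: bk_Linv.
apply: lev_le; [exact: bk_W|exact: bkM (bk_cst _) bk_Linv|] => x Ox.
apply: ler_wpM2r; first by rewrite invr_ge0 ltW// Lambda_gt0.
rewrite -real_normK ?num_real//.
have h := oC x Ox; have h0 := normr_ge0 (omega x).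
by apply: lerXn2r; rewrite ?nnegrE//; exact: le_trans h0 h.
Qed.

Lemma sl_int_fin k C : (forall x, 0 <= k x <= C) -> nnmeas (EFin \o k) -> sl_int Omega psi k a \is a fin_num.
Proof.
move=> kC nk; have [K OK] := domain_bound.
have k0 x : (0 <= (k x)%:E)%E by rewrite lee_fin; have /andP[] := kC x.
rewrite ge0_fin_numE; last by apply: integral_ge0 => x _; exact: k0.
apply: le_lt_trans (sl_int_le oO psib_cont kC (ltW a0) nk) _.
by rewrite -[X in (_ * X)%E](fineK (leb_bounded_fin mO OK)) -EFinM ltry.
Qed.

Lemma sl_int_div_fin : sl_int Omega psi (div_pos Omega A psi) a \is a fin_num /\
  sl_int Omega psi (div_neg Omega A psi) a \is a fin_num.
Proof.
have [mf [C fC]] := bk_f.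
have dC x : 0 <= div_pos Omega A psi x <= `|C| /\ 0 <= div_neg Omega A psi x <= `|C|.
  rewrite /div_pos /div_neg !patchE; case: ifPn => [/set_mem Ox|_]; last by rewrite !lexx !normr_ge0.
  have := le_trans (fC x Ox) (ler_norm C); rewrite ler_norml => /andP[h1 h2].
  rewrite !le_max !lexx /= !ge_max !normr_ge0 h2/=; split=> //.
  by rewrite lerNl h1.
split; first exact: sl_int_fin (fun x => (dC x).1) (nn_div_pos oO mf).
exact: sl_int_fin (fun x => (dC x).2) (nn_div_neg oO mf).
Qed.

Lemma energy_split : lev (energy A psi) a =
  fine (sl_int Omega psi (div_neg Omega A psi) a) - fine (sl_int Omega psi (div_pos Omega A psi) a).
Proof.
have [fp fn] := sl_int_div_fin; have := good_energy ga.
have -> : (\int[tau a]_x (energyO Omega A psi x)%:E)%E = (lev (energy A psi) a)%:E.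
  by rewrite (lev_restrict (fun x Ox => energy_ge0 Ox) bk_energy).
by rewrite -(fineK fp) -(fineK fn) -EFinD => -[] /= <-; rewrite addrK.
Qed.

(** The divergence theorem on a good level, with the two signs recombined; it turns the numerator of
    F into an energy on the level, hence a quantity of known sign. *)
Lemma source_integral : Defs.Rint lebesgue (superlevel Omega psi a) f = - lev (energy A psi) a.
Proof.
have [fp fn] := sl_int_div_fin; rewrite energy_split opprB.
rewrite /Defs.Rint integral_lebE integralE superlevelE ?(ltW a0)//.
have E1 : (\int[leb n.+1]_(x in [set x | (a < psib x)%R]) ((fun x => (f x)%:E)^\+ x) =
    sl_int Omega psi (div_pos Omega A psi) a)%E.
  apply: eq_integral => x /set_mem /= ax; have Ox : Omega x by exact: psib_Omega (lt_trans a0 ax).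
  by rewrite funeposE /div_pos patchE mem_set// -EFin_max maxC.
have E2 : (\int[leb n.+1]_(x in [set x | (a < psib x)%R]) ((fun x => (f x)%:E)^\- x) =
    sl_int Omega psi (div_neg Omega A psi) a)%E.
  apply: eq_integral => x /set_mem /= ax; have Ox : Omega x by exact: psib_Omega (lt_trans a0 ax).
  by rewrite funenegE /div_neg patchE mem_set// -EFinN -EFin_max maxC.
by rewrite E1 E2 fineB.
Qed.

(** The energy on the level is minus the integral of the divergence over the superlevel set, so it
    is controlled by that volume. This decay at the centre keeps F bounded although it is divided by
    the area of a small sphere. *)
Lemma energy_bound C : (forall x, Omega x -> `|f x| <= C) ->
  lev (energy A psi) a <= C * (@alpha R n * Defs.rho Omega psi a ^+ n.+1).
Proof.
move=> fC; have [K OK] := domain_bound; have [mf _] := bk_f.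
have ms : measurable (superlevel Omega psi a : set B).
  by apply: open_measurable_rV; apply: open_superlevel => //; exact: ltW.
have fs := leb_bounded_fin ms (fun x h => OK x (h.1)).
have if' : (leb n.+1).-integrable (superlevel Omega psi a) (EFin \o f).
  apply: measurable_bounded_integrable => //.
  - by rewrite ltey_eq fs.
  - by apply: measurable_funS mf => // x [].
  by exists C; split; [exact: num_real|move=> z Cz x [Ox _]; exact: le_trans (fC x Ox) (ltW Cz)].
have -> : lev (energy A psi) a = - \int[leb n.+1]_(x in superlevel Omega psi a) f x.
  by rewrite -[LHS]opprK -source_integral /Defs.Rint integral_lebE.
apply: le_trans (ler_norm _) _; rewrite normrN.
apply: le_trans (le_normr_Rintegral ms if') _.
have E : fine (leb n.+1 (superlevel Omega psi a)) = @alpha R n * Defs.rho Omega psi a ^+ n.+1.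
  by rewrite volume_radiusE.
rewrite -E -Rintegral_cst//; apply: le_Rintegral => //.
- exact: integrable_norm.
- by apply: measurable_bounded_integrable => //; [rewrite ltey_eq fs|exists `|C|; split; [exact: num_real|move=> z Cz x _; exact: ltW]].
- by move=> x [Ox _]; exact: fC.
Qed.

End at_good.

(** * The rearranged data as functions of the radius *)

Section radial_functions.
Variables (x0 : 'rV[R]_n.+1) (N : set (measurableTypeR R)).
Hypotheses (Ox0 : Omega x0) (psix0 : psi x0 = psi_max Omega psi)
  (psiM : forall x, Omega x -> psi x <= psi_max Omega psi)
  (mN : measurable N) (N0 : mu N = 0%E) (NP : forall a, 0 < a < psi x0 -> ~ N a -> good a).
Local Notation M := (psi x0).
Local Notation R0 := (@Defs.radius R n Omega).
Local Notation c := (sphere_area (n := n)).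
Local Notation rho := (Defs.rho Omega psi).
Local Notation rho_inv := (Defs.rho_inv Omega psi).
Local Notation kinv := (kinv Omega psi).
Local Notation Linv := (fun y => (Lambda y)^-1).
Local Notation Wf := (fun y => omega y ^+ 2 * (Lambda y)^-1).
Local Notation Vm := (fun y => Num.max 0 (- V y)).
Local Notation RR := (measurableTypeR R).

Let ME : psi_max Omega psi = M := esym psix0.
Let psiM' x : Omega x -> psi x <= M.
Proof. by rewrite psix0; exact: psiM. Qed.

Let K := sval (cid domain_bound).
Let OK : forall x, Omega x -> `|x| <= K := svalP (cid domain_bound).

Let change := radial_change oO OK psiC1 psib_cont psi_pos Ox0 erefl psiM' ME tauP regular_null.
Let R0_gt0 : 0 < R0 := R0_gt0 OK psib_cont psi_pos Ox0 erefl.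
Let rinvP r : 0 <= r -> r <= R0 -> 0 <= rho_inv r <= M /\ rho (rho_inv r) = r.
Proof. exact: (rho_invP oO OK psiC1 psib_cont psi_pos Ox0 erefl psiM' ME tauP regular_null). Qed.
Let rinv_gt r s : 0 <= r -> r <= R0 -> 0 <= s -> (s < rho_inv r) = (r < rho s).
Proof. exact: (rho_inv_gt oO OK psiC1 psib_cont psi_pos Ox0 erefl psiM' ME tauP regular_null). Qed.
Let rholt s t : 0 <= s -> s < t -> t <= M -> rho t < rho s.
Proof. exact: (rho_lt OK psib_cont psi_pos Ox0 erefl). Qed.
Let mkinv : measurable_fun setT kinv.
Proof. exact: (measurable_kinv oO OK psiC1 psib_cont psi_pos Ox0 erefl psiM' ME tauP regular_null). Qed.

(** The radii whose level avoids the exceptional null set N, all of them corresponding to good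
    levels. *)
Definition Gs : set RR := `]0, R0[%classic `&` ~` (kinv @^-1` N).

Lemma measurable_Gs : measurable Gs.
Proof.
apply: measurableI; first exact: measurable_itv.
by apply: measurableC; rewrite -[X in measurable X]setTI; exact: mkinv.
Qed.

Lemma rho_inv_pos r : 0 < r -> r < R0 -> 0 < rho_inv r < M.
Proof.
move=> r0 rR; have [/andP[a0 aM] ar] := rinvP (ltW r0) (ltW rR).
rewrite !lt_neqAle a0 aM !andbT; apply/andP; split; apply/negP => /eqP E.
  by move: rR; rewrite -ar -E (rho0 psi_pos) ltxx.
by move: r0; rewrite -ar E (rho_out OK psib_cont psi_pos Ox0 erefl psiM') ?ltxx.
Qed.

Lemma Gs_itv r : Gs r -> 0 < r < R0.
Proof. by move=> []; rewrite /= in_itv. Qed.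

Lemma kinv_in r : 0 < r < R0 -> kinv r = rho_inv r.
Proof. by move=> /andP[r0 rR]; apply: kinvE; rewrite (ltW r0). Qed.

Lemma Gs_good r : Gs r -> [/\ 0 < kinv r < M, rho (kinv r) = r, ~ N (kinv r) & good (kinv r)].
Proof.
move=> Gr; have /andP[r0 rR] := Gs_itv Gr; have [_ nN] := Gr.
have kr : kinv r = rho_inv r by apply: kinv_in; rewrite r0.
have aM := rho_inv_pos r0 rR; have [_ ar] := rinvP (ltW r0) (ltW rR).
by rewrite kr; split => //; [move=> h; apply: nN; rewrite /= kr|apply: NP => // h; apply: nN; rewrite /= kr].
Qed.

Definition bad : set RR := `[0, R0]%classic `\` Gs.

Lemma measurable_bad : measurable bad.
Proof. by apply: measurableD measurable_Gs; exact: measurable_itv. Qed.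

(** By the change of variable, the integral of the sphere area over the radii sent into N equals the
    integral of [area] over N, which is 0; the sphere area being positive for r > 0, those radii
    form a null set. *)
Lemma bad_null : mu bad = 0%E.
Proof.
pose D : set RR := `[0, R0[%classic `&` kinv @^-1` N.
have mD : measurable D.
  apply: measurableI; first exact: measurable_itv.
  by rewrite -[X in measurable X]setTI; exact: mkinv.
have ng : nnmeas (fun a : RR => (\1_N a : R)%:E) := nnmeas_indic mN.
have c0 r : D r -> 0 <= c r by move=> [] /=; rewrite in_itv/= => /andP[r0 _] _; exact: sphere_area_ge0.
have z0 : (\int[mu]_(r in D) (c r)%:E = 0)%E.
  transitivity (\int[mu]_(r in `[0%R, R0[) ((c r)%:E * (\1_N (rho_inv r) : R)%:E))%E.
    rewrite [LHS]integral_mkcondr; apply: eq_integral => r /set_mem /=; rewrite in_itv => rR.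
    rewrite patchE -(kinvE psi rR) indicE -[r \in _]/(kinv r \in N).
    by case: (kinv r \in N); rewrite ?mule1 ?mule0.
  etransitivity; first exact: (change ng).
  have -> : (\int[mu]_(a in `]0%R, M]) ((area Omega tau a)%:E * (\1_N a : R)%:E) =
      \int[mu]_(a in `]0%R, M]) 0)%E; last by rewrite integral0.
  apply: (integral_off mN N0) => a _ nN; by rewrite indicE memNset ?mule0.
have mc : measurable_fun D (fun r : RR => (c r)%:E).
  by apply/measurable_EFinP; apply: measurable_funTS; exact: (continuous_measurable_fun continuous_sphere_area).
have [Z [mZ Z0 ZP]] : ae_eq mu D (fun r : RR => (c r)%:E) (cst 0%E).
  apply/(ae_eq_integral_abs mu mD mc); rewrite -[RHS]z0; apply: eq_integral => r /set_mem Dr.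
  by rewrite gee0_abs// lee_fin c0.
apply/eqP; rewrite eq_le measure_ge0 andbT.
have sub : bad `<=` Z `|` ([set 0] `|` [set R0]).
  move=> r [] /=; rewrite in_itv/= => /andP[r0 rR] nG.
  have [->|r0'] := eqVneq r 0; first by right; left.
  have [->|rR'] := eqVneq r R0; first by right; right.
  left; have r1 : 0 < r by rewrite lt_neqAle eq_sym r0' r0.
  have r2 : r < R0 by rewrite lt_neqAle rR' rR.
  apply: ZP => Dr; have /Dr[] : D r; last first.
    by move=> cr0; have := sphere_area_gt0 (n := n) r1; rewrite cr0 ltxx.
  split; first by rewrite /= in_itv/= r0 r2.
  by apply: contrapT => h; apply: nG; split => //; rewrite /= in_itv/= r1 r2.
have m1 : measurable ([set 0] `|` [set R0] : set RR) by apply: measurableU; exact: measurable_set1.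
apply: le_trans (le_measure _ _ _ sub) _; rewrite ?inE; [exact: measurable_bad|exact: measurableU|].
apply: (@le_trans _ _ (mu Z + mu ([set 0%R] `|` [set R0]))%E); first exact: (measureU2 _ mZ m1).
rewrite Z0 add0e.
apply: (@le_trans _ _ (mu [set 0%R] + mu [set R0])%E); first by apply: measureU2; exact: measurable_set1.
by rewrite !lebesgue_measure_set1 adde0.
Qed.

Lemma measurable_lev k : bk k -> (forall x, Omega x -> 0 <= k x) -> measurable_fun setT (lev k : RR -> R).
Proof.
move=> [mk _] k0.
have nk : nnmeas (EFin \o (k \_ Omega : B -> R)).
  split; first by apply/measurable_EFinP/(measurable_restrictT _ _).1.
  by move=> x; rewrite lee_fin patchE; case: ifPn => // /set_mem; exact: k0.
have := measurableT_comp (fine_measurable (D := setT) measurableT) (level_measurable tauP nk).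
apply: eq_measurable_fun => a _; rewrite /lev /Rintegral integral_mkcond -restrict_EFin//.
Qed.

Definition on_good (h : R -> R) : R -> R := (fun r => h (kinv r)) \_ Gs.

Lemma bmeas_on_good (h : R -> R) C : measurable_fun setT (h : RR -> R) ->
  (forall r, Gs r -> `|h (kinv r)| <= C) -> bmeas R0 (on_good h).
Proof.
move=> mh hC; split; last first.
  exists `|C| => r _; rewrite /on_good patchE; case: ifPn => [/set_mem Gr|_]; last by rewrite normr0.
  exact: le_trans (hC r Gr) (ler_norm _).
apply: measurable_funTS; apply/(measurable_restrictT _ _).1; first exact: measurable_Gs.
by apply: measurable_funTS; exact: measurableT_comp mh mkinv.
Qed.

Definition GN : set RR := `]0, M[%classic `\` N.

Lemma measurable_GN : measurable GN.
Proof. by apply: measurableD mN; exact: measurable_itv. Qed.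

Lemma GN_good a : GN a -> 0 < a < M /\ good a.
Proof. by move=> [] /=; rewrite in_itv/= => aM nN; split => //; exact: NP. Qed.

Lemma Gs_GN r : Gs r -> GN (kinv r).
Proof. by move=> /Gs_good[aM _ nN _]; split => //; rewrite /= in_itv. Qed.

Lemma rho_gt0 a : 0 < a < M -> 0 < rho a.
Proof.
move=> /andP[a0 aM]; apply: le_lt_trans (rholt (ltW a0) aM (lexx M)).
exact: rho_ge0.
Qed.

Lemma sphere_rho_gt0 a : GN a -> 0 < c (rho a).
Proof. by move=> /GN_good[aM _]; apply: sphere_area_gt0; exact: rho_gt0. Qed.

Lemma lev_gr_gt0 a : GN a -> 0 < lev gr a.
Proof. by move=> Ga; apply: lt_le_trans (sphere_rho_gt0 Ga) (per_le_lev (GN_good Ga).2). Qed.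

Lemma lev1_gt0 a : GN a -> 0 < lev (fun=> 1) a.
Proof.
move=> Ga; have [_ ga] := GN_good Ga; have [C gC] := isC1_closure_grad_bounded bO hpsi.
have : lev gr a <= lev (fun x => C * 1) a.
  apply: (lev_le ga bk_gr (bk_cst _)) => x Ox; rewrite mulr1.
  by apply: le_trans (gC x Ox).
rewrite (levZ ga C (bk_cst 1)) => h; have {}h := lt_le_trans (lev_gr_gt0 Ga) h.
have D0 : 0 <= lev (fun=> 1) a by apply: lev_ge0.
rewrite lt_def D0 andbT; by apply/negP => /eqP E; move: h; rewrite E mulr0 ltxx.
Qed.

Lemma lev_energy_ge0 a : 0 <= lev (energy A psi) a.
Proof. by apply: lev_ge0; exact: energy_ge0. Qed.

Lemma lev_Linv_gt0 a : GN a -> 0 < lev Linv a.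
Proof.
move=> Ga; have [_ ga] := GN_good Ga.
have L0 : 0 <= lev Linv a by apply: lev_ge0 => x Ox; rewrite invr_ge0 ltW// Lambda_gt0.
rewrite lt_def L0 andbT; apply/negP => /eqP E; have := lev_perim_sqr ga.
by rewrite E mul0r leNgt exprn_gt0// lev_gr_gt0.
Qed.

Lemma on_good_in h r : Gs r -> on_good h r = h (kinv r).
Proof. by move=> Gr; rewrite /on_good patchE mem_set. Qed.

Lemma bad_Gs (r : RR) : 0 <= r <= R0 -> ~ bad r -> Gs r.
Proof. by move=> rR nb; apply: contrapT => nG; apply: nb; split => //; rewrite /= in_itv. Qed.

Lemma rinv_lt r t : 0 <= r <= R0 -> 0 <= t <= R0 -> (rho_inv t < rho_inv r) = (r < t).
Proof.
move=> /andP[r0 rR] /andP[t0 tR]; have [/andP[s0 _] st] := rinvP t0 tR.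
by rewrite (rinv_gt r0 rR s0) st.
Qed.

(** The change of variable for functions controlled at good levels only; the sign of h is required
    nowhere else, and the bad radii are discarded as a null set. *)
Lemma change_good (h : R -> R) (S : set RR) : measurable_fun setT (h : RR -> R) -> measurable S ->
  (forall a, GN a -> 0 <= h a) ->
  (\int[mu]_(r in `[0%R, R0[ `&` rho_inv @^-1` S) (c r * on_good h r)%:E =
   \int[mu]_(a in S `&` GN) (lev (fun=> 1) a * h a)%:E)%E.
Proof.
move=> mh mS h0; pose T : set RR := S `&` GN.
have mT : measurable T by apply: measurableI => //; exact: measurable_GN.
have ng : nnmeas (EFin \o (h \_ T : RR -> R)).
  split; first by apply/measurable_EFinP/(measurable_restrictT _ _).1 => //; exact: measurable_funTS.
  by move=> a; rewrite lee_fin patchE; case: ifPn => // /set_mem[_]; exact: h0.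
transitivity (\int[mu]_(r in `[0%R, R0[) ((c r)%:E * ((h \_ T) (rho_inv r))%:E))%E.
  rewrite [LHS]integral_mkcondr; apply: (integral_off measurable_bad bad_null) => r /=.
  rewrite in_itv/= => /andP[r0 rR] nb; have Gr : Gs r by apply: bad_Gs; rewrite ?r0 ?ltW.
  have kr : kinv r = rho_inv r by apply: (kinvE psi); rewrite r0.
  have GNr : GN (rho_inv r) by rewrite -kr; exact: Gs_GN.
  rewrite patchE patchE on_good_in// kr.
  have -> : (rho_inv r \in T) = (r \in rho_inv @^-1` S).
    by apply/idP/idP => /set_mem; [move=> [Sr _]|move=> Sr]; apply/mem_set.
  by case: ifPn => _; rewrite ?mule0// EFinM.
etransitivity; first exact: (change ng).
rewrite integral_mkcond [RHS]integral_mkcond; apply: eq_integral => a _.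
rewrite [LHS]patchE [RHS]patchE -/T /= patchE; case: (boolP (a \in T)) => aT; last by rewrite mule0; case: ifPn.
have [Sa Ga] := set_mem aT; have [/andP[a0 aM] _] := GN_good Ga.
by rewrite mem_set ?EFinM//= in_itv/= a0 ltW.
Qed.

(** As [rho_inv] is decreasing, radii below r correspond to levels above [rho_inv r]; the end point
    r is dropped as a null set. *)
Lemma integral_lower (h : R -> R) r : measurable_fun setT (h : RR -> R) ->
  (forall a, GN a -> 0 <= h a) -> 0 <= r <= R0 ->
  (\int[mu]_(t in `[0%R, r]) (c t * on_good h t)%:E =
   \int[mu]_(a in `]rho_inv r, +oo[%classic `&` GN) (lev (fun=> 1) a * h a)%:E)%E.
Proof.
move=> mh h0 rR; rewrite -(change_good (S := `]rho_inv r, +oo[%classic) mh _ h0); last exact: measurable_itv.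
rewrite [LHS]integral_mkcond [RHS]integral_mkcond.
have m1 : measurable ([set r] : set RR) := measurable_set1 r.
have N1 : mu [set r] = 0%E := lebesgue_measure_set1 r.
apply: (integral_off m1 N1) => t _ tr.
rewrite !patchE; case/andP: (rR) => r0 rR0.
suff -> : (t \in `[0, r]%classic) = (t \in `[0, R0[ `&` rho_inv @^-1` `]rho_inv r, +oo[%classic) by [].
have tr' : t != r by apply/eqP.
apply/idP/idP => /set_mem H; apply/mem_set.
  move: H; rewrite /= !in_itv/= andbT => /andP[t0 tler]; have t_r : t < r by rewrite lt_neqAle tr'.
  have tR := lt_le_trans t_r rR0; split; first by rewrite t0.
  by rewrite rinv_lt// t0 ltW.
move: H; rewrite /= !in_itv/= andbT => -[/andP[t0 tR]].
by rewrite rinv_lt ?t0 ?(ltW tR)// => /ltW.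
Qed.

Lemma integral_upper (h : R -> R) r : measurable_fun setT (h : RR -> R) ->
  (forall a, GN a -> 0 <= h a) -> 0 <= r <= R0 ->
  (\int[mu]_(t in `[r, R0]) (c t * on_good h t)%:E =
   \int[mu]_(a in `]-oo, rho_inv r[%classic `&` GN) (lev (fun=> 1) a * h a)%:E)%E.
Proof.
move=> mh h0 rR; rewrite -(change_good (S := `]-oo, rho_inv r[%classic) mh _ h0); last exact: measurable_itv.
have N2 : mu ([set r] `|` [set R0]) = 0%E.
  apply/eqP; rewrite eq_le measure_ge0 andbT.
  apply: (@le_trans _ _ (mu [set r] + mu [set R0])%E); first by apply: measureU2; exact: measurable_set1.
  by rewrite !lebesgue_measure_set1 adde0.
have m2 : measurable ([set r] `|` [set R0] : set RR) by apply: measurableU; exact: measurable_set1.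
rewrite [LHS]integral_mkcond [RHS]integral_mkcond.
apply: (integral_off m2 N2) => t _ tr.
rewrite !patchE; case/andP: (rR) => r0 rR0.
suff -> : (t \in `[r, R0]%classic) = (t \in `[0, R0[ `&` rho_inv @^-1` `]-oo, rho_inv r[%classic) by [].
have tr' : t != r by apply/eqP => E; apply: tr; left.
have tR' : t != R0 by apply/eqP => E; apply: tr; right.
apply/idP/idP => /set_mem H; apply/mem_set.
  move: H; rewrite /= !in_itv/= => /andP[rt tR].
  have t0 := le_trans r0 rt; split; first by rewrite t0 lt_neqAle tR'.
  by rewrite rinv_lt ?t0// lt_neqAle eq_sym tr'.
move: H; rewrite /= !in_itv/= => -[/andP[t0 tR]].
by rewrite rinv_lt ?t0 ?(ltW tR)// => /ltW ->.
Qed.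

(** Averaging k over levels and spreading the averages over spheres preserves its integral over a
    superlevel set: change of variable, then the coarea formula. *)
Lemma lower_superlevel (k : B -> R) r : bk k -> (forall x, Omega x -> 0 <= k x) -> 0 <= r <= R0 ->
  (\int[mu]_(t in `[0%R, r]) (c t * on_good (fun a => lev k a / lev (fun=> 1) a) t)%:E =
   sl_int Omega psi (k \_ Omega) (rho_inv r))%E.
Proof.
move=> kb k0 rR; have [mk _] := kb; case/andP: (rR) => r0 rR0; have [/andP[a0 aM] _] := rinvP r0 rR0.
have nk : nnmeas (EFin \o (k \_ Omega : B -> R)).
  split; first by apply/measurable_EFinP/(measurable_restrictT _ _).1.
  by move=> x; rewrite lee_fin patchE; case: ifPn => // /set_mem; exact: k0.
rewrite integral_lower//; last first.
- by move=> a Ga; rewrite divr_ge0 ?lev_ge0.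
- apply: measurable_funM; first exact: measurable_lev.
  apply: (measurableT_comp (@measurable_invr R)); apply: measurable_lev => //; exact: bk_cst.
have mJ : measurable (`]rho_inv r, M]%classic : set RR) by exact: measurable_itv.
have sJ : (`]rho_inv r, M]%classic : set RR) `<=` `]0, +oo[%classic.
  by move=> a /=; rewrite !in_itv/= andbT => /andP[ra _]; exact: le_lt_trans a0 ra.
transitivity (\int[mu]_(s in `]rho_inv r, M]) \int[tau s]_x (EFin \o (k \_ Omega : B -> R)) x)%E.
  have mNM : measurable (N `|` [set M]) by apply: measurableU => //; exact: measurable_set1.
  have NM0 : mu (N `|` [set M]) = 0%E.
    apply/eqP; rewrite eq_le measure_ge0 andbT.
    apply: (@le_trans _ _ (mu N + mu [set M])%E); first by apply: measureU2 => //; exact: measurable_set1.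
    by rewrite N0 lebesgue_measure_set1 adde0.
  rewrite [LHS]integral_mkcond [RHS]integral_mkcond.
  apply: (integral_off mNM NM0) => a _ na; rewrite !patchE.
  have -> : (a \in `]rho_inv r, M]%classic) = (a \in `]rho_inv r, +oo[ `&` GN).
    apply/idP/idP => /set_mem H; apply/mem_set.
      move: H; rewrite /= !in_itv/= => /andP[ra aM']; rewrite ra; split=> //.
      split; last by move=> h; apply: na; left.
      rewrite /= in_itv/= (le_lt_trans a0 ra)/= lt_neqAle aM' andbT.
      by apply/eqP => h; apply: na; right.
    by move: H; rewrite /= !in_itv/= andbT => -[-> [/=]]; rewrite in_itv/= => /andP[_ /ltW].
  case: ifPn => // /set_mem[_ Ga]; have [_ ga] := GN_good Ga.
  rewrite mulrC divfK ?gt_eqF ?lev1_gt0//.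
  exact: (lev_restrict ga k0 kb).
have [K' OK'] := domain_bound.
rewrite (coarea_full psib_cont tauP regular_null mJ sJ nk).
rewrite /sl_int; congr (integral _ _ _); apply/seteqP; split => x /=; rewrite in_itv/=; first by case/andP.
move=> rx; rewrite rx/=; have Ox : Omega x by exact: psib_Omega (le_lt_trans a0 rx).
by rewrite psibE// psiM'.
Qed.
Local Notation D := (lev (fun=> 1)).
Local Notation L := (lev Linv).
Local Notation W := (lev Wf).
Local Notation X := (lev (energy A psi)).
Local Notation fpos := (fun x => Num.max 0 (f x)).
Local Notation fneg := (fun x => Num.max 0 (- f x)).

Lemma prim_lower (a : R -> R) : bmeas R0 a -> prim R0 a (fun t => \int[mu]_(x in `[0, t]) a x).
Proof.
move=> ba; split => // s t s0 st tR; rewrite Rintegral_itvB ?bnd_simp//; last exact: bmeas_integrable ba _ _.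
rewrite Rintegral_itv_obnd_cbnd//.
apply: integrableS (bmeas_integrable ba s0 tR) => //.
by move=> x /=; rewrite !in_itv/= => /andP[/ltW -> ->].
Qed.

Lemma prim_upper (a : R -> R) : bmeas R0 a ->
  prim R0 (fun x => - a x) (fun t => \int[mu]_(x in `[t, R0]) a x).
Proof.
move=> ba; have [_ E] := prim_lower ba; split; first exact: bmeasN.
have I t : 0 <= t -> t <= R0 -> \int[mu]_(x in `[t, R0]) a x =
    \int[mu]_(x in `[0, R0]) a x - \int[mu]_(x in `[0, t]) a x by move=> t0 tR; rewrite E.
move=> s t s0 st tR; rewrite (I t) ?(le_trans s0 st)// (I s) ?(le_trans st tR)//.
transitivity (- \int[mu]_(x in `[s, t]) a x).
  by rewrite -(E s t s0 st tR) opprB addrC opprB addrA subrK.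
rewrite -mulN1r -RintegralZl//; last exact: bmeas_integrable ba _ _.
by apply: eq_Rintegral => x _; rewrite mulN1r.
Qed.

Lemma bmeas_patch (h : R -> R) C : measurable_fun setT (h : RR -> R) ->
  (forall r, Gs r -> `|h r| <= C) -> bmeas R0 (h \_ Gs).
Proof.
move=> mh hC; split; last first.
  exists `|C| => r _; rewrite patchE; case: ifPn => [/set_mem Gr|_]; last by rewrite normr0.
  exact: le_trans (hC r Gr) (ler_norm _).
apply: measurable_funTS; apply/(measurable_restrictT _ _).1; first exact: measurable_Gs.
exact: measurable_funTS.
Qed.

Let measurable_c : measurable_fun setT (c : RR -> R) := continuous_measurable_fun continuous_sphere_area.

Lemma bmeas_c : bmeas R0 c.
Proof.
split; first exact: measurable_funTS.
exists (c R0) => r /andP[r0 rR]; rewrite ger0_norm ?sphere_area_ge0// /sphere_area.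
apply: ler_wpM2l; first by rewrite mulr_ge0 ?ler0n// ltW// alpha_gt0.
by apply: lerXn2r; rewrite ?nnegrE//; exact: le_trans r0 rR.
Qed.

Let mD : measurable_fun setT (D : RR -> R).
Proof. by apply: measurable_lev => //; exact: bk_cst. Qed.
Let mL : measurable_fun setT (L : RR -> R).
Proof. by apply: measurable_lev bk_Linv _ => x Ox; rewrite invr_ge0 ltW// Lambda_gt0. Qed.
Let mX : measurable_fun setT (X : RR -> R).
Proof. exact: measurable_lev bk_energy energy_ge0. Qed.
Let mW : measurable_fun setT (W : RR -> R).
Proof. by apply: measurable_lev bk_W _ => x Ox; rewrite mulr_ge0 ?sqr_ge0// invr_ge0 ltW// Lambda_gt0. Qed.
Let minv (k : RR -> R) : measurable_fun setT k -> measurable_fun setT (fun r => (k r)^-1).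
Proof. by move=> mk; exact: (measurableT_comp (@measurable_invr R) mk). Qed.

(** Radial models of the rearranged data, set to 0 off the good radii so that they are bounded and
    measurable: [gF] is -F, [ww] is |v_hat| / Lambda_hat, [VV] is -V_hat, and [pp], [uu] are
    psi_tilde and U. *)
Definition gF : R -> R := (fun r => (X (kinv r) * L (kinv r)) / (c r * D (kinv r))) \_ Gs.
Definition ww : R -> R := (fun r => Num.sqrt (W (kinv r) / L (kinv r)) * (L (kinv r) / D (kinv r))) \_ Gs.
Definition VV : R -> R := (fun r => lev Vm (kinv r) / D (kinv r)) \_ Gs.
(** Sphere area times the level average of -div (A grad psi), kept as a difference of two
    nonnegative parts. Its primitive [hh] is the integral of -div (A grad psi) over the superlevel
    set. *)
Definition kk (r : R) : R := c r * on_good (fun a => lev fneg a / D a) r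
  - c r * on_good (fun a => lev fpos a / D a) r.
Definition pp (r : R) : R := \int[mu]_(t in `[r, R0]) gF t.
Definition hh (r : R) : R := \int[mu]_(t in `[0, r]) kk t.
Definition uu (r : R) : R := \int[mu]_(t in `[0, r]) ww t.

Lemma bk_fneg : bk fneg.
Proof.
have [mf [C fC]] := bk_f; split.
  by apply: measurable_maxr; [exact: measurable_cst|exact: measurableT_comp].
exists C => x Ox; have C0 : 0 <= C := le_trans (normr_ge0 _) (fC x Ox).
by case: (leP 0 (- f x)) => h; rewrite ?normr0// normrN; exact: fC.
Qed.

Lemma bk_fpos : bk fpos.
Proof.
have [mf [C fC]] := bk_f; split.
  by apply: measurable_maxr => //; exact: measurable_cst.
exists C => x Ox; have C0 : 0 <= C := le_trans (normr_ge0 _) (fC x Ox).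
by case: (leP 0 (f x)) => h; rewrite ?normr0//; exact: fC.
Qed.

Lemma max0_ge0 (x : R) : 0 <= Num.max 0 x. Proof. by rewrite le_max lexx. Qed.

Lemma lev_ratio_bound k : bk k -> (forall x, Omega x -> 0 <= k x) ->
  exists C, forall a, GN a -> 0 <= lev k a / D a <= C.
Proof.
move=> kb k0; have [mk [C kC]] := kb; exists C => a Ga; have [_ ga] := GN_good Ga.
have D0 := lev1_gt0 Ga; rewrite divr_ge0 ?(ltW D0) ?lev_ge0//= ler_pdivrMr//.
rewrite -(levZ ga C (bk_cst 1)); apply: (lev_le ga kb (bkM (bk_cst _) (bk_cst _))) => x Ox.
by rewrite mulr1; exact: le_trans (ler_norm _) (kC x Ox).
Qed.

Lemma bmeas_ratio k : bk k -> (forall x, Omega x -> 0 <= k x) ->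
  bmeas R0 (on_good (fun a => lev k a / D a)).
Proof.
move=> kb k0; have [C kC] := lev_ratio_bound kb k0.
apply: (@bmeas_on_good _ C).
  apply: measurable_funM; first exact: measurable_lev.
  exact: minv.
by move=> r /Gs_GN/kC/andP[h1 h2]; rewrite ger0_norm.
Qed.

Lemma bmeas_kk : bmeas R0 kk.
Proof.
apply: bmeasD; [|apply: bmeasN]; apply: bmeasM bmeas_c _; apply: bmeas_ratio => [|x _].
- exact: bk_fneg.
- exact: max0_ge0.
- exact: bk_fpos.
- exact: max0_ge0.
Qed.

Lemma Gs_facts r : Gs r -> let a := kinv r in
  [/\ 0 < c r, 0 < D a, 0 < L a, c r <= lev gr a & lev gr a ^+ 2 <= L a * X a].
Proof.
move=> Gr /=; have Ga := Gs_GN Gr; have [_ ar _ ga] := Gs_good Gr.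
have := per_le_lev ga; rewrite ar => h; split => //.
- by rewrite -[in c r]ar sphere_rho_gt0.
- exact: lev1_gt0.
- exact: lev_Linv_gt0.
- exact: lev_perim_sqr ga.
Qed.

(** Near the centre the energy is at most a constant times alpha r^(n+1), which compensates the
    division by the sphere area; the remaining factor L / D is at most 1 / gamma by ellipticity. *)
Lemma bmeas_gF : bmeas R0 gF.
Proof.
have [_ [C fC]] := bk_f.
apply: (@bmeas_patch _ (C * R0 / gamma)).
  apply: measurable_funM.
    by apply: measurable_funM; [exact: measurableT_comp mX mkinv|exact: measurableT_comp mL mkinv].
  apply: minv; apply: measurable_funM; [exact: measurable_c|exact: measurableT_comp mD mkinv].
move=> r Gr; have [c0 D0 L0 _ _] := Gs_facts Gr; have [aM ar _ ga] := Gs_good Gr.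
have /andP[a0 _] := aM; have /andP[r0 rR] := Gs_itv Gr.
have X0 := lev_energy_ge0 (kinv r).
have C0 : 0 <= C := le_trans (normr_ge0 _) (fC _ Ox0).
rewrite (ger0_norm (divr_ge0 (mulr_ge0 X0 (ltW L0)) (mulr_ge0 (ltW c0) (ltW D0)))).
have -> : X (kinv r) * L (kinv r) / (c r * D (kinv r)) = (X (kinv r) / c r) * (L (kinv r) / D (kinv r)).
  by field; rewrite !gt_eqF.
have h1 : X (kinv r) / c r <= C * R0.
  rewrite ler_pdivrMr//; apply: le_trans (energy_bound a0 ga fC) _; rewrite ar -mulrA ler_wpM2l//.
  have h3 : r <= R0 * n.+1%:R by apply: le_trans (ltW rR) _; rewrite ler_peMr ?(ltW R0_gt0)// ler1n.
  have h4 : 0 <= @alpha R n * r ^+ n by apply: mulr_ge0; [rewrite ltW// alpha_gt0|rewrite exprn_ge0// ltW].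
  have := ler_wpM2r h4 h3; rewrite /sphere_area exprS.
  have aux (b x s q k : R) : s * (b * x) <= q * k * (b * x) -> b * (s * x) <= q * (k * b * x) by lra.
  exact: aux.
have h2 : L (kinv r) / D (kinv r) <= gamma^-1.
  by rewrite ler_pdivrMr// -ler_pdivrMl ?invr_gt0// invrK; exact: lev_Linv_le ga.
exact: (ler_pM (divr_ge0 X0 (ltW c0)) (divr_ge0 (ltW L0) (ltW D0)) h1 h2).
Qed.

Lemma bmeas_ww : bmeas R0 ww.
Proof.
have [_ [C oC]] := bk_omega; have C0 : 0 <= C := le_trans (normr_ge0 _) (oC _ Ox0).
apply: (@bmeas_patch _ (C / gamma)).
  apply: measurable_funM.
    apply: (measurableT_comp (continuous_measurable_fun (@sqrt_continuous R))).
    by apply: measurable_funM; [exact: measurableT_comp mW mkinv|apply: minv; exact: measurableT_comp mL mkinv].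
  by apply: measurable_funM; [exact: measurableT_comp mL mkinv|apply: minv; exact: measurableT_comp mD mkinv].
move=> r Gr; have [c0 D0 L0 _ _] := Gs_facts Gr; have [aM ar _ ga] := Gs_good Gr.
have h2 : L (kinv r) / D (kinv r) <= gamma^-1.
  by rewrite ler_pdivrMr// -ler_pdivrMl ?invr_gt0// invrK; exact: lev_Linv_le ga.
have LD : 0 <= L (kinv r) / D (kinv r) by rewrite divr_ge0 ?ltW.
have q0 := mulr_ge0 (sqrtr_ge0 (W (kinv r) / L (kinv r))) LD; rewrite (ger0_norm q0).
apply: ler_pM; [exact: sqrtr_ge0|exact: LD| |exact: h2].
rewrite -[leRHS]ger0_norm// -sqrtr_sqr; apply: ler_wsqrtr.
by rewrite ler_pdivrMr//; exact: lev_W_le ga _ oC.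
Qed.

Lemma bmeas_VV : bmeas R0 VV.
Proof. by apply: bmeas_ratio bk_Vm _ => x _; exact: max0_ge0. Qed.
Let p_prim : prim R0 (fun x => - gF x) pp := prim_upper bmeas_gF.
Let h_prim : prim R0 kk hh := prim_lower bmeas_kk.
Let u_prim : prim R0 ww uu := prim_lower bmeas_ww.

(** [hh] is introduced as a primitive so that it can be integrated by parts on the whole interval;
    only at good radii is it identified, through the divergence theorem, with the energy on the
    level. *)
Lemma hh_energy r : Gs r -> hh r = X (kinv r).
Proof.
move=> Gr; have /andP[r0 rR] := Gs_itv Gr; have [aM ar _ ga] := Gs_good Gr; have /andP[a0 _] := aM.
have kr : kinv r = rho_inv r by apply: (kinvE psi); rewrite ltW.
have rI : 0 <= r <= R0 by rewrite !ltW.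
have bn : bmeas R0 (fun t => c t * on_good (fun a => lev fneg a / D a) t).
  by apply: bmeasM bmeas_c (bmeas_ratio bk_fneg _) => x _; exact: max0_ge0.
have bp : bmeas R0 (fun t => c t * on_good (fun a => lev fpos a / D a) t).
  by apply: bmeasM bmeas_c (bmeas_ratio bk_fpos _) => x _; exact: max0_ge0.
rewrite (energy_split a0 ga) kr /hh /kk RintegralB//; last 2 first.
- exact: bmeas_integrable bn (lexx _) (ltW rR).
- exact: bmeas_integrable bp (lexx _) (ltW rR).
congr (_ - _); congr fine.
  by apply: (lower_superlevel bk_fneg _ rI) => x _; exact: max0_ge0.
by apply: (lower_superlevel bk_fpos _ rI) => x _; exact: max0_ge0.
Qed.

(** Isoperimetry and Cauchy-Schwarz combined: c^2 <= P^2 <= L X, with P the perimeter of the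
    level. *)
Lemma gF_ge r : Gs r -> c r * (D (kinv r))^-1 <= gF r.
Proof.
move=> Gr; have [c0 D0 L0 h1 h2] := Gs_facts Gr.
rewrite /gF patchE mem_set// invfM [leRHS]mulrA ler_pM2r ?invr_gt0// ler_pdivlMr//.
rewrite -expr2 [leRHS]mulrC; apply: le_trans h2.
by apply: lerXn2r; rewrite ?nnegrE ?(ltW c0)//; exact: le_trans (ltW c0) h1.
Qed.

Lemma gF_ge0 r : 0 <= gF r.
Proof.
rewrite /gF patchE; case: ifPn => // /set_mem Gr; have [c0 D0 L0 _ _] := Gs_facts Gr.
exact: (divr_ge0 (mulr_ge0 (lev_energy_ge0 _) (ltW L0)) (mulr_ge0 (ltW c0) (ltW D0))).
Qed.

Lemma pp_ge0 r : 0 <= pp r.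
Proof. by apply: Rintegral_ge0 => t _; exact: gF_ge0. Qed.

(** By [gF_ge] the integrand dominates c / D. In the variable a this lower bound becomes D / D = 1
    on ]0, kinv r[ up to a null set, whose integral is the level itself. *)
Lemma pp_ge r : Gs r -> kinv r <= pp r.
Proof.
move=> Gr; have /andP[r0 rR] := Gs_itv Gr; have [/andP[a0 aM] ar _ ga] := Gs_good Gr.
have kr : kinv r = rho_inv r by apply: (kinvE psi); rewrite ltW.
have rI : 0 <= r <= R0 by rewrite !ltW.
have gi := bmeas_integrable bmeas_gF (ltW r0) (lexx R0).
have [_ [C gC]] := bmeas_gF.
have og1 t : on_good (fun a => (D a)^-1) t = if t \in Gs then (D (kinv t))^-1 else 0 by rewrite /on_good patchE.
have og0 t : 0 <= t <= R0 -> 0 <= c t * on_good (fun a => (D a)^-1) t <= gF t.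
  move=> /andP[t0 tR]; rewrite og1; case: ifPn => [/set_mem Gt|_]; last by rewrite mulr0 lexx gF_ge0.
  have [c0 D0 _ _ _] := Gs_facts Gt.
  by rewrite gF_ge// mulr_ge0 ?invr_ge0 ?(ltW c0) ?(ltW D0).
have b1 : bmeas R0 (fun t => c t * on_good (fun a => (D a)^-1) t).
  split; last first.
    by exists C => t tI; have /andP[q1 q2] := og0 t tI; rewrite ger0_norm// (le_trans q2)// (le_trans (ler_norm _))// gC.
  apply: measurable_funTS; apply: measurable_funM; first exact: measurable_c.
  apply/(measurable_restrictT _ _).1; first exact: measurable_Gs.
  by apply: measurable_funTS; exact: measurableT_comp (minv mD) mkinv.
apply: (@le_trans _ _ (\int[mu]_(t in `[r, R0]) (c t * on_good (fun a => (D a)^-1) t))); last first.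
  apply: le_Rintegral => //; first exact: bmeas_integrable b1 (ltW r0) (lexx R0).
  move=> t /=; rewrite in_itv/= => /andP[rt tR]; suff /og0/andP[] : 0 <= t <= R0 by [].
  by rewrite tR (le_trans (ltW r0)).
rewrite /Rintegral integral_upper//; [|exact: minv|by move=> a Ga; rewrite invr_ge0 ltW// lev1_gt0].
have -> : (\int[mu]_(a in `]-oo, rho_inv r[ `&` GN) (D a * (D a)^-1)%:E = \int[mu]_(a in `]0%R, rho_inv r[) 1)%E.
  rewrite [LHS]integral_mkcond [RHS]integral_mkcond.
  apply: (integral_off mN N0) => a _ na; rewrite !patchE.
  have -> : (a \in `]-oo, rho_inv r[ `&` GN) = (a \in `]0, rho_inv r[%classic).
    apply/idP/idP => /set_mem H; apply/mem_set.
      by move: H; rewrite /= !in_itv/= => -[-> [/=]]; rewrite in_itv/= => /andP[-> _].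
    move: H; rewrite /= !in_itv/= => /andP[h1 h2]; split => //; split => //.
    by rewrite /= in_itv/= h1 (lt_trans h2)// -kr.
  case: ifPn => // /set_mem; rewrite /= in_itv/= => /andP[h1 h2].
  have Ga : GN a by split => //; rewrite /= in_itv/= h1 (lt_trans h2)// -kr.
  by rewrite divff// gt_eqF// lev1_gt0.
rewrite integral_cst.
change (kinv r <= fine (1 * lebesgue_measure (`]0%R, rho_inv r[%classic : set R))%E).
by rewrite mul1e lebesgue_measure_itv/= lte_fin -kr a0 -EFinD /= subr0.
exact: measurable_itv.
Qed.

Lemma ww_ge0 r : 0 <= ww r.
Proof.
rewrite /ww patchE; case: ifPn => // /set_mem Gr; have [c0 D0 L0 _ _] := Gs_facts Gr.
by rewrite mulr_ge0 ?sqrtr_ge0// divr_ge0 ?(ltW D0) ?(ltW L0).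
Qed.

Lemma uu_ge0 r : 0 <= uu r.
Proof. by apply: Rintegral_ge0 => t _; exact: ww_ge0. Qed.

(** At a good radius this is [level_inequality] multiplied by the nonnegative factor pp c; at a bad
    radius all the models vanish and only the right-hand side remains. *)
Lemma radial_pointwise r : 0 <= r <= R0 ->
  pp r * (kk r - hh r * ww r) - (omega0 * c r * gF r * pp r + c r * VV r * pp r ^+ 2) <= m * (c r * pp r ^+ 2).
Proof.
move=> /andP[r0 rR]; have p0 := pp_ge0 r; have cr0 := sphere_area_ge0 (n := n) r0.
have [Gr|nG] := pselect (Gs r); last first.
  have og0 h : on_good h r = 0 by rewrite /on_good patchE memNset.
  have g0 : gF r = 0 by rewrite /gF patchE memNset.
  have w0 : ww r = 0 by rewrite /ww patchE memNset.
  have v0 : VV r = 0 by rewrite /VV patchE memNset.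
  rewrite /kk v0 !og0 g0 w0 !mulr0 !mul0r !subr0 mulr0 addr0 subrr.
  by rewrite mulr_ge0// mulr_ge0// sqr_ge0.
have [c0 D0 L0 h1 h2] := Gs_facts Gr; have [aM ar _ ga] := Gs_good Gr; have /andP[a0 _] := aM.
have W0 : 0 <= W (kinv r) by apply: lev_ge0 => x Ox; rewrite mulr_ge0 ?sqr_ge0// invr_ge0 ltW// Lambda_gt0.
have V0 : 0 <= lev Vm (kinv r) by apply: lev_ge0 => x _; exact: max0_ge0.
have O0 : 0 <= lev (fun x => `|omega x| * gr x) (kinv r) by apply: lev_ge0 => x _; rewrite mulr_ge0// enorm_ge0.
have := level_inequality c0 L0 D0 W0 (lev_energy_ge0 _) V0 O0 h1 h2 (lev_omega_sqr ga) (lev_source_le a0 ga) homega0 hm (pp_ge Gr).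
have -> : lev (fun x => - f x) (kinv r) = lev fneg (kinv r) - lev fpos (kinv r).
  rewrite (lev_source_split ga) /div_neg /div_pos.
  by rewrite -(lev_restrict ga (fun x _ => max0_ge0 _) bk_fneg) -(lev_restrict ga (fun x _ => max0_ge0 _) bk_fpos).
rewrite (hh_energy Gr) /kk /on_good /gF /ww /VV /on_good !patchE mem_set//.
set v := Num.sqrt _; set F1 := lev fneg _; set F2 := lev fpos _; set Q := pp r.
set d := D _; set l := L _; set x := X _; set vm := lev Vm _; set cc := c r => h.
have c0' : 0 < cc := c0; have d0 : 0 < d := D0; have Q0 : 0 <= Q := p0.
have := ler_wpM2l (mulr_ge0 Q0 (ltW c0')) h.
(* The term h U' is exactly c times the |v_hat| part of the right-hand side of [level_inequality],
   so it cancels the drift. *)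
have -> : Q * (cc * (F1 / d) - cc * (F2 / d) - x * (v * (l / d))) =
   Q * cc * ((F1 - F2) / d) - Q * cc * (v * (x * l / (cc * d))) by field; rewrite !gt_eqF.
lra.
Qed.

Lemma radial_inequality :
  \int[mu]_(r in `[0, R0]) ((gF r * hh r - (omega0 * c r * gF r * pp r + c r * VV r * pp r ^+ 2)) * expR (- uu r))
  <= m * \int[mu]_(r in `[0, R0]) (c r * pp r ^+ 2 * expR (- uu r)).
Proof.
have R00 := ltW R0_gt0.
have bE := prim_bmeas (prim_expN u_prim (fun x _ => ww_ge0 x) (fun x _ => uu_ge0 x)).
have bpp := prim_bmeas p_prim; have bh := prim_bmeas h_prim.
have bg := bmeas_gF; have bw := bmeas_ww; have bk' := bmeas_kk; have bV := bmeas_VV; have bc := bmeas_c.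
have bp2 : bmeas R0 (fun r => pp r ^+ 2) by exact: (bmeasM bpp bpp).
have b1 : bmeas R0 (fun r => gF r * hh r * expR (- uu r)) by exact: bmeasM (bmeasM bg bh) bE.
have b2 : bmeas R0 (fun r => (omega0 * c r * gF r * pp r + c r * VV r * pp r ^+ 2) * expR (- uu r)).
  apply: bmeasM bE; apply: bmeasD; last exact: bmeasM (bmeasM bc bV) bp2.
  by apply: bmeasM bpp; apply: bmeasM bg; exact: bmeasM (bmeas_cst _ _) bc.
have b3 : bmeas R0 (fun r => pp r * (kk r - hh r * ww r) * expR (- uu r)).
  by apply: bmeasM bE; apply: bmeasM bpp _; apply: bmeasD bk' _; apply: bmeasN; exact: bmeasM bh bw.
have b4 : bmeas R0 (fun r => c r * pp r ^+ 2 * expR (- uu r)) by apply: bmeasM bE; exact: bmeasM bc bp2.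
have ii g : bmeas R0 g -> mu.-integrable `[0, R0] (EFin \o g) by move=> bg'; exact: bmeas_integrable bg' _ _.
under eq_Rintegral do rewrite mulrBl.
rewrite RintegralB//; [|exact: ii|exact: ii].
rewrite (weighted_energy R00 p_prim _ h_prim _ u_prim (fun x _ => ww_ge0 x) (fun x _ => uu_ge0 x)); last 2 first.
- by rewrite /pp set_itv1 Rintegral_set1.
- by rewrite /hh set_itv1 Rintegral_set1.
rewrite -RintegralB//; [|exact: ii|exact: ii].
rewrite -RintegralZl//; last exact: ii.
apply: le_Rintegral => //.
- by apply: ii; apply: bmeasD b3 (bmeasN b2).
- by apply: ii; apply: bmeasM (bmeas_cst _ _) b4.
move=> r /=; rewrite in_itv/= => rI; rewrite -mulrBl [leRHS]mulrA ler_wpM2r ?expR_ge0//.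
exact: radial_pointwise.
Qed.

(** * Identification of the radial models with the rearranged functions *)

Lemma Gs_regular r : Gs r -> regular_radii Omega psi r /\ rho_inv r = kinv r.
Proof.
move=> Gr; have /andP[r0 rR] := Gs_itv Gr; have [/andP[a0 aM] ar _ ga] := Gs_good Gr.
split; last by rewrite kinv_in// r0.
exists (kinv r) => //; have aI : 0 <= kinv r <= psi_max Omega psi by rewrite ME !ltW.
split => // -[_ [x]]; rewrite (levelE oO psi_bnd a0) => -[Ox xa]; rewrite (gradpsiE oO hpsi Ox) => g0.
by have := good_reg ga Ox xa; rewrite g0 eqxx.
Qed.

Lemma G_good r : Gs r -> Defs.G Omega Lambda psi r = D (kinv r) / L (kinv r).
Proof.
move=> Gr; have [reg kr] := Gs_regular Gr; have [_ _ _ ga] := Gs_good Gr.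
rewrite /Defs.G patchE mem_set// kr (good_lev ga) ?(good_lev ga)//.
- exact: bk_Linv.1.
- by move=> x Ox; rewrite invr_ge0 ltW// Lambda_gt0.
Qed.

Lemma F_good r : Gs r -> Defs.F Omega A Lambda psi r = - gF r.
Proof.
move=> Gr; have [reg kr] := Gs_regular Gr; have [/andP[a0 _] _ _ ga] := Gs_good Gr.
have [c0 D0 L0 _ _] := Gs_facts Gr.
rewrite /Defs.F patchE mem_set// (G_good Gr) kr (source_integral a0 ga) /gF patchE mem_set//.
rewrite -/(c r) mulrN; congr (- _); field; by rewrite !gt_eqF.
Qed.

(** The two integrands agree off the null set of bad radii, so the identity holds at every x, which
    is needed to take the gradient of psi_tilde. *)
Lemma psi_tildeE (x : 'rV[R]_n.+1) : psi_tilde Omega A Lambda psi x = pp (enorm x).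
Proof.
have x_ge0 := enorm_ge0 x.
rewrite /psi_tilde (_ : \int[mu]_(r in `[enorm x, R0]) _ = \int[mu]_(r in `[enorm x, R0]) (-1 * gF r)).
  by rewrite RintegralZl ?mulN1r ?opprK//; exact: bmeas_integrable bmeas_gF x_ge0 (lexx _).
congr fine; apply: (integral_off measurable_bad bad_null) => r /=; rewrite in_itv/= => /andP[xr rR] nb.
by rewrite F_good ?mulN1r//; apply: bad_Gs => //; rewrite rR (le_trans x_ge0).
Qed.

Lemma E_good (x : 'rV[R]_n.+1) : Gs (enorm x) -> Defs.E Omega psi x.
Proof. by move=> Gx; split; [have /andP[_ /ltW] := Gs_itv Gx|exact: (Gs_regular Gx).1]. Qed.

Lemma V_hatE (x : 'rV[R]_n.+1) : Gs (enorm x) -> V_hat Omega V psi x = - VV (enorm x).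
Proof.
move=> Gx; have [_ kr] := Gs_regular Gx; have [_ _ _ ga] := Gs_good Gx.
rewrite /V_hat patchE mem_set; last exact: E_good.
rewrite /= kr (good_lev ga) ?(good_lev ga)//; first by rewrite /VV patchE mem_set.
- exact: bk_Vm.1.
- by move=> y _; exact: max0_ge0.
Qed.

Lemma Lambda_hatE (x : 'rV[R]_n.+1) : Gs (enorm x) ->
  Lambda_hat Omega Lambda psi x = D (kinv (enorm x)) / L (kinv (enorm x)).
Proof. by move=> Gx; rewrite /Lambda_hat patchE mem_set ?G_good//; exact: E_good. Qed.

Lemma v_hatE (x : 'rV[R]_n.+1) : Gs (enorm x) ->
  enorm (v_hat Omega Lambda omega psi x) = Num.sqrt (W (kinv (enorm x)) / L (kinv (enorm x))).
Proof.
move=> Gx; have [_ kr] := Gs_regular Gx; have [_ _ _ ga] := Gs_good Gx; have /andP[x_gt0 _] := Gs_itv Gx.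
rewrite /v_hat patchE mem_set; last exact: E_good.
rewrite /= kr (good_lev ga) ?(good_lev ga)//.
- rewrite enormZ ger0_norm ?sqrtr_ge0// enormZ ger0_norm ?invr_ge0 ?enorm_ge0// mulVf ?mulr1//.
  by rewrite gt_eqF.
- exact: bk_Linv.1.
- by move=> y Oy; rewrite invr_ge0 ltW// Lambda_gt0.
- exact: bk_W.1.
- by move=> y Oy; rewrite mulr_ge0 ?sqr_ge0// invr_ge0 ltW// Lambda_gt0.
Qed.

(** At good radii the integrand depends on the point s e only through its norm s, so the choice of
    the unit vector disappears. *)
Lemma UE (e x : 'rV[R]_n.+1) : enorm e = 1 -> enorm x <= R0 -> Defs.U Omega Lambda omega psi e x = uu (enorm x).
Proof.
move=> e1 xR; congr fine; apply: (integral_off measurable_bad bad_null) => s /=; rewrite in_itv/= => /andP[s0 sx] nb.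
have Gss : Gs s by apply: bad_Gs => //; rewrite s0 (le_trans sx).
have se : enorm (s *: e) = s by rewrite enormZ e1 mulr1 ger0_norm.
rewrite v_hatE ?se// Lambda_hatE ?se// /ww patchE mem_set//.
by rewrite invf_div.
Qed.

(** Lebesgue differentiation of the primitive of [gF], which is 0 outside [0, R0]; there pp differs
    from the constant [pp 0] by this primitive. *)
Lemma pp_derive : exists Z : set RR, [/\ measurable Z, mu Z = 0%E &
  forall r, 0 < r < R0 -> ~ Z r -> is_derive (r : R) 1 (pp : R -> R) (- gF r)].
Proof.
have [mg [C gC]] := bmeas_gF.
have g_out r : ~~ (0 <= r <= R0) -> gF r = 0.
  move=> nr; rewrite /gF patchE memNset// => /Gs_itv/andP[h1 h2].
  by move/negP: nr; apply; rewrite !ltW.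
have ig : mu.-integrable setT (EFin \o gF).
  have -> : EFin \o gF = (EFin \o gF) \_ `[0, R0].
    apply/funext => r; rewrite patchE; case: ifPn => // nr; rewrite /= g_out//.
    by apply/negP => rI; move/negP: nr; apply; apply/mem_set; rewrite /= in_itv.
  apply/(integrable_mkcond _ _).1; first exact: measurable_itv.
  exact: bmeas_integrable bmeas_gF (lexx _) (lexx _).
have lg : locally_integrable setT gF := open_integrable_locally openT ig.
have iy y : mu.-integrable `]-oo, y] (EFin \o gF).
  by apply: integrableS ig => //; exact: measurable_itv.
have [Z [mZ Z0 ZP]] := FTC1Ny iy lg.
exists Z; split => // r rI nZ; have /andP[r0 rR] := rI.
have [dF F'] := contrapT (fun h => nZ (ZP r h)).
have IE (y : R) : \int[mu]_(t in `]-oo, y]) gF t = \int[mu]_(t in `[0, y]) gF t.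
  congr fine; rewrite integral_mkcond [RHS]integral_mkcond; apply: eq_integral => t _; rewrite !patchE.
  case: (ltP t 0) => t0; last first.
    suff -> : (t \in `]-oo, y]%classic) = (t \in `[0, y]%classic) by [].
    by apply/idP/idP => /set_mem H; apply/mem_set; move: H; rewrite /= !in_itv/= t0.
  rewrite g_out; last by rewrite leNgt t0.
  by case: ifPn; case: ifPn.
pose I (x : R) : R := \int[mu]_(t in `]-oo, x]) gF t.
have dI : is_derive (r : R) 1 (I : R -> R) (gF r) by split; [exact: dF|rewrite -F' derive1E].
have dH : is_derive (r : R) 1 ((cst (pp 0) : R -> R) - (I : R -> R)) (0 - gF r) by apply: is_deriveB.
rewrite sub0r in dH; apply: near_eq_is_derive dH.
have rN : nbhs r (`]0, R0[%classic : set R) by apply: open_nbhs_nbhs; split; [exact: itv_open|rewrite /= in_itv].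
apply: filterS rN => y /=; rewrite in_itv/= => /andP[y0 yR].
have [_ /(_ 0 y (lexx _) (ltW y0) (ltW yR))] := p_prim.
have -> : \int[mu]_(t in `[0, y]) (- gF t) = - \int[mu]_(t in `[0, y]) gF t.
  rewrite -[RHS]mulN1r -RintegralZl//; last exact: bmeas_integrable bmeas_gF (lexx _) (ltW yR).
  by apply: eq_Rintegral => t _; rewrite mulN1r.
move=> h; change (pp 0 - I y = pp y); rewrite /I IE -h; by rewrite addrC subrK.
Qed.

(** * Integration over the ball and the final inequality *)

Lemma polar_ball_ge0 (Phi : R -> R) : bmeas R0 Phi -> (forall r, 0 <= r <= R0 -> 0 <= Phi r) ->
  (\int[leb n.+1]_(x in [set x | (enorm x < R0)%R]) (Phi (enorm x) / c (enorm x))%:E =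
   \int[mu]_(r in `[0%R, R0]) (Phi r)%:E)%E.
Proof.
move=> [mP _] P0; pose g : RR -> R := (fun r => Phi r / c r) \_ `[0, R0[.
have ng : nnmeas (EFin \o g).
  split; last first.
    move=> r; rewrite lee_fin /g patchE; case: ifPn => // /set_mem; rewrite /= in_itv/= => /andP[r0 rR].
    by rewrite divr_ge0 ?sphere_area_ge0// P0// r0 ltW.
  apply/measurable_EFinP; apply/(measurable_restrictT _ _).1; first exact: measurable_itv.
  apply: measurable_funM; last by apply: measurable_funTS; exact: minv.
  apply: measurable_funS mP; [exact: measurable_itv|].
  by move=> r /=; rewrite !in_itv/= => /andP[-> /ltW].
have m2 : measurable ([set 0] `|` [set R0] : set RR) by apply: measurableU; exact: measurable_set1.
have N2 : mu ([set 0] `|` [set R0]) = 0%E.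
  apply/eqP; rewrite eq_le measure_ge0 andbT.
  apply: (@le_trans _ _ (mu [set 0%R] + mu [set R0])%E); first by apply: measureU2; exact: measurable_set1.
  by rewrite !lebesgue_measure_set1 adde0.
transitivity (\int[leb n.+1]_x (EFin \o g) (enorm x))%E.
  rewrite [LHS]integral_mkcond; apply: eq_integral => x _; rewrite /= /g !patchE.
  have -> : (enorm x \in `[0, R0[%classic) = (x \in [set x | enorm x < R0]).
    by apply/idP/idP => /set_mem H; apply/mem_set; move: H; rewrite /= in_itv/= ?enorm_ge0.
  by case: ifPn.
rewrite (polar ng) [LHS]integral_mkcond [RHS]integral_mkcond.
apply: (integral_off m2 N2) => r _ nr.
have r1 : r != 0 by apply/eqP => E; apply: nr; left.
have r2 : r != R0 by apply/eqP => E; apply: nr; right.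
rewrite patchE [RHS]patchE /= /g patchE.
case: ifPn => [/set_mem|nr0]; last first.
  rewrite memNset// => /=; rewrite in_itv/= => /andP[r0 _].
  by move/negP: nr0; apply; apply/mem_set; rewrite /= in_itv/= r0.
rewrite /= in_itv/= andbT => r0; have cr : 0 < c r by apply: sphere_area_gt0; rewrite lt_def r1.
have [rR|Rr] := ltP r R0.
  rewrite mem_set; last by rewrite /= in_itv/= r0.
  rewrite mem_set; last by rewrite /= in_itv/= r0 ltW.
  by rewrite -EFinM mulrC divfK// gt_eqF.
rewrite memNset; last by rewrite /= in_itv/= r0/= ltNge Rr.
rewrite memNset; last by rewrite /= in_itv/= r0/= => h; move: r2; rewrite eq_le h Rr.
by rewrite mule0.
Qed.

Lemma polar_ball (Phi : R -> R) : bmeas R0 Phi ->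
  (\int[leb n.+1]_(x in [set x | (enorm x < R0)%R]) (Phi (enorm x) / c (enorm x))%:E =
   (\int[mu]_(r in `[0, R0]) Phi r)%:E)%E.
Proof.
move=> bP; have iP := bmeas_integrable bP (lexx 0) (lexx R0).
have bmax (a : R -> R) : bmeas R0 a -> bmeas R0 (fun r => Num.max (a r) 0).
  move=> [ma [C aC]]; split; first by apply: measurable_maxr => //; exact: measurable_cst.
  exists C => r rI; have C0 := le_trans (normr_ge0 _) (aC r rI).
  by case: (leP (a r) 0) => h; rewrite ?normr0//; exact: aC.
have max0 (x : R) : 0 <= Num.max x 0 by rewrite le_max lexx orbT.
have cinv (x : B) : 0 <= (c (enorm x))^-1 by rewrite invr_ge0 sphere_area_ge0 ?enorm_ge0.
rewrite /Rintegral fineK; last exact: integrable_fin_num iP.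
rewrite [LHS]integralE [RHS]integralE; congr (_ - _)%E.
  transitivity (\int[mu]_(r in `[0%R, R0]) (Num.max (Phi r) 0)%:E)%E; last first.
    by apply: eq_integral => r _; rewrite funeposE -EFin_max.
  rewrite -(polar_ball_ge0 (bmax _ bP)); last by move=> r _; exact: max0.
  by apply: eq_integral => x _; rewrite funeposE -EFin_max maxr_pMl// mul0r.
transitivity (\int[mu]_(r in `[0%R, R0]) (Num.max (- Phi r) 0)%:E)%E; last first.
  by apply: eq_integral => r _; rewrite funenegE -EFinN -EFin_max.
rewrite -(polar_ball_ge0 (bmax _ (bmeasN bP))); last by move=> r _; exact: max0.
by apply: eq_integral => x _; rewrite funenegE -EFinN -EFin_max maxr_pMl// mul0r mulNr.
Qed.

(** Polar coordinates applied to the indicator of Z. Exceptional sets of radii thereby become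
    exceptional sets of points of the ball. *)
Lemma radial_null (Z : set RR) : measurable Z -> mu Z = 0%E ->
  measurable [set x : B | Z (enorm x)] /\ leb n.+1 [set x : B | Z (enorm x)] = 0%E.
Proof.
move=> mZ Z0; have mS : measurable [set x : B | Z (enorm x)].
  by rewrite -[X in measurable X]setTI; exact: (@measurable_enorm R n measurableT _ mZ).
split => //; rewrite -[X in leb n.+1 X]setIT -integral_indic//.
have -> : (\int[leb n.+1]_x (\1_[set x : B | Z (enorm x)] x : R)%:E =
    \int[leb n.+1]_x (fun r => (\1_Z r : R)%:E) (enorm x))%E.
  by apply: eq_integral => x _; rewrite !indicE.
rewrite (polar (nnmeas_indic mZ)).
transitivity (\int[mu]_(r in (`[0%R, +oo[%classic : set RR)) (0 : \bar R))%E; last by rewrite integral0.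
by apply: (integral_off mZ Z0) => r _ nZ; rewrite indicE memNset// mule0.
Qed.

Lemma grad_psi_tilde (x : 'rV[R]_n.+1) : Gs (enorm x) ->
  is_derive (enorm x) 1 (pp : R -> R) (- gF (enorm x)) ->
  enorm (grad (psi_tilde Omega A Lambda psi) x) = gF (enorm x).
Proof.
move=> Gx dp; have /andP[x_gt0 _] := Gs_itv Gx.
have x_neq0 : x != 0 by apply/eqP => E; move: x_gt0; rewrite E enorm0 ltxx.
have -> : psi_tilde Omega A Lambda psi = (fun y => pp (enorm y)) by apply/funext => y; exact: psi_tildeE.
rewrite (grad_radial x_neq0 dp) enormZ normrM normrN (ger0_norm (gF_ge0 _)).
by rewrite (@ger0_norm _ (enorm x)^-1) ?invr_ge0 ?enorm_ge0// mulfVK// gt_eqF.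
Qed.

(** Off a null set of radii the two integrands are radial and known explicitly, so both sides become
    one-dimensional integrals, compared by [radial_inequality]. *)
Lemma rearranged_inequality (e : 'rV[R]_n.+1) : enorm e = 1 ->
  (\int[lebesgue]_(x in Omega_star Omega)
     ((Lambda_hat Omega Lambda psi x * enorm (grad (psi_tilde Omega A Lambda psi) x) ^+ 2
       - omega0 * enorm (grad (psi_tilde Omega A Lambda psi) x) * psi_tilde Omega A Lambda psi x
       + V_hat Omega V psi x * psi_tilde Omega A Lambda psi x ^+ 2)
      * expR (- Defs.U Omega Lambda omega psi e x))%:E
   <= m%:E *
      \int[lebesgue]_(x in Omega_star Omega)
        (psi_tilde Omega A Lambda psi x ^+ 2 * expR (- Defs.U Omega Lambda omega psi e x))%:E)%E.
Proof.
move=> e1; set psit := psi_tilde _ _ _ _; set Lambdah := Lambda_hat _ _ _.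
set Vh := V_hat _ _ _; set U := Defs.U _ _ _ _ _.
have [Z [mZ Z0 ZP]] := pp_derive.
have mZ' : measurable (Z `|` bad) by apply: measurableU mZ measurable_bad.
have Z0' : mu (Z `|` bad) = 0%E.
  apply/eqP; rewrite eq_le measure_ge0 andbT.
  apply: (@le_trans _ _ (mu Z + mu bad)%E); first by apply: measureU2 => //; exact: measurable_bad.
  by rewrite Z0 bad_null adde0.
have [mB B0] := radial_null mZ' Z0'.
have bE := prim_bmeas (prim_expN u_prim (fun x _ => ww_ge0 x) (fun x _ => uu_ge0 x)).
have bpp := prim_bmeas p_prim; have bh := prim_bmeas h_prim.
have bg := bmeas_gF; have bV := bmeas_VV; have bc := bmeas_c.
have bp2 : bmeas R0 (fun r => pp r ^+ 2) by exact: (bmeasM bpp bpp).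
have b1 : bmeas R0 (fun r => (gF r * hh r - (omega0 * c r * gF r * pp r + c r * VV r * pp r ^+ 2)) * expR (- uu r)).
  apply: bmeasM bE; apply: bmeasD (bmeasM bg bh) _; apply: bmeasN; apply: bmeasD; last exact: bmeasM (bmeasM bc bV) bp2.
  by apply: bmeasM bpp; apply: bmeasM bg; exact: bmeasM (bmeas_cst _ _) bc.
have b2 : bmeas R0 (fun r => c r * pp r ^+ 2 * expR (- uu r)) by apply: bmeasM bE; exact: bmeasM bc bp2.
have GZ (x : B) : enorm x < R0 -> ~ (Z `|` bad) (enorm x) -> Gs (enorm x) /\ ~ Z (enorm x).
  move=> xR nB; split; last by move=> h; apply: nB; left.
  by apply: bad_Gs; [rewrite enorm_ge0 ltW|move=> h; apply: nB; right].
rewrite !integral_lebE /Omega_star.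
have -> : (\int[leb n.+1]_(x in [set x | (enorm x < R0)%R]) (psit x ^+ 2 * expR (- U x))%:E =
    (\int[mu]_(r in `[0, R0]) (c r * pp r ^+ 2 * expR (- uu r)))%:E)%E.
  rewrite -(polar_ball b2); apply: (integral_off mB B0) => x xR /(GZ x xR)[Gx _].
  have [c0 _ _ _ _] := Gs_facts Gx.
  rewrite /psit psi_tildeE /U UE// ?(ltW xR)//.
  by congr EFin; field; rewrite gt_eqF.
have -> : (\int[leb n.+1]_(x in [set x | (enorm x < R0)%R])
     ((Lambdah x * enorm (grad psit x) ^+ 2 - omega0 * enorm (grad psit x) * psit x + Vh x * psit x ^+ 2)
        * expR (- U x))%:E = (\int[mu]_(r in `[0, R0])
   ((gF r * hh r - (omega0 * c r * gF r * pp r + c r * VV r * pp r ^+ 2)) * expR (- uu r)))%:E)%E.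
  rewrite -(polar_ball b1); apply: (integral_off mB B0) => x xR /(GZ x xR)[Gx nZ].
  have [c0 D0 L0 _ _] := Gs_facts Gx.
  have dp := ZP _ (Gs_itv Gx) nZ.
  rewrite /psit (grad_psi_tilde Gx dp) psi_tildeE /U UE// ?(ltW xR)// /Lambdah Lambda_hatE// /Vh V_hatE//.
  have gE : gF (enorm x) = X (kinv (enorm x)) * L (kinv (enorm x)) / (c (enorm x) * D (kinv (enorm x))).
    by rewrite /gF patchE mem_set.
  (* With Lambda_hat = D / L and |grad psi_tilde| = X L / (c D), the product c Lambda_hat |grad
     psi_tilde|^2 equals gF X = gF h. *)
  rewrite (hh_energy Gx) !gE.
  congr EFin; field; by rewrite !gt_eqF.
by rewrite -EFinM lee_fin; exact: radial_inequality.
Qed.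

End radial_functions.
End good_levels.

Theorem corollary3p11 (R : realType) (n : nat)
  (Omega : set 'rV[R]_n.+1) (A : 'rV[R]_n.+1 -> 'M[R]_n.+1)
  (Lambda omega V psi : 'rV[R]_n.+1 -> R) (gamma : R)
  (omega0 mu : R) (e : 'rV[R]_n.+1)
  (hOmega : C2_domain Omega)
  (hA : forall i j, isC1_closure Omega (fun x => A x i j))
  (hAsym : forall x : 'rV[R]_n.+1, closure Omega x -> (A x)^T = A x)
  (hLambda : isC1_closure Omega Lambda)
  (homega : isC0_closure Omega omega)
  (hV : isC0_closure Omega V)
  (hALambda : forall x : 'rV[R]_n.+1, closure Omega x -> forall xi : 'rV[R]_n.+1,
     Lambda x * dot xi xi <= dot xi (A x *m xi^T)^T)
  (hgamma : 0 < gamma)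
  (hLambdagamma : forall x : 'rV[R]_n.+1, closure Omega x -> gamma <= Lambda x)
  (hpsi : isC1_closure Omega psi)
  (hpsi_analytic : forall x : 'rV[R]_n.+1, Omega x -> analytic_at psi x)
  (hpsi_pos : forall x : 'rV[R]_n.+1, Omega x -> 0 < psi x)
  (hpsi_bnd : forall x : 'rV[R]_n.+1, boundary Omega x -> psi x = 0)
  (hgradpsi_bnd : forall x : 'rV[R]_n.+1, boundary Omega x -> grad_closure Omega psi x != 0)
  (hf : nonzero_polynomial_on Omega (fun x => - div_A_grad A psi x))
  (homega0 : 0 <= omega0) (hmu : 0 <= mu)
  (he : enorm e = 1)
  (hineq : forall y, Omega y ->
     - div_A_grad A psi y - `|omega y| * enorm (grad psi y)
       - omega0 * enorm (grad psi y) + V y * psi y <= mu * psi y) :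
  let psit := psi_tilde Omega A Lambda psi in
  let Lambdah := Lambda_hat Omega Lambda psi in
  let Vh := V_hat Omega V psi in
  let U := U Omega Lambda omega psi e in
  (\int[lebesgue]_(x in Omega_star Omega)
     ((Lambdah x * enorm (grad psit x) ^+ 2
       - omega0 * enorm (grad psit x) * psit x
       + Vh x * psit x ^+ 2) * expR (- U x))%:E
   <= mu%:E *
      \int[lebesgue]_(x in Omega_star Omega)
        (psit x ^+ 2 * expR (- U x))%:E)%E.
Proof.
have [[z Oz] oO _ bO _] := hOmega.
have [x0 Ox0 [psix0 psiM]] := psi_max_attained oO bO hpsi hpsi_pos hpsi_bnd (ex_intro _ z Oz).
have [tau tauP] := ex_level_measures oO (isC1_closure_isC1 oO hpsi).
(* A single null set of levels is fixed here; the radial functions are then defined relative to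
   it. *)
have [N [mN N0 NP]] := ae_good oO bO hA hALambda hgamma hLambdagamma hpsi hpsi_analytic hpsi_bnd hf tauP Ox0.
have NG a : 0 < a < psi x0 -> ~ N a -> good Omega A psi tau a.
  by move=> aM nN; apply: contrapT => ng; apply: nN; apply: NP => /(_ aM).
exact: (rearranged_inequality oO bO hA hLambda homega hV hALambda hgamma hLambdagamma hpsi
  hpsi_analytic hpsi_pos hpsi_bnd hf homega0 hmu hineq tauP Ox0 psix0 psiM mN N0 NG he).
Qed.
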